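(* Let $\phi,\psi$ be fixed nonnegative smooth functions supported in $(0,1)$ and let $\epsilon>0$. Then for all sufficiently large $X,Y$, $$\sum_{\substack{m\geq1\\ m\text{ odd}}}\sum_{\substack{n\geq 1\\ n\text{ odd}}}\left(\frac mn\right)\phi\!\left(\frac mX\right)\psi\!\left(\frac nY\right)=\frac{\hat\phi(1)\hat\psi(\tfrac12)XY^{1/2}+\hat\psi(1)\hat\phi(\tfrac12)YX^{1/2}}{\pi^2}$$ $$+\left(\frac{1}{2\pi i}\right)^2\int_{\operatorname{Re}(s)=3/4}\ \int_{\operatorname{Re}(w)=3/4+\epsilon}A(s,w)X^wY^s\hat\phi(w)\hat\psi(s)\,dw\,ds+O_\epsilon\!\left(YX^\delta+XY^\delta\right),$$ where $\delta=\epsilon$; if the Riemann Hypothesis is true, one may take $\delta=-\tfrac14+\epsilon$.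
   Context: $\left(\frac mn\right)$ is the Kronecker (Jacobi) symbol. For a function $f$ on $(0,\infty)$, $\hat f(s)=\int_0^\infty f(x)x^{s-1}dx$ is its Mellin transform. $A(s,w)$ is the double Dirichlet series $A(s,w)=\sum_{m\text{ odd}}\sum_{n\text{ odd}}\left(\frac mn\right)m^{-w}n^{-s}$ (sums over positive odd integers), absolutely convergent for $\operatorname{Re}(s),\operatorname{Re}(w)$ sufficiently large, and extended to $\mathbb C^2$ by its meromorphic continuation (which exists, with polar lines $s=1$, $w=1$, $s+w=3/2$ and the lines where $\zeta_2(2s+2w-1)=0$, $\zeta_2$ being $\zeta$ with the Euler factor at $2$ removed). The vertical integrals are over the lines $\operatorname{Re}(w)=3/4+\epsilon$ (inner) and $\operatorname{Re}(s)=3/4$ (outer), traversed upward. The implied constant may depend on $\epsilon,\phi,\psi$.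
   Formalization: The formal statement takes 0 < ε < 1/4: at ε = 1/4 the inner line meets the pole w = 1, and for 1/4 < ε < 1/2 the printed formula fails (X = Y: the term XY^{1/2} is not in the error); for ε ≥ 1/2 the unconditional error absorbs the main terms. *)

(* Defs.v *)
From mathcomp Require Export all_boot all_order all_algebra.
From mathcomp Require Export all_classical all_reals all_analysis.
From mathcomp Require Export complex.

Export Order.TTheory GRing.Theory Num.Theory.
Export numFieldNormedType.Exports.

Set Implicit Arguments.
Unset Strict Implicit.
Unset Printing Implicit Defensive.

#[export] Set Implicit Arguments.
#[export] Unset Strict Implicit.
#[export] Unset Printing Implicit Defensive.

Global Open Scope classical_set_scope.
Global Open Scope ring_scope.
Global Open Scope complex_scope.

(* The regular module [R[i]^o] carries the topology and the normed
   [R[i]]-module structure, so differentiability below is complex. *)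
Notation Cplx R := (R[i]^o).

Definition legendre (m p : nat) : int :=
  if (p %| m)%N then 0
  else if [exists x : 'I_p, (x ^ 2 == m %[mod p])%N] then 1 else -1.

(* Used for odd [n] only, where it agrees with the Kronecker symbol. *)
Definition jacobi (m n : nat) : int :=
  \prod_(p <- primes n) legendre m p ^+ logn p n.

(* x ^ s = exp (s log x), meant for x > 0. *)
Definition cpow (R : realType) (x : R) (s : Cplx R) : Cplx R :=
  (expR (complex.Re s * ln x))%:C * (cos (complex.Im s * ln x) +i* sin (complex.Im s * ln x)).

Section ComplexIntegral.
Variable R : realType.
Implicit Types (D : set R) (f : R -> Cplx R).

Definition cintegrable D f : Prop :=
  lebesgue_measure.-integrable D (fun x => (complex.Re (f x))%:E) /\
  lebesgue_measure.-integrable D (fun x => (complex.Im (f x))%:E).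

Definition cintegral D f : Cplx R :=
  (\int[lebesgue_measure]_(x in D) complex.Re (f x)) +i*
  (\int[lebesgue_measure]_(x in D) complex.Im (f x)).

(* The line Re z = c is parametrized upward by z = c + i t, so dz = i dt. *)
Definition vline_integrable (c : R) (F : Cplx R -> Cplx R) : Prop :=
  cintegrable setT (fun t => F (c +i* t)).

Definition vline_integral (c : R) (F : Cplx R -> Cplx R) : Cplx R :=
  'i%C * cintegral setT (fun t => F (c +i* t)).

Definition mellin (f : R -> R) (s : Cplx R) : Cplx R :=
  cintegral `]0, +oo[ (fun x => (f x)%:C * cpow x (s - 1)).

End ComplexIntegral.

Definition smooth (R : realType) (f : R -> R) : Prop :=
  forall (k : nat) (x : R), derivable (derive1n k f) x 1.

Definition supported_in01 (R : realType) (f : R -> R) : Prop :=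
  forall x : R, f x != 0 -> 0 < x < 1.

Section Zeta.
Variable R : realType.
Implicit Type zeta : Cplx R -> Cplx R.

(* These two properties determine [zeta] on the complement of 1; its value at
   1 is unconstrained. *)
Definition is_riemann_zeta zeta : Prop :=
  (forall s : Cplx R, 1 < complex.Re s ->
     (fun N : nat => \sum_(1 <= n < N) cpow n%:R (- s)) @ \oo --> zeta s) /\
  (forall s : Cplx R, s != 1 -> differentiable zeta s).

Definition riemann_hypothesis zeta : Prop :=
  forall s : Cplx R, 0 < complex.Re s < 1 -> zeta s = 0 -> complex.Re s = 2^-1.

Definition zeta2 zeta (s : Cplx R) : Cplx R :=
  (1 - cpow 2 (- s)) * zeta s.

Definition polar_set zeta : set (Cplx R * Cplx R) :=
  [set p | let: (s, w) := p in
    [\/ s = 1, w = 1, s + w = 3 / 2 |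
        2 * s + 2 * w - 1 <> 1 /\ zeta2 zeta (2 * s + 2 * w - 1) = 0]].

(* The series converges absolutely for large real parts, so square partial
   sums compute its value there. The function is holomorphic off the polar
   lines, and near every point it is a quotient of holomorphic functions.
   The complement of the polar lines is connected, so [A] is determined on
   it; its values on the polar lines are unconstrained. *)
Definition is_double_dirichlet zeta (A : Cplx R * Cplx R -> Cplx R) : Prop :=
  [/\ exists sigma : R, forall s w : Cplx R,
        sigma < complex.Re s -> sigma < complex.Re w ->
        (fun N : nat =>
           \sum_(0 <= m < N | odd m) \sum_(0 <= n < N | odd n)
             (jacobi m n)%:~R * cpow m%:R (- w) * cpow n%:R (- s) : Cplx R)
          @ \oo --> A (s, w),
      forall p, ~ polar_set zeta p -> differentiable A p
    & forall p : Cplx R * Cplx R, exists g h : Cplx R * Cplx R -> Cplx R,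
        [/\ \forall q \near p, differentiable g q /\ differentiable h q,
            ~ (\forall q \near p, h q = 0)
          & \forall q \near p, ~ polar_set zeta q -> h q * A q = g q]].

End Zeta.

Section Asymptotics.
Variables (R : realType) (A : Cplx R * Cplx R -> Cplx R) (phi psi : R -> R).

(* Finitely supported sum: phi and psi vanish outside (0,1). *)
Definition char_sum (X Y : R) : R :=
  \sum_(m \in [set m : nat | odd m]) \sum_(n \in [set n : nat | odd n])
    ((jacobi m n)%:~R * phi (m%:R / X) * psi (n%:R / Y)).

Definition main_term (X Y : R) : Cplx R :=
  (mellin phi 1 * mellin psi 2^-1 * (X * Num.sqrt Y)%:C +
   mellin psi 1 * mellin phi 2^-1 * (Y * Num.sqrt X)%:C) / (pi ^+ 2)%:C.

Definition integrand (X Y : R) (s w : Cplx R) : Cplx R :=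
  A (s, w) * cpow X w * cpow Y s * mellin phi w * mellin psi s.

Definition inner_integral (eps X Y : R) (s : Cplx R) : Cplx R :=
  vline_integral (3 / 4 + eps) (integrand X Y s).

Definition double_integral (eps X Y : R) : Cplx R :=
  (2 * pi%:C * 'i%C)^-1 ^+ 2 *
  vline_integral (3 / 4) (inner_integral eps X Y).

(* Convergence is stated explicitly, as the Lebesgue integral of a
   non-integrable function has a default value. *)
Definition double_integral_converges (eps X Y : R) : Prop :=
  (forall s : Cplx R, complex.Re s = 3 / 4 ->
     vline_integrable (3 / 4 + eps) (integrand X Y s)) /\
  vline_integrable (3 / 4) (inner_integral eps X Y).

Definition asymptotic_formula (eps delta : R) : Prop :=
  exists K B : R, forall X Y : R, B <= X -> B <= Y ->
    double_integral_converges eps X Y /\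
    `|(char_sum X Y)%:C - (main_term X Y + double_integral eps X Y)|
      <= (K * (Y * X `^ delta + X * Y `^ delta))%:C.

End Asymptotics.

(* Main.v *)
Require Import Defs.
From mathcomp Require all_fingroup all_solvable all_field.
From mathcomp Require Import ring lra zify measurable_realfun.

(** For odd [n] the mean of the Jacobi symbol over [m] is [qd n], that is
    [totient k / (2 * k)] if [n = k ^ 2] and [0] otherwise; reciprocity gives the
    same for [m]. By the Polya-Vinogradov inequality the sums [EE M N] of
    [jacobi m n - qd m - qd n] over [m <= M], [n <= N] are
    O(N^(3/2+h) + N M^(1/2)), and also O(M^(3/2+h) + M N^(1/2)), hence
    O(M^(3/4+2h) N^(3/4-h)). Summation by parts and the identity theorem then
    yield [A (s, w) = zeta w * Dq s + zeta s * Dq w + FF s w] for [Re s = 3/4] and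
    [Re w > 3/4 + 2h], where [Dq] is the Dirichlet series of [qd] and [FF] is an
    absolutely convergent series in the [EE M N].

    Termwise Mellin inversion turns the double integral into the character sum,
    except that the pole of [zeta] at 1 lies to the right of both lines; the
    difference is [X phi^(1) Q_psi(Y) + Y psi^(1) Q_phi(X)] with
    [Q_psi(Y) = sum qd(n) psi(n / Y)]. Since
    [Dq w = zeta2 (2 w) / (2 * zeta2 (2 w + 1))] and [zeta2 2 = pi^2 / 8], moving
    the line of the integral for [Q_psi] to [Re w = delta] extracts
    [psi^(1/2) Y^(1/2) / pi^2] from the pole at 1/2. On that line
    [1 / zeta (2 w + 1)] is bounded if [delta > 0]; under the Riemann hypothesis
    it is of polynomial growth for every [delta > - 1/4], by Borel-Caratheodory. *)

(** The lines of integration dictate the shape of the bound for [EE]. The outer line is exactly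
    [Re s = 3/4], so the exponent of [N] must lie strictly below 3/4; the excess is moved to [M],
    where the inner line leaves room [eps]. Hence the asymmetric exponents, used with [h = eps / 4];
    their sum [3/2 + h] is the size of both bounds on the diagonal [M = N]. The identity for [A] is
    needed only where [Re (s + w) > 3/2]. No polar lines except [s = 1] and [w = 1] occur there, so
    uniqueness in one variable at a time reaches the lines of integration without a functional
    equation. The formula for the double integral is exact. Error terms arise only from moving the
    lines for [Q_phi] and [Q_psi], which is why [delta] is decided by the behaviour of
    [1 / zeta (2 w + 1)] alone. All contours are rectangles and squares, and integrability on a
    vertical line is always reduced to a majorant [D / (1 + t^2)]. *)

Notation RE := complex.Re (only parsing).
Notation IM := complex.Im (only parsing).

(** * The modulus as a real number *)

Section ComplexModulus.
Variable R : realType.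
Local Notation C := R[i].
Implicit Types z w : C.

(** The norm of [R[i]] takes its values in [R[i]]; a copy with values in [R] keeps all estimates in
    a totally ordered field, where [lra] and [nra] apply. *)
Definition cabs z : R := Num.sqrt (RE z ^+ 2 + IM z ^+ 2).

Lemma cabsE z : `|z| = (cabs z)%:C.
Proof. exact: normc_def. Qed.

Lemma cabs_ge0 z : 0 <= cabs z.
Proof. exact: sqrtr_ge0. Qed.

Lemma cabsM z w : cabs (z * w) = cabs z * cabs w.
Proof. by apply: (@complexI R); rewrite rmorphM /= -!cabsE normrM. Qed.

Lemma cabsD z w : cabs (z + w) <= cabs z + cabs w.
Proof. by rewrite -lecR rmorphD /= -!cabsE ler_normD. Qed.

Lemma cabsN z : cabs (- z) = cabs z.
Proof. by apply: (@complexI R); rewrite -!cabsE normrN. Qed.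

Lemma cabsBC z w : cabs (z - w) = cabs (w - z).
Proof. by rewrite -cabsN opprB. Qed.

Lemma cabs0 : cabs 0 = 0.
Proof. by apply: (@complexI R); rewrite -cabsE normr0. Qed.

Lemma cabs1 : cabs 1 = 1.
Proof. by apply: (@complexI R); rewrite -cabsE normr1. Qed.

Lemma cabs_eq0 z : (cabs z == 0) = (z == 0).
Proof. by rewrite -(normr_eq0 z) cabsE eq_complex /= eqxx andbT. Qed.

Lemma cabs_gt0 z : (0 < cabs z) = (z != 0).
Proof. by rewrite lt0r cabs_ge0 andbT cabs_eq0. Qed.

Lemma cabsV z : cabs z^-1 = (cabs z)^-1.
Proof.
have [->|z0] := eqVneq z 0; first by rewrite invr0 cabs0 invr0.
have h : cabs z != 0 by rewrite cabs_eq0.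
by apply: (mulfI h); rewrite -cabsM divff // divff // cabs1.
Qed.

Lemma cabsX z n : cabs (z ^+ n) = cabs z ^+ n.
Proof. by elim: n => [|n ih]; rewrite ?expr0 ?cabs1 // !exprS cabsM ih. Qed.

Lemma cabs_real (x : R) : cabs x%:C = `|x|.
Proof. by rewrite /cabs /= expr0n /= addr0 sqrtr_sqr. Qed.

Lemma cabs_nat n : cabs n%:R = n%:R.
Proof. by rewrite -(rmorph_nat (real_complex R)) /= cabs_real ger0_norm. Qed.

Lemma cabs_i : cabs ('i : C) = 1.
Proof. by rewrite /cabs /= expr0n /= add0r expr1n sqrtr1. Qed.

Lemma abs_Re_le z : `|RE z| <= cabs z.
Proof.
by rewrite -sqrtr_sqr /cabs ler_sqrt ?lerDl ?sqr_ge0 // addr_ge0 // sqr_ge0.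
Qed.

Lemma abs_Im_le z : `|IM z| <= cabs z.
Proof.
by rewrite -sqrtr_sqr /cabs ler_sqrt ?lerDr ?sqr_ge0 // addr_ge0 // sqr_ge0.
Qed.

Lemma Re_le_cabs z : RE z <= cabs z.
Proof. exact: le_trans (ler_norm _) (abs_Re_le z). Qed.

Lemma cabs_le_ReIm z : cabs z <= `|RE z| + `|IM z|.
Proof.
have h : z = (RE z)%:C + 'i * (IM z)%:C by rewrite -complexE.
rewrite {1}h (le_trans (cabsD _ _)) // cabsM cabs_i mul1r !cabs_real //.
Qed.

Lemma cabsB z w : cabs (z - w) <= cabs z + cabs w.
Proof. by rewrite (le_trans (cabsD _ _)) // cabsN. Qed.

Lemma cabsB_ge z w : cabs z - cabs w <= cabs (z - w).
Proof. by rewrite lerBlDr -{1}(subrK w z) cabsD. Qed.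

Lemma cabsD_ge z w : cabs z - cabs w <= cabs (z + w).
Proof. by rewrite -{2}(opprK w) (le_trans _ (cabsB_ge _ _)) // cabsN. Qed.

Lemma cabs_triangle z w u : cabs (z - w) <= cabs (z - u) + cabs (u - w).
Proof. by rewrite -(subrKA u) cabsD. Qed.

Lemma cabs_sum (I : Type) (r : seq I) (P : pred I) (F : I -> C) :
  cabs (\sum_(i <- r | P i) F i) <= \sum_(i <- r | P i) cabs (F i).
Proof.
elim/big_rec2: _ => [|i y x _ h]; first by rewrite cabs0.
by rewrite (le_trans (cabsD _ _)) // lerD2l.
Qed.

Lemma cabs_sqr z : cabs z ^+ 2 = RE z ^+ 2 + IM z ^+ 2.
Proof. by rewrite /cabs sqr_sqrtr // addr_ge0 ?sqr_ge0. Qed.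

Lemma ReM_real (x : R) z : RE (x%:C * z) = x * RE z.
Proof. by case: z => a b /=; rewrite mul0r subr0. Qed.

Lemma ImM_real (x : R) z : IM (x%:C * z) = x * IM z.
Proof. by case: z => a b /=; rewrite mul0r addr0. Qed.

Lemma ReD z w : RE (z + w) = RE z + RE w. Proof. by case: z; case: w. Qed.
Lemma ImD z w : IM (z + w) = IM z + IM w. Proof. by case: z; case: w. Qed.
Lemma ReN z : RE (- z) = - RE z. Proof. by case: z. Qed.
Lemma ImN z : IM (- z) = - IM z. Proof. by case: z. Qed.
Lemma ReB z w : RE (z - w) = RE z - RE w. Proof. by rewrite ReD ReN. Qed.
Lemma ImB z w : IM (z - w) = IM z - IM w. Proof. by rewrite ImD ImN. Qed.
Lemma ReM z w : RE (z * w) = RE z * RE w - IM z * IM w.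
Proof. by case: z; case: w. Qed.
Lemma ImM z w : IM (z * w) = RE z * IM w + IM z * RE w.
Proof. by case: z; case: w => a b c d /=; rewrite addrC. Qed.
Lemma Re_nat n : RE (n%:R : C) = n%:R.
Proof. by rewrite -(rmorph_nat (real_complex R)). Qed.
Lemma Im_nat n : IM (n%:R : C) = 0.
Proof. by rewrite -(rmorph_nat (real_complex R)). Qed.

Lemma complex_ext z w : RE z = RE w -> IM z = IM w -> z = w.
Proof. by case: z; case: w => a b c d /= -> ->. Qed.

(** Turns a modulus into a real part, so that real theorems (mean value, monotonicity of the
    integral) bound moduli of complex quantities. *)
Lemma cabs_rotation z : exists u : C, cabs u = 1 /\ u * z = (cabs z)%:C.
Proof.
have [->|z0] := eqVneq z 0.
  by exists 1; rewrite cabs1 mulr0 cabs0.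
have h : cabs z != 0 by rewrite cabs_eq0.
exists ((cabs z)%:C * z^-1); split.
  by rewrite cabsM cabsV cabs_real ger0_norm ?cabs_ge0 // divff.
by rewrite -mulrA mulVf // mulr1.
Qed.

Lemma cabs_small z : (forall e : R, 0 < e -> cabs z <= e) -> z = 0.
Proof.
move=> h; apply/eqP; rewrite -cabs_eq0; apply/eqP/le_anti.
rewrite cabs_ge0 andbT; apply/ler_addgt0Pr => e e0; rewrite add0r; exact: h.
Qed.

End ComplexModulus.

(** * Complex differentiability and its calculus *)

Section ComplexDerivative.
Variable R : realType.
Local Notation C := R[i].
Implicit Types (f g : C -> C) (z w l : C).

(** The remainder form, with real [e] and [d], needs no division and no exception at [h = 0], and
    composes directly in the chain rule. *)
Definition cderiv f z l := forall e : R, 0 < e -> exists d : R, 0 < d /\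
  forall h, cabs h < d -> cabs (f (z + h) - f z - l * h) <= e * cabs h.

Definition ccont f z := forall e : R, 0 < e -> exists d : R, 0 < d /\
  forall h, cabs h < d -> cabs (f (z + h) - f z) <= e.

Definition hol f z := exists l, cderiv f z l.

Lemma cderiv_lip f z l : cderiv f z l -> exists d : R, 0 < d /\
  forall h, cabs h < d -> cabs (f (z + h) - f z) <= (1 + cabs l) * cabs h.
Proof.
move=> /(_ 1 ltr01) [d [d0 H]]; exists d; split=> // h /H hh.
have -> : f (z + h) - f z = (f (z + h) - f z - l * h) + l * h by ring.
rewrite (le_trans (cabsD _ _)) // cabsM mulrDl lerD2r.
exact: le_trans hh _.
Qed.

Lemma lin_ccont f z (K d : R) : 0 <= K -> 0 < d ->
  (forall h, cabs h < d -> cabs (f (z + h) - f z) <= K * cabs h) -> ccont f z.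
Proof.
move=> K0 d0 H e e0; have K1 : 0 < K + 1 by lra.
exists (Num.min d (e / (K + 1))); split.
  by rewrite lt_min d0 divr_gt0.
move=> h; rewrite lt_min => /andP[h1 h2]; rewrite (le_trans (H _ h1)) //.
rewrite ltr_pdivlMr // in h2; have := cabs_ge0 h; nra.
Qed.

Lemma cderiv_ccont f z l : cderiv f z l -> ccont f z.
Proof.
move=> /cderiv_lip [d [d0 H]]; apply: lin_ccont d0 H.
by rewrite addr_ge0 ?cabs_ge0.
Qed.

Lemma hol_ccont f z : hol f z -> ccont f z.
Proof. by case=> l /cderiv_ccont. Qed.

Lemma ccont_bounded f z : ccont f z -> exists d : R, 0 < d /\
  forall h, cabs h < d -> cabs (f (z + h)) <= 1 + cabs (f z).
Proof.
move=> /(_ 1 ltr01) [d [d0 H]]; exists d; split=> // h /H hh.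
have -> : f (z + h) = f (z + h) - f z + f z by ring.
by rewrite (le_trans (cabsD _ _)) // lerD2r.
Qed.

Lemma cderiv_near f g z l (r : R) : 0 < r ->
  (forall h, cabs h < r -> f (z + h) = g (z + h)) -> cderiv f z l -> cderiv g z l.
Proof.
move=> r0 E H e /H [d [d0 Hd]]; exists (Num.min d r); split.
  by rewrite lt_min d0.
move=> h; rewrite lt_min => /andP[h1 h2]; rewrite -E //.
have := E 0; rewrite cabs0 addr0 => <- //; exact: Hd.
Qed.

Lemma cderiv_ext f g z l : f =1 g -> cderiv f z l -> cderiv g z l.
Proof. by move=> E; apply: (@cderiv_near _ _ _ _ 1) => // h _; rewrite E. Qed.

Lemma hol_near f g z (r : R) : 0 < r ->
  (forall h, cabs h < r -> f (z + h) = g (z + h)) -> hol f z -> hol g z.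
Proof. by move=> r0 E [l H]; exists l; exact: cderiv_near E H. Qed.

Lemma cderiv_cst (c : C) z : cderiv (fun=> c) z 0.
Proof.
move=> e e0; exists 1; split=> // h _.
by rewrite mul0r !subrr cabs0 mulr_ge0 ?cabs_ge0 ?ltW.
Qed.

Lemma cderiv_id z : cderiv id z 1.
Proof.
move=> e e0; exists 1; split=> // h _.
have -> : z + h - z - 1 * h = 0 by ring.
by rewrite cabs0 mulr_ge0 ?cabs_ge0 ?ltW.
Qed.

Lemma cderivD f g z l m : cderiv f z l -> cderiv g z m ->
  cderiv (fun x => f x + g x) z (l + m).
Proof.
move=> F G e e0; have e2 : 0 < e / 2 by lra.
have [d1 [d10 H1]] := F _ e2; have [d2 [d20 H2]] := G _ e2.
exists (Num.min d1 d2); split; first by rewrite lt_min d10.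
move=> h; rewrite lt_min => /andP[h1 h2].
have -> : f (z + h) + g (z + h) - (f z + g z) - (l + m) * h =
  (f (z + h) - f z - l * h) + (g (z + h) - g z - m * h) by ring.
rewrite (le_trans (cabsD _ _)) //; have := H1 _ h1; have := H2 _ h2; lra.
Qed.

Lemma cderivM f g z l m : cderiv f z l -> cderiv g z m ->
  cderiv (fun x => f x * g x) z (l * g z + f z * m).
Proof.
move=> F G e e0.
pose K := 3 * (1 + cabs (g z) + cabs (f z) + cabs l + cabs m).
have [gz fz la ma] := And4 (cabs_ge0 (g z)) (cabs_ge0 (f z)) (cabs_ge0 l) (cabs_ge0 m).
have K0 : 0 < K by rewrite /K; lra.
have eK : 0 < e / K by rewrite divr_gt0.
have [d1 [d10 H1]] := F _ eK; have [d2 [d20 H2]] := G _ eK.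
have [d3 [d30 H3]] := ccont_bounded (cderiv_ccont G).
have [d4 [d40 H4]] := cderiv_ccont G eK.
exists (Num.min (Num.min d1 d2) (Num.min d3 d4)); split.
  by rewrite !lt_min d10 d20 d30 d40.
move=> h; rewrite !lt_min => /andP[/andP[h1 h2] /andP[h3 h4]].
have -> : f (z + h) * g (z + h) - f z * g z - (l * g z + f z * m) * h =
  (f (z + h) - f z - l * h) * g (z + h) + f z * (g (z + h) - g z - m * h)
  + l * h * (g (z + h) - g z) by ring.
have h0 := cabs_ge0 h.
have ? : cabs ((f (z + h) - f z - l * h) * g (z + h)) <= e / K * cabs h * (1 + cabs (g z)).
  by rewrite cabsM ler_pM ?cabs_ge0 ?H1 ?H3.
have ? : cabs (f z * (g (z + h) - g z - m * h)) <= cabs (f z) * (e / K * cabs h).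
  by rewrite cabsM ler_wpM2l ?H2.
have ? : cabs (l * h * (g (z + h) - g z)) <= cabs l * cabs h * (e / K).
  by rewrite !cabsM ler_wpM2l ?H4 // mulr_ge0.
apply: (@le_trans _ _ (e / K * cabs h * (1 + cabs (g z)) + cabs (f z) * (e / K * cabs h)
   + cabs l * cabs h * (e / K))).
  rewrite (le_trans (cabsD _ _)) // lerD // (le_trans (cabsD _ _)) // lerD //.
have -> : e * cabs h = e / K * cabs h * K by field; rewrite gt_eqF.
have : 0 <= e / K * cabs h by rewrite mulr_ge0 // ltW.
rewrite /K; set t := e / K * cabs h; move=> t0.
have -> : cabs l * cabs h * (e / K) = t * cabs l by rewrite /t; ring.
nra.
Qed.

Lemma cderiv_inv z : z != 0 -> cderiv (fun x => x^-1) z (- z^-1 ^+ 2).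
Proof.
move=> z0 e e0; have a0 : 0 < cabs z by rewrite cabs_gt0.
have a30 : 0 < cabs z ^+ 3 by rewrite exprn_gt0.
(* The first bound keeps [cabs (z + h)] above [cabs z / 2]; the second then absorbs the exact
   remainder [h^2 / (z^2 (z + h))]. *)
exists (Num.min (cabs z / 2) (e * cabs z ^+ 3 / 2)); split.
  by rewrite lt_min !divr_gt0 // mulr_gt0.
move=> h; rewrite lt_min => /andP[h1 h2].
have g : cabs z / 2 <= cabs (z + h).
  by have := cabsD_ge z h; lra.
have zh : z + h != 0 by rewrite -cabs_gt0; lra.
have -> : (z + h)^-1 - z^-1 - - z^-1 ^+ 2 * h = h ^+ 2 / (z ^+ 2 * (z + h)).
  by field; rewrite zh z0.
rewrite cabsM cabsV cabsM !cabsX ler_pdivrMr ?mulr_gt0 ?exprn_gt0 ?cabs_gt0 //.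
have h0 := cabs_ge0 h.
apply: (@le_trans _ _ (e * cabs h * (cabs z ^+ 2 * (cabs z / 2)))); last first.
  by rewrite ler_wpM2l ?mulr_ge0 ?ler_wpM2l ?exprn_ge0 ?cabs_ge0 // ltW.
have -> : e * cabs h * (cabs z ^+ 2 * (cabs z / 2)) = cabs h * (e * cabs z ^+ 3 / 2) by field.
by rewrite expr2 ler_wpM2l // ltW.
Qed.

Lemma cderiv_comp f g z l m : cderiv f z l -> cderiv g (f z) m ->
  cderiv (fun x => g (f x)) z (m * l).
Proof.
move=> F G e e0.
have [d1 [d10 H1]] := cderiv_lip F.
have l0 := cabs_ge0 l; have m0 := cabs_ge0 m.
have e1 : 0 < e / (2 * (1 + cabs l)) by rewrite divr_gt0 //; lra.
have e2 : 0 < e / (2 * (1 + cabs m)) by rewrite divr_gt0 //; lra.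
have [d2 [d20 H2]] := G _ e1; have [d3 [d30 H3]] := F _ e2.
have d4 : 0 < d2 / (1 + cabs l) by rewrite divr_gt0 //; lra.
exists (Num.min d1 (Num.min d3 (d2 / (1 + cabs l)))); split.
  by rewrite !lt_min d10 d30.
move=> h; rewrite !lt_min => /andP[h1 /andP[h3 h4]].
rewrite ltr_pdivlMr in h4; last lra.
have k1 := H1 _ h1; pose k := f (z + h) - f z.
have kd : cabs k < d2 by rewrite (le_lt_trans k1) // mulrC.
have fk : f z + k = f (z + h) by rewrite /k; ring.
have := H2 _ kd; rewrite fk => G1.
have -> : g (f (z + h)) - g (f z) - m * l * h =
  (g (f (z + h)) - g (f z) - m * k) + m * (f (z + h) - f z - l * h).
  by rewrite /k; ring.
rewrite (le_trans (cabsD _ _)) // cabsM.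
have t1 : cabs (g (f (z + h)) - g (f z) - m * k) <= e / 2 * cabs h.
  apply: le_trans G1 _; rewrite -/k in k1.
  apply: (@le_trans _ _ (e / (2 * (1 + cabs l)) * ((1 + cabs l) * cabs h))).
    by rewrite ler_wpM2l // ltW.
  by rewrite le_eqVlt; apply/orP; left; apply/eqP; field; apply/lt0r_neq0; lra.
have t2 : cabs m * cabs (f (z + h) - f z - l * h) <= e / 2 * cabs h.
  apply: (@le_trans _ _ (cabs m * (e / (2 * (1 + cabs m)) * cabs h))).
    by rewrite ler_wpM2l // H3.
  have -> : cabs m * (e / (2 * (1 + cabs m)) * cabs h) = (cabs m / (1 + cabs m)) * (e / 2 * cabs h).
    by field; apply/lt0r_neq0; lra.
  rewrite ler_piMl ?mulr_ge0 ?cabs_ge0 //; first lra.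
  rewrite ler_pdivrMr; lra.
lra.
Qed.

Lemma hol_cst (c : C) z : hol (fun=> c) z.
Proof. by exists 0; exact: cderiv_cst. Qed.

Lemma hol_id z : hol (fun x => x) z.
Proof. by exists 1; exact: cderiv_id. Qed.

Lemma holD f g z : hol f z -> hol g z -> hol (fun x => f x + g x) z.
Proof. by move=> [l F] [m G]; exists (l + m); exact: cderivD. Qed.

Lemma holM f g z : hol f z -> hol g z -> hol (fun x => f x * g x) z.
Proof. by move=> [l F] [m G]; eexists; exact: cderivM F G. Qed.

Lemma holN f z : hol f z -> hol (fun x => - f x) z.
Proof.
move=> F; apply: (hol_near ltr01 _ (holM (hol_cst (-1) z) F)).
by move=> h _; rewrite mulN1r.
Qed.

Lemma holB f g z : hol f z -> hol g z -> hol (fun x => f x - g x) z.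
Proof. by move=> F G; apply: holD => //; exact: holN. Qed.

Lemma holV f z : f z != 0 -> hol f z -> hol (fun x => (f x)^-1) z.
Proof. by move=> z0 [l F]; eexists; exact: cderiv_comp F (cderiv_inv z0). Qed.

Lemma hol_comp f g z : hol f z -> hol g (f z) -> hol (fun x => g (f x)) z.
Proof. by move=> [l F] [m G]; eexists; exact: cderiv_comp F G. Qed.

Lemma holX f z n : hol f z -> hol (fun x => f x ^+ n) z.
Proof.
move=> F; elim: n => [|n ih].
  by apply: (hol_near ltr01 _ (hol_cst 1 z)) => h _; rewrite expr0.
by apply: (hol_near ltr01 _ (holM F ih)) => h _; rewrite exprS.
Qed.

Lemma hol_sum (I : Type) (r : seq I) (F : I -> C -> C) z :
  (forall i, hol (F i) z) -> hol (fun x => \sum_(i <- r) F i x) z.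
Proof.
move=> H; elim: r => [|i r ih].
  by apply: (hol_near ltr01 _ (hol_cst 0 z)) => h _; rewrite big_nil.
by apply: (hol_near ltr01 _ (holD (H i) ih)) => h _; rewrite big_cons.
Qed.

End ComplexDerivative.

(** * Complex-valued functions of a real variable *)

Section RealBridge.
Variable R : realType.
Local Notation C := R[i].

Lemma continuous_epsP (f : R -> R) (x : R) : {for x, continuous f} <->
  (forall e : R, 0 < e -> exists d : R, 0 < d /\
    forall h, `|h| < d -> `|f (x + h) - f x| <= e).
Proof.
split=> [cf e e0|H].
  move/cvgrPdist_le: cf => /(_ _ e0) /nbhs_ballP [d /= d0 Hd].
  exists d; split=> // h hd; rewrite distrC; apply: Hd.
  by rewrite /ball /= opprD addNKr normrN.
apply/cvgrPdist_le => e e0; have [d [d0 Hd]] := H _ e0.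
apply/nbhs_ballP; exists d => //= y; rewrite /ball /= => yd.
by have := Hd (y - x); rewrite [x + _]addrC subrK distrC (distrC (f x)); exact.
Qed.

(** Caratheodory's slope function mediates between the topological derivative and the remainder form
    used for [cderiv]. *)
Lemma is_derive_epsP (f : R -> R) (x l : R) : is_derive x 1 f l <->
  (forall e : R, 0 < e -> exists d : R, 0 < d /\
    forall h, `|h| < d -> `|f (x + h) - f x - l * h| <= e * `|h|).
Proof.
split=> [H e e0|H].
  have [g [Hg cg gx]] := (is_derive1_caratheodory f x l).1 H.
  have [d [d0 Hd]] := (continuous_epsP g x).1 cg e e0.
  exists d; split=> // h /Hd; rewrite gx => hg.
  rewrite Hg; have -> : x + h - x = h by ring.
  by rewrite -mulrBl normrM ler_wpM2r.
apply/is_derive1_caratheodory.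
exists (fun z => if z == x then l else (f z - f x) / (z - x)); split.
- move=> z; case: eqP => [->|/eqP zx]; first by rewrite !subrr mulr0.
  by rewrite divfK // subr_eq0.
- apply/continuous_epsP => e e0; have [d [d0 Hd]] := H _ e0.
  exists d; split=> // h hd; rewrite eqxx.
  case: eqP => [_|/eqP]; first by rewrite subrr normr0 ltW.
  rewrite -subr_eq0 [x + h]addrC addrK => h0.
  have -> : (f (h + x) - f x) / h - l = (f (x + h) - f x - l * h) / h.
    by rewrite (addrC x); field.
  by rewrite normrM normfV ler_pdivrMr ?normr_gt0 // Hd.
- by rewrite eqxx.
Qed.

(** Componentwise, so that the real derivative rules and the real fundamental theorem of calculus
    apply to each part. *)
Definition rcderiv (f : R -> C) (t : R) (l : C) :=
  is_derive t 1 (fun x => RE (f x)) (RE l) /\ is_derive t 1 (fun x => IM (f x)) (IM l).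

Definition rccont (f : R -> C) (t : R) := forall e : R, 0 < e -> exists d : R, 0 < d /\
  forall h, `|h| < d -> cabs (f (t + h) - f t) <= e.

Lemma rccontP (f : R -> C) t : rccont f t <->
  {for t, continuous (fun x => RE (f x))} /\ {for t, continuous (fun x => IM (f x))}.
Proof.
split=> [H|[/continuous_epsP Hr /continuous_epsP Hi] e e0].
  split; apply/continuous_epsP => e e0; have [d [d0 Hd]] := H _ e0; exists d; split=> // h hd.
    by rewrite -ReB (le_trans (abs_Re_le _)) // Hd.
  by rewrite -ImB (le_trans (abs_Im_le _)) // Hd.
have e2 : 0 < e / 2 by lra.
have [d [d0 Hd]] := Hr _ e2; have [d' [d0' Hd']] := Hi _ e2.
exists (Num.min d d'); split; first by rewrite lt_min d0.
move=> h; rewrite lt_min => /andP[h1 h2]; rewrite (le_trans (cabs_le_ReIm _)) // ReB ImB.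
have := Hd _ h1; have := Hd' _ h2; lra.
Qed.

Lemma cderiv_line (f : C -> C) (a b : C) (t : R) l :
  cderiv f (a + t%:C * b) l -> rcderiv (fun x => f (a + x%:C * b)) t (l * b).
Proof.
move=> H.
have key : forall e : R, 0 < e -> exists d : R, 0 < d /\ forall h : R, `|h| < d ->
   cabs (f (a + (t + h)%:C * b) - f (a + t%:C * b) - l * b * h%:C) <= e * `|h|.
  move=> e e0; have b0 := cabs_ge0 b.
  have e1 : 0 < e / (1 + cabs b) by rewrite divr_gt0 //; lra.
  have [d [d0 Hd]] := H _ e1.
  exists (d / (1 + cabs b)); split; first by rewrite divr_gt0 //; lra.
  move=> h; rewrite ltr_pdivlMr; last lra.
  move=> hd; have hb : cabs (h%:C * b) < d.
    rewrite cabsM cabs_real; have := normr_ge0 h; nra.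
  have := Hd _ hb.
  have -> : a + t%:C * b + h%:C * b = a + (t + h)%:C * b by rewrite rmorphD /=; ring.
  have -> : l * (h%:C * b) = l * b * h%:C by ring.
  move=> /le_trans; apply; rewrite cabsM cabs_real.
  have -> : e * `|h| = e / (1 + cabs b) * (`|h| * (1 + cabs b)).
    by field; apply/lt0r_neq0; lra.
  rewrite ler_wpM2l //; first exact: ltW.
  rewrite ler_wpM2l //; lra.
split; apply/is_derive_epsP => e /key [d [d0 Hd]]; exists d; split=> // h /Hd; apply: le_trans.
  apply: le_trans _ (abs_Re_le _); rewrite !ReB (ReM (l * b)) /= mulr0 subr0 //.
apply: le_trans _ (abs_Im_le _); rewrite !ImB (ImM (l * b)) /= mulr0 add0r //.
Qed.

Lemma ccont_line (f : C -> C) (a b : C) (t : R) :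
  ccont f (a + t%:C * b) -> rccont (fun x => f (a + x%:C * b)) t.
Proof.
move=> H e e0; have [d [d0 Hd]] := H _ e0; have b0 := cabs_ge0 b.
exists (d / (1 + cabs b)); split; first by rewrite divr_gt0 //; lra.
move=> h; rewrite ltr_pdivlMr; last lra.
move=> hd; have hb : cabs (h%:C * b) < d.
  rewrite cabsM cabs_real; have := normr_ge0 h; nra.
have := Hd _ hb.
by have -> : a + t%:C * b + h%:C * b = a + (t + h)%:C * b by rewrite rmorphD /=; ring.
Qed.

Lemma rcderiv_cont (f : R -> C) t l : rcderiv f t l -> rccont f t.
Proof.
move=> [H1 H2]; apply/rccontP; split; apply: differentiable_continuous;
  apply/derivable1_diffP; [exact: ex_derive | exact: ex_derive].
Qed.

Lemma rcderivM (f g : R -> C) t l m : rcderiv f t l -> rcderiv g t m ->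
  rcderiv (fun x => f x * g x) t (l * g t + f t * m).
Proof.
move=> [f1 f2] [g1 g2]; split.
  have -> : (fun x => RE (f x * g x)) = (fun x => RE (f x) * RE (g x) - IM (f x) * IM (g x)).
    by apply/funext => x; rewrite ReM.
  apply: is_derive_eq; rewrite ReD !ReM /GRing.scale /=; ring.
have -> : (fun x => IM (f x * g x)) = (fun x => RE (f x) * IM (g x) + IM (f x) * RE (g x)).
  by apply/funext => x; rewrite ImM.
apply: is_derive_eq; rewrite ImD !ImM /GRing.scale /=; ring.
Qed.

Lemma rcderiv_cst (c : C) t : rcderiv (fun=> c) t 0.
Proof. by split; exact: is_derive_cst. Qed.

Lemma rcderivD (f g : R -> C) t l m : rcderiv f t l -> rcderiv g t m ->
  rcderiv (fun x => f x + g x) t (l + m).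
Proof.
move=> [f1 f2] [g1 g2]; split.
  have -> : (fun x => RE (f x + g x)) = (fun x => RE (f x) + RE (g x)).
    by apply/funext => x; rewrite ReD.
  by rewrite ReD; exact: is_deriveD.
have -> : (fun x => IM (f x + g x)) = (fun x => IM (f x) + IM (g x)).
  by apply/funext => x; rewrite ImD.
by rewrite ImD; exact: is_deriveD.
Qed.

Lemma rcderivZ (c : C) (f : R -> C) t l : rcderiv f t l ->
  rcderiv (fun x => c * f x) t (c * l).
Proof. by move=> /(rcderivM (rcderiv_cst c t)); rewrite mul0r add0r. Qed.

(** The mean value theorem as an equality fails for complex values. It is applied to [Re (u f)],
    with the rotation [u] that makes [f b - f a] real and nonnegative. *)
Lemma mean_value_cabs (f : R -> C) (df : R -> C) (a b K : R) : a <= b ->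
  (forall t, a <= t <= b -> rcderiv f t (df t)) ->
  (forall t, a <= t <= b -> cabs (df t) <= K) -> cabs (f b - f a) <= K * (b - a).
Proof.
rewrite le_eqVlt => /orP[/eqP <-|ab] H HK; first by rewrite !subrr cabs0 mulr0.
have [u [u1 uE]] := cabs_rotation (f b - f a).
pose g t := RE (u * f t).
have dg t : a <= t <= b -> is_derive t 1 g (RE (u * df t)).
  by move=> /H /(rcderivZ u) [].
have [c cab E] : exists2 c, c \in `]a, b[%R & g b - g a = RE (u * df c) * (b - a).
  apply: MVT => // [x xab|].
    by apply: dg; move: xab; rewrite in_itv /= => /andP[/ltW -> /ltW ->].
  apply: continuous_in_subspaceT => x /[!inE] /=; rewrite in_itv /= => xab.
  apply: differentiable_continuous; apply/derivable1_diffP.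
  by have [] := dg _ xab.
have -> : cabs (f b - f a) = g b - g a.
  by rewrite /g -ReB -mulrBr uE.
rewrite E ler_wpM2r //; first by rewrite subr_ge0 ltW.
rewrite (le_trans (Re_le_cabs _)) // cabsM u1 mul1r HK //.
by move: cab; rewrite in_itv /= => /andP[/ltW -> /ltW ->].
Qed.

End RealBridge.

(** * The complex exponential and complex powers *)

Section ComplexExp.
Variable R : realType.
Local Notation C := R[i].
Implicit Types z w s : C.

Definition cexp z : C := (expR (RE z))%:C * (cos (IM z) +i* sin (IM z)).

Lemma Re_cexp z : RE (cexp z) = expR (RE z) * cos (IM z).
Proof. by rewrite /cexp ReM_real. Qed.

Lemma Im_cexp z : IM (cexp z) = expR (RE z) * sin (IM z).
Proof. by rewrite /cexp ImM_real. Qed.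

Lemma cexp0 : cexp 0 = 1.
Proof.
by apply: complex_ext; rewrite ?Re_cexp ?Im_cexp /= expR0 ?cos0 ?sin0 ?mulr1 ?mulr0.
Qed.

Lemma cexpD z w : cexp (z + w) = cexp z * cexp w.
Proof.
apply: complex_ext.
  by rewrite (ReM (cexp z)) !Re_cexp !Im_cexp ReD ImD expRD cosD; ring.
by rewrite (ImM (cexp z)) !Re_cexp !Im_cexp ReD ImD expRD sinD; ring.
Qed.

Lemma cexpN z : cexp (- z) * cexp z = 1.
Proof. by rewrite -cexpD addNr cexp0. Qed.

Lemma cabs_cexp z : cabs (cexp z) = expR (RE z).
Proof.
rewrite /cexp cabsM cabs_real ger0_norm ?expR_ge0 // /cabs /= cos2Dsin2 sqrtr1 mulr1 //.
Qed.

Lemma cexp_neq0 z : cexp z != 0.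
Proof. by rewrite -cabs_gt0 cabs_cexp expR_gt0. Qed.

Lemma cderiv_cexp0 : cderiv cexp 0 1.
Proof.
have de : is_derive (0 : R) 1 expR (expR 0) by exact: is_derive_expR.
have dc : is_derive (0 : R) 1 cos (- sin 0) by exact: is_derive_cos.
have ds : is_derive (0 : R) 1 sin (cos 0) by exact: is_derive_sin.
move/is_derive_epsP: de => de; move/is_derive_epsP: dc => dc; move/is_derive_epsP: ds => ds.
(* The remainders of [expR], [sin], [cos] are each at most [k |h|], and [|h| < k <= 1] controls the
   products; in total this gives at most [9 k |h|]. *)
move=> e e0; pose k := Num.min (e / 16) 1.
have k0 : 0 < k by rewrite lt_min; lra.
have ke : k <= e / 16 by rewrite ge_min lexx.
have k1 : k <= 1 by rewrite ge_min lexx orbT.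
clearbody k.
have [d1 [d10 H1]] := de _ k0; have [d2 [d20 H2]] := dc _ k0.
have [d3 [d30 H3]] := ds _ k0.
exists (Num.min (Num.min d1 d2) (Num.min d3 k)); split.
  by rewrite !lt_min d10 d20 d30 k0.
move=> h; rewrite !lt_min => /andP[/andP[h1 h2] /andP[h3 hk]].
have hr := abs_Re_le h; have hi := abs_Im_le h.
have h0 := cabs_ge0 h.
have := H1 _ (le_lt_trans hr h1); have := H2 _ (le_lt_trans hi h2).
have := H3 _ (le_lt_trans hi h3).
rewrite !add0r expR0 sin0 cos0 oppr0 !mul0r !subr0 !mul1r cexp0.
set a := RE h; set b := IM h; rewrite -/a in hr; rewrite -/b in hi.
rewrite addr0; set x := sin b - b; set y := cos b - 1; set w := expR a - 1 - a.
move=> Hx Hy Hw.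
have es : sin b = b + x by rewrite /x; ring.
have ec : cos b = 1 + y by rewrite /y; ring.
have ee : expR a = 1 + a + w by rewrite /w; ring.
apply: le_trans (cabs_le_ReIm _) _.
rewrite !ReB !ImB Re_cexp Im_cexp -/a -/b es ec ee /= subr0.
set H := cabs h in h0 hr hi hk h1 h2 h3 *.
have nx : `|x| <= k * H by apply: le_trans Hx _; rewrite ler_wpM2l // ltW.
have ny : `|y| <= k * H by apply: le_trans Hy _; rewrite ler_wpM2l // ltW.
have nw : `|w| <= k * H by apply: le_trans Hw _; rewrite ler_wpM2l // ltW.
have -> : (1 + a + w) * (1 + y) - 1 - a = w + y + (a + w) * y by ring.
have -> : (1 + a + w) * (b + x) - b = x + (a + w) * (b + x) by ring.
have kH : k * H <= H by rewrite ler_piMl.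
have aw : `|a + w| <= 2 * H by rewrite (le_trans (ler_normD _ _)) //; lra.
have bx : `|b + x| <= 2 * H by rewrite (le_trans (ler_normD _ _)) //; lra.
have t1 : `|(a + w) * y| <= 2 * H * (k * H) by rewrite normrM ler_pM.
have t2 : `|(a + w) * (b + x)| <= 2 * H * (2 * H) by rewrite normrM ler_pM.
have HH : H * H <= k * H by rewrite ler_wpM2r // ltW.
have s1 := ler_normD (w + y) ((a + w) * y); have s2 := ler_normD w y.
have s3 := ler_normD x ((a + w) * (b + x)).
have ek : k * H <= e / 16 * H by rewrite ler_wpM2r.
have eH : 0 <= e * H by rewrite mulr_ge0 // ltW.
have u1 : 2 * H * (k * H) <= 2 * (k * H) by clear -h0 hk k1 k0; nra.
have u2 : 2 * H * (2 * H) <= 4 * (k * H) by clear -HH; nra.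
have u3 : `|w + y + (a + w) * y| <= k * H + k * H + 2 * H * (k * H) by clear -s1 s2 t1 nw ny; lra.
have u4 : `|x + (a + w) * (b + x)| <= k * H + 2 * H * (2 * H) by clear -s3 t2 nx; lra.
clear -u1 u2 u3 u4 ek eH; lra.
Qed.

(** The derivative at 0 is transported to [z] by the functional equation. *)
Lemma cderiv_cexp z : cderiv cexp z (cexp z).
Proof.
have H : cderiv (fun x => x - z) z 1.
  apply: (@cderiv_near _ (fun x => x + - z) _ _ _ 1) => //.
  by have := cderivD (cderiv_id z) (cderiv_cst (- z) z); rewrite addr0.
have H2 : cderiv cexp (z - z) 1 by rewrite subrr; exact: cderiv_cexp0.
have := cderivM (cderiv_cst (cexp z) z) (cderiv_comp H H2).
rewrite mul0r add0r mulr1 mulr1; apply: cderiv_ext => x.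
by rewrite -cexpD; congr cexp; ring.
Qed.

Lemma cpowE (x : R) s : cpow x s = cexp (s * (ln x)%:C).
Proof.
rewrite /cpow /cexp; have -> : RE (s * (ln x)%:C) = RE s * ln x by case: s => a b /=; ring.
by have -> : IM (s * (ln x)%:C) = IM s * ln x by case: s => a b /=; ring.
Qed.

Lemma cabs_cpow (x : R) s : 0 < x -> cabs (cpow x s) = x `^ RE s.
Proof.
move=> x0; rewrite cpowE cabs_cexp /powR gt_eqF //.
by congr expR; case: s => a b /=; ring.
Qed.

Lemma cpowD (x : R) s w : cpow x (s + w) = cpow x s * cpow x w.
Proof. by rewrite !cpowE mulrDl cexpD. Qed.

Lemma cpow0 (x : R) : cpow x 0 = 1.
Proof. by rewrite cpowE mul0r cexp0. Qed.

Lemma cpowN (x : R) s : cpow x (- s) = (cpow x s)^-1.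
Proof.
have h : cpow x s != 0 by rewrite cpowE cexp_neq0.
by apply: (mulfI h); rewrite -cpowD subrr cpow0 divff.
Qed.

Lemma cpowM (x y : R) s : 0 < x -> 0 < y -> cpow (x * y) s = cpow x s * cpow y s.
Proof. by move=> x0 y0; rewrite !cpowE lnM ?posrE // rmorphD /= mulrDr cexpD. Qed.

Lemma cpow1l s : cpow 1 s = 1 :> C.
Proof. by rewrite cpowE ln1 mulr0 cexp0. Qed.

Lemma cpow_real (x a : R) : 0 < x -> cpow x a%:C = (x `^ a)%:C.
Proof.
move=> x0; rewrite /cpow /= mul0r cos0 sin0 /powR gt_eqF // mulr1 //.
Qed.

Lemma cpow_1r (x : R) : 0 < x -> cpow x 1 = x%:C.
Proof. by move=> x0; rewrite -[1]/(1%:C) cpow_real // powRr1 // ltW. Qed.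

Lemma cpow_powR (x a : R) s : 0 < x -> cpow (x `^ a) s = cpow x (a%:C * s).
Proof.
by move=> x0; rewrite !cpowE ln_powR rmorphM /=; congr cexp; ring.
Qed.

Lemma cderiv_cpow (x : R) s : cderiv (cpow x) s ((ln x)%:C * cpow x s).
Proof.
have H : cderiv (fun z => z * (ln x)%:C) s (ln x)%:C.
  have := cderivM (cderiv_id s) (cderiv_cst (ln x)%:C s).
  by rewrite mul1r mulr0 addr0.
have := cderiv_comp H (cderiv_cexp (s * (ln x)%:C)).
rewrite -cpowE mulrC; apply: cderiv_ext => z; by rewrite cpowE.
Qed.

Lemma hol_cpow (x : R) s : hol (cpow x) s.
Proof. by eexists; exact: cderiv_cpow. Qed.

Lemma rcderiv_cpow (x : R) s : 0 < x ->
  rcderiv (fun y => cpow y s) x (s * cpow x (s - 1)).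
Proof.
move=> x0.
have dl : is_derive x 1 (@ln R) x^-1 by exact: is_derive1_ln.
have E : s * cpow x (s - 1) = x^-1%:C * (s * cpow x s).
  rewrite cpowD cpowN cpow_1r // mulrA mulrC fmorphV /=; ring.
rewrite E; split.
  have -> : (fun y => RE (cpow y s)) =
     (fun y => expR (RE s * ln y) * cos (IM s * ln y)).
    by apply/funext => y; rewrite /cpow ReM_real.
  apply: is_derive_eq; rewrite ReM_real ReM.
  rewrite /cpow ReM_real ImM_real /GRing.scale /=; ring.
have -> : (fun y => IM (cpow y s)) =
   (fun y => expR (RE s * ln y) * sin (IM s * ln y)).
  by apply/funext => y; rewrite /cpow ImM_real.
apply: is_derive_eq; rewrite ImM_real ImM.
rewrite /cpow ReM_real ImM_real /GRing.scale /=; ring.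
Qed.

Lemma powR_nonpos_le (a x y : R) : 0 < x -> x <= y -> a <= 0 -> y `^ a <= x `^ a.
Proof.
move=> x0 xy a0; have y0 := lt_le_trans x0 xy.
rewrite -(opprK a) (powRN y) (powRN x) lef_pV2 ?posrE ?powR_gt0 //.
by rewrite ge0_ler_powR ?nnegrE ?oppr_ge0 // ltW.
Qed.

End ComplexExp.

(** * Integrals of complex-valued functions over segments *)

Section SegmentIntegral.
Variable R : realType.
Local Notation C := R[i].
Local Notation mu := (@lebesgue_measure R).
Implicit Types (f g : R -> C) (a b c t : R).

Definition cint a b f : C := cintegral `[a, b] f.

(** Continuity is two-sided even at the end points, so that it restricts to subsegments and follows
    at once from differentiability. *)
Definition cont_on a b f := forall t, a <= t <= b -> rccont f t.

Lemma Re_cintegral D f : RE (cintegral D f) = \int[mu]_(x in D) RE (f x).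
Proof. by []. Qed.

Lemma Im_cintegral D f : IM (cintegral D f) = \int[mu]_(x in D) IM (f x).
Proof. by []. Qed.

Lemma within_continuousW (g : R -> R) a b :
  (forall t, a <= t <= b -> {for t, continuous g}) -> {within `[a, b], continuous g}.
Proof.
move=> H; apply: continuous_in_subspaceT => x /[!inE] /=; rewrite in_itv /=; exact: H.
Qed.

Lemma cont_on_integrable a b f : cont_on a b f -> cintegrable `[a, b] f.
Proof.
move=> H; split; apply: (@continuous_compact_integrable R); try exact: segment_compact.
  by apply: within_continuousW => t /H /rccontP [].
by apply: within_continuousW => t /H /rccontP [].
Qed.

Lemma eq_cintegral D f g : (forall t, D t -> f t = g t) -> cintegral D f = cintegral D g.
Proof.
move=> E; apply: complex_ext; apply: eq_Rintegral => x /set_mem /E -> //.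
Qed.

Lemma cintegralD D f g : measurable D -> cintegrable D f -> cintegrable D g ->
  cintegral D (fun t => f t + g t) = cintegral D f + cintegral D g.
Proof.
move=> mD [f1 f2] [g1 g2]; apply: complex_ext.
  rewrite ReD !Re_cintegral -RintegralD //; apply: eq_Rintegral => x _; exact: ReD.
rewrite ImD !Im_cintegral -RintegralD //; apply: eq_Rintegral => x _; exact: ImD.
Qed.

Lemma integrable_lin D (f g : R -> R) (x y : R) : measurable D ->
  mu.-integrable D (EFin \o f) -> mu.-integrable D (EFin \o g) ->
  mu.-integrable D (fun t => (x * f t + y * g t)%:E).
Proof.
move=> mD F G.
apply: (eq_integrable mD (fun t => x%:E * (f t)%:E + y%:E * (g t)%:E)%E) => //.
by apply: integrableD => //; apply: integrableZl.
Qed.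

Lemma cintegrableZ D (k : C) f : measurable D -> cintegrable D f ->
  cintegrable D (fun t => k * f t).
Proof.
move=> mD [f1 f2]; split.
  have -> : (fun x => (RE (k * f x))%:E) = (fun x => (RE k * RE (f x) + (- IM k) * IM (f x))%:E).
    by apply/funext => x; rewrite ReM mulNr.
  exact: integrable_lin.
have -> : (fun x => (IM (k * f x))%:E) = (fun x => (RE k * IM (f x) + IM k * RE (f x))%:E).
  by apply/funext => x; rewrite ImM.
exact: integrable_lin.
Qed.

Lemma Rintegral_lin D (f g : R -> R) (x y : R) : measurable D ->
  mu.-integrable D (EFin \o f) -> mu.-integrable D (EFin \o g) ->
  \int[mu]_(t in D) (x * f t + y * g t) =
  x * \int[mu]_(t in D) f t + y * \int[mu]_(t in D) g t.
Proof.
move=> mD F G; rewrite RintegralD //; last 2 first.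
- by apply: (eq_integrable mD (fun t => x%:E * (f t)%:E)%E) => //; exact: integrableZl.
- by apply: (eq_integrable mD (fun t => y%:E * (g t)%:E)%E) => //; exact: integrableZl.
by rewrite !RintegralZl.
Qed.

Lemma cintegralZ D (k : C) f : measurable D -> cintegrable D f ->
  cintegral D (fun t => k * f t) = k * cintegral D f.
Proof.
move=> mD [f1 f2]; apply: complex_ext.
  rewrite ReM !Re_cintegral Im_cintegral -mulNr -Rintegral_lin //.
  by apply: eq_Rintegral => x _; rewrite ReM mulNr.
rewrite ImM !Im_cintegral Re_cintegral -Rintegral_lin //.
by apply: eq_Rintegral => x _; rewrite ImM.
Qed.

Lemma cintegralN D f : measurable D -> cintegrable D f ->
  cintegral D (fun t => - f t) = - cintegral D f.
Proof.
move=> mD F; rewrite -mulN1r -cintegralZ //; apply: eq_cintegral => t _.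
by rewrite mulN1r.
Qed.

Lemma cintegrableN D f : measurable D -> cintegrable D f -> cintegrable D (fun t => - f t).
Proof.
move=> mD F; have -> : (fun t => - f t) = (fun t => -1 * f t).
  by apply/funext => t; rewrite mulN1r.
exact: cintegrableZ.
Qed.

Lemma cintegralB D f g : measurable D -> cintegrable D f -> cintegrable D g ->
  cintegral D (fun t => f t - g t) = cintegral D f - cintegral D g.
Proof.
move=> mD F G; rewrite -cintegralN // -cintegralD //; exact: cintegrableN.
Qed.

(** After a rotation the modulus of the integral is the integral of a real part, which [G] dominates
    pointwise. *)
Lemma cabs_cintegral_le D f (G : R -> R) : measurable D -> cintegrable D f ->
  mu.-integrable D (EFin \o G) -> (forall t, D t -> cabs (f t) <= G t) ->
  cabs (cintegral D f) <= \int[mu]_(t in D) G t.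
Proof.
move=> mD F IG H; have [u [u1 uE]] := cabs_rotation (cintegral D f).
have -> : cabs (cintegral D f) = RE (cintegral D (fun t => u * f t)).
  by rewrite cintegralZ // uE.
rewrite Re_cintegral; apply: le_Rintegral => //.
  by have [] := cintegrableZ u mD F.
by move=> t /H; apply: le_trans; rewrite (le_trans (Re_le_cabs _)) // cabsM u1 mul1r.
Qed.

Lemma measurable_cintegrable D f (G : R -> R) : measurable D ->
  measurable_fun D (fun t => RE (f t)) -> measurable_fun D (fun t => IM (f t)) ->
  mu.-integrable D (EFin \o G) -> (forall t, D t -> cabs (f t) <= G t) ->
  cintegrable D f.
Proof.
move=> mD mr mi IG H; split; apply: (@le_integrable _ _ _ mu D mD _ _ _ _ IG).
- exact/measurable_EFinP.
- move=> t /H h /=; rewrite lee_fin (le_trans (abs_Re_le _)) // (le_trans h) // ler_norm //.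
- exact/measurable_EFinP.
- move=> t /H h /=; rewrite lee_fin (le_trans (abs_Im_le _)) // (le_trans h) // ler_norm //.
Qed.

Lemma cont_on_sub a b a' b' f : a <= a' -> b' <= b -> cont_on a b f -> cont_on a' b' f.
Proof. by move=> h1 h2 H t /andP[t1 t2]; apply: H; rewrite (le_trans h1) // (le_trans t2). Qed.

Lemma cont_onZ a b k f : cont_on a b f -> cont_on a b (fun t => k * f t).
Proof.
move=> H t /H ct e e0; have k1 : 0 < 1 + cabs k by rewrite ltr_pwDl ?cabs_ge0.
have [d [d0 Hd]] := ct _ (divr_gt0 e0 k1); exists d; split=> // h /Hd hh.
rewrite -mulrBr cabsM; have := cabs_ge0 k.
rewrite ler_pdivlMr // in hh; have := cabs_ge0 (f (t + h) - f t); nra.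
Qed.

Lemma cont_onD a b f g : cont_on a b f -> cont_on a b g -> cont_on a b (fun t => f t + g t).
Proof.
move=> F G t ht e e0; have e2 : 0 < e / 2 by lra.
have [d [d0 Hd]] := F t ht _ e2; have [d' [d0' Hd']] := G t ht _ e2.
exists (Num.min d d'); split; first by rewrite lt_min d0.
move=> h; rewrite lt_min => /andP[/Hd h1 /Hd' h2].
have -> : f (t + h) + g (t + h) - (f t + g t) = (f (t + h) - f t) + (g (t + h) - g t) by ring.
rewrite (le_trans (cabsD _ _)) //; lra.
Qed.

Lemma cont_onB a b f g : cont_on a b f -> cont_on a b g -> cont_on a b (fun t => f t - g t).
Proof.
move=> F /(cont_onZ (-1)) G; have := cont_onD F G.
by have -> : (fun t => f t + -1 * g t) = (fun t => f t - g t)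
  by apply/funext => t; rewrite mulN1r.
Qed.

Lemma eq_cint a b f g : (forall t, a <= t <= b -> f t = g t) -> cint a b f = cint a b g.
Proof. by move=> E; apply: eq_cintegral => t /=; rewrite in_itv /=; exact: E. Qed.

Lemma cintD a b f g : cont_on a b f -> cont_on a b g ->
  cint a b (fun t => f t + g t) = cint a b f + cint a b g.
Proof. by move=> F G; apply: cintegralD => //; exact: cont_on_integrable. Qed.

Lemma cintB a b f g : cont_on a b f -> cont_on a b g ->
  cint a b (fun t => f t - g t) = cint a b f - cint a b g.
Proof. by move=> F G; apply: cintegralB => //; exact: cont_on_integrable. Qed.

Lemma cintZ a b k f : cont_on a b f -> cint a b (fun t => k * f t) = k * cint a b f.
Proof. by move=> F; apply: cintegralZ => //; exact: cont_on_integrable. Qed.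

Lemma cabs_cint_le a b f K : a <= b -> cont_on a b f ->
  (forall t, a <= t <= b -> cabs (f t) <= K) -> cabs (cint a b f) <= K * (b - a).
Proof.
move=> ab F H.
have -> : K * (b - a) = \int[mu]_(t in `[a, b]) K.
  rewrite Rintegral_cst //= lebesgue_measure_itv /= lte_fin.
  case: ltP => [_|ba] //=; have -> : a = b by apply/le_anti; rewrite ab ba.
  by rewrite subrr.
apply: cabs_cintegral_le => //; first exact: cont_on_integrable.
  apply: (@continuous_compact_integrable R); first exact: segment_compact.
  apply: within_continuousW => t _; exact: cst_continuous.

Qed.

Lemma cint_chasles a c b f : a <= c <= b -> cont_on a b f ->
  cint a b f = cint a c f + cint c b f.
Proof.
move=> /andP[ac cb] F; have [i1 i2] := cont_on_integrable F.
have [j1 j2] := cont_on_integrable (cont_on_sub ac (lexx b) F).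
have key (h : R -> R) : mu.-integrable `[a, b] (EFin \o h) ->
    mu.-integrable `[c, b] (EFin \o h) ->
    \int[mu]_(x in `[a, b]) h x = \int[mu]_(x in `[a, c]) h x + \int[mu]_(x in `[c, b]) h x.
  move=> I J; have := Rintegral_itvB (x := c) I.
  rewrite !bnd_simp => /(_ ac cb) /eqP; rewrite subr_eq => /eqP ->.
  rewrite addrC; congr (_ + _); apply: Rintegral_itv_obnd_cbnd.
  apply: integrableS J => //; exact: subset_itv_oc_cc.
by apply: complex_ext; rewrite ?ReD ?ImD; apply: key.
Qed.

Lemma cint_FTC a b f (df : R -> C) : a <= b ->
  (forall t, a <= t <= b -> rcderiv f t (df t)) -> cont_on a b df ->
  cint a b df = f b - f a.
Proof.
rewrite le_eqVlt => /orP[/eqP <-|ab] H cdf.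
  rewrite subrr; apply: complex_ext.
    by rewrite /cint Re_cintegral set_itv1 Rintegral_set1.
  by rewrite /cint Im_cintegral set_itv1 Rintegral_set1.
have key (F dF : R -> R) : (forall t, a <= t <= b -> is_derive t 1 F (dF t)) ->
    {within `[a, b], continuous dF} -> \int[mu]_(x in `[a, b]) dF x = F b - F a.
  move=> dFF cF; rewrite /Rintegral (@continuous_FTC2 _ dF F) //.
    have cF' t : a <= t <= b -> {for t, continuous F}.
      move=> /dFF h; apply: differentiable_continuous.
      by apply/derivable1_diffP; case: h.
    split.
    - move=> x; rewrite in_itv /= => /andP[/ltW h1 /ltW h2].
      by have [] : is_derive x 1 F (dF x) by apply: dFF; rewrite h1.
    - by apply: cvg_at_right_filter; apply: cF'; rewrite lexx ltW.
    - by apply: cvg_at_left_filter; apply: cF'; rewrite lexx ltW.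
  move=> x; rewrite in_itv /= => /andP[/ltW h1 /ltW h2].
  have [D E] : is_derive x 1 F (dF x) by apply: dFF; rewrite h1.
  by rewrite derive1E E.
apply: complex_ext; rewrite ?ReB ?ImB.
  apply: (key (fun t => RE (f t))); first by move=> t /H [].
  by apply: within_continuousW => t /cdf /rccontP [].
apply: (key (fun t => IM (f t))); first by move=> t /H [].
by apply: within_continuousW => t /cdf /rccontP [].
Qed.

Lemma cint_id a f : cint a a f = 0.
Proof.
apply: complex_ext.
  by rewrite /cint Re_cintegral set_itv1 Rintegral_set1.
by rewrite /cint Im_cintegral set_itv1 Rintegral_set1.
Qed.

End SegmentIntegral.

(** * Boundary integrals of rectangles *)

Section Rectangles.
Variable R : realType.
Local Notation C := R[i].
Implicit Types (f g : C -> C) (a b c d x y t : R) (z w : C).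

Definition hint f a b y := cint a b (fun t => f (t +i* y)).
Definition vint f x c d := cint c d (fun t => f (x +i* t)).
(** The boundary is run through counterclockwise: bottom, right, top, left. *)
Definition rect f a b c d :=
  hint f a b c + 'i * vint f b c d - hint f a b d - 'i * vint f a c d.

Definition hcont f a b y := forall t, a <= t <= b -> ccont f (t +i* y).
Definition vcont f x c d := forall t, c <= t <= d -> ccont f (x +i* t).

Lemma horiz_lineE y t : (t +i* y : C) = (0 +i* y) + t%:C * 1.
Proof. by rewrite mulr1; apply: complex_ext; rewrite /= ?add0r ?addr0. Qed.

Lemma vert_lineE x t : (x +i* t : C) = x%:C + t%:C * 'i.
Proof. by apply: complex_ext; rewrite /= ?mulr0 ?mul0r ?mulr1 ?subr0 ?addr0 ?add0r. Qed.

Lemma ccont_h f y t : ccont f (t +i* y) -> rccont (fun u => f (u +i* y)) t.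
Proof.
rewrite horiz_lineE => /ccont_line H.
have -> // : (fun u => f (u +i* y)) = (fun u => f (0 +i* y + u%:C * 1)).
by apply/funext => u; rewrite -horiz_lineE.
Qed.

Lemma ccont_v f x t : ccont f (x +i* t) -> rccont (fun u => f (x +i* u)) t.
Proof.
rewrite vert_lineE => /ccont_line H.
have -> // : (fun u => f (x +i* u)) = (fun u => f (x%:C + u%:C * 'i)).
by apply/funext => u; rewrite -vert_lineE.
Qed.

Lemma hcont_on f a b y : hcont f a b y -> cont_on a b (fun t => f (t +i* y)).
Proof. by move=> H t /H /ccont_h. Qed.

Lemma vcont_on f x c d : vcont f x c d -> cont_on c d (fun t => f (x +i* t)).
Proof. by move=> H t /H /ccont_v. Qed.

Lemma rect_split_h f a m b c d : a <= m <= b -> hcont f a b c -> hcont f a b d ->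
  rect f a b c d = rect f a m c d + rect f m b c d.
Proof.
move=> amb H1 H2; rewrite /rect /hint (cint_chasles amb (hcont_on H1)).
rewrite (cint_chasles amb (hcont_on H2)); ring.
Qed.

Lemma rect_split_v f a b c m d : c <= m <= d -> vcont f a c d -> vcont f b c d ->
  rect f a b c d = rect f a b c m + rect f a b m d.
Proof.
move=> cmd H1 H2; rewrite /rect /vint (cint_chasles cmd (vcont_on H1)).
rewrite (cint_chasles cmd (vcont_on H2)); ring.
Qed.

Definition rcont f a b c d :=
  [/\ hcont f a b c, hcont f a b d, vcont f a c d & vcont f b c d].

Lemma rectB f g a b c d : rcont f a b c d -> rcont g a b c d ->
  rect (fun z => f z - g z) a b c d = rect f a b c d - rect g a b c d.
Proof.
move=> [f1 f2 f3 f4] [g1 g2 g3 g4]; rewrite /rect /hint /vint.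
rewrite !cintB; try exact: hcont_on; try exact: vcont_on; ring.
Qed.

Lemma rectZ k f a b c d : rcont f a b c d ->
  rect (fun z => k * f z) a b c d = k * rect f a b c d.
Proof.
move=> [f1 f2 f3 f4]; rewrite /rect /hint /vint.
rewrite !cintZ; try exact: hcont_on; try exact: vcont_on; ring.
Qed.

Definition onbd a b c d (P : C -> Prop) :=
  (forall t, a <= t <= b -> P (t +i* c) /\ P (t +i* d)) /\
  (forall t, c <= t <= d -> P (a +i* t) /\ P (b +i* t)).

Lemma rect_bound f a b c d K : a <= b -> c <= d -> rcont f a b c d ->
  onbd a b c d (fun z => cabs (f z) <= K) ->
  cabs (rect f a b c d) <= K * (2 * ((b - a) + (d - c))).
Proof.
move=> ab cd [f1 f2 f3 f4] [B1 B2]; rewrite /rect.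
have h1 : cabs (hint f a b c) <= K * (b - a).
  by apply: cabs_cint_le => //; [exact: hcont_on|move=> t /B1 []].
have h2 : cabs (hint f a b d) <= K * (b - a).
  by apply: cabs_cint_le => //; [exact: hcont_on|move=> t /B1 []].
have h3 : cabs ('i * vint f b c d) <= K * (d - c).
  rewrite cabsM cabs_i mul1r.
  by apply: cabs_cint_le => //; [exact: vcont_on|move=> t /B2 []].
have h4 : cabs ('i * vint f a c d) <= K * (d - c).
  rewrite cabsM cabs_i mul1r.
  by apply: cabs_cint_le => //; [exact: vcont_on|move=> t /B2 []].
have s1 := cabsB (hint f a b c + 'i * vint f b c d - hint f a b d) ('i * vint f a c d).
have s2 := cabsB (hint f a b c + 'i * vint f b c d) (hint f a b d).
have s3 := cabsD (hint f a b c) ('i * vint f b c d).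
lra.
Qed.

Definition inrect a b c d z := (a <= RE z <= b) && (c <= IM z <= d).

Lemma inrect_rcont f a b c d : a <= b -> c <= d ->
  (forall z, inrect a b c d z -> ccont f z) -> rcont f a b c d.
Proof.
move=> ab cd H; split=> t /andP[t1 t2]; apply: H; rewrite /inrect /=;
  by rewrite ?lexx ?ab ?cd ?t1 ?t2.
Qed.

Lemma inrect_onbd (P : C -> Prop) a b c d : a <= b -> c <= d ->
  (forall z, inrect a b c d z -> P z) -> onbd a b c d P.
Proof.
move=> ab cd H; split=> t /andP[t1 t2]; split; apply: H; rewrite /inrect /=;
  by rewrite ?lexx ?ab ?cd ?t1 ?t2.
Qed.

(** Each side contributes the difference of [F] at two corners, and around the boundary these
    cancel. *)
Lemma rect_primitive F f a b c d : a <= b -> c <= d ->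
  (forall z, inrect a b c d z -> cderiv F z (f z)) ->
  (forall z, inrect a b c d z -> ccont f z) -> rect f a b c d = 0.
Proof.
move=> ab cd H cf; have [f1 f2 f3 f4] := inrect_rcont ab cd cf.
have hE y : c <= y <= d -> hcont f a b y -> hint f a b y = F (b +i* y) - F (a +i* y).
  move=> /andP[cy yd] hy; apply: (@cint_FTC R a b (fun t => F (t +i* y))) => //; last exact: hcont_on.
  move=> t /andP[t1 t2]; have := H (t +i* y); rewrite /inrect /= t1 t2 cy yd => /(_ isT).
  rewrite horiz_lineE => /cderiv_line; rewrite mulr1 -horiz_lineE.
  have -> // : (fun u => F (u +i* y)) = (fun u => F (0 +i* y + u%:C * 1)).
  by apply/funext => u; rewrite -horiz_lineE.
have vE x : a <= x <= b -> vcont f x c d -> 'i * vint f x c d = F (x +i* d) - F (x +i* c).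
  move=> /andP[ax xb] hx; rewrite /vint -cintZ; last exact: vcont_on.
  apply: (@cint_FTC R c d (fun t => F (x +i* t))) => //; last first.
    move=> t /hx /ccont_v ct e e0; have [k [k0 Hk]] := ct e e0; exists k; split=> // h /Hk.
    by rewrite -mulrBr cabsM cabs_i mul1r.
  move=> t /andP[t1 t2]; have := H (x +i* t); rewrite /inrect /= t1 t2 ax xb => /(_ isT).
  rewrite vert_lineE => /cderiv_line; rewrite -vert_lineE mulrC.
  have -> // : (fun u => F (x +i* u)) = (fun u => F (x%:C + u%:C * 'i)).
  by apply/funext => u; rewrite -vert_lineE.
rewrite /rect hE ?hE ?vE ?vE ?lexx ?ab ?cd //; ring.
Qed.

Lemma rect_affine (u v : C) a b c d : a <= b -> c <= d ->
  rect (fun z => u + v * z) a b c d = 0.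
Proof.
move=> ab cd.
have D z : cderiv (fun z => u * z + v * (z * z) / 2) z (u + v * z).
  have d1 := cderivM (cderiv_cst u z) (cderiv_id z).
  have d2 := cderivM (cderivM (cderiv_cst v z) (cderivM (cderiv_id z) (cderiv_id z)))
    (cderiv_cst (2^-1) z).
  have := cderivD d1 d2.
  have -> // : 0 * id z + u * 1 +
   ((0 * (id z * id z) + v * (1 * id z + id z * 1)) / 2 +
    v * (id z * id z) * 0) = u + v * z by rewrite /id; field.
apply: (rect_primitive ab cd (F := fun z => u * z + v * (z * z) / 2)) => z _ //.
have := cderivD (cderiv_cst u z) (cderivM (cderiv_cst v z) (cderiv_id z)).
exact: cderiv_ccont.
Qed.

End Rectangles.

(** * Goursat's theorem for rectangles *)

Section Goursat.
Variable R : realType.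
Local Notation C := R[i].
Implicit Types (f g : C -> C) (a b c d x y t : R) (z w : C).

(** Common sides cancel, so the integrals over the four quarters add up to the whole; they cannot
    all be below a quarter of it in modulus. *)
Lemma bisect_rect f a b c d : a <= b -> c <= d ->
  (forall z, inrect a b c d z -> ccont f z) ->
  exists a' b' c' d', [/\ a <= a', b' <= b, c <= c' & d' <= d] /\
    [/\ b' - a' = (b - a) / 2, d' - c' = (d - c) / 2 &
     cabs (rect f a b c d) <= 4 * cabs (rect f a' b' c' d')].
Proof.
move=> ab cd cf.
have [m [am mb ma bm]] : exists m, [/\ a <= m, m <= b, m - a = (b - a) / 2 & b - m = (b - a) / 2].
  by exists ((a + b) / 2); split; lra.
have [n [cn nd nc dn]] : exists n, [/\ c <= n, n <= d, n - c = (d - c) / 2 & d - n = (d - c) / 2].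
  by exists ((c + d) / 2); split; lra.
have E : rect f a b c d = rect f a m c n + rect f a m n d + (rect f m b c n + rect f m b n d).
  have [f1 f2 f3 f4] := inrect_rcont ab cd cf.
  have vm : vcont f m c d.
    by move=> t /andP[t1 t2]; apply: cf; rewrite /inrect /= t1 t2 am mb.
  rewrite (@rect_split_h _ f a m b) ?am //.
  by rewrite (@rect_split_v _ f a m c n d) ?cn // (@rect_split_v _ f m b c n d) ?cn.
set r1 := rect f a m c n in E *; set r2 := rect f a m n d in E *.
set r3 := rect f m b c n in E *; set r4 := rect f m b n d in E *.
have s1 := cabsD (r1 + r2) (r3 + r4); rewrite -E in s1.
have s2 := cabsD r1 r2; have s3 := cabsD r3 r4.
have [h1|h1] := leP (cabs (rect f a b c d)) (4 * cabs r1).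
  by exists a, m, c, n; split; split.
have [h2|h2] := leP (cabs (rect f a b c d)) (4 * cabs r2).
  by exists a, m, n, d; split; split.
have [h3|h3] := leP (cabs (rect f a b c d)) (4 * cabs r3).
  by exists m, b, c, n; split; split.
exists m, b, n, d; split; split=> //; rewrite -/r4.
have key (x1 x2 x3 x4 x5 x6 x7 : R) : x7 <= x5 + x6 -> x5 <= x1 + x2 -> x6 <= x3 + x4 ->
  4 * x1 < x7 -> 4 * x2 < x7 -> 4 * x3 < x7 -> x7 <= 4 * x4 by clear; lra.
exact: key s1 s2 s3 h1 h2 h3.
Qed.

Lemma nested_point (l u : nat -> R) : (forall n, l n <= u n) ->
  (forall n, l n <= l n.+1) -> (forall n, u n.+1 <= u n) ->
  exists x, forall n, l n <= x <= u n.
Proof.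
move=> lu ln un.
have lm n m : (n <= m)%N -> l n <= l m.
  by move=> /subnK <-; elim: (m - n)%N => // k ih; rewrite addSn (le_trans ih).
have um n m : (n <= m)%N -> u m <= u n.
  by move=> /subnK <-; elim: (m - n)%N => // k ih; rewrite addSn (le_trans _ ih).
have all n m : l n <= u m.
  have [h|h] := leqP n m; first by rewrite (le_trans (lm _ _ h)).
  by rewrite (le_trans (lu n)) // um // ltnW.
exists (sup (range l)) => n; apply/andP; split.
  apply: sup_upper_bound; last by exists n.
  by split; [exists (l 0%N); exists 0%N|exists (u 0%N) => _ [k _ <-]].
by apply: ge_sup; [exists (l 0%N); exists 0%N|move=> _ [k _ <-]].
Qed.

Lemma goursat f a b c d : a <= b -> c <= d ->
  (forall z, inrect a b c d z -> hol f z) -> rect f a b c d = 0.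
Proof.
move=> ab cd hf.
pose V (q : R * R * (R * R)) := [/\ q.1.1 <= q.1.2, q.2.1 <= q.2.2 &
  forall z, inrect q.1.1 q.1.2 q.2.1 q.2.2 z -> inrect a b c d z].
pose T (q : R * R * (R * R)) := rect f q.1.1 q.1.2 q.2.1 q.2.2.
(* The validity of [q] is a premise inside the existential, so that [choice] yields a total function
   which can be iterated; on an invalid rectangle its value is irrelevant. *)
have step q : exists q', V q -> [/\ V q', q.1.1 <= q'.1.1, q'.1.2 <= q.1.2 &
   [/\ q.2.1 <= q'.2.1, q'.2.2 <= q.2.2, q'.1.2 - q'.1.1 = (q.1.2 - q.1.1) / 2,
   q'.2.2 - q'.2.1 = (q.2.2 - q.2.1) / 2 & cabs (T q) <= 4 * cabs (T q')]].
  have [[h1 h2 h3]|nV] := pselect (V q); last by exists q.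
  have [a' [b' [c' [d' [[k1 k2 k3 k4] [k5 k6 k7]]]]]] := bisect_rect h1 h2
    (fun z hz => hol_ccont (hf z (h3 z hz))).
  exists ((a', b'), (c', d')) => _; split=> //=; split=> /=; try lra.
  move=> z /andP[/andP[z1 z2] /andP[z3 z4]]; apply: h3; rewrite /inrect.
  by rewrite (le_trans k1) // (le_trans z2) // (le_trans k3) // (le_trans z4).
have [g Hg] := choice step.
pose q n := iter n g ((a, b), (c, d)).
have Vq n : V (q n).
  by elim: n => [|n ih]; [split|rewrite /q iterS; have [] := Hg _ ih].
have w n : (q n).1.2 - (q n).1.1 = (b - a) / 2 ^+ n.
  elim: n => [|n ih]; first by rewrite expr0 divr1.
  have [_ _ _ [_ _ E _ _]] := Hg _ (Vq n).
  by rewrite /q iterS E ih exprS; field; rewrite expf_neq0.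
have h n : (q n).2.2 - (q n).2.1 = (d - c) / 2 ^+ n.
  elim: n => [|n ih]; first by rewrite expr0 divr1.
  have [_ _ _ [_ _ _ E _]] := Hg _ (Vq n).
  by rewrite /q iterS E ih exprS; field; rewrite expf_neq0.
have B n : cabs (rect f a b c d) <= 4 ^+ n * cabs (T (q n)).
  elim: n => [|n ih]; first by rewrite expr0 mul1r.
  have [_ _ _ [_ _ _ _ E]] := Hg _ (Vq n).
  rewrite (le_trans ih) // exprSr -mulrA ler_wpM2l ?exprn_ge0 //.
have [x0 Hx] := @nested_point (fun n => (q n).1.1) (fun n => (q n).1.2)
  (fun n => let: And3 h _ _ := Vq n in h)
  (fun n => let: And4 _ h _ _ := Hg _ (Vq n) in h)
  (fun n => let: And4 _ _ h _ := Hg _ (Vq n) in h).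
have [y0 Hy] := @nested_point (fun n => (q n).2.1) (fun n => (q n).2.2)
  (fun n => let: And3 _ h _ := Vq n in h)
  (fun n => let: And4 _ _ _ (And5 h _ _ _ _) := Hg _ (Vq n) in h)
  (fun n => let: And4 _ _ _ (And5 _ h _ _ _) := Hg _ (Vq n) in h).
have z0in : inrect a b c d (x0 +i* y0) by rewrite /inrect /= (Hx 0%N) (Hy 0%N).
have [l Hl] := hf _ z0in.
set z0 := (x0 +i* y0) in z0in Hl.
apply: cabs_small => e e0.
pose S := (b - a) + (d - c); have S0 : 0 <= S by rewrite /S; lra.
pose e1 := e / (2 * (S + 1) ^+ 2).
have S1 : 0 < 2 * (S + 1) ^+ 2 by rewrite mulr_gt0 // exprn_gt0 //; lra.
have e10 : 0 < e1 by rewrite divr_gt0.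
have [k [k0 Hk]] := Hl _ e10.
have [n Hn] : exists n, S / 2 ^+ n < k.
  exists (Num.truncn (S / k)).+1.
  have t1 := truncnS_gt (S / k).
  rewrite ltr_pdivrMr ?exprn_gt0 //; rewrite ltr_pdivrMr // in t1.
  rewrite (lt_le_trans t1) // mulrC ler_wpM2l //; first exact: ltW.
  by rewrite -natrX ler_nat ltnW // ltn_expl.
rewrite (le_trans (B n)) //.
have [v1 v2 v3] := Vq n.
pose g0 z := f z0 - l * z0 + l * z.
have cf z : inrect (q n).1.1 (q n).1.2 (q n).2.1 (q n).2.2 z -> ccont f z.
  by move=> /v3 /hf /hol_ccont.
have cg z : ccont g0 z.
  have := cderivD (cderiv_cst (f z0 - l * z0) z) (cderivM (cderiv_cst l z) (cderiv_id z)).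
  exact: cderiv_ccont.
have E : T (q n) = rect (fun z => f z - g0 z) (q n).1.1 (q n).1.2 (q n).2.1 (q n).2.2.
  rewrite rectB; try exact: inrect_rcont.
  by rewrite rect_affine // subr0.
have cfg z : inrect (q n).1.1 (q n).1.2 (q n).2.1 (q n).2.2 z -> ccont (fun z => f z - g0 z) z.
  move=> /v3 /hf [m Hm]; apply: hol_ccont; apply: holB; first by exists m.
  apply: holD; first exact: hol_cst.
  by apply: holM; [exact: hol_cst|exact: hol_id].
have bd z : inrect (q n).1.1 (q n).1.2 (q n).2.1 (q n).2.2 z ->
    cabs (f z - g0 z) <= e1 * (S / 2 ^+ n).
  move=> /andP[/andP[z1 z2] /andP[z3 z4]].
  have [/andP[x1 x2] /andP[y1 y2]] := (Hx n, Hy n).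
  have := w n; have := h n => hh ww.
  have dz : cabs (z - z0) <= S / 2 ^+ n.
    rewrite (le_trans (cabs_le_ReIm _)) // ReB ImB /= /S mulrDl -ww -hh.
    by rewrite lerD // ler_norml; clear -z1 z2 z3 z4 x1 x2 y1 y2; apply/andP; split; lra.
  have := Hk _ (le_lt_trans dz Hn).
  have -> : z0 + (z - z0) = z by ring.
  have -> : f z - f z0 - l * (z - z0) = f z - g0 z by rewrite /g0; ring.
  by move=> /le_trans; apply; rewrite ler_wpM2l // ltW.
have := rect_bound v1 v2 (inrect_rcont v1 v2 cfg) (inrect_onbd v1 v2 bd).
rewrite -E w h => Hb.
apply: (@le_trans _ _ (4 ^+ n * (e1 * (S / 2 ^+ n) * (2 * ((b - a) / 2 ^+ n + (d - c) / 2 ^+ n))))).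
  by rewrite ler_wpM2l ?exprn_ge0.
have p2 : (2 : R) ^+ n != 0 by rewrite expf_neq0.
have -> : (4 : R) ^+ n = 2 ^+ n * 2 ^+ n by rewrite -exprMn; congr (_ ^+ _); ring.
have -> : 2 ^+ n * 2 ^+ n * (e1 * (S / 2 ^+ n) * (2 * ((b - a) / 2 ^+ n + (d - c) / 2 ^+ n)))
   = e1 * (2 * S ^+ 2).
  by rewrite /S; field.
rewrite /e1 mulrAC ler_pdivrMr // ler_wpM2l ?(ltW e0) //.
rewrite ler_pM2l // ler_sqr ?nnegrE //; clear -S0; lra.
Qed.

End Goursat.

(** * Cauchy's integral formula for rectangles *)

Section CauchyFormula.
Variable R : realType.
Local Notation C := R[i].
Implicit Types (f g : C -> C) (a b c d x y t s : R) (z w : C).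

Lemma rccont_real (g : R -> R) t : {for t, continuous g} -> rccont (fun u => (g u)%:C) t.
Proof. by move=> cg; apply/rccontP; split=> //; exact: cst_continuous. Qed.

Lemma continuous_poisson x s t : 0 < s ->
  {for t, continuous (fun t => 2 * s / ((t - x) ^+ 2 + s ^+ 2))}.
Proof.
move=> s0; apply: cvgM; first exact: cvg_cst.
apply: cvgV; first by rewrite gt_eqF // ltr_wpDl ?sqr_ge0 ?exprn_gt0.
apply: cvgD; last exact: cvg_cst.
have h : (fun u => (u - x) ^+ 2) = (fun u => (u - x) * (u - x)) by apply/funext => u; exact: expr2.
by rewrite h expr2; apply: cvgM; (apply: cvgB; [exact: cvg_id|exact: cvg_cst]).
Qed.

Lemma cint_atan x s : 0 < s ->
  cint (x - s) (x + s) (fun t => (2 * s / ((t - x) ^+ 2 + s ^+ 2))%:C) = pi%:C.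
Proof.
move=> s0; have sn : s != 0 by rewrite gt_eqF.
have D t : is_derive t 1 (fun t => 2 * atan ((t - x) / s)) (2 * s / ((t - x) ^+ 2 + s ^+ 2)).
  have -> : 2 * s / ((t - x) ^+ 2 + s ^+ 2) = 2 * ((1 + ((t - x) / s) ^+ 2)^-1 * s^-1).
    have h : 0 < (t - x) ^+ 2 + s ^+ 2 by rewrite ltr_wpDl ?sqr_ge0 ?exprn_gt0.
    have h2 : 0 < 1 + ((t - x) / s) ^+ 2 by rewrite ltr_pwDl ?sqr_ge0.
    have -> : 1 + ((t - x) / s) ^+ 2 = ((t - x) ^+ 2 + s ^+ 2) / s ^+ 2 by field.
    by field; rewrite sn gt_eqF.
  apply: is_derive_eq; rewrite /GRing.scale /=; ring.
rewrite (@cint_FTC R _ _ (fun t => (2 * atan ((t - x) / s))%:C)); last 1 first.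
- by move=> t _; apply: rccont_real; exact: continuous_poisson.
- have -> : (x + s - x) / s = 1 by field.
  have -> : (x - s - x) / s = -1 by field.
  by rewrite atanN atan1 -rmorphB /=; congr (_%:C); field.
- lra.
- by move=> t _; split => //=; exact: is_derive_cst.
Qed.

(** Opposite sides are combined: the difference of [1 / (w - z)] on them is, up to the factor ['i]
    for the horizontal pair, the Poisson kernel of [cint_atan], with integral [pi]. No branch of the
    logarithm enters. *)
Lemma rect_inv_square z s : 0 < s ->
  rect (fun w => (w - z)^-1) (RE z - s) (RE z + s) (IM z - s) (IM z + s) = 2 * pi%:C * 'i.
Proof.
move=> s0; set x := RE z; set y := IM z.
have inv2 (A B : C) : A != 0 -> B != 0 -> A^-1 - B^-1 = (B - A) / (A * B).
  by move=> A0 B0; field; rewrite A0 B0.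
have zE : z = x +i* y by rewrite /x /y; case: (z).
have nz t : (t +i* (y - s) - z != 0) /\ (t +i* (y + s) - z != 0).
  by split; rewrite eq_complex zE /= negb_and; apply/orP; right; apply/eqP; lra.
have nz' t : ((x - s) +i* t - z != 0) /\ ((x + s) +i* t - z != 0).
  by split; rewrite eq_complex zE /= negb_and; apply/orP; left; apply/eqP; lra.
have hV w : w - z != 0 -> ccont (fun w => (w - z)^-1) w.
  move=> w0; apply: hol_ccont; apply: holV => //; apply: holB; [exact: hol_id|exact: hol_cst].
have h1 : hcont (fun w => (w - z)^-1) (x - s) (x + s) (y - s).
  by move=> t _; apply: hV; have [] := nz t.
have h2 : hcont (fun w => (w - z)^-1) (x - s) (x + s) (y + s).
  by move=> t _; apply: hV; have [] := nz t.
have h3 : vcont (fun w => (w - z)^-1) (x - s) (y - s) (y + s).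
  by move=> t _; apply: hV; have [] := nz' t.
have h4 : vcont (fun w => (w - z)^-1) (x + s) (y - s) (y + s).
  by move=> t _; apply: hV; have [] := nz' t.
have E1 : hint (fun w => (w - z)^-1) (x - s) (x + s) (y - s) -
   hint (fun w => (w - z)^-1) (x - s) (x + s) (y + s) = 'i * pi%:C.
  rewrite /hint -cintB; [|exact: (hcont_on h1)|exact: (hcont_on h2)].
  rewrite -(cint_atan x s0) -cintZ; last first.
    by move=> t _; apply: rccont_real; exact: continuous_poisson.
  apply: eq_cint => t _; have [n1 n2] := nz t.
  have e1 : t +i* (y - s) - z = (t - x)%:C - 'i * s%:C.
    by rewrite zE; apply: complex_ext; rewrite /=; ring.
  have e2 : t +i* (y + s) - z = (t - x)%:C + 'i * s%:C.
    by rewrite zE; apply: complex_ext; rewrite /=; ring.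
  rewrite e1 in n1 *; rewrite e2 in n2 *.
  have q : ((t - x) ^+ 2 + s ^+ 2)%:C = ((t - x)%:C - 'i * s%:C) * ((t - x)%:C + 'i * s%:C).
    by apply: complex_ext; rewrite /=; ring.
  rewrite inv2 // fmorph_div /= q mulrA; congr (_ / _).
  by apply: complex_ext; rewrite /=; ring.
have E2 : vint (fun w => (w - z)^-1) (x + s) (y - s) (y + s) -
   vint (fun w => (w - z)^-1) (x - s) (y - s) (y + s) = pi%:C.
  rewrite /vint -cintB; [|exact: (vcont_on h4)|exact: (vcont_on h3)].
  rewrite -(cint_atan y s0); apply: eq_cint => t _; have [n1 n2] := nz' t.
  have e1 : (x - s) +i* t - z = - (s%:C - 'i * (t - y)%:C).
    by rewrite zE; apply: complex_ext; rewrite /=; ring.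
  have e2 : (x + s) +i* t - z = s%:C + 'i * (t - y)%:C.
    by rewrite zE; apply: complex_ext; rewrite /=; ring.
  rewrite e1 oppr_eq0 in n1 *; rewrite e2 in n2 *.
  have q : ((t - y) ^+ 2 + s ^+ 2)%:C = (s%:C - 'i * (t - y)%:C) * (s%:C + 'i * (t - y)%:C).
    by apply: complex_ext; rewrite /=; ring.
  rewrite inv2 ?oppr_eq0 // fmorph_div /= q.
  have -> : (s%:C + 'i * (t - y)%:C) * - (s%:C - 'i * (t - y)%:C) =
    - ((s%:C - 'i * (t - y)%:C) * (s%:C + 'i * (t - y)%:C)) by ring.
  rewrite invrN mulrN -mulNr; congr (_ / _).
  by apply: complex_ext; rewrite /=; ring.
have -> : rect (fun w => (w - z)^-1) (x - s) (x + s) (y - s) (y + s) =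
  (hint (fun w => (w - z)^-1) (x - s) (x + s) (y - s) -
   hint (fun w => (w - z)^-1) (x - s) (x + s) (y + s)) +
  'i * (vint (fun w => (w - z)^-1) (x + s) (y - s) (y + s) -
   vint (fun w => (w - z)^-1) (x - s) (y - s) (y + s)).
  rewrite /rect; ring.
rewrite E1 E2; ring.
Qed.

(** The rectangle minus the square splits into four rectangles that avoid [z], on which Goursat's
    theorem applies. *)
Lemma rect_shrink g a b c d z s : 0 < s -> a < RE z - s -> RE z + s < b ->
  c < IM z - s -> IM z + s < d ->
  (forall w, inrect a b c d w -> w != z -> hol g w) ->
  rect g a b c d = rect g (RE z - s) (RE z + s) (IM z - s) (IM z + s).
Proof.
move=> s0 h1 h2 h3 h4 hg.
set x1 := RE z - s; set x2 := RE z + s; set y1 := IM z - s; set y2 := IM z + s.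
have x12 : x1 < RE z < x2 by rewrite /x1 /x2; apply/andP; split; lra.
have y12 : y1 < IM z < y2 by rewrite /y1 /y2; apply/andP; split; lra.
move: x12 y12 h1 h2 h3 h4; rewrite -/x1 -/x2 -/y1 -/y2.
move: x1 x2 y1 y2 => x1 x2 y1 y2 /andP[xa xb] /andP[ya yb] h1 h2 h3 h4.
have G w : inrect a b c d w -> (RE w != RE z) || (IM w != IM z) -> hol g w.
  move=> wi /orP ne; apply: hg => //; apply/eqP => wz.
  by rewrite wz !eqxx in ne; case: ne.
have lab : a <= b by lra.
have zero a' b' c' d' : a <= a' -> a' <= b' -> b' <= b -> c <= c' -> c' <= d' -> d' <= d ->
   (b' < RE z) || (RE z < a') || (d' < IM z) || (IM z < c') -> rect g a' b' c' d' = 0.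
  move=> k1 k2 k3 k4 k5 k6 k; apply: goursat => // w /andP[/andP[w1 w2] /andP[w3 w4]].
  apply: G; first by rewrite /inrect (le_trans k1) // (le_trans w2) // (le_trans k4) // (le_trans w4).
  move: k => /orP[/orP[/orP[k|k]|k]|k].
  - by rewrite lt_eqF ?(le_lt_trans w2).
  - by rewrite gt_eqF ?(lt_le_trans k).
  - by rewrite (lt_eqF (le_lt_trans w4 k)) orbT.
  - by rewrite (gt_eqF (lt_le_trans k w3)) orbT.
have cy t y : a <= t <= b -> c <= y <= d -> y != IM z -> ccont g (t +i* y).
  by move=> ta yc yz; apply: hol_ccont; apply: G; rewrite /inrect /= ?ta ?yc ?yz ?orbT.
have cx t x : c <= t <= d -> a <= x <= b -> x != RE z -> ccont g (x +i* t).
  by move=> ta yc yz; apply: hol_ccont; apply: G; rewrite /inrect /= ?ta ?yc ?yz.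
have [nc nd] : c != IM z /\ d != IM z by rewrite lt_eqF ?gt_eqF; lra.
have [n1 n2] : x1 != RE z /\ x2 != RE z by rewrite lt_eqF ?gt_eqF.
rewrite (@rect_split_h _ g a x1 b); first last.
- by move=> t ta; apply: cy => //; apply/andP; split; lra.
- by move=> t ta; apply: cy => //; apply/andP; split; lra.
- by apply/andP; split; lra.
rewrite (@rect_split_h _ g x1 x2 b); first last.
- by move=> t /andP[ta tb]; apply: cy => //; clear -ta tb xa xb ya yb h1 h2 h3 h4; apply/andP; split; lra.
- by move=> t /andP[ta tb]; apply: cy => //; clear -ta tb xa xb ya yb h1 h2 h3 h4; apply/andP; split; lra.
- by clear -xa xb ya yb h1 h2 h3 h4; apply/andP; split; lra.
rewrite (@rect_split_v _ g x1 x2 c y1 d); first last.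
- by move=> t ta; apply: cx => //; apply/andP; split; lra.
- by move=> t ta; apply: cx => //; apply/andP; split; lra.
- by apply/andP; split; lra.
rewrite (@rect_split_v _ g x1 x2 y1 y2 d); first last.
- by move=> t /andP[ta tb]; apply: cx => //; clear -ta tb xa xb ya yb h1 h2 h3 h4; apply/andP; split; lra.
- by move=> t /andP[ta tb]; apply: cx => //; clear -ta tb xa xb ya yb h1 h2 h3 h4; apply/andP; split; lra.
- by clear -xa xb ya yb h1 h2 h3 h4; apply/andP; split; lra.
have -> : rect g a x1 c d = 0 by apply: zero; rewrite ?xa ?orbT //; clear -xa xb ya yb h1 h2 h3 h4; lra.
have -> : rect g x2 b c d = 0 by apply: zero; rewrite ?xb ?orbT //; clear -xa xb ya yb h1 h2 h3 h4; lra.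
have -> : rect g x1 x2 c y1 = 0 by apply: zero; rewrite ?ya ?orbT //; clear -xa xb ya yb h1 h2 h3 h4; lra.
have -> : rect g x1 x2 y2 d = 0 by apply: zero; rewrite ?yb ?orbT //; clear -xa xb ya yb h1 h2 h3 h4; lra.
ring.
Qed.

Lemma cauchy_formula f a b c d z : a < RE z < b -> c < IM z < d ->
  (forall w, inrect a b c d w -> hol f w) ->
  rect (fun w => f w / (w - z)) a b c d = 2 * pi%:C * 'i * f z.
Proof.
move=> /andP[az zb] /andP[cz zd] hf.
have hz : hol f z by apply: hf; rewrite /inrect !ltW.
have [l Hl] := hz; have [d0 [d00 Hd]] := cderiv_lip Hl.
pose L := 1 + cabs l; have L0 : 0 < L by rewrite /L; have := cabs_ge0 l; lra.
apply/eqP; rewrite -subr_eq0; apply/eqP; apply: cabs_small => e e0.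
pose m := Num.min (Num.min (RE z - a) (b - RE z)) (Num.min (IM z - c) (d - IM z)).
have m0 : 0 < m by rewrite /m !lt_min; apply/andP; split; apply/andP; split; lra.
(* [m / 2] keeps the square inside the rectangle. [d0 / 4] keeps its boundary where the difference
   quotient of [f] is at most [L]; the perimeter [8 s] then gives an error of at most
   [8 L s <= e]. *)
pose s := Num.min (m / 2) (Num.min (d0 / 4) (e / (8 * L))).
have s0 : 0 < s by rewrite /s !lt_min !divr_gt0 // mulr_gt0.
have sm : s <= m / 2 by rewrite /s ge_min lexx.
have sd : s <= d0 / 4 by rewrite /s !ge_min lexx orbT.
have se : s <= e / (8 * L) by rewrite /s !ge_min lexx !orbT.
have [m1 m2 m3 m4] : [/\ m <= RE z - a, m <= b - RE z, m <= IM z - c & m <= d - IM z].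
  by rewrite /m; split; rewrite !ge_min lexx ?orbT.
clearbody s m.
have nz w : w != z -> w - z != 0 by rewrite subr_eq0.
have hq w : inrect a b c d w -> w != z -> hol (fun w => f w / (w - z)) w.
  move=> wi wz; apply: holM; first exact: hf.
  by apply: holV; [exact: nz|apply: holB; [exact: hol_id|exact: hol_cst]].
have hi w : w != z -> hol (fun w => (w - z)^-1) w.
  by move=> wz; apply: holV; [exact: nz|apply: holB; [exact: hol_id|exact: hol_cst]].
rewrite (@rect_shrink _ a b c d z s) //; try lra.
rewrite -(rect_inv_square z s0).
set x1 := RE z - s; set x2 := RE z + s; set y1 := IM z - s; set y2 := IM z + s.
have bdz : onbd x1 x2 y1 y2 (fun w => [/\ inrect a b c d w, w != z & s <= cabs (w - z) <= 2 * s]).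
  have key w : `|RE w - RE z| <= s -> `|IM w - IM z| <= s ->
     `|RE w - RE z| = s \/ `|IM w - IM z| = s ->
     [/\ inrect a b c d w, w != z & s <= cabs (w - z) <= 2 * s].
    move=> k1 k2 k3; split.
    - by move: k1 k2; rewrite !ler_norml /inrect => /andP[u1 u2] /andP[u3 u4];
        clear -u1 u2 u3 u4 m1 m2 m3 m4 sm s0; apply/andP; split; apply/andP; split; lra.
    - by apply/eqP => wz; move: k3; rewrite wz !subrr normr0 => -[]; lra.
    apply/andP; split.
      by case: k3 => <-; rewrite -?ReB -?ImB ?abs_Re_le ?abs_Im_le.
    by rewrite (le_trans (cabs_le_ReIm _)) // ReB ImB; lra.
  have ns : `|s| = s by rewrite gtr0_norm.
  have ab1 t u : u - s <= t <= u + s -> `|t - u| <= s.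
    by move=> /andP[? ?]; rewrite ler_norml; apply/andP; split; lra.
  have e1 u : `|u - s - u| = s by rewrite addrAC subrr add0r normrN.
  have e2 u : `|u + s - u| = s by rewrite addrAC subrr add0r.
  split=> t /ab1 ht; split; apply: key => /=; rewrite ?e1 ?e2 //; by [left|right].
have rc g : (forall w, inrect a b c d w -> w != z -> hol g w) -> rcont g x1 x2 y1 y2.
  move=> hg; case: bdz => b1 b2; split=> t ht; apply: hol_ccont; apply: hg.
  - by have [[]] := b1 _ ht.
  - by have [[]] := b1 _ ht.
  - by have [_ []] := b1 _ ht.
  - by have [_ []] := b1 _ ht.
  - by have [[]] := b2 _ ht.
  - by have [[]] := b2 _ ht.
  - by have [_ []] := b2 _ ht.
  - by have [_ []] := b2 _ ht.
rewrite mulrC -rectZ; last by apply: rc => w _; exact: hi.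
have rfz : rcont (fun w => f z * (w - z)^-1) x1 x2 y1 y2.
  by apply: rc => w _ wz; apply: holM; [exact: hol_cst|exact: hi].
rewrite -rectB //; last exact: rc.
have rq : rcont (fun w => f w / (w - z) - f z * (w - z)^-1) x1 x2 y1 y2.
  apply: rc => w wi wz; apply: holB; first exact: hq.
  by apply: holM; [exact: hol_cst|exact: hi].
have bd : onbd x1 x2 y1 y2 (fun w => cabs (f w / (w - z) - f z * (w - z)^-1) <= L).
  have k w : [/\ inrect a b c d w, w != z & s <= cabs (w - z) <= 2 * s] ->
     cabs (f w / (w - z) - f z * (w - z)^-1) <= L.
    move=> [_ /nz wz /andP[k1 k2]]; rewrite -mulrBl cabsM cabsV ler_pdivrMr ?cabs_gt0 //.
    have := Hd (w - z); have -> : z + (w - z) = w by ring.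
    apply; lra.
  by case: bdz => b1 b2; split=> t ht; [have [] := b1 _ ht|have [] := b2 _ ht];
    move=> B1 B2; split; apply: k.
have xx : x1 <= x2 by rewrite /x1 /x2; lra.
have yy : y1 <= y2 by rewrite /y1 /y2; lra.
have := rect_bound xx yy rq bd; move=> /le_trans; apply.
have -> : L * (2 * (x2 - x1 + (y2 - y1))) = 8 * L * s by rewrite /x1 /x2 /y1 /y2; ring.
by rewrite mulrC -ler_pdivlMr // mulr_gt0.
Qed.

End CauchyFormula.

(** * Consequences of Cauchy's formula: limits, maximum principle, identity theorem *)

Section CauchyConsequences.
Variable R : realType.
Local Notation C := R[i].
Implicit Types (f g : C -> C) (a b c d x y t s r M : R) (z w h : C).

Lemma ccontB f g z : ccont f z -> ccont g z -> ccont (fun w => f w - g w) z.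
Proof.
move=> F G e e0; have e2 : 0 < e / 2 by lra.
have [d1 [d10 H1]] := F _ e2; have [d2 [d20 H2]] := G _ e2.
exists (Num.min d1 d2); split; first by rewrite lt_min d10.
move=> h; rewrite lt_min => /andP[/H1 h1 /H2 h2].
have -> : f (z + h) - g (z + h) - (f z - g z) = (f (z + h) - f z) - (g (z + h) - g z) by ring.
rewrite (le_trans (cabsB _ _)) //; lra.
Qed.

Lemma ccontM f g z : ccont f z -> ccont g z -> ccont (fun w => f w * g w) z.
Proof.
move=> F G e e0.
pose A := 1 + cabs (f z); pose B := 1 + cabs (g z).
have A0 : 0 < A by rewrite ltr_pwDl ?cabs_ge0.
have B0 : 0 < B by rewrite ltr_pwDl ?cabs_ge0.
have e2 : 0 < e / 2 by lra.
have [d1 [d10 H1]] := F _ (divr_gt0 e2 B0).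
have [d2 [d20 H2]] := G _ (divr_gt0 e2 A0).
have [d3 [d30 H3]] := ccont_bounded F.
exists (Num.min d1 (Num.min d2 d3)); split; first by rewrite !lt_min d10 d20.
move=> h; rewrite !lt_min => /andP[/H1 h1 /andP[/H2 h2 /H3 h3]].
have -> : f (z + h) * g (z + h) - f z * g z =
  (f (z + h) - f z) * g z + f (z + h) * (g (z + h) - g z) by ring.
rewrite (le_trans (cabsD _ _)) // !cabsM.
have t1 : cabs (f (z + h) - f z) * cabs (g z) <= e / 2.
  apply: (@le_trans _ _ (e / 2 / B * B)); last by rewrite divfK // gt_eqF.
  by rewrite ler_pM ?cabs_ge0 // /B lerDr.
have t2 : cabs (f (z + h)) * cabs (g (z + h) - g z) <= e / 2.
  apply: (@le_trans _ _ (A * (e / 2 / A))); last by rewrite mulrC divfK // gt_eqF.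
  by rewrite ler_pM ?cabs_ge0.
lra.
Qed.

Lemma cderiv_quadratic f z l M r : 0 < r ->
  (forall h, cabs h < r -> cabs (f (z + h) - f z - l * h) <= M * cabs h ^+ 2) -> cderiv f z l.
Proof.
move=> r0 H e e0; exists (Num.min r (e / (1 + `|M|))).
have M0 : 0 < 1 + `|M| by rewrite ltr_pwDl.
split; first by rewrite lt_min r0 divr_gt0.
move=> h; rewrite lt_min => /andP[h1]; rewrite ltr_pdivlMr // => h2.
rewrite (le_trans (H _ h1)) // expr2 mulrA ler_wpM2r ?cabs_ge0 //.
have := ler_norm M; have := cabs_ge0 h; nra.
Qed.

(** Closed squares of half-side [s] play the role of discs, since their boundary [bdsq] consists of
    four segments. *)
Definition insq z s w := (`|RE w - RE z| <= s) && (`|IM w - IM z| <= s).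
Definition bdsq z s w := insq z s w && ((`|RE w - RE z| == s) || (`|IM w - IM z| == s)).

Lemma insqE z s w : inrect (RE z - s) (RE z + s) (IM z - s) (IM z + s) w = insq z s w.
Proof. by rewrite /inrect /insq !ler_distl. Qed.

Definition sqi f z s := rect f (RE z - s) (RE z + s) (IM z - s) (IM z + s).

Lemma onbd_bdsq z s (P : C -> Prop) : 0 <= s -> (forall w, bdsq z s w -> P w) ->
  onbd (RE z - s) (RE z + s) (IM z - s) (IM z + s) P.
Proof.
move=> s0 H.
have ns u : `|u - s - u| = s by rewrite addrAC subrr add0r normrN ger0_norm.
have ps u : `|u + s - u| = s by rewrite addrAC subrr add0r ger0_norm.
split=> t ht; split; apply: H; rewrite /bdsq /insq /= ?ns ?ps ?ler_distl ?ht ?lexx ?eqxx ?orbT //.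
Qed.

Lemma bdsq_rcont f z s : 0 <= s -> (forall w, bdsq z s w -> ccont f w) ->
  rcont f (RE z - s) (RE z + s) (IM z - s) (IM z + s).
Proof.
move=> s0 H; have [h1 h2] := onbd_bdsq s0 H.
by split=> t ht; [have [] := h1 t ht|have [] := h1 t ht|have [] := h2 t ht|have [] := h2 t ht].
Qed.

Lemma eq_rect_bd f g z s : 0 <= s -> (forall w, bdsq z s w -> f w = g w) ->
  rect f (RE z - s) (RE z + s) (IM z - s) (IM z + s) =
  rect g (RE z - s) (RE z + s) (IM z - s) (IM z + s).
Proof.
move=> s0 H; have [h1 h2] := onbd_bdsq s0 H; rewrite /rect /hint /vint.
congr (_ + _ * _ - _ - _ * _); apply: eq_cint => t ht;
  by [have [] := h1 t ht|have [] := h2 t ht].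
Qed.

Lemma sqi_bound f z s M : 0 <= s -> (forall w, bdsq z s w -> ccont f w) ->
  (forall w, bdsq z s w -> cabs (f w) <= M) -> cabs (sqi f z s) <= M * (8 * s).
Proof.
move=> s0 cf bf; have := @rect_bound R f (RE z - s) (RE z + s) (IM z - s) (IM z + s) M.
have -> : 2 * (RE z + s - (RE z - s) + (IM z + s - (IM z - s))) = 8 * s by ring.
apply; [lra|lra|exact: bdsq_rcont|exact: onbd_bdsq].
Qed.

Lemma bdsq_dist z s r w u : bdsq z s w -> insq z (s - r) u -> r <= cabs (w - u).
Proof.
move=> /andP[/andP[w1 w2] w3] /andP[u1 u2].
move: w3 => /orP[/eqP w3|/eqP w3].
  apply: le_trans _ (abs_Re_le _); rewrite ReB.
  have := ler_distD (RE u) (RE w) (RE z); lra.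
apply: le_trans _ (abs_Im_le _); rewrite ImB.
have := ler_distD (IM u) (IM w) (IM z); lra.
Qed.

Lemma insq_shift z s r u h : insq z (s - r) u -> cabs h <= r / 2 -> insq z (s - r / 2) (u + h).
Proof.
move=> /andP[u1 u2] hr; have h1 := abs_Re_le h; have h2 := abs_Im_le h.
rewrite /insq ReD ImD; apply/andP; split.
  by rewrite addrAC (le_trans (ler_normD _ _)) //; lra.
by rewrite addrAC (le_trans (ler_normD _ _)) //; lra.
Qed.

Lemma insq_cabs z s w : insq z s w -> cabs (w - z) <= 2 * s.
Proof.
by move=> /andP[h1 h2]; rewrite (le_trans (cabs_le_ReIm _)) // ReB ImB; lra.
Qed.

Lemma cabs_insq z s w : cabs (w - z) <= s -> insq z s w.
Proof.
by move=> h; rewrite /insq -ReB -ImB !(le_trans _ h) ?abs_Re_le ?abs_Im_le.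
Qed.

Lemma sqi_param_deriv z s (K : C -> C -> C) (D : C -> C) u h M : 0 <= s ->
  (forall w, bdsq z s w -> ccont (fun w => K w (u + h)) w) ->
  (forall w, bdsq z s w -> ccont (fun w => K w u) w) ->
  (forall w, bdsq z s w -> ccont D w) ->
  (forall w, bdsq z s w -> cabs (K w (u + h) - K w u - h * D w) <= M * cabs h ^+ 2) ->
  cabs (sqi (fun w => K w (u + h)) z s - sqi (fun w => K w u) z s - sqi D z s * h)
    <= M * (8 * s) * cabs h ^+ 2.
Proof.
move=> s0 c1 c2 c3 H.
have c4 w : bdsq z s w -> ccont (fun w => h * D w) w.
  move=> bw e e0; have k1 : 0 < 1 + cabs h by rewrite ltr_pwDl ?cabs_ge0.
  have [d [d0 Hd]] := c3 w bw _ (divr_gt0 e0 k1); exists d; split=> // k /Hd hh.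
  rewrite -mulrBr cabsM; have := cabs_ge0 h.
  rewrite ler_pdivlMr // in hh; have := cabs_ge0 (D (w + k) - D w); nra.
have c5 w : bdsq z s w -> ccont (fun w => K w (u + h) - K w u) w.
  by move=> bw; apply: ccontB; [exact: c1|exact: c2].
have -> : sqi (fun w => K w (u + h)) z s - sqi (fun w => K w u) z s - sqi D z s * h =
   sqi (fun w => K w (u + h) - K w u - h * D w) z s.
  rewrite /sqi rectB; [|exact: bdsq_rcont|exact: bdsq_rcont].
  rewrite rectB; [|exact: bdsq_rcont|exact: bdsq_rcont].
  by rewrite rectZ; [rewrite mulrC|exact: bdsq_rcont].
rewrite mulrAC; apply: sqi_bound => //.
by move=> w bw; apply: ccontB; [exact: c5|exact: c4].
Qed.

(** The second-order remainder of [1 / (w - h)] in closed form; its bound depends only on the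
    distance [r], hence is uniform over the boundary. *)
Lemma kernel1_bound (w h : C) r B F : 0 < r -> r <= cabs w -> cabs h <= r / 2 -> cabs F <= B ->
  cabs (F * (w - h)^-1 - F * w^-1 - h * (F * w^-1 ^+ 2)) <= 2 * B / r ^+ 3 * cabs h ^+ 2.
Proof.
move=> r0 rw hr FB.
have wh : r / 2 <= cabs (w - h) by have := cabsB_ge w h; lra.
have w0 : w != 0 by rewrite -cabs_gt0; lra.
have wh0 : w - h != 0 by rewrite -cabs_gt0; lra.
have -> : F * (w - h)^-1 - F * w^-1 - h * (F * w^-1 ^+ 2) = F * h ^+ 2 * (w^-1 ^+ 2 * (w - h)^-1).
  by field; rewrite w0 wh0.
rewrite !cabsM !cabsV -!expr2.
have B0 : 0 <= B by rewrite (le_trans _ FB) ?cabs_ge0.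
have i1 : (cabs w)^-1 <= r^-1 by rewrite lef_pV2 ?posrE //; lra.
have i2 : (cabs (w - h))^-1 <= (r / 2)^-1 by rewrite lef_pV2 ?posrE //; lra.
have -> : 2 * B / r ^+ 3 * cabs h ^+ 2 = B * cabs h ^+ 2 * (r^-1 ^+ 2 * (r / 2)^-1).
  by field; rewrite gt_eqF.
apply: ler_pM; rewrite ?mulr_ge0 ?exprn_ge0 ?invr_ge0 ?cabs_ge0 //.
  by rewrite ler_wpM2r ?exprn_ge0 ?cabs_ge0.
apply: ler_pM; rewrite ?exprn_ge0 ?invr_ge0 ?cabs_ge0 //.
by rewrite lerXn2r ?nnegrE ?invr_ge0 ?cabs_ge0 // ltW.
Qed.

Lemma kernel2_bound (w h : C) r B F : 0 < r -> r <= cabs w -> cabs h <= r / 2 -> cabs F <= B ->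
  cabs (F * (w - h)^-1 ^+ 2 - F * w^-1 ^+ 2 - h * (F * (2 * w^-1 ^+ 3)))
    <= 16 * B / r ^+ 4 * cabs h ^+ 2.
Proof.
move=> r0 rw hr FB.
have wh : r / 2 <= cabs (w - h) by have := cabsB_ge w h; lra.
have w0 : w != 0 by rewrite -cabs_gt0; lra.
have wh0 : w - h != 0 by rewrite -cabs_gt0; lra.
have -> : F * (w - h)^-1 ^+ 2 - F * w^-1 ^+ 2 - h * (F * (2 * w^-1 ^+ 3)) =
    F * h ^+ 2 * ((3 - 2 * (h / w)) * (w^-1 ^+ 2 * (w - h)^-1 ^+ 2)).
  by field; rewrite w0 wh0.
rewrite !cabsM !cabsV -!expr2.
have B0 : 0 <= B by rewrite (le_trans _ FB) ?cabs_ge0.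
have i1 : (cabs w)^-1 <= r^-1 by rewrite lef_pV2 ?posrE //; lra.
have i2 : (cabs (w - h))^-1 <= (r / 2)^-1 by rewrite lef_pV2 ?posrE //; lra.
have i3 : cabs (3 - 2 * (h / w)) <= 4.
  rewrite (le_trans (cabsB _ _)) // !cabsM !cabs_nat cabsV.
  suff : cabs h / cabs w <= 1 / 2 by lra.
  rewrite ler_pdivrMr; lra.
have -> : 16 * B / r ^+ 4 * cabs h ^+ 2 = B * cabs h ^+ 2 * (4 * (r^-1 ^+ 2 * (r / 2)^-1 ^+ 2)).
  by field; rewrite gt_eqF.
apply: ler_pM; rewrite ?mulr_ge0 ?exprn_ge0 ?invr_ge0 ?cabs_ge0 //.
  by rewrite ler_wpM2r ?exprn_ge0 ?cabs_ge0.
apply: ler_pM; rewrite ?mulr_ge0 ?exprn_ge0 ?invr_ge0 ?cabs_ge0 //.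
apply: ler_pM; rewrite ?exprn_ge0 ?invr_ge0 ?cabs_ge0 //.
  by rewrite lerXn2r ?nnegrE ?invr_ge0 ?cabs_ge0 // ltW.
by rewrite lerXn2r ?nnegrE ?invr_ge0 ?cabs_ge0 //; lra.
Qed.

Lemma cont_on_bounded a b (f : R -> C) : a <= b -> cont_on a b f ->
  exists M, forall t, a <= t <= b -> cabs (f t) <= M.
Proof.
move=> ab cf.
have cc : {within `[a, b], continuous (fun t => cabs (f t))}.
  apply: within_continuousW => t /cf ct; apply/continuous_epsP => e /ct [d [d0 Hd]].
  exists d; split=> // h /Hd; apply: le_trans; rewrite ler_norml.
  have := cabsB_ge (f (t + h)) (f t); have := cabsB_ge (f t) (f (t + h)).
  by rewrite (cabsBC (f t)) => ? ?; apply/andP; split; lra.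
have [c _ Hc] := EVT_max ab cc.
by exists (cabs (f c)) => t ht; apply: Hc; rewrite in_itv.
Qed.

Lemma bdsq_bounded f z s : 0 <= s -> (forall w, bdsq z s w -> ccont f w) ->
  exists2 B, 0 <= B & forall w, bdsq z s w -> cabs (f w) <= B.
Proof.
move=> s0 cf; have [h1 h2 h3 h4] := bdsq_rcont s0 cf.
have lx : RE z - s <= RE z + s by lra.
have ly : IM z - s <= IM z + s by lra.
have [M1 H1] := cont_on_bounded lx (hcont_on h1).
have [M2 H2] := cont_on_bounded lx (hcont_on h2).
have [M3 H3] := cont_on_bounded ly (vcont_on h3).
have [M4 H4] := cont_on_bounded ly (vcont_on h4).
exists (`|M1| + `|M2| + `|M3| + `|M4|); first by rewrite !addr_ge0.
move=> [x y] /andP[/andP[]] /=; rewrite !ler_distl => w1 w2 w3.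
have n1 := ler_norm M1; have n2 := ler_norm M2; have n3 := ler_norm M3; have n4 := ler_norm M4.
have p1 := normr_ge0 M1; have p2 := normr_ge0 M2; have p3 := normr_ge0 M3; have p4 := normr_ge0 M4.
move: w3 => /orP[|] /eqP w3.
  have [k|k] := leP 0 (x - RE z).
    have -> : x = RE z + s by rewrite -w3 ger0_norm //; ring.
    by rewrite (le_trans (H4 _ w2)) //; lra.
  have -> : x = RE z - s by rewrite -w3 ltr0_norm //; ring.
  by rewrite (le_trans (H3 _ w2)) //; lra.
have [k|k] := leP 0 (y - IM z).
  have -> : y = IM z + s by rewrite -w3 ger0_norm //; ring.
  by rewrite (le_trans (H2 _ w1)) //; lra.
have -> : y = IM z - s by rewrite -w3 ltr0_norm //; ring.
by rewrite (le_trans (H1 _ w1)) //; lra.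
Qed.

Definition tpi : C := 2 * pi%:C * 'i.

Lemma tpi_neq0 : tpi != 0.
Proof.
rewrite /tpi !mulf_neq0 // -cabs_gt0 ?cabs_i //.
by rewrite cabs_real gtr0_norm pi_gt0.
Qed.

Lemma cabs_tpi : cabs tpi = 2 * pi.
Proof. by rewrite /tpi !cabsM cabs_i cabs_nat cabs_real mulr1 gtr0_norm ?pi_gt0. Qed.

Lemma cabs_tpiV_le : cabs tpi^-1 <= 4^-1.
Proof. by rewrite cabsV cabs_tpi lef_pV2 ?posrE; have := pi_ge2 R; lra. Qed.

Lemma cauchy_sq f z s u : 0 < s -> `|RE u - RE z| < s -> `|IM u - IM z| < s ->
  (forall w, insq z s w -> hol f w) -> f u = tpi^-1 * sqi (fun w => f w * (w - u)^-1) z s.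
Proof.
move=> s0 h1 h2 hf; rewrite /sqi cauchy_formula.
- by rewrite mulrA mulVf ?mul1r // tpi_neq0.
- by rewrite -ltr_distl.
- by rewrite -ltr_distl.
- by move=> w; rewrite insqE; exact: hf.
Qed.

Lemma bdsq_neq z s r w u : 0 < r -> bdsq z s w -> insq z (s - r) u -> w - u != 0.
Proof. by move=> r0 /bdsq_dist /[apply] h; rewrite -cabs_gt0; lra. Qed.

Lemma bdsq_ccont_kernel f z s r u n : 0 < r -> insq z (s - r) u ->
  (forall w, bdsq z s w -> ccont f w) ->
  forall w, bdsq z s w -> ccont (fun w => f w * (w - u)^-1 ^+ n) w.
Proof.
move=> r0 hu cf w bw; apply: ccontM; first exact: cf.
apply: hol_ccont; apply: holX; apply: holV; first exact: bdsq_neq bw hu.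
by apply: holB; [exact: hol_id|exact: hol_cst].
Qed.

(** [G n] is the Cauchy integral with kernel [(w - u)^(-n)], so [G 1] has derivative [G 2] and [G 2]
    has derivative [2 G 3]. Only continuity of [f] on the boundary is assumed, because the lemma
    serves for uniform limits and for quotients [f w / (w - z)]. *)
Lemma cauchy_kernel_deriv f z s r : 0 < r -> r <= s -> (forall w, bdsq z s w -> ccont f w) ->
  let G := fun n u => tpi^-1 * sqi (fun w => f w * (w - u)^-1 ^+ n) z s in
  exists M, forall u h, insq z (s - r) u -> cabs h <= r / 2 ->
    cabs (G 1%N (u + h) - G 1%N u - G 2%N u * h) <= M * cabs h ^+ 2 /\
    cabs (G 2%N (u + h) - G 2%N u - 2 * G 3%N u * h) <= M * cabs h ^+ 2.
Proof.
move=> r0 rs cf G; have s0 : 0 <= s by lra.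
have [B B0 HB] := bdsq_bounded s0 cf.
exists (4^-1 * ((2 * B / r ^+ 3 + 16 * B / r ^+ 4) * (8 * s))) => u h hu hr.
have hu' : insq z (s - r / 2) (u + h) by exact: insq_shift.
have r20 : 0 < r / 2 by lra.
have rn3 : 0 <= B / r ^+ 3 by rewrite divr_ge0 // exprn_ge0 // ltW.
have rn4 : 0 <= B / r ^+ 4 by rewrite divr_ge0 // exprn_ge0 // ltW.
have h20 : 0 <= cabs h ^+ 2 by rewrite exprn_ge0 ?cabs_ge0.
have wE w : w - (u + h) = (w - u) - h by ring.
split.
  have -> : G 1%N (u + h) - G 1%N u - G 2%N u * h = tpi^-1 *
    (sqi (fun w => f w * (w - (u + h))^-1 ^+ 1) z s - sqi (fun w => f w * (w - u)^-1 ^+ 1) z s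
     - sqi (fun w => f w * (w - u)^-1 ^+ 2) z s * h) by rewrite /G; ring.
  rewrite cabsM -[X in _ <= X]mulrA; apply: ler_pM; [exact: cabs_ge0|exact: cabs_ge0|exact: cabs_tpiV_le|].
  apply: (@sqi_param_deriv z s (fun w v => f w * (w - v)^-1 ^+ 1)
    (fun w => f w * (w - u)^-1 ^+ 2) u h (2 * B / r ^+ 3 + 16 * B / r ^+ 4) s0).
  - exact: bdsq_ccont_kernel hu' cf.
  - exact: bdsq_ccont_kernel hu cf.
  - exact: bdsq_ccont_kernel hu cf.
  move=> w bw; rewrite !expr1 wE.
  apply: le_trans (kernel1_bound r0 (bdsq_dist bw hu) hr (HB w bw)) _.
  by rewrite ler_wpM2r // lerDl // -mulrA mulr_ge0.
have -> : G 2%N (u + h) - G 2%N u - 2 * G 3%N u * h = tpi^-1 *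
  (sqi (fun w => f w * (w - (u + h))^-1 ^+ 2) z s - sqi (fun w => f w * (w - u)^-1 ^+ 2) z s
   - sqi (fun w => 2 * (f w * (w - u)^-1 ^+ 3)) z s * h).
  have -> : sqi (fun w => 2 * (f w * (w - u)^-1 ^+ 3)) z s =
      2 * sqi (fun w => f w * (w - u)^-1 ^+ 3) z s.
    by rewrite /sqi rectZ //; apply: bdsq_rcont => //; exact: bdsq_ccont_kernel hu cf.
  rewrite /G; ring.
rewrite cabsM -[X in _ <= X]mulrA; apply: ler_pM; [exact: cabs_ge0|exact: cabs_ge0|exact: cabs_tpiV_le|].
apply: (@sqi_param_deriv z s (fun w v => f w * (w - v)^-1 ^+ 2)
  (fun w => 2 * (f w * (w - u)^-1 ^+ 3)) u h (2 * B / r ^+ 3 + 16 * B / r ^+ 4) s0).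
- exact: bdsq_ccont_kernel hu' cf.
- exact: bdsq_ccont_kernel hu cf.
- move=> w bw; apply: ccontM; first exact: (cderiv_ccont (cderiv_cst _ _)).
  exact: bdsq_ccont_kernel hu cf w bw.
move=> w bw; rewrite wE.
have := kernel2_bound r0 (bdsq_dist bw hu) hr (HB w bw).
have -> : f w * (2 * (w - u)^-1 ^+ 3) = 2 * (f w * (w - u)^-1 ^+ 3) by ring.
move=> /le_trans; apply.
by rewrite ler_wpM2r // lerDr // -mulrA mulr_ge0.
Qed.

(** Yields a derivative that is itself holomorphic, with a uniform quadratic remainder: what
    primitives and logarithms require. *)
Lemma taylor2 f z s r : 0 < r -> r < s -> (forall w, insq z s w -> hol f w) ->
  exists df M, (forall u, insq z (s - r) u -> hol df u) /\
   forall u h, insq z (s - r) u -> cabs h <= r / 2 ->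
    cabs (f (u + h) - f u - df u * h) <= M * cabs h ^+ 2.
Proof.
move=> r0 rs hf; have s0 : 0 < s by lra.
have cf w : bdsq z s w -> ccont f w by move=> /andP[/hf /hol_ccont].
have [M HM] := cauchy_kernel_deriv r0 (ltW rs) cf.
exists (fun u => tpi^-1 * sqi (fun w => f w * (w - u)^-1 ^+ 2) z s), M; split=> [u hu|u h hu hr].
  eexists; apply: (@cderiv_quadratic _ _ _ M (r / 2)); first lra.
  by move=> h /ltW hr; have [_] := HM u h hu hr; apply.
have [] := HM u h hu hr; have hu' := insq_shift hu hr.
have E v q : 0 < q -> insq z (s - q) v -> tpi^-1 * sqi (fun w => f w * (w - v)^-1 ^+ 1) z s = f v.
  move=> q0 /andP[v1 v2]; rewrite (cauchy_sq s0 _ _ hf) //; lra.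
by rewrite (E u r) // (E (u + h) (r / 2)) //; lra.
Qed.

Lemma disc_insq z r w : 0 < r -> insq z (r / 2) w -> cabs (w - z) < r.
Proof.
move=> r0 /andP[h1 h2].
rewrite -(@ltr_pXn2r _ 2) ?nnegrE ?cabs_ge0 ?ltW // cabs_sqr ReB ImB.
rewrite -(real_normK (num_real (RE w - RE z))) -(real_normK (num_real (IM w - IM z))).
have := normr_ge0 (RE w - RE z); have := normr_ge0 (IM w - IM z); nra.
Qed.

Lemma ccont_unif (f_ : nat -> C -> C) f z r : 0 < r ->
  (forall n w, cabs (w - z) < r -> ccont (f_ n) w) ->
  (forall e, 0 < e -> exists n, forall w, cabs (w - z) < r -> cabs (f_ n w - f w) <= e) ->
  forall w, cabs (w - z) < r -> ccont f w.
Proof.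
move=> r0 cf U w wr e e0; have e3 : 0 < e / 3 by lra.
have [n Hn] := U _ e3; have [d [d0 Hd]] := cf n w wr _ e3.
exists (Num.min d (r - cabs (w - z))); split; first by rewrite lt_min d0 subr_gt0.
move=> h; rewrite lt_min => /andP[h1 h2].
have wh : cabs (w + h - z) < r.
  by rewrite addrAC (le_lt_trans (cabsD _ _)) //; lra.
have -> : f (w + h) - f w = - (f_ n (w + h) - f (w + h)) + (f_ n (w + h) - f_ n w)
   + (f_ n w - f w) by ring.
have k1 := Hn _ wh; have k2 := Hn _ wr; have k3 := Hd _ h1.
have s1 := cabsD (- (f_ n (w + h) - f (w + h)) + (f_ n (w + h) - f_ n w)) (f_ n w - f w).
have s2 := cabsD (- (f_ n (w + h) - f (w + h))) (f_ n (w + h) - f_ n w).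
rewrite cabsN in s2; lra.
Qed.

(** Cauchy's formula for [f_ n] passes to the uniform limit, so [f] is the Cauchy integral of its
    own continuous boundary values and is differentiable by [cauchy_kernel_deriv]. *)
Lemma weierstrass (f_ : nat -> C -> C) f z r : 0 < r ->
  (forall n w, cabs (w - z) < r -> hol (f_ n) w) ->
  (forall e, 0 < e -> exists n, forall w, cabs (w - z) < r -> cabs (f_ n w - f w) <= e) ->
  hol f z.
Proof.
move=> r0 hf U.
have cf := ccont_unif r0 (fun n w (h : cabs (w - z) < r) => hol_ccont (hf n w h)) U.
pose s := r / 2; have s0 : 0 < s by rewrite /s; lra.
have ins w : insq z s w -> cabs (w - z) < r by exact: disc_insq.
have cb w : bdsq z s w -> ccont f w by move=> /andP[/ins /cf].
pose q := s / 2; have q0 : 0 < q by rewrite /q; lra.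
have qs : q <= s by rewrite /q; lra.
have [M HM] := cauchy_kernel_deriv q0 qs cb.
have zin : insq z (s - q) z.
  by rewrite /insq !subrr normr0 /q; apply/andP; split; lra.
have E u : insq z (s - q / 2) u -> tpi^-1 * sqi (fun w => f w * (w - u)^-1 ^+ 1) z s = f u.
  move=> hu; apply/eqP; rewrite -subr_eq0; apply/eqP; apply: cabs_small => e e0.
  have q20 : 0 < q / 2 by lra.
  pose k := 1 + (q / 2)^-1 * (8 * s).
  have k0 : 0 < k by rewrite /k ltr_pwDl // mulr_ge0 ?invr_ge0 //; lra.
  have [n Hn] := U _ (divr_gt0 e0 k0).
  have ur : cabs (u - z) < r.
    apply: ins; move: hu => /andP[u1 u2]; rewrite /insq; apply/andP; split; lra.
  have fn : f_ n u = tpi^-1 * sqi (fun w => f_ n w * (w - u)^-1 ^+ 1) z s.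
    move: hu => /andP[u1 u2]; apply: cauchy_sq => //; [lra|lra|].
    by move=> w /ins; exact: hf.
  have kn := @bdsq_ccont_kernel (f_ n) z s (q / 2) u 1 q20 hu
    (fun w bw => hol_ccont (hf n w (ins w (andP bw).1))).
  have k0' := @bdsq_ccont_kernel f z s (q / 2) u 1 q20 hu cb.
  have -> : tpi^-1 * sqi (fun w => f w * (w - u)^-1 ^+ 1) z s - f u =
     - (tpi^-1 * sqi (fun w => f_ n w * (w - u)^-1 ^+ 1 - f w * (w - u)^-1 ^+ 1) z s)
      + (f_ n u - f u).
    rewrite /sqi rectB.
    - by rewrite -!/(sqi _ z s) fn; ring.
    - apply: bdsq_rcont; first exact: ltW.
      exact: kn.
    - by apply: bdsq_rcont; [exact: ltW|exact: k0'].
  have b : cabs (sqi (fun w => f_ n w * (w - u)^-1 ^+ 1 - f w * (w - u)^-1 ^+ 1) z s) <=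
     e / k * (q / 2)^-1 * (8 * s).
    apply: sqi_bound; first exact: ltW.
      by move=> w bw; apply: ccontB; [exact: kn|exact: k0'].
    move=> w bw; have wr : cabs (w - z) < r by apply: ins; case/andP: bw.
    rewrite -mulrBl expr1 cabsM cabsV; apply: ler_pM; rewrite ?cabs_ge0 ?invr_ge0 ?cabs_ge0 //.
      exact: Hn.
    have dd := bdsq_dist bw hu.
    by rewrite lef_pV2 ?posrE //; lra.
  rewrite (le_trans (cabsD _ _)) // cabsN cabsM.
  have t := cabs_tpiV_le; have hn := Hn _ ur.
  have sq0 := cabs_ge0 (sqi (fun w => f_ n w * (w - u)^-1 ^+ 1 - f w * (w - u)^-1 ^+ 1) z s).
  have ek : e / k + e / k * (q / 2)^-1 * (8 * s) = e.
    by rewrite -mulrA -{1}[e / k]mulr1 -mulrDr -/k divfK // gt_eqF.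
  have t2 : cabs tpi^-1 * cabs (sqi (fun w => f_ n w * (w - u)^-1 ^+ 1 - f w * (w - u)^-1 ^+ 1) z s)
    <= 1 * (e / k * (q / 2)^-1 * (8 * s)).
    by apply: ler_pM; rewrite ?cabs_ge0 //; lra.
  by rewrite -ek addrC lerD // (le_trans t2) // mul1r.
eexists; apply: (@cderiv_quadratic _ _ _ M (q / 2)); first lra.
move=> h /ltW hr; have [] := HM z h zin hr.
have zin' : insq z (s - q / 2) z by rewrite /insq !subrr normr0 /q; apply/andP; split; lra.
by rewrite (E z zin') (E (z + h) (insq_shift zin hr)) => k _; exact: k.
Qed.

Lemma cauchy_sq_bound f z s r u M : 0 < r -> r <= s -> insq z (s - r) u ->
  (forall w, insq z s w -> hol f w) -> (forall w, bdsq z s w -> cabs (f w) <= M) ->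
  cabs (f u) <= 2 * s / r * M.
Proof.
move=> r0 rs hu hf B; have s0 : 0 < s by lra.
have E : f u = tpi^-1 * sqi (fun w => f w * (w - u)^-1 ^+ 1) z s.
  by move: hu => /andP[u1 u2]; apply: cauchy_sq => //; lra.
have cf w : bdsq z s w -> ccont f w by move=> /andP[/hf /hol_ccont].
have b : cabs (sqi (fun w => f w * (w - u)^-1 ^+ 1) z s) <= M * r^-1 * (8 * s).
  apply: sqi_bound; first exact: ltW.
    exact: bdsq_ccont_kernel hu cf.
  move=> w bw; rewrite expr1 cabsM cabsV; apply: ler_pM; rewrite ?cabs_ge0 ?invr_ge0 ?cabs_ge0 //.
    exact: B.
  have dd := bdsq_dist bw hu.
  by rewrite lef_pV2 ?posrE //; lra.
rewrite E cabsM.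
have -> : 2 * s / r * M = 4^-1 * (M * r^-1 * (8 * s)) by field; rewrite gt_eqF.
by apply: ler_pM; rewrite ?cabs_ge0 ?cabs_tpiV_le.
Qed.

Lemma bounded_powers_le1 x K : 0 <= x -> (forall n, x ^+ n <= K) -> x <= 1.
Proof.
move=> x0 H; rewrite leNgt; apply/negP => x1.
pose d := x - 1; have d0 : 0 < d by rewrite /d; lra.
have bern n : 1 + n%:R * d <= x ^+ n.
  elim: n => [|n ih]; first by rewrite mul0r addr0 expr0.
  have n0 : (0 : R) <= n%:R by [].
  have d1 : 0 <= 1 + d by lra.
  have := ler_wpM2l d1 ih; have -> : (1 + d) * x ^+ n = x ^+ n.+1.
    by rewrite exprS /d; congr (_ * _); ring.
  by apply: le_trans; rewrite -natr1; nra.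
have [n Hn] : exists n : nat, K < 1 + n%:R * d.
  exists (Num.truncn (K / d)).+1; have := truncnS_gt (K / d).
  by rewrite ltr_pdivrMr // => h; lra.
have := le_trans (bern n) (H n); lra.
Qed.

(** Cauchy's estimate loses the factor [2 s / r]. Applied to [f ^+ n] it bounds all powers of
    [cabs (f u) / M] by the same constant, which forces the base to be at most 1. *)
Lemma max_principle_sq f z s u M : 0 < s -> `|RE u - RE z| < s -> `|IM u - IM z| < s ->
  (forall w, insq z s w -> hol f w) -> (forall w, bdsq z s w -> cabs (f w) <= M) ->
  0 < M -> cabs (f u) <= M.
Proof.
move=> s0 u1 u2 hf B M0.
pose r := Num.min (s - `|RE u - RE z|) (s - `|IM u - IM z|).
have r0 : 0 < r by rewrite lt_min !subr_gt0 u1.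
have rs : r <= s by rewrite ge_min lerBlDr lerDl normr_ge0.
have hu : insq z (s - r) u.
  rewrite /insq; have : r <= s - `|RE u - RE z| by rewrite ge_min lexx.
  have : r <= s - `|IM u - IM z| by rewrite ge_min lexx orbT.
  by move=> k1 k2; apply/andP; split; lra.
suff : cabs (f u) / M <= 1 by rewrite ler_pdivrMr // mul1r.
apply: (@bounded_powers_le1 _ (2 * s / r)); first by rewrite divr_ge0 ?cabs_ge0 // ltW.
move=> n; rewrite expr_div_n ler_pdivrMr ?exprn_gt0 // -cabsX.
apply: (@cauchy_sq_bound (fun w => f w ^+ n) z s r) => //.
  by move=> w /hf hw; exact: holX.
by move=> w /B bw; rewrite cabsX lerXn2r ?nnegrE ?cabs_ge0 // ltW.
Qed.

(** Since [f] vanishes near [z], division by [(w - z)^n] keeps it holomorphic. The maximum principle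
    for the quotient gives [cabs (f w) <= (t / s)^n (B + 1)] for every [n], so the radius [q] of the
    given disc does not affect the result. *)
Lemma identity_local f z r q : 0 < q -> 0 < r ->
  (forall w, cabs (w - z) < r -> hol f w) -> (forall w, cabs (w - z) < q -> f w = 0) ->
  forall w, cabs (w - z) < r / 2 -> f w = 0.
Proof.
move=> q0 r0 hf fz w wr; apply: cabs_small => e e0.
pose s := r / 2; have s0 : 0 < s by rewrite /s; lra.
have cf u : bdsq z s u -> ccont f u by move=> /andP[/(disc_insq r0) /hf /hol_ccont].
have [B B0 HB] := bdsq_bounded (ltW s0) cf.
have [->|wz] := eqVneq w z; first by rewrite fz ?cabs0 ?subrr ?cabs0 ?ltW // cabs0.
pose t := cabs (w - z); have t0 : 0 < t by rewrite cabs_gt0 subr_eq0.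
have ts : t < s by [].
pose g n u := f u * (u - z)^-1 ^+ n.
have hg n u : insq z s u -> hol (g n) u.
  move=> /(disc_insq r0) ur; have [uq|uq] := ltP (cabs (u - z)) q.
    apply: (@hol_near _ (fun=> 0) _ _ (q - cabs (u - z))); rewrite ?subr_gt0 //; last exact: hol_cst.
    by move=> h hq; rewrite /g fz ?mul0r // addrAC (le_lt_trans (cabsD _ _)) //; lra.
  apply: holM; first exact: hf.
  apply: holX; apply: holV; last by apply: holB; [exact: hol_id|exact: hol_cst].
  by rewrite -cabs_gt0 (lt_le_trans q0).
have key n : cabs (f w) <= (t / s) ^+ n * (B + 1).
  have : cabs (g n w) <= s^-1 ^+ n * (B + 1).
    apply: (@max_principle_sq (g n) z s) => //.
    - by rewrite -ReB (le_lt_trans (abs_Re_le _)).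
    - by rewrite -ImB (le_lt_trans (abs_Im_le _)).
    - exact: hg.
    - move=> u bu; rewrite /g cabsM cabsX cabsV mulrC.
      apply: ler_pM; rewrite ?exprn_ge0 ?invr_ge0 ?cabs_ge0 //; last by rewrite (le_trans (HB _ bu)) //; lra.
      rewrite lerXn2r ?nnegrE ?invr_ge0 ?cabs_ge0 ?(ltW s0) //.
      have zin : insq z (s - s) z by rewrite /insq !subrr normr0 lexx.
      by have := bdsq_dist bu zin => k; rewrite lef_pV2 ?posrE //; lra.
    - by rewrite mulr_gt0 ?exprn_gt0 ?invr_gt0 //; lra.
  rewrite /g cabsM cabsX cabsV -/t => k.
  have -> : cabs (f w) = cabs (f w) * t^-1 ^+ n * t ^+ n.
    by rewrite -mulrA -exprMn mulVf ?gt_eqF // expr1n mulr1.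
  have -> : (t / s) ^+ n * (B + 1) = s^-1 ^+ n * (B + 1) * t ^+ n by rewrite exprMn; ring.
  by rewrite ler_wpM2r // exprn_ge0 // ltW.
pose x := s / t; have x1 : 1 < x by rewrite /x ltr_pdivlMr // mul1r.
rewrite leNgt; apply/negP => fe.
suff : x <= 1 by rewrite leNgt x1.
apply: (@bounded_powers_le1 _ ((B + 1) / cabs (f w))); first lra.
move=> n; rewrite ler_pdivlMr; last lra.
have := key n; have -> : t / s = x^-1 by rewrite /x; field; rewrite !gt_eqF.
have xn : 0 < x ^+ n by rewrite exprn_gt0 //; lra.
rewrite exprVn mulrC ler_pdivlMr // mulrC //.
Qed.

(** The point 1 is excepted for the sake of the pole of [zeta]. A nonreal point is joined to the far
    right by discs along a horizontal line, which miss the real axis; real points follow by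
    continuity. *)
Lemma identity_halfplane f a b : (forall z, a < RE z -> z != 1 -> hol f z) ->
  (forall z, b < RE z -> f z = 0) -> forall z, a < RE z -> z != 1 -> f z = 0.
Proof.
move=> hf fz.
have nonreal z : a < RE z -> IM z != 0 -> f z = 0.
  move=> az iz; pose d : R := Num.min `|IM z| (RE z - a).
  have d0 : 0 < d by rewrite lt_min normr_gt0 iz subr_gt0.
  have d1 : d <= `|IM z| by rewrite ge_min lexx.
  have d2 : d <= RE z - a by rewrite ge_min lexx orbT.
  clearbody d.
  (* [n] counts the steps of length [d / 4] that lead from [z + t] to the half-plane of vanishing.
     Zeros on the disc of radius [d / 2] about the next centre cover a disc of radius [d / 4] about
     the present one. *)
  have step n : forall t, 0 <= t -> b + 1 < RE z + t + n%:R * (d / 4) ->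
     forall w, cabs (w - (z + t%:C)) < d / 2 -> f w = 0.
    elim: n => [|n ih] t t0 ht.
      have zt : b + 1 < RE (z + t%:C) by rewrite ReD /=; lra.
      apply: (@identity_local _ _ _ 1) => // w.
        move=> wd; apply: hf.
          have := abs_Re_le (w - (z + t%:C)); rewrite ReB ReD /= ler_norml => /andP[? ?]; lra.
        apply/eqP => w1; have := abs_Im_le (w - (z + t%:C)).
        by move: wd; rewrite w1 ImB ImD /= sub0r addr0 normrN => ? ?; lra.
      move=> w1; apply: fz; have := abs_Re_le (w - (z + t%:C)).
      rewrite ReB ReD /= ler_norml => /andP[? ?]; rewrite ReD /= in zt; lra.
    have ih' := ih (t + d / 4) _ _; apply: (@identity_local _ _ _ (d / 4)); try lra.
      move=> w wd; apply: hf.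
        have := abs_Re_le (w - (z + t%:C)); rewrite ReB ReD /= ler_norml => /andP[? ?]; lra.
      apply/eqP => w1; have := abs_Im_le (w - (z + t%:C)).
      by move: wd; rewrite w1 ImB ImD /= sub0r addr0 normrN => ? ?; lra.
    move=> w wd; apply: ih'; first lra.
      by rewrite -natr1 in ht; lra.
    have -> : w - (z + (t + d / 4)%:C) = (w - (z + t%:C)) - (d / 4)%:C by rewrite rmorphD /=; ring.
    have d40 : 0 < d / 4 by lra.
    rewrite (le_lt_trans (cabsB _ _)) // cabs_real gtr0_norm //; lra.
  have [n Hn] : exists n : nat, b + 1 < RE z + 0 + n%:R * (d / 4).
    have d40 : 0 < d / 4 by lra.
    exists (Num.truncn ((`|b + 1 - RE z|) / (d / 4))).+1.
    have := truncnS_gt (`|b + 1 - RE z| / (d / 4)); rewrite ltr_pdivrMr //.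
    by have := ler_norm (b + 1 - RE z); lra.
  apply: (step n 0 (lexx 0) Hn); rewrite addr0 subrr cabs0; lra.
move=> z az z1; have [iz|iz] := eqVneq (IM z) 0; last exact: nonreal.
apply: cabs_small => e e0.
have [d [d0 Hd]] := hol_ccont (hf z az z1) e0.
pose h : C := 0 +i* (d / 2).
have hE : cabs h = d / 2 by rewrite /cabs /= expr0n /= add0r sqrtr_sqr gtr0_norm //; lra.
have := Hd h; rewrite hE nonreal; first by rewrite sub0r cabsN; apply; lra.
  by rewrite ReD /= addr0.
by rewrite ImD /= iz add0r; apply/eqP; lra.
Qed.

Lemma cint_param_deriv a b (K : R -> C -> C) (D : R -> C) z M r :
  a <= b -> 0 < r ->
  (forall h, cabs h < r -> cont_on a b (fun t => K t (z + h))) -> cont_on a b D ->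
  (forall t h, a <= t <= b -> cabs h < r ->
     cabs (K t (z + h) - K t z - D t * h) <= M * cabs h ^+ 2) ->
  forall h, cabs h < r ->
  cabs (cint a b (fun t => K t (z + h)) - cint a b (fun t => K t z) - cint a b D * h)
    <= M * (b - a) * cabs h ^+ 2.
Proof.
move=> ab r0 cK cD H h hr.
have cK0 : cont_on a b (fun t => K t z).
  by have := cK 0; rewrite cabs0 addr0; exact.
have cDh : cont_on a b (fun t => h * D t).
  by apply: cont_onZ.
rewrite [cint a b D * h]mulrC -cintZ // -cintB //; last exact: cK.
rewrite -cintB //; last by apply: cont_onB => //; exact: cK.
rewrite mulrAC; apply: cabs_cint_le => //.
  by apply: cont_onB => //; apply: cont_onB => //; exact: cK.
by move=> t ht; rewrite (mulrC h); exact: H.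
Qed.

(** Removes the singularity of [(f u - f z) / (u - z)]: the quotient is the Cauchy integral of
    [f w / (w - z)], by partial fractions of the two kernels. *)
Lemma factor_sq f z s r : 0 < r -> r < s -> (forall w, insq z s w -> hol f w) ->
  exists g, (forall u, insq z (s - r) u -> hol g u) /\
    (forall u, insq z (s - r) u -> f u - f z = (u - z) * g u).
Proof.
move=> r0 rs hf; have s0 : 0 < s by lra.
have zin : insq z (s - s) z by rewrite /insq !subrr normr0 lexx.
have cf0 w : bdsq z s w -> ccont f w by move=> /andP[/hf /hol_ccont].
have cf := @bdsq_ccont_kernel f z s s z 1 s0 zin cf0.
have [M HM] := cauchy_kernel_deriv r0 (ltW rs) cf.
exists (fun u => tpi^-1 * sqi (fun w => f w * (w - z)^-1 ^+ 1 * (w - u)^-1 ^+ 1) z s).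
split=> u hu.
  eexists; apply: (@cderiv_quadratic _ _ _ M (r / 2)); first lra.
  by move=> h /ltW hr; have [k _] := HM u h hu hr; exact: k.
have [->|uz] := eqVneq u z; first by rewrite !subrr mul0r.
have uz0 : u - z != 0 by rewrite subr_eq0.
have [u1 u2] := andP hu.
have E1 : f u = tpi^-1 * sqi (fun w => f w * (w - u)^-1 ^+ 1) z s.
  by apply: cauchy_sq => //; lra.
have E2 : f z = tpi^-1 * sqi (fun w => f w * (w - z)^-1 ^+ 1) z s.
  by apply: cauchy_sq => //; rewrite !subrr normr0; lra.
rewrite {1}E1 {1}E2 mulrCA -mulrBr; congr (_ * _).
have c1 := @bdsq_ccont_kernel f z s r u 1 r0 hu cf0.
have c2 := @bdsq_ccont_kernel (fun w => f w * (w - z)^-1 ^+ 1) z s r u 1 r0 hu cf.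
rewrite /sqi -rectB; [|apply: bdsq_rcont => //; exact: ltW|apply: bdsq_rcont => //; exact: ltW].
rewrite -rectZ; last by apply: bdsq_rcont => //; exact: ltW.
apply: eq_rect_bd; first exact: ltW.
move=> w bw; have n1 := bdsq_neq r0 bw hu; have n2 := bdsq_neq s0 bw zin.
by rewrite !expr1; field; rewrite n1 n2.
Qed.

(* Schwarz' lemma applied to L / (2 M - L), which maps the square into the unit disc. *)
Lemma borel_caratheodory L z s M u t : 0 < s -> 0 < M -> 0 <= t < 1 ->
  (forall w, insq z s w -> hol L w) -> L z = 0 ->
  (forall w, insq z s w -> RE (L w) <= M) -> cabs (u - z) <= t * s ->
  cabs (L u) <= 2 * M * t / (1 - t).
Proof.
move=> s0 M0 /andP[t0 t1] hL Lz HM ut.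
have den w : insq z s w -> 2 * M%:C - L w != 0.
  move=> /HM h; apply/eqP => E; have := congr1 (fun x : C => RE x) E.
  by rewrite ReB ReM Re_nat Im_nat /= mul0r subr0; lra.
pose h w := L w / (2 * M%:C - L w).
have hh w : insq z s w -> hol h w.
  move=> wi; apply: holM; first exact: hL.
  by apply: holV; [exact: den|apply: holB; [exact: hol_cst|exact: hL]].
have h1 w : insq z s w -> cabs (h w) <= 1.
  move=> wi; rewrite /h cabsM cabsV ler_pdivrMr ?cabs_gt0 ?den // mul1r.
  rewrite -(@ler_pXn2r _ 2) ?nnegrE ?cabs_ge0 // !cabs_sqr ReB ImB ReM ImM Re_nat Im_nat /=.
  have := HM w wi; nra.
have hz : h z = 0 by rewrite /h Lz mul0r.
suff key : cabs (h u) <= t.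
  have tin : insq z s u.
    by apply: cabs_insq; rewrite (le_trans ut) // ler_piMl ?ltW.
  have E : L u = 2 * M%:C * h u / (1 + h u).
    have d := den u tin; have m0 : (2 * M%:C : C) != 0.
      by rewrite mulf_neq0 // -cabs_gt0 cabs_real gtr0_norm.
    rewrite /h; have -> : 1 + L u / (2 * M%:C - L u) = 2 * M%:C / (2 * M%:C - L u) by field.
    have alg (P l : C) : P != 0 -> P - l != 0 -> l = P * (l / (P - l)) / (P / (P - l)).
      by move=> p q; field; rewrite p q.
    exact: alg.
  have d1 : 1 - t <= cabs (1 + h u).
    by have := cabsD_ge 1 (h u); rewrite cabs1; lra.
  rewrite E (cabsM _ (1 + h u)^-1) (cabsM (2 * M%:C)) (cabsM 2) cabsV cabs_nat cabs_real gtr0_norm //.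
  rewrite -mulrA -[X in _ <= X]mulrA.
  rewrite ler_wpM2l ?mulr_ge0 ?(ltW M0) // ler_pM ?cabs_ge0 ?invr_ge0 ?cabs_ge0 //.
  by rewrite lef_pV2 ?posrE //; lra.
apply/ler_addgt0Pr => e e0.
have [->|uz] := eqVneq u z; first by rewrite hz cabs0; lra.
have c0 : 0 < cabs (u - z) by rewrite cabs_gt0 subr_eq0.
have tp : 0 < t by have := lt_le_trans c0 ut; rewrite pmulr_lgt0.
have tm : 0 < 1 - t by lra.
(* a slightly smaller square, so that the quotient h / (w - z) is holomorphic on it *)
pose k := Num.min ((1 - t) / 2) (e / (2 * (t + e))).
have k0 : 0 < k by rewrite /k lt_min !divr_gt0 //; lra.
have k1 : k <= (1 - t) / 2 by rewrite /k ge_min lexx.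
have k2 : k <= e / (2 * (t + e)) by rewrite /k ge_min lexx orbT.
clearbody k.
have ks0 : 0 < k * s by rewrite mulr_gt0.
have kss : k * s < s by rewrite gtr_pMl //; lra.
have [g [hg gE]] := factor_sq ks0 kss hh.
have s'0 : 0 < s - k * s by lra.
have ut' : cabs (u - z) < s - k * s by rewrite (le_lt_trans ut) //; nra.
have uin : insq z (s - k * s) u by apply: cabs_insq; exact: ltW.
have gu : cabs (g u) <= (s - k * s)^-1.
  apply: (@max_principle_sq g z (s - k * s)) => //.
  - by rewrite -ReB (le_lt_trans (abs_Re_le _)).
  - by rewrite -ImB (le_lt_trans (abs_Im_le _)).
  - move=> w bw; have wi : insq z (s - k * s) w by case/andP: bw.
    have zin : insq z (s - k * s - (s - k * s)) z by rewrite /insq !subrr normr0 lexx.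
    have dd := bdsq_dist bw zin.
    have wi' : insq z s w by move: wi => /andP[w1 w2]; apply/andP; split; lra.
    have := h1 w wi'; have := gE w wi; rewrite hz subr0 => ->; rewrite cabsM => hb.
    rewrite -[X in _ <= X]mul1r ler_pdivlMr // mulrC (le_trans _ hb) // ler_wpM2r ?cabs_ge0 //.
  - by rewrite invr_gt0.
have := gE u uin; rewrite hz subr0 => ->; rewrite cabsM.
apply: (@le_trans _ _ (t * s * (s - k * s)^-1)).
  by rewrite ler_pM ?cabs_ge0.
have -> : t * s * (s - k * s)^-1 = t / (1 - k).
  by field; rewrite !gt_eqF //; lra.
rewrite ler_pdivrMr; last lra.
have te : 0 < t + e by lra.
have : k * (2 * (t + e)) <= e by rewrite -ler_pdivlMr //; lra.
nra.
Qed.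

End CauchyConsequences.

(** * The Legendre symbol and Euler's criterion *)

Module QuadraticReciprocity.
Import all_fingroup all_solvable all_field.
Import ring lra zify.

Section Legendre.
Implicit Types (p q m n a b : nat).

Lemma legendre_modn m p : legendre (m %% p) p = legendre m p.
Proof. by rewrite /legendre /dvdn modn_mod. Qed.

Lemma legendre_cases m p : [\/ legendre m p = 0, legendre m p = 1 | legendre m p = -1].
Proof.
rewrite /legendre; case: ifP => _; first by constructor 1.
by case: ifP => _; [constructor 2|constructor 3].
Qed.

Lemma legendre_eq0 m p : (legendre m p == 0) = (p %| m)%N.
Proof. by rewrite /legendre; case: ifP => // _; case: ifP. Qed.

Lemma natr_Fp_eq p a b : prime p -> (a%:R == b%:R :> 'F_p) = (a == b %[mod p])%N.
Proof.
move=> pp; rewrite -(inj_eq val_inj) /= !val_Fp_nat //.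
Qed.

Lemma natr_Fp_eq0 p a : prime p -> (a%:R == 0 :> 'F_p) = (p %| a)%N.
Proof. by move=> pp; rewrite -[0]/(0%:R) natr_Fp_eq // mod0n. Qed.

Lemma primitive_root p : prime p -> exists g : 'F_p,
  [/\ g != 0, forall x : 'F_p, x != 0 -> exists k, x = g ^+ k &
      forall k, g ^+ k = 1 -> (p.-1 %| k)%N].
Proof.
move=> pp; have /cyclicP [u uE] := field_unit_group_cyclic [group of [set: {unit 'F_p}]].
have ou : #[u]%g = p.-1.
  by rewrite orderE -uE /= card_finField_unit card_Fp.
exists (val u); split.
- by rewrite -unitfE; exact: (valP u).
- move=> x x0; have xu : x \is a GRing.unit by rewrite unitfE.
  pose v : {unit 'F_p} := Sub x xu.
  have : v \in <[u]>%g by rewrite -uE finset.inE.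
  move=> /cycleP [k vk]; exists k.
  by rewrite -FinRing.val_unitX -vk.
- move=> k; rewrite -FinRing.val_unitX -[1]/(val (1%g : {unit 'F_p})) => /val_inj /eqP.
  by rewrite -ou order_dvdn.
Qed.

Lemma odd_prime_half p : prime p -> odd p -> p.-1 = (p.-1./2).*2.
Proof. by move=> /prime_gt0; lia. Qed.

Lemma Fp_neq_opp1 p : prime p -> odd p -> (1 : 'F_p) != -1.
Proof.
move=> pp op; rewrite -subr_eq0 opprK -[1 + 1]/(2%:R) natr_Fp_eq0 //.
by apply/negP => /dvdn_leq; have := prime_gt1 pp; lia.
Qed.

Lemma legendre_Fp p m : prime p -> ((exists x : 'F_p, x ^+ 2 = m%:R) <->
  [exists x : 'I_p, (x ^ 2 == m %[mod p])%N]).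
Proof.
move=> pp; split=> [[x Ex]|/existsP [x /eqP Ex]].
  have xp : (x < p)%N by have := ltn_ord x; rewrite [X in (_ < X)%N]Fp_cast.
  apply/existsP; exists (Ordinal xp) => /=; rewrite -natr_Fp_eq // natrX.
  by rewrite natr_Zp Ex.
by exists (x%:R); rewrite -natrX; apply/eqP; rewrite natr_Fp_eq //; apply/eqP.
Qed.

(** Write [m] as a power of a primitive root. An even exponent would make it a square, and for an
    odd exponent the half power is -1, because the root has exact order [p - 1]. *)
Lemma euler_criterion p m : prime p -> odd p ->
  (m%:R : 'F_p) ^+ (p.-1./2) = (legendre m p)%:~R.
Proof.
move=> pp op; have hp := odd_prime_half pp op; have p1 := prime_gt1 pp.
rewrite /legendre; case: ifP => [pm|/negbT pm].
  have /eqP -> : (m%:R : 'F_p) == 0 by rewrite natr_Fp_eq0.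
  by rewrite expr0n; have -> : (p.-1./2 == 0)%N = false by lia.
have m0 : (m%:R : 'F_p) != 0 by rewrite natr_Fp_eq0.
have [g [g0 gen ord]] := primitive_root pp.
have gp : g ^+ p.-1 = 1.
  have := expf_card g; rewrite card_Fp // => E; apply: (mulfI g0).
  by rewrite mulr1 -exprS prednK // prime_gt0.
case: ifP => [/(legendre_Fp m pp).2 [x xE]|/negbT/negP nsq].
  have x0 : x != 0 by apply: contraNneq m0 => x0; rewrite -xE x0 expr0n.
  rewrite -xE -exprM mul2n -hp.
  have [k ->] := gen _ x0; by rewrite -exprM mulnC exprM gp expr1n.
have [k mk] := gen _ m0.
have ok : odd k.
  apply/negP => /negP ek; apply: nsq; apply: (legendre_Fp m pp).1.
  exists (g ^+ k./2); rewrite -exprM mk; congr (_ ^+ _); lia.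
have s1 : (g ^+ p.-1./2) ^+ 2 = 1 by rewrite -exprM muln2 -hp.
have gm : g ^+ p.-1./2 = -1.
  move/eqP: s1; rewrite sqrf_eq1 => /orP[/eqP h|/eqP //].
  by have := ord _ h => /dvdn_leq; lia.
rewrite mk -exprM mulnC exprM gm -signr_odd ok expr1 //.
Qed.

(** Identities between symbols are proved in a field where 1 and -1 differ and are then pulled back
    to [int]. *)
Lemma sign_intr_inj (F : fieldType) (x y : int) : (1 : F) != -1 ->
  [\/ x = 0, x = 1 | x = -1] -> [\/ y = 0, y = 1 | y = -1] ->
  x%:~R = y%:~R :> F -> x = y.
Proof.
move=> n1; have n0 : (1 : F) != 0 := oner_neq0 F.
have nn : (-1 : F) != 0 by rewrite oppr_eq0.
by case=> -> [] -> // /eqP; rewrite ?mulrN1z ?mulr1z ?mulr0z ?(negPf n1) ?(negPf n0) ?(negPf nn)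
  // eq_sym ?mulrN1z ?mulr1z ?mulr0z ?(negPf n1) ?(negPf n0) ?(negPf nn).
Qed.

(** Euler's criterion at odd primes; at 2 the symbol is the parity of its argument. *)
Lemma legendreM p a b : prime p -> legendre (a * b) p = legendre a p * legendre b p.
Proof.
move=> pp; have [op|ep] := boolP (odd p).
  apply: (sign_intr_inj (Fp_neq_opp1 pp op)); first exact: legendre_cases.
    case: (legendre_cases a p) => ->; case: (legendre_cases b p) => ->;
    rewrite ?mul0r ?mulr0 ?mul1r ?mulr1 ?mulrNN ?opprK; by [constructor 1|constructor 2|constructor 3].
  by rewrite intrM -!euler_criterion // natrM exprMn.
have -> : p = 2%N by apply/eqP; rewrite (even_prime_eq2 pp ep) || case: (even_prime pp) ep => [->|->].
have l2 m : legendre m 2 = (odd m)%:R.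
  rewrite /legendre dvdn2; case: (odd m) (modn2 m) => //= h.
  by case: existsP => // -[]; exists (Ordinal (isT : (1 < 2)%N)); rewrite /= h.
by rewrite !l2 oddM; case: (odd a); case: (odd b).
Qed.

Lemma legendre_sqr_eq1 p a : ~~ (p %| a)%N -> legendre a p * legendre a p = 1.
Proof.
rewrite -legendre_eq0; case: (legendre_cases a p) => ->; rewrite ?eqxx // ?mulr1 //.
Qed.

Lemma nonresidue p : prime p -> odd p -> exists2 g, (0 < g < p)%N & legendre g p = -1.
Proof.
move=> pp op; have hp := odd_prime_half pp op; have p1 := prime_gt1 pp.
have [g [g0 gen ord]] := primitive_root pp.
have gp : (g < p)%N by have := ltn_ord g; rewrite [X in (_ < X)%N]Fp_cast.
exists g; first by rewrite gp lt0n andbT; apply: contraNneq g0 => g0; apply/eqP/val_inj.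
have := euler_criterion g pp op; rewrite natr_Zp.
have nd : ~~ (p %| g)%N by rewrite -natr_Fp_eq0 // natr_Zp.
case: (legendre_cases g p) => -> //; last first.
  by move=> /ord /dvdn_leq; lia.
by move=> /eqP; rewrite expf_eq0 (negPf g0) andbF.
Qed.

End Legendre.

(** * Gauss sums in finite fields and quadratic reciprocity *)

Section GaussSum.
Variables (p : nat) (F : fieldType) (z : F).
Hypotheses (pp : prime p) (op : odd p) (F2 : (1 : F) != -1).
Hypotheses (zp : z ^+ p = 1) (z1 : z != 1).

Definition lchi (x : 'F_p) : F := (legendre x p)%:~R.
Definition zz (x : 'F_p) : F := z ^+ x.
Local Notation chi := lchi.

Lemma val_FpM (x y : 'F_p) : nat_of_ord (x * y) = ((x * y)%N %% p)%N.
Proof.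
have -> : x * y = ((x * y)%N)%:R :> 'F_p by rewrite natrM !natr_Zp.
by rewrite val_Fp_nat.
Qed.

Lemma zz_nat n : zz n%:R = z ^+ n.
Proof. by rewrite /zz val_Fp_nat // expr_mod. Qed.

Lemma zzD x y : zz (x + y) = zz x * zz y.
Proof. by rewrite -[x in LHS]natr_Zp -[y in LHS]natr_Zp -natrD zz_nat exprD. Qed.

Lemma zz_natM q x : zz (q%:R * x) = zz x ^+ q.
Proof. by rewrite -[x in LHS]natr_Zp -natrM zz_nat mulnC exprM. Qed.

Lemma zz0 : zz 0 = 1. Proof. by []. Qed.

Lemma zz1 : zz 1 = z. Proof. by rewrite -[1]/(1%:R) zz_nat. Qed.

Lemma chiM x y : chi (x * y) = chi x * chi y.
Proof. by rewrite /chi val_FpM legendre_modn legendreM // intrM. Qed.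

Lemma chi_nat n : chi n%:R = (legendre n p)%:~R.
Proof. by rewrite /chi val_Fp_nat // legendre_modn. Qed.

Lemma chi0 : chi 0 = 0.
Proof. by rewrite /chi /legendre /= dvdn0. Qed.

Lemma chi_sqr x : x != 0 -> chi x * chi x = 1.
Proof.
by move=> x0; rewrite -intrM legendre_sqr_eq1 // -natr_Fp_eq0 // natr_Zp.
Qed.

Lemma two_neq0 : (2 : F) != 0.
Proof. by move: F2; rewrite -subr_eq0 opprK. Qed.

Lemma sum_chi : \sum_x chi x = 0.
Proof.
have [g /andP[g0 gp] gE] := nonresidue pp op.
have gn0 : (g%:R : 'F_p) != 0 by rewrite natr_Fp_eq0 // gtnNdvd.
have E : \sum_x chi x = - \sum_x chi x.
  rewrite {1}(reindex_inj (mulfI gn0)) -sumrN; apply: eq_bigr => x _.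
  by rewrite chiM chi_nat gE mulrN1z mulN1r.
have : 2 * \sum_x chi x = 0 by rewrite mulr_natl mulr2n {2}E subrr.
by move/eqP; rewrite mulf_eq0 (negPf two_neq0) => /eqP.
Qed.

Lemma sum_root (t : 'F_p) : \sum_(x : 'F_p) zz (x * t) = if t == 0 then p%:R else 0.
Proof.
case: eqP => [->|/eqP t0].
  rewrite (eq_bigr (fun=> 1)) => [|x _]; last by rewrite mulr0.
  by rewrite sumr_const card_Fp.
have -> : \sum_(x : 'F_p) zz (x * t) = \sum_(x : 'F_p) zz x.
  by rewrite [RHS](reindex_inj (mulIf t0)).
have E : z * (\sum_(x : 'F_p) zz x) = \sum_(x : 'F_p) zz x.
  rewrite mulr_sumr [RHS](reindex_inj (addrI 1)); apply: eq_bigr => x _.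
  by rewrite zzD zz1.
have : (z - 1) * (\sum_(x : 'F_p) zz x) = 0 by rewrite mulrBl mul1r E subrr.
by move/eqP; rewrite mulf_eq0 subr_eq0 (negPf z1) => /eqP.
Qed.

(** Substituting [y = x t] in the double sum leaves, for each [t], the sum of [zz (x (1 + t))] over
    nonzero [x]: it is [p - 1] at [t = -1] and [-1] elsewhere, and the constant part is killed by
    [sum_chi]. *)
Lemma gauss_sum_sqr : (\sum_(x : 'F_p) chi x * zz x) ^+ 2 = chi (-1) * p%:R.
Proof.
rewrite expr2 mulr_suml.
have step (x : 'F_p) : chi x * zz x * (\sum_(y : 'F_p) chi y * zz y) =
   \sum_(t : 'F_p) (if x == 0 then 0 else chi t * zz (x * (1 + t))).
  case: eqP => [->|/eqP x0]; first by rewrite chi0 !mul0r big1.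
  rewrite (reindex_inj (mulfI x0)) mulr_sumr; apply: eq_bigr => t _.
  rewrite chiM mulrDr mulr1 zzD.
  have := chi_sqr x0; set u := zz _; set v := zz _; set c := chi x => cc.
  by rewrite -[RHS]mul1r -cc; ring.
rewrite (eq_bigr _ (fun x _ => step x)) exchange_big /=.
have step2 (t : 'F_p) : \sum_(x : 'F_p) (if x == 0 then 0 else chi t * zz (x * (1 + t)))
   = chi t * (if 1 + t == 0 then p%:R else 0) - chi t.
  rewrite -sum_root mulr_sumr (bigD1 0) //= ?eqxx add0r [in RHS](bigD1 0) //=.
  rewrite mul0r zz0 mulr1 addrAC subrr add0r; apply: eq_bigr => x x0.
  by rewrite (negPf x0).
rewrite (eq_bigr _ (fun t _ => step2 t)) big_split /= sumrN sum_chi subr0.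
rewrite (bigD1 (-1)) //= subrr eqxx big1 ?addr0 // => t tN.
by rewrite addrC addr_eq0 (negPf tN) mulr0.
Qed.

(** In characteristic [q] the power is additive. It fixes the values of the character and multiplies
    the exponents of the root of unity by [q], which reindexing undoes at the cost of one symbol. *)
Lemma gauss_sum_frobenius q : prime q -> odd q -> q \in [pchar F] -> ~~ (p %| q)%N ->
  (\sum_(x : 'F_p) chi x * zz x) ^+ q =
  (legendre q p)%:~R * (\sum_(x : 'F_p) chi x * zz x).
Proof.
move=> pq oq cq npq.
have q0 : (q%:R : 'F_p) != 0 by rewrite natr_Fp_eq0.
have -> : (\sum_(x : 'F_p) chi x * zz x) ^+ q = \sum_(x : 'F_p) (chi x * zz x) ^+ q.
  rewrite -(pFrobenius_autE cq) rmorph_sum; apply: eq_bigr => x _.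
  exact: pFrobenius_autE.
rewrite -chi_nat [in RHS](reindex_inj (mulfI q0)) mulr_sumr; apply: eq_bigr => x _.
rewrite exprMn chiM mulrA mulrA chi_sqr // mul1r zz_natM.
congr (_ * _).
rewrite /lchi; case: (legendre_cases x p) => ->.
- by rewrite mulr0z expr0n; case: q pq {oq cq npq q0} => // -[].
- by rewrite mulr1z expr1n.
- by rewrite mulrN1z -signr_odd oq expr1.
Qed.

End GaussSum.

(** [G ^+ (q - 1)] is computed twice in characteristic [q]: by Frobenius it is the symbol of [q]
    modulo [p]; as a power of [G ^+ 2], which is [p] up to sign, it is by Euler's criterion the
    symbol of [p] modulo [q] up to sign. *)
Lemma quadratic_reciprocity (p q : nat) : prime p -> prime q -> odd p -> odd q -> p != q ->
  legendre q p = (-1) ^+ (p./2 * q./2)%N * legendre p q.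
Proof.
move=> pp pq op oq npq.
have nqp : ~~ (p %| q)%N by rewrite dvdn_prime2.
have npq' : ~~ (q %| p)%N by rewrite dvdn_prime2 // eq_sym.
have k0 : (0 < p.-1)%N by have := prime_gt1 pp; lia.
(* [F] has [q^(p-1)] elements. By Fermat [p] divides the order of its unit group, so Cauchy's
   theorem provides an element of order [p]. *)
have [F cq cardF] := PrimePowerField pq k0.
have F2 : (1 : F) != -1.
  rewrite -subr_eq0 opprK -[1 + 1]/(2%:R) -(dvdn_pcharf cq).
  by apply/negP => /dvdn_leq; have := prime_gt1 pq; lia.
have [|u _ ou] := @Cauchy _ p [group of [set: {unit F}]] pp.
  rewrite /= card_finField_unit cardF -subn1.
  have h : (q ^ p == q %[mod p])%N by apply/eqP; exact: fermat_little.
  have : (p %| q * (q ^ p.-1 - 1))%N.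
    rewrite mulnBr muln1 -expnS prednK ?prime_gt0 // -eqn_mod_dvd //.
    by rewrite -{1}(expn1 q) leq_exp2l ?prime_gt1 ?prime_gt0.
  by rewrite Euclid_dvdM // (negPf nqp).
pose z := val u.
have zp : z ^+ p = 1 by rewrite -FinRing.val_unitX -ou expg_order.
have z1 : z != 1.
  apply/eqP => h; have u1 : u = 1%g by apply: val_inj.
  by move: ou pp; rewrite u1 order1 => <-.
set chi1 := (legendre (val (-1 : 'F_p)) p)%:~R : F.
have sq := gauss_sum_sqr pp op F2 zp z1.
have fr := gauss_sum_frobenius pp zp pq oq cq nqp.
set G := \sum_(x : 'F_p) _ in sq fr.
have chiN1 : (legendre (val (-1 : 'F_p)) p) = (-1) ^+ p./2.
  apply: (sign_intr_inj (Fp_neq_opp1 pp op)); first exact: legendre_cases.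
    rewrite -signr_odd; case: (odd _); [constructor 3|constructor 2]; by rewrite ?expr0 ?expr1.
  rewrite -euler_criterion // natr_Zp.
  have -> : p./2 = p.-1./2 by clear -op; lia.
  by rewrite rmorphXn /= mulrN1z.
have lN : lchi F (-1 : 'F_p) = (-1) ^+ p./2.
  by rewrite /lchi -[nat_of_ord _]/(\val _) chiN1 rmorphXn /= mulrN1z.
have pF : (p%:R : F) != 0 by rewrite -(dvdn_pcharf cq).
have G0 : G != 0.
  apply/eqP => G0; move: sq; rewrite G0 expr0n lN => /eqP.
  by rewrite eq_sym mulf_eq0 (negPf pF) orbF signr_eq0.
have E1 : G ^+ q.-1 = (legendre q p)%:~R.
  by apply: (mulIf G0); rewrite -exprSr prednK ?prime_gt0.
have eul : (p%:R : F) ^+ q.-1./2 = (legendre p q)%:~R.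
  have := euler_criterion p pq oq; rewrite -natrX.
  case: (legendre_cases p q) (legendre_eq0 p q) => -> //.
  - by rewrite (negPf npq').
  - move=> _ /eqP; rewrite -[X in _ == X]/(1%:R) natr_Fp_eq // -natrX => h.
    apply/eqP; rewrite -[X in _ == X]/(1%:R) -subr_eq0.
    have l : (1 <= p ^ q.-1./2)%N by rewrite expn_gt0 prime_gt0.
    by rewrite -natrB // -(dvdn_pcharf cq) -eqn_mod_dvd.
  - move=> _ /eqP; rewrite mulrN1z -subr_eq0 opprK natr1 natr_Fp_eq0 // => h.
    by apply/eqP; rewrite mulrN1z -subr_eq0 opprK -natrX natr1 -(dvdn_pcharf cq).
apply: (sign_intr_inj F2); first exact: legendre_cases.
  rewrite -signr_odd; case: (odd _); case: (legendre_cases p q) => ->;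
  rewrite ?expr0 ?expr1 ?mulr0 ?mul1r ?mulN1r ?opprK; by [constructor 1|constructor 2|constructor 3].
rewrite -E1 (odd_prime_half pq oq) -mul2n exprM sq lN exprMn eul.
rewrite intrM rmorphXn /= mulrN1z -exprM.
by congr (_ ^+ _ * _); congr (_ * _)%N; clear -op oq; lia.
Qed.

(** * The Jacobi symbol *)

Section Jacobi.
Implicit Types (p q m n a b k : nat).

(** Extending the product to all primes below a common bound makes multiplicativity in the lower
    argument a factorwise statement. *)
Lemma jacobi_prodE m n N : (0 < n < N)%N ->
  jacobi m n = \prod_(0 <= p < N | prime p) legendre m p ^+ logn p n.
Proof.
move=> /andP[n0 nN]; rewrite /jacobi.
rewrite [RHS](bigID (fun p => (p %| n)%N)) /= [X in _ * X]big1 ?mulr1; last first.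
  move=> p /andP[pp pn]; rewrite logn_coprime ?expr0 // prime_coprime //.
rewrite -[RHS]big_filter; apply: perm_big; apply: uniq_perm.
- exact: primes_uniq.
- by rewrite filter_uniq // iota_uniq.
move=> p; rewrite mem_filter mem_primes mem_index_iota leq0n /= n0 /= andbC.
have [pp|//] := boolP (prime p); last by rewrite !andbF.
have [pn|//] := boolP (p %| n)%N; rewrite ?andbF //=.
by rewrite (leq_ltn_trans (dvdn_leq n0 pn) nN).
Qed.

Lemma jacobi1r m : jacobi m 1 = 1.
Proof. by rewrite /jacobi big_nil. Qed.

Lemma jacobi_prime m p : prime p -> jacobi m p = legendre m p.
Proof. by move=> pp; rewrite /jacobi primes_prime // big_seq1 logn_prime // eqxx expr1. Qed.

Lemma jacobiMr m a b : (0 < a)%N -> (0 < b)%N -> jacobi m (a * b) = jacobi m a * jacobi m b.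
Proof.
move=> a0 b0; have N1 : (a < (a * b).+1)%N by nia.
have N2 : (b < (a * b).+1)%N by nia.
rewrite (@jacobi_prodE m (a * b) (a * b).+1); last by rewrite muln_gt0 a0 b0 /=.
rewrite (@jacobi_prodE m a (a * b).+1) ?a0 // (@jacobi_prodE m b (a * b).+1) ?b0 //.
rewrite -big_split /=; apply: eq_bigr => p pp; rewrite lognM // exprD //.
Qed.

Lemma jacobiMl a b n : jacobi (a * b) n = jacobi a n * jacobi b n.
Proof.
rewrite /jacobi -big_split /= big_seq [RHS]big_seq; apply: eq_bigr => p.
by rewrite mem_primes => /and3P[pp _ _]; rewrite legendreM // exprMn.
Qed.

Lemma jacobi_mod a b n : a = b %[mod n] -> jacobi a n = jacobi b n.
Proof.
move=> ab; rewrite /jacobi big_seq [RHS]big_seq; apply: eq_bigr => p.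
rewrite mem_primes => /and3P[pp _ pn]; congr (_ ^+ _).
rewrite -(legendre_modn a) -(legendre_modn b); congr (legendre _ p).
by rewrite -(modn_dvdm a pn) ab modn_dvdm.
Qed.

Lemma jacobi_cases m n : [\/ jacobi m n = 0, jacobi m n = 1 | jacobi m n = -1].
Proof.
rewrite /jacobi; elim/big_ind: _ => [|x y hx hy|p _]; first by constructor 2.
  case: hx => ->; case: hy => ->; rewrite ?mul0r ?mulr0 ?mul1r ?mulr1 ?mulrNN;
  by [constructor 1|constructor 2|constructor 3].
elim: (logn p n) => [|k ih]; first by rewrite expr0; constructor 2.
rewrite exprS; case: ih => ->; case: (legendre_cases m p) => ->;
rewrite ?mul0r ?mulr0 ?mul1r ?mulr1 ?mulrNN ?mulN1r ?opprK;
  by [constructor 1|constructor 2|constructor 3].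
Qed.

Lemma jacobi_eq0 m n : (0 < n)%N -> (jacobi m n == 0) = ~~ coprime m n.
Proof.
move=> n0; apply/idP/idP.
  rewrite /jacobi prodf_seq_eq0 => /hasP [p]; rewrite mem_primes => /and3P[pp _ pn].
  rewrite andTb expf_eq0 legendre_eq0 => /andP[_ pm].
  apply/negP => /(coprime_dvdl pm) /(coprime_dvdr pn).
  by rewrite /coprime gcdnn => /eqP p1; rewrite p1 in pp.
move=> ncop; have g1 : (1 < gcdn m n)%N.
  by rewrite ltn_neqAle eq_sym ncop gcdn_gt0 n0 orbT.
have pp := pdiv_prime g1; have pg := pdiv_dvd (gcdn m n).
set p := pdiv (gcdn m n) in pp pg.
have pm : (p %| m)%N := dvdn_trans pg (dvdn_gcdl m n).
have pn : (p %| n)%N := dvdn_trans pg (dvdn_gcdr m n).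
rewrite /jacobi prodf_seq_eq0; apply/hasP; exists p; first by rewrite mem_primes pp n0 pn.
by rewrite expf_eq0 legendre_eq0 pm andbT logn_gt0 mem_primes pp n0 pn.
Qed.

Lemma jacobi_sqrr m k : (0 < k)%N -> jacobi m (k * k) = (coprime m k)%:R.
Proof.
move=> k0; rewrite jacobiMr //; have := jacobi_eq0 m k0.
case: (coprime m k); case: (jacobi_cases m k) => -> //=.
Qed.

Lemma jacobi_sqrl k n : (0 < n)%N -> jacobi (k * k) n = (coprime k n)%:R.
Proof.
move=> k0; rewrite jacobiMl //; have := jacobi_eq0 k k0.
case: (coprime k n); case: (jacobi_cases k n) => -> //=.
Qed.

Lemma jacobi1l n : jacobi 1 n = 1.
Proof.
rewrite /jacobi big_seq big1 // => p; rewrite mem_primes => /and3P[pp _ _].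
suff -> : legendre 1 p = 1 by rewrite expr1n.
have := legendre_eq0 1 p; have := @legendreM p 1 1 pp; rewrite dvdn1.
case: (legendre_cases 1 p) => -> //.
by move=> _ /esym /eqP p1; have := prime_gt1 pp; rewrite p1.
Qed.

Lemma odd_halfM a b : odd a -> odd b -> odd (a * b)./2 = odd a./2 (+) odd b./2.
Proof. by move=> oa ob; lia. Qed.

(** The exponent is additive modulo 2 in each argument ([odd_halfM]). Splitting off one prime at a
    time extends the law from two primes, first to any odd lower argument below a prime, then to any
    odd upper argument. *)
Lemma jacobi_reciprocity m n : odd m -> odd n ->
  jacobi m n = (-1) ^+ (m./2 * n./2)%N * jacobi n m.
Proof.
have sgM (a b c : nat) : odd a -> odd b -> (-1 : int) ^+ ((a * b)./2 * c)%N =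
    (-1) ^+ (a./2 * c)%N * (-1) ^+ (b./2 * c)%N.
  move=> oa ob; rewrite -exprD -[LHS]signr_odd -[RHS]signr_odd; congr (_ ^+ (nat_of_bool _)).
  by rewrite oddD !oddM odd_halfM //; case: (odd a./2); case: (odd b./2); case: (odd c).
have pr p n' : prime p -> odd p -> odd n' ->
    jacobi p n' = (-1) ^+ (p./2 * n'./2)%N * jacobi n' p.
  move=> pp op; have [N] := ubnP n'; elim: N n' => // N ih n' nN on.
  have [n1|n1] := leqP n' 1.
    have -> : n' = 1%N by lia.
    by rewrite jacobi1r jacobi1l muln0 expr0 mulr1.
  have pq := pdiv_prime n1; have [k nk] := dvdnP (pdiv_dvd n').
  move: (pdiv n') pq nk => q pq nk.
  have [ok oq] : odd k /\ odd q by move: on; rewrite nk oddM => /andP[].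
  have kN : (k < N)%N by have := prime_gt1 pq; nia.
  have k0 : (0 < k)%N by lia.
  rewrite nk (jacobiMr p k0 (prime_gt0 pq)) (jacobiMl k q p) (ih k kN ok).
  rewrite (mulnC p./2 (k * q)./2) sgM // !(mulnC _ p./2).
  have -> : jacobi p q = (-1) ^+ (p./2 * q./2)%N * jacobi q p.
    rewrite !jacobi_prime //; have [->|npq] := eqVneq p q.
      have /eqP -> : legendre q q == 0 by rewrite legendre_eq0 dvdnn.
      by rewrite mulr0.
    by rewrite (@quadratic_reciprocity q p) // ?(mulnC q./2) // eq_sym.
  by rewrite mulrACA.
move=> om on; have [N] := ubnP m; elim: N m om => // N ih m om mN.
have [m1|m1] := leqP m 1.
  have -> : m = 1%N by lia.
  by rewrite jacobi1r jacobi1l mul0n expr0 mulr1.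
have pq := pdiv_prime m1; have [k mk] := dvdnP (pdiv_dvd m).
move: (pdiv m) pq mk => q pq mk.
have [ok oq] : odd k /\ odd q by move: om; rewrite mk oddM => /andP[].
have kN : (k < N)%N by have := prime_gt1 pq; nia.
have k0 : (0 < k)%N by lia.
rewrite mk (jacobiMl k q n) (ih k ok kN) (pr q n) // sgM // (jacobiMr n k0 (prime_gt0 pq)).
by rewrite mulrACA.
Qed.

End Jacobi.

End QuadraticReciprocity.
Import QuadraticReciprocity.

(** * The additive characters modulo q *)

Section AdditiveCharacter.
Variable R : realType.
Local Notation C := R[i].
Variable q : nat.
Hypothesis q0 : (0 < q)%N.

(** The root of unity usually written [e(n / q)]. *)
Definition ec (n : nat) : C := cexp (0 +i* (2 * pi * n%:R / q%:R)).

Lemma qR_neq0 : q%:R != 0 :> R.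
Proof. by rewrite pnatr_eq0 -lt0n. Qed.

Lemma ecD m n : ec (m + n) = ec m * ec n.
Proof.
rewrite /ec -cexpD natrD; congr cexp; apply: complex_ext => /=; first by rewrite addr0.
by field; exact: qR_neq0.
Qed.

Lemma ec0 : ec 0 = 1.
Proof. by rewrite /ec mulr0 mul0r -[0 +i* 0]/(0 : C) cexp0. Qed.

Lemma ecX m n : ec (m * n) = ec m ^+ n.
Proof. by elim: n => [|n ih]; rewrite ?muln0 ?ec0 // mulnS ecD ih exprS. Qed.

Lemma ec_q : ec q = 1.
Proof.
rewrite /ec; have -> : 2 * pi * q%:R / q%:R = pi *+ 2 :> R by field; exact: qR_neq0.
by apply: complex_ext; rewrite ?Re_cexp ?Im_cexp /= expR0 mul1r ?cos2pi ?sin2pi.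
Qed.

Lemma ec_mod n : ec (n %% q) = ec n.
Proof. by rewrite {2}(divn_eq n q) ecD mulnC ecX ec_q expr1n mul1r. Qed.

Lemma ec_eq_mod m n : m = n %[mod q] -> ec m = ec n.
Proof. by move=> E; rewrite -(ec_mod m) E ec_mod. Qed.

Lemma cabs_ec n : cabs (ec n) = 1.
Proof. by rewrite /ec cabs_cexp /= expR0. Qed.

Lemma half_angle (t : R) : (1 - cos (t *+ 2)) ^+ 2 + sin (t *+ 2) ^+ 2 = 4 * sin t ^+ 2.
Proof.
rewrite cos_mulr2n sin_mulr2n !mulr2n.
have := cos2Dsin2 t; generalize (cos t) (sin t) => c s cs.
have -> : (1 - (c ^+ 2 + c ^+ 2 - 1)) ^+ 2 + (c * s + c * s) ^+ 2 =
   4 * (1 - c ^+ 2) ^+ 2 + 4 * c ^+ 2 * s ^+ 2 by ring.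
have -> : c ^+ 2 = 1 - s ^+ 2 by rewrite -cs; ring.
ring.
Qed.

Lemma cabs_1ec b : cabs (1 - ec b) = 2 * `|sin (pi * b%:R / q%:R)|.
Proof.
apply/eqP; rewrite -(@eqrXn2 _ 2) ?cabs_ge0 ?mulr_ge0 // cabs_sqr ReB ImB.
rewrite Re_cexp Im_cexp [IM (_ +i* _)]/= [RE (_ +i* _)]/= expR0 !mul1r /= sub0r sqrrN.
rewrite exprMn real_normK ?num_real //.
have -> : 2 * pi * b%:R / q%:R = (pi * b%:R / q%:R) *+ 2 :> R.
  by rewrite -mulr_natl; field; exact: qR_neq0.
by rewrite half_angle; apply/eqP; congr (_ * _); ring.
Qed.

End AdditiveCharacter.

(** * Jordan's inequality *)

Section SineBound.
Variable R : realType.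

(* sin is concave on [0, pi/2]: the quotient sin x / x decreases, as x cos x <= sin x. *)
Lemma xcos_le_sin (x : R) : 0 <= x <= pi / 2 -> x * cos x <= sin x.
Proof.
move=> /andP[x0 xp].
pose f (y : R) := sin y - y * cos y.
have df (y : R) : is_derive y 1 f (y * sin y).
  by apply: is_derive_eq; rewrite /GRing.scale /=; ring.
rewrite -subr_ge0; have -> : 0 = f 0 by rewrite /f sin0 mul0r subr0.
rewrite -/(f x); apply: (@ger0_derive1_le_cc R f 0 (pi / 2)) => //.
- move=> y; rewrite in_itv /= => /andP[y0 yp].
  rewrite derive1E; have [_ ->] := df y; rewrite mulr_ge0 ?ltW //.
  by apply: sin_gt0_pihalf; rewrite y0.
- by apply: derivable_within_continuous => y _; case: (df y).
- by rewrite in_itv /= lexx (le_trans x0).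
- by rewrite in_itv /= x0.
Qed.

Lemma sin_jordan (x : R) : 0 < x <= pi / 2 -> 2 * x / pi <= sin x.
Proof.
move=> /andP[x0 xp]; have p0 := pi_gt0 R.
pose f (y : R) := sin y / y.
have df (y : R) : 0 < y -> is_derive y 1 f ((y * cos y - sin y) / y ^+ 2).
  move=> y0; have y0' : y != 0 by rewrite gt_eqF.
  have di : is_derive y 1 (fun z : R => z^-1) (- y ^- 2).
    have := @is_deriveV R id y 1 1 y0' (is_derive_id y 1); rewrite /GRing.scale /= mulr1; exact.
  have := is_deriveM (is_derive_sin y) di.
  rewrite /GRing.scale /= => /is_derive_eq; apply; field.
  by rewrite ?y0'.
have h : f (pi / 2) <= f x.
  apply: (@ler0_derive1_le_cc R f x (pi / 2)) => //.
  - by move=> y; rewrite in_itv /= => /andP[xy _]; case: (df y (lt_trans x0 xy)).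
  - move=> y; rewrite in_itv /= => /andP[xy yp].
    have y0 := lt_trans x0 xy.
    rewrite derive1E; have [_ ->] := df y y0.
    rewrite pmulr_lle0 ?invr_gt0 ?exprn_gt0 // subr_le0 xcos_le_sin //.
    by rewrite !ltW.
  - apply: derivable_within_continuous => y; rewrite in_itv /= => /andP[xy _].
    by case: (df y (lt_le_trans x0 xy)).
  - by rewrite in_itv /= xp lexx.
  - by rewrite in_itv /= xp lexx.
move: h; rewrite /f sin_pihalf ler_pdivlMr // => /(le_trans _); apply.
have p1 : pi != 0 :> R by rewrite gt_eqF.
move: (pi : R) p1 => P P0; rewrite le_eqVlt; apply/orP; left; apply/eqP; field.
by rewrite P0.
Qed.

End SineBound.

Lemma jacobi0l q : (1 < q)%N -> jacobi 0 q = 0.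
Proof.
move=> q1; apply/eqP; rewrite jacobi_eq0; last by lia.
by rewrite /coprime gcd0n; lia.
Qed.

(** * Gauss sums over the complex numbers and the Polya-Vinogradov inequality *)

Section PolyaVinogradov.
Variable R : realType.
Local Notation C := R[i].

Lemma geometric_sum (z : C) n : (1 - z) * (\sum_(0 <= j < n) z ^+ j) = 1 - z ^+ n.
Proof.
elim: n => [|n ih]; first by rewrite big_nil mulr0 expr0 subrr.
by rewrite big_nat_recr //= mulrDr ih exprS; ring.
Qed.

(** A geometric sum: [|1 - ec b| = 2 |sin (pi b / q)|] is at least [4 m / q] by Jordan's inequality,
    where [m] is the distance from [b] to the multiples of [q]. *)
Lemma ec_interval_sum (q b a n : nat) : (0 < b < q)%N ->
  cabs (\sum_(a <= j < a + n) ec R q (b * j)) <= q%:R / (2 * (minn b (q - b))%:R).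
Proof.
move=> /andP[b0 bq]; have q0 : (0 < q)%N by lia.
have qR : (0 : R) < q%:R by rewrite ltr0n.
pose m := minn b (q - b); have m0 : (0 < m)%N by rewrite /m; lia.
have mq : (2 * m <= q)%N by rewrite /m; lia.
have sb : (2 * m)%:R / q%:R <= `|sin (pi * b%:R / q%:R)| :> R.
  have E : `|sin (pi * b%:R / q%:R)| = `|sin (pi * m%:R / q%:R)| :> R.
    rewrite /m /minn; case: ifP => // _.
    have -> : pi * (q - b)%:R / q%:R = pi - pi * b%:R / q%:R :> R.
      by rewrite natrB ?(ltnW bq) //; field; rewrite gt_eqF.
    by rewrite sinB sinpi cospi mul0r sub0r mulN1r opprK.
  rewrite E; apply: le_trans (ler_norm _).
  have -> : (2 * m)%:R / q%:R = 2 * (pi * m%:R / q%:R) / pi :> R.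
    have p0 : pi != 0 :> R by rewrite gt_eqF // pi_gt0.
    have q0' : q%:R != 0 :> R by rewrite gt_eqF.
    by rewrite natrM; move: (pi : R) p0 (q%:R : R) q0' => P P0 Q Q0; field; rewrite P0 Q0.
  apply: sin_jordan; rewrite divr_gt0 ?mulr_gt0 ?pi_gt0 ?ltr0n //=.
  rewrite ler_pdivrMr // -mulrA ler_wpM2l ?pi_ge0 //.
  rewrite mulrC ler_pdivlMr // -natrM ler_nat; lia.
have n1 : 0 < cabs (1 - ec R q b).
  rewrite cabs_1ec // mulr_gt0 // (lt_le_trans _ sb) // divr_gt0 // ltr0n muln_gt0 m0 //.
have -> : \sum_(a <= j < a + n) ec R q (b * j) = ec R q (b * a) * (\sum_(0 <= j < n) ec R q b ^+ j).
  rewrite -{1}(add0n a) big_addn addKn mulr_sumr; apply: eq_bigr => j _.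
  by rewrite mulnDr ecD // ecX // mulrC.
rewrite cabsM cabs_ec mul1r -(ler_pM2l n1) -cabsM geometric_sum.
apply: (@le_trans _ _ 2).
  by rewrite (le_trans (cabsB _ _)) // cabs1 cabsX cabs_ec expr1n; lra.
rewrite cabs_1ec //.
have mR : (0 : R) < m%:R by rewrite ltr0n.
rewrite -/m; apply: (@le_trans _ _ (2 * ((2 * m)%:R / q%:R) * (q%:R / (2 * m%:R)))).
  by rewrite natrM le_eqVlt; apply/orP; left; apply/eqP; field; rewrite !gt_eqF.
by rewrite ler_wpM2r ?divr_ge0 ?mulr_ge0 // ler_wpM2l.
Qed.

Lemma jacobi_intr_sqr m n : (0 < n)%N -> ((jacobi m n)%:~R ^+ 2 = (coprime m n)%:R :> C).
Proof.
move=> n0; have := jacobi_eq0 m n0; case: (coprime m n); case: (jacobi_cases m n) => -> //= _.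
- by rewrite expr1n.
- by rewrite mulrN1z sqrrN expr1n.
- by rewrite mulr0z expr0n.
Qed.

Definition squarefree (n : nat) := forall p, prime p -> ~~ (p * p %| n)%N.

Definition gauss q a : C := \sum_(0 <= x < q) (jacobi x q)%:~R * ec R q (a * x).

Lemma sum_mod_perm q (u : nat) (F : nat -> C) : (0 < q)%N -> coprime u q ->
  (forall x y, x = y %[mod q] -> F x = F y) ->
  \sum_(0 <= x < q) F (u * x)%N = \sum_(0 <= x < q) F x.
Proof.
move=> q0 cu FE; rewrite !big_mkord.
have h (x : 'I_q) : (u * x %% q < q)%N by rewrite ltn_mod.
rewrite [RHS](reindex_inj (h := fun x => Ordinal (h x))) /=.
  by apply: eq_bigr => x _; apply: FE; rewrite modn_mod.
move=> x y /(congr1 val) /= /eqP; rewrite eqn_modMl_coprime || idtac.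
move=> /eqP E; apply: val_inj => /=.
wlog xy : x y E / (x <= y)%N.
  by move=> H; case/orP: (leq_total x y) => /H ->.
have : (q %| u * y - u * x)%N by rewrite -eqn_mod_dvd ?leq_mul // E.
rewrite -mulnBr Gauss_dvdr; last by rewrite coprime_sym.
move=> /dvdn_leq dl; apply/eqP; rewrite eqn_leq xy /= leqNgt; apply/negP => lt.
by have := dl; rewrite subn_gt0 => /(_ lt); have := ltn_ord y; lia.
Qed.

Lemma gauss_coprime q a : (0 < q)%N -> coprime a q ->
  gauss q a = (jacobi a q)%:~R * gauss q 1.
Proof.
move=> q0 ca; rewrite /gauss.
rewrite -(@sum_mod_perm q a (fun x => (jacobi x q)%:~R * ec R q (1 * x))) //; last first.
  move=> x y E; rewrite (jacobi_mod E) (@ec_eq_mod R q q0 (1 * x) (1 * y)) //.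
  by rewrite !mul1n.
rewrite mulr_sumr; apply: eq_bigr => x _.
rewrite jacobiMl intrM mul1n !mulrA -expr2 jacobi_intr_sqr // ca mul1r //.
Qed.

(** Let [p] divide [a] and [q]. As [q] is squarefree, there is a [u] that is a nonresidue modulo [p]
    and 1 modulo [q / p]. Replacing [x] by [u x] fixes [a x] modulo [q] and reverses the sign of the
    symbol, so the sum equals its negative. *)
Lemma gauss_ncoprime q a : (0 < q)%N -> odd q -> squarefree q -> ~~ coprime a q -> gauss q a = 0.
Proof.
move=> q0 oq sq nca.
have g1 : (1 < gcdn a q)%N by rewrite ltn_neqAle eq_sym nca gcdn_gt0 q0 orbT.
have pp := pdiv_prime g1; have pg := pdiv_dvd (gcdn a q).
move: (pdiv _) pp pg => p pp pg.
have pa : (p %| a)%N := dvdn_trans pg (dvdn_gcdl a q).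
have [q' qE] := dvdnP (dvdn_trans pg (dvdn_gcdr a q)).
have q'0 : (0 < q')%N by move: q0; rewrite qE muln_gt0 => /andP[].
have cp : coprime p q'.
  rewrite prime_coprime //; apply/negP => /dvdnP [k kE]; have := sq p pp.
  by rewrite qE kE -mulnA dvdn_mull.
have op : odd p by move: oq; rewrite qE oddM => /andP[].
have [g gp gE] := nonresidue pp op.
pose u := chinese p q' g 1.
have up : u = g %[mod p] by exact: chinese_modl.
have uq : u = 1 %[mod q'] by exact: chinese_modr.
have jE : jacobi u q = -1.
  rewrite qE (jacobiMr u q'0 (prime_gt0 pp)) (jacobi_mod uq) jacobi1l mul1r jacobi_prime //.
  by rewrite -gE -(legendre_modn u) up legendre_modn.
have cu : coprime u q.
  by have := jacobi_eq0 u q0; rewrite jE => /esym/negbFE.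
have au x : a * (u * x) = a * x %[mod q].
  have [a' aE] := dvdnP pa.
  have h : (a * u = a %[mod q])%N.
    by rewrite aE qE mulnAC -!muln_modl -modnMmr uq modnMmr muln1.
  by rewrite mulnA -modnMml h modnMml.
have E : gauss q a = - gauss q a.
  rewrite {1}/gauss -(@sum_mod_perm q u (fun x => (jacobi x q)%:~R * ec R q (a * x))) //; last first.
    move=> x y E; rewrite (jacobi_mod E) (@ec_eq_mod R q q0 (a * x) (a * y)) //.
    by apply/eqP; rewrite -modnMmr E modnMmr.
  rewrite /gauss -sumrN; apply: eq_bigr => x _.
  by rewrite jacobiMl jE (@ec_eq_mod R q q0 _ _ (au x)) mulN1r mulrNz mulNr.
have : 2 * gauss q a = 0 by rewrite mulr_natl mulr2n {2}E subrr.
by move/eqP; rewrite mulf_eq0 pnatr_eq0 => /eqP.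
Qed.

Lemma ec_orthogonal q (x y : nat) : (0 < q)%N -> (x < q)%N -> (y < q)%N ->
  \sum_(0 <= a < q) ec R q (a * x) * (ec R q (a * y))^-1 = if x == y then q%:R else 0.
Proof.
move=> q0 xq yq.
have n0 z : ec R q z != 0 by rewrite -cabs_gt0 cabs_ec.
pose w := ec R q x / ec R q y.
have -> : \sum_(0 <= a < q) ec R q (a * x) * (ec R q (a * y))^-1 = \sum_(0 <= a < q) w ^+ a.
  by apply: eq_bigr => a _; rewrite /w expr_div_n -!ecX // !(mulnC _ a).
case: eqP => [xy|/eqP ne].
  rewrite (eq_bigr (fun=> 1)); last by move=> a _; rewrite /w xy divff // expr1n.
  by rewrite sumr_const_nat subn0.
have wq : w ^+ q = 1.
  by rewrite /w expr_div_n -!ecX // !(mulnC _ q) !ecX // ec_q // !expr1n divr1.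
have w1 : 1 - w != 0.
  have key (i j : nat) : (i < j)%N -> (j < q)%N -> 1 - ec R q i / ec R q j != 0.
    move=> ij jq; have b0 : (0 < j - i < q)%N by lia.
    have : 1 - ec R q (j - i) != 0.
      rewrite -cabs_gt0 cabs_1ec // mulr_gt0 // normr_gt0 gt_eqF //.
      apply: sin_gt0_pi; rewrite divr_gt0 ?mulr_gt0 ?pi_gt0 ?ltr0n //; last by lia.
      rewrite /= ltr_pdivrMr ?ltr0n // ltr_pM2l ?pi_gt0 // ltr_nat; lia.
    have -> : ec R q j = ec R q i * ec R q (j - i) by rewrite -ecD // subnKC // ltnW.
    move=> h; rewrite invfM mulrA divff // mul1r.
    have := n0 (j - i)%N; move: (ec R q (j - i)) h => e h e0.
    by apply: contraNneq h => /eqP; rewrite subr_eq0 => /eqP E; rewrite -(mulVf e0) -E mul1r subrr.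
  move: ne; rewrite neq_ltn => /orP[lt|lt]; first exact: key.
  have := key _ _ lt xq; apply: contraNneq => /eqP; rewrite subr_eq0 => /eqP E.
  by rewrite -invf_div -/w -E invr1 subrr.
by apply: (mulfI w1); rewrite geometric_sum wq subrr mulr0.
Qed.

Lemma ec_conj q n : RE (ec R q n)^-1 = RE (ec R q n) /\ IM (ec R q n)^-1 = - IM (ec R q n).
Proof.
have c1 : RE (ec R q n) ^+ 2 + IM (ec R q n) ^+ 2 = 1 by rewrite -cabs_sqr cabs_ec expr1n.
by case: (ec R q n) c1 => a b /= ->; rewrite !divr1.
Qed.

Lemma cabs_sqr_conj (z : C) : (cabs z ^+ 2)%:C = z * z^*%C.
Proof.
by rewrite cabs_sqr; case: z => a b /=; apply: complex_ext => /=; ring.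
Qed.

Lemma conj_ec q n : (ec R q n)^*%C = (ec R q n)^-1.
Proof.
have [h1 h2] := ec_conj q n; apply: complex_ext; rewrite ?h1 ?h2; by case: (ec R q n).
Qed.

Lemma conj_intr (x : int) : (x%:~R : C)^*%C = x%:~R.
Proof. by rewrite -(rmorph_int (real_complex R)) conjc_real. Qed.

Lemma parseval_gauss q : (0 < q)%N ->
  \sum_(0 <= a < q) cabs (gauss q a) ^+ 2 = q%:R * \sum_(0 <= x < q) (coprime x q)%:R.
Proof.
move=> q0; apply: (@complexI R); rewrite rmorph_sum rmorphM rmorph_nat rmorph_sum /=.
have -> : \sum_(0 <= i < q) (cabs (gauss q i) ^+ 2)%:C = \sum_(0 <= a < q)
   \sum_(0 <= x < q) \sum_(0 <= y < q) (jacobi x q)%:~R * (jacobi y q)%:~R *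
      (ec R q (a * x) * (ec R q (a * y))^-1).
  apply: eq_bigr => a _; rewrite cabs_sqr_conj /gauss rmorph_sum mulr_suml.
  apply: eq_bigr => x _; rewrite mulr_sumr; apply: eq_bigr => y _.
  transitivity ((jacobi x q)%:~R * ec R q (a * x) * ((jacobi y q)%:~R * ec R q (a * y))^*%C) => //.
  have -> : ((jacobi y q)%:~R * ec R q (a * y))^*%C = (jacobi y q)%:~R * (ec R q (a * y))^-1.
    by rewrite -conj_ec -[in RHS]conj_intr; exact: rmorphM.
  by ring.
rewrite exchange_big /= mulr_sumr; apply: eq_big_nat => x /andP[_ xq].
rewrite exchange_big /=.
rewrite (eq_big_nat _ _ (F2 := fun y => if y == x then (coprime x q)%:R * q%:R else 0)); last first.
  move=> y /andP[_ yq]; rewrite -mulr_sumr ec_orthogonal // eq_sym.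
  case: eqP => [->|_]; last by rewrite mulr0.
  by rewrite -expr2 jacobi_intr_sqr.
rewrite -big_mkcond /= big_nat1_eq /= xq; rewrite rmorph_nat; ring.
Qed.

(** Parseval evaluates the sum of the squared moduli of all [gauss q a]. These are
    [cabs (gauss q 1) ^+ 2] for [a] coprime to [q] and 0 otherwise, so the common value can be read
    off. *)
Lemma cabs_gauss q : (0 < q)%N -> odd q -> squarefree q -> cabs (gauss q 1) ^+ 2 = q%:R.
Proof.
move=> q0 oq sq; have := parseval_gauss q0.
have -> : \sum_(0 <= a < q) cabs (gauss q a) ^+ 2 =
   cabs (gauss q 1) ^+ 2 * \sum_(0 <= x < q) (coprime x q)%:R.
  rewrite mulr_sumr; apply: eq_bigr => a _; case: (boolP (coprime a q)) => ca.
    by rewrite (gauss_coprime q0 ca) cabsM exprMn -(cabsX (jacobi a q)%:~R) (jacobi_intr_sqr a q0) ca cabs1 mul1r mulr1.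
  by rewrite gauss_ncoprime // cabs0 expr0n mulr0.
move/mulIf; apply; rewrite gt_eqF //.
have [q1|q1] := leqP q 1.
  have -> : q = 1%N by lia.
  by rewrite big_nat1.
rewrite (big_cat_nat (n := 2)) //= ltr_wpDr //; first by apply: sumr_ge0.
by rewrite big_nat_recr //= big_nat1 coprime1n ltr_wpDl.
Qed.

Lemma sqrt_nat_sqr q : Num.sqrt q%:R ^+ 2 = q%:R :> R.
Proof. by rewrite sqr_sqrtr. Qed.

Lemma polya_vinogradov_squarefree q a n : (1 < q)%N -> odd q -> squarefree q ->
  `|\sum_(a <= m < a + n) (jacobi m q)%:~R : R| <=
     Num.sqrt q%:R * \sum_(1 <= b < q) (b%:R)^-1.
Proof.
move=> q1 oq sq; have q0 : (0 < q)%N by lia.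
have G2 := cabs_gauss q0 oq sq.
have G1 : cabs (gauss q 1) = Num.sqrt q%:R.
  by apply/eqP; rewrite -(@eqrXn2 _ 2) ?cabs_ge0 ?sqrtr_ge0 // G2 sqrt_nat_sqr.
have qR : (0 : R) < q%:R by rewrite ltr0n.
have sq0 : 0 < Num.sqrt q%:R :> R by rewrite sqrtr_gt0.
have E m : (jacobi m q)%:~R * gauss q 1 = gauss q m.
  case: (boolP (coprime m q)) => cm; first by rewrite -gauss_coprime.
  rewrite (gauss_ncoprime q0 oq sq cm); have : jacobi m q == 0 by rewrite jacobi_eq0.
  by move/eqP ->; rewrite mulr0z mul0r.
have E2 : (\sum_(a <= m < a + n) (jacobi m q)%:~R) * gauss q 1 =
   \sum_(0 <= b < q) (jacobi b q)%:~R * (\sum_(a <= m < a + n) ec R q (b * m)).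
  rewrite mulr_suml (eq_bigr _ (fun m _ => E m)) /gauss exchange_big /=.
  by apply: eq_bigr => b _; rewrite mulr_sumr; apply: eq_bigr => m _; rewrite mulnC.
have jb b : cabs (jacobi b q)%:~R <= 1 :> R.
  case: (jacobi_cases b q) => ->; rewrite ?mulr0z ?mulr1z ?mulrN1z ?cabsN ?cabs0 ?cabs1 //.
have bound : cabs ((\sum_(a <= m < a + n) (jacobi m q)%:~R) * gauss q 1) <=
   q%:R * \sum_(1 <= b < q) (b%:R)^-1.
  rewrite E2 (le_trans (cabs_sum _ _ _)) // big_ltn // jacobi0l // mulr0z mul0r cabs0 add0r.
  (* The reciprocal of [minn b (q - b)] is at most the sum of both reciprocals, and the two
     resulting sums agree by the reflection [b -> q - b]. *)
  apply: (@le_trans _ _ (\sum_(1 <= b < q) (q%:R / 2) * (b%:R^-1 + (q - b)%:R^-1))).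
    apply: ler_sum_nat => b /andP[b1 bq].
    rewrite cabsM; have bb : (0 < b < q)%N by rewrite b1.
    apply: le_trans (_ : 1 * (q%:R / (2 * (minn b (q - b))%:R)) <= _).
      by apply: ler_pM; rewrite ?cabs_ge0 ?jb ?ec_interval_sum.
    rewrite mul1r invfM mulrA ler_wpM2l ?divr_ge0 //.
    by rewrite /minn; case: ifP => _; rewrite ?lerDl ?lerDr invr_ge0.
  rewrite -mulr_sumr big_split /=.
  have -> : \sum_(1 <= b < q) ((q - b)%:R)^-1 = \sum_(1 <= b < q) b%:R^-1 :> R.
    rewrite big_nat_rev /= add1n; apply: eq_big_nat => b /andP[b1 bq].
    by rewrite subSS subKn // ltnW.
  by rewrite le_eqVlt; apply/orP; left; apply/eqP; field.
move: bound; rewrite cabsM G1.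
have -> : \sum_(a <= m < a + n) (jacobi m q)%:~R = (\sum_(a <= m < a + n) (jacobi m q)%:~R : R)%:C.
  by rewrite rmorph_sum; apply: eq_bigr => m _; rewrite rmorph_int.
rewrite cabs_real -ler_pdivlMr // => /le_trans; apply.
rewrite -{1}(sqrt_nat_sqr q) expr2 le_eqVlt; apply/orP; left; apply/eqP.
by move: (Num.sqrt _) sq0 => r r0; field; rewrite gt_eqF.
Qed.

Definition harm q : R := \sum_(1 <= b < q) (b%:R)^-1.

Lemma harm_ge0 q : 0 <= harm q.
Proof. by apply: sumr_ge0 => i _; rewrite invr_ge0. Qed.

(** [(M + (s - 1 - r)) / s], rounded down, is the number of [m < M] in the class of [r]. *)
Lemma sum_residue_class (V : zmodType) (F : nat -> V) (P : pred nat) s r M : (r < s)%N ->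
  \sum_(0 <= m < M | (m %% s == r)%N && P m) F m =
  \sum_(0 <= j < (M + (s.-1 - r)) %/ s | P (s * j + r)%N) F (s * j + r)%N.
Proof.
move=> rs; have s0 : (0 < s)%N by lia.
elim: M => [|M ih]; first by rewrite add0n divn_small ?big_geq //; lia.
have E : M = ((M %/ s) * s + M %% s)%N by exact: divn_eq.
have iM : (M %% s < s)%N by rewrite ltn_mod.
rewrite big_mkcond big_nat_recr //= -big_mkcond /= ih.
have [h|h] := eqVneq (M %% s)%N r.
  have e1 : ((M + (s.-1 - r)) %/ s)%N = (M %/ s)%N.
    rewrite {1}E -addnA divnMDl // h (_ : (_ + _) %/ s = 0)%N ?addn0 //.
    by apply: divn_small; lia.
  have e2 : ((M.+1 + (s.-1 - r)) %/ s)%N = (M %/ s).+1.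
    rewrite {1}E -addnS -addnA divnMDl // h.
    have -> : (r.+1 + (s.-1 - r))%N = s by lia.
    by rewrite divnn s0 addn1.
  rewrite e1 e2 [in RHS]big_mkcond big_nat_recr //= -big_mkcond /=; congr (_ + _).
  by rewrite mulnC -h -E.
have -> : ((M.+1 + (s.-1 - r)) %/ s)%N = ((M + (s.-1 - r)) %/ s)%N; last by rewrite addr0.
suff D : (((M %% s).+1 + (s.-1 - r)) %/ s = (M %% s + (s.-1 - r)) %/ s)%N.
  by rewrite E -addnS -!addnA !divnMDl // D.
have [lt|gt] := ltnP (M %% s) r; first by rewrite !divn_small //; lia.
have gt' : (r < M %% s)%N by lia.
have h1 : ((M %% s).+1 + (s.-1 - r) = 1 * s + (M %% s - r))%N by lia.
have h2 : (M %% s + (s.-1 - r) = 1 * s + (M %% s - r.+1))%N by lia.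
by rewrite h1 h2 !divnMDl // !divn_small //; lia.
Qed.

(** The sieve step for one prime: the multiples of [p] are subtracted, reindexed by [m / p]. It
    serves both for imprimitive characters and for the Euler product. *)
Lemma coprime_interval_split (V : zmodType) (F : nat -> V) p r a b : prime p -> (a <= b)%N ->
  \sum_(a <= m < b | coprime m (p * r)) F m =
  \sum_(a <= m < b | coprime m r) F m -
  \sum_((a + p.-1) %/ p <= m < (b + p.-1) %/ p | coprime (p * m) r) F (p * m)%N.
Proof.
move=> pp ab; have p0 := prime_gt0 pp.
rewrite [X in _ = X - _](bigID (fun m => (p %| m)%N)) /=.
have -> : \sum_(a <= i < b | coprime i r && ~~ (p %| i)%N) F i =
   \sum_(a <= m < b | coprime m (p * r)) F m.
  apply: eq_bigl => m; rewrite coprimeMr andbC; congr (_ && _).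
  by rewrite coprime_sym prime_coprime.
have -> : \sum_(a <= i < b | coprime i r && (p %| i)%N) F i =
  \sum_((a + p.-1) %/ p <= m < (b + p.-1) %/ p | coprime (p * m) r) F (p * m)%N;
  last by rewrite addrAC subrr add0r.
have key M := @sum_residue_class V F (fun m => coprime m r) p 0 M p0.
have E1 := key b; have E0 := key a; rewrite !subn0 in E1 E0.
have ab' : ((a + p.-1) %/ p <= (b + p.-1) %/ p)%N by apply: leq_div2r; lia.
rewrite (big_cat_nat (n := a)) //= in E1.
rewrite [in RHS](big_cat_nat (n := ((a + p.-1) %/ p)%N)) //= in E1.
rewrite E0 in E1; move/addrI: E1 => E1.
have q1 m : coprime m r && (p %| m)%N = (m %% p == 0)%N && coprime m r by rewrite andbC.
rewrite (eq_bigl _ _ q1) E1.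
by apply: eq_big => m; rewrite addn0.
Qed.

(* Removing the primes of r one at a time doubles the bound each time. *)
Lemma interval_coprime_bound q r (B : R) : (0 < r)%N ->
  (forall a n, `|\sum_(a <= m < a + n) (jacobi m q)%:~R : R| <= B) ->
  forall a n, `|\sum_(a <= m < a + n | coprime m r) (jacobi m q)%:~R : R| <= r%:R * B.
Proof.
move=> r0 H; have [N] := ubnP r; elim: N r r0 => // N ih r r0 rN a n.
have [r1|r1] := leqP r 1.
  have -> : r = 1%N by lia.
  by under eq_bigl do rewrite coprimen1; rewrite mul1r; exact: H.
have pp := pdiv_prime r1; have [k rk] := dvdnP (pdiv_dvd r).
move: (pdiv r) pp rk => p pp rk.
have p1 := prime_gt1 pp; have k0 : (0 < k)%N by lia.
have kN : (k < N)%N by nia.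
have B0 : 0 <= B := le_trans (normr_ge0 _) (H 0%N 0%N).
rewrite rk mulnC coprime_interval_split ?leq_addr //.
rewrite (le_trans (ler_normB _ _)) //.
have h1 := ih k k0 kN a n.
have h2 : `|\sum_((a + p.-1) %/ p <= m < (a + n + p.-1) %/ p | coprime (p * m) k)
     (jacobi (p * m) q)%:~R : R| <= k%:R * B.
  case: (boolP (coprime p k)) => cpk; last first.
    rewrite big1 ?normr0 ?mulr_ge0 // => m; rewrite coprimeMl (negPf cpk) //.
  rewrite (eq_bigl (fun m => coprime m k)); last by move=> m; rewrite coprimeMl cpk.
  rewrite (eq_bigr (fun m => (jacobi p q)%:~R * (jacobi m q)%:~R)); last first.
    by move=> m _; rewrite jacobiMl intrM.
  rewrite -mulr_sumr normrM.
  have j1 : `|(jacobi p q)%:~R : R| <= 1.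
    by case: (jacobi_cases p q) => ->; rewrite ?normr0 ?mulr1z ?mulrN1z ?normrN ?normr1.
  have le : ((a + p.-1) %/ p <= (a + n + p.-1) %/ p)%N by apply: leq_div2r; lia.
  have := ih k k0 kN ((a + p.-1) %/ p)%N ((a + n + p.-1) %/ p - (a + p.-1) %/ p)%N.
  rewrite subnKC // => h; rewrite -[X in _ <= X]mul1r ler_pM //.
have : (2 * k)%:R <= (p * k)%:R :> R by rewrite ler_nat leq_mul2r p1 orbT.
rewrite natrM => /(ler_wpM2r B0); lra.
Qed.

Lemma squarefree_part n : (0 < n)%N -> exists n0 k, [/\ n = (n0 * (k * k))%N, (0 < k)%N & squarefree n0].
Proof.
have [N] := ubnP n; elim: N n => // N ih n nN n0.
have [[p [pp pn]]|H] := pselect (exists p, prime p /\ (p * p %| n)%N); last first.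
  by exists n, 1%N; split; rewrite ?muln1 // => p pp; apply/negP => pn; apply: H; exists p.
have [n' nE] := dvdnP pn; have p1 := prime_gt1 pp.
have n'0 : (0 < n')%N by lia.
have n'N : (n' < N)%N by nia.
have [m [k [E k0 sf]]] := ih n' n'N n'0.
exists m, (p * k)%N; split=> //; last by rewrite muln_gt0 prime_gt0.
by rewrite nE E; ring.
Qed.

(** Write [n = m k^2] with [m] squarefree; [m > 1] since [n] is no square. The symbol modulo [n] is
    the one modulo [m] restricted to arguments coprime to [k], and the resulting loss [k] is
    absorbed by [sqrt n = k sqrt m]. *)
Lemma polya_vinogradov n a l : odd n -> (forall k, n != k * k)%N ->
  `|\sum_(a <= m < a + l) (jacobi m n)%:~R : R| <= Num.sqrt n%:R * harm n.
Proof.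
move=> on nsq; have n0 : (0 < n)%N by lia.
have [m [k [E k0 sf]]] := squarefree_part n0.
have om : odd m by move: on; rewrite E oddM => /andP[].
have m1 : (1 < m)%N.
  case: m E om {sf} => [|[|m]] //; rewrite mul1n => E; by have := nsq k; rewrite E eqxx.
have kk0 : (0 < k * k)%N by rewrite muln_gt0 k0.
have m0 : (0 < m)%N by lia.
have jE j : jacobi j n = if coprime j k then jacobi j m else 0.
  rewrite E jacobiMr // jacobi_sqrr //; case: (coprime j k); by rewrite ?mulr1 ?mulr0.
rewrite (eq_bigr (fun j => if coprime j k then (jacobi j m)%:~R else 0)); last first.
  by move=> j _; rewrite jE; case: (coprime j k).
rewrite -big_mkcond /=.
apply: le_trans (interval_coprime_bound k0 (fun a n => polya_vinogradov_squarefree a n m1 om sf) a l) _.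
have -> : Num.sqrt n%:R = k%:R * Num.sqrt m%:R :> R.
  by rewrite E !natrM mulrC sqrtrM ?mulr_ge0 // -expr2 sqrtr_sqr ger0_norm.
rewrite mulrA ler_wpM2l ?mulr_ge0 ?sqrtr_ge0 // /harm.
have mn : (m <= n)%N by rewrite E leq_pmulr.
by rewrite [X in _ <= X](big_cat_nat (n := m)) //= ?lerDl ?sumr_ge0 // 1?ltnW // => i _; rewrite invr_ge0.
Qed.

End PolyaVinogradov.

(** * Rows and columns of the matrix of Jacobi symbols *)

Section CharacterSums.
Variable R : realType.

(** The parity conditions are built into the matrix, so that sums run over full intervals. *)
Definition jac (m n : nat) : R := if odd m && odd n then (jacobi m n)%:~R else 0.

(** For odd [k], the density of the odd integers coprime to [k]. *)
Definition sqwt (k : nat) : R := (totient k)%:R / (2 * k)%:R.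

(** At most one term is nonzero; as a sum it needs no choice of a square root. *)
Definition qd (n : nat) : R := \sum_(0 <= k < n.+1 | odd k && (k * k == n)%N) sqwt k.

Lemma qd_sqr k : odd k -> qd (k * k) = sqwt k.
Proof.
move=> ok; rewrite /qd big_mkcond (bigD1_seq k) ?mem_index_iota ?iota_uniq //=; last by nia.
rewrite ok eqxx /= big1 ?addr0 // => j jk; case: ifP => // /andP[_ /eqP E].
by exfalso; move/eqP: jk; nia.
Qed.

Lemma qd_nsqr n : (forall k, odd k -> n != k * k)%N -> qd n = 0.
Proof.
by move=> H; rewrite /qd big1 // => k /andP[ok /eqP E]; have := H k ok; rewrite E eqxx.
Qed.

Lemma sqwt_ge0 k : 0 <= sqwt k.
Proof. by rewrite /sqwt divr_ge0. Qed.

Lemma totient_le k : (totient k <= k)%N.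
Proof.
rewrite totient_count_coprime; apply: leq_trans (_ : \sum_(0 <= d < k) 1 <= _)%N.
  by apply: leq_sum => i _; case: (coprime _ _).
by rewrite sum_nat_const_nat subn0 muln1.
Qed.

Lemma sqwt_le1 k : sqwt k <= 1.
Proof.
rewrite /sqwt; case: k => [|k]; first by rewrite mul0r.
rewrite ler_pdivrMr ?ltr0n // mul1r ler_nat (leq_trans (totient_le _)) //; lia.
Qed.

Lemma qd_ge0 n : 0 <= qd n.
Proof. by apply: sumr_ge0 => k _; exact: sqwt_ge0. Qed.

(** With [r = s b] modulo [n], where [b] comes from Euler's theorem, the symbol of [s] factors out
    of the progression and an interval remains. *)
Lemma jacobi_AP_bound n s r J (B : R) : coprime s n -> (0 < n)%N ->
  (forall a l, `|\sum_(a <= m < a + l) (jacobi m n)%:~R : R| <= B) ->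
  `|\sum_(0 <= j < J) (jacobi (s * j + r) n)%:~R : R| <= B.
Proof.
move=> cs n0 H.
have [b Hb] : exists b, (s * b = r %[mod n])%N.
  exists (s ^ (totient n).-1 * r)%N.
  rewrite mulnA -expnS prednK ?totient_gt0 // -modnMml.
  by rewrite (cyclic.Euler_exp_totient cs) modnMml mul1n.
rewrite (eq_bigr (fun j => (jacobi s n)%:~R * (jacobi (j + b) n)%:~R)); last first.
  move=> j _; rewrite -intrM -jacobiMl; congr (_%:~R); apply: jacobi_mod.
  by rewrite mulnDr -modnDmr -Hb modnDmr.
rewrite -mulr_sumr normrM.
have j1 : `|(jacobi s n)%:~R : R| <= 1.
  by case: (jacobi_cases s n) => ->; rewrite ?normr0 ?mulr1z ?mulrN1z ?normrN ?normr1.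
have := H b J; rewrite -{1}(add0n b) big_addn addKn => h.
by rewrite -[X in _ <= X]mul1r ler_pM.
Qed.

Lemma row_bound_nonsquare n M : odd n -> (forall k, n != k * k)%N ->
  `|\sum_(0 <= m < M) jac m n| <= Num.sqrt n%:R * harm R n.
Proof.
move=> on nsq; have n0 : (0 < n)%N by lia.
have -> : \sum_(0 <= m < M) jac m n = \sum_(0 <= m < M | (m %% 2 == 1)%N && xpredT m) (jacobi m n)%:~R.
  rewrite [RHS]big_mkcond; apply: eq_bigr => m _; rewrite /jac on andbT modn2 andbT.
  by case: (odd m).
rewrite (@sum_residue_class _ _ xpredT) //; apply: jacobi_AP_bound => //.
  by rewrite coprime2n.
by move=> a l; exact: polya_vinogradov.
Qed.

(** By reciprocity the symbol is [jacobi n m] up to a sign that depends only on [n] modulo 4; the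
    two odd classes account for the factor 2. *)
Lemma col_bound_nonsquare m N : odd m -> (forall k, m != k * k)%N ->
  `|\sum_(0 <= n < N) jac m n| <= 2 * (Num.sqrt m%:R * harm R m).
Proof.
move=> om nsq; have m0 : (0 < m)%N by lia.
have B0 : 0 <= Num.sqrt m%:R * harm R m by rewrite mulr_ge0 ?sqrtr_ge0 ?harm_ge0.
have E : \sum_(0 <= n < N) jac m n =
   \sum_(0 <= n < N | (n %% 4 == 1)%N && xpredT n) (jacobi n m)%:~R +
   (-1) ^+ m./2 * \sum_(0 <= n < N | (n %% 4 == 3)%N && xpredT n) (jacobi n m)%:~R.
  rewrite mulr_sumr [X in _ = X + _]big_mkcond [X in _ = _ + X]big_mkcond -big_split /=.
  apply: eq_bigr => n _; rewrite /jac om /=.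
  have o4 := odd_mod n (erefl : odd 4 = false).
  have l4 : (n %% 4 < 4)%N by rewrite ltn_mod.
  case: (boolP (odd n)) o4 => on /esym o4; last first.
    by case: (n %% 4)%N l4 o4 => [|[|[|[|]]]] //; rewrite addr0.
  rewrite jacobi_reciprocity // intrM rmorphXn /= mulrN1z.
  have hE : (n = 4 * (n %/ 4) + n %% 4)%N by rewrite {1}(divn_eq n 4) mulnC.
  case: (n %% 4)%N l4 o4 hE => [|[|[|[|]]]] //= _ _ hE.
    have -> : (-1) ^+ (m./2 * n./2) = 1 :> R.
      rewrite -signr_odd oddM; have -> : odd n./2 = false by lia.
      by rewrite andbF expr0.
    by rewrite mul1r addr0.
  have -> : (-1) ^+ (m./2 * n./2) = (-1) ^+ m./2 :> R.
    rewrite -signr_odd oddM; have -> : odd n./2 = true by lia.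
    by rewrite andbT signr_odd.
  by rewrite add0r.
rewrite E (le_trans (ler_normD _ _)) // normrM normr_sign mul1r mulrDl mul1r.
have c4 : coprime 4 m by rewrite (@coprimeXl 2 2 m) // coprime2n.
apply: lerD; rewrite (@sum_residue_class _ _ xpredT) //; apply: jacobi_AP_bound => //;
  by move=> a l; exact: polya_vinogradov.
Qed.

(** The summand has period [2 k] and mean 0, so only an incomplete period contributes. *)
Lemma periodic_mean_bound (k M : nat) : (0 < k)%N -> odd k ->
  `|\sum_(0 <= m < M) ((odd m && coprime m k)%:R - sqwt k)| <= (4 * k)%:R :> R.
Proof.
move=> k0 ok; set f := fun m : nat => (odd m && coprime m k)%:R - sqwt k : R.
pose d := (2 * k)%N; have d0 : (0 < d)%N by rewrite /d; lia.
have fE m : f m = (coprime m d)%:R - sqwt k.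
  by rewrite /f /d coprimeMr coprimen2.
have per m : f (m + d)%N = f m by rewrite !fE -coprime_modl modnDr coprime_modl.
have tot : totient d = totient k.
  by rewrite /d totient_coprime ?coprime2n // (_ : totient 2 = 1%N) ?mul1n.
have zero : \sum_(0 <= m < d) f m = 0.
  rewrite (eq_bigr _ (fun m _ => fE m)) big_split /= sumrN sumr_const_nat subn0.
  have -> : \sum_(0 <= i < d) (coprime i d)%:R = (totient d)%:R :> R.
    rewrite totient_count_coprime natr_sum; apply: eq_bigr => i _; by rewrite coprime_sym.
  have dn : d%:R != 0 :> R by rewrite pnatr_eq0; lia.
  by rewrite tot -(mulr_natr (sqwt k) d) {1}/sqwt -/d mulrVK ?unitfE // subrr.
have full j : \sum_(0 <= m < j * d) f m = 0.
  elim: j => [|j ih]; first by rewrite mul0n big_geq.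
  rewrite mulSn addnC (big_cat_nat (n := (j * d)%N)) ?leq_addr //= ih add0r.
  rewrite -{1}(add0n (j * d)%N) big_addn addKn -[RHS]zero; apply: eq_bigr => m _.
  elim: j {ih} => [|j ih]; first by rewrite mul0n addn0.
  by rewrite mulSn (addnC d) addnA per.
rewrite (divn_eq M d) (big_cat_nat (n := (M %/ d * d)%N)) ?leq_addr //= full add0r.
rewrite (le_trans (ler_norm_sum _ _ _)) //.
apply: (@le_trans _ _ (\sum_(M %/ d * d <= m < M %/ d * d + M %% d) 1)).
  apply: ler_sum => m _; rewrite /f; have q0 := sqwt_ge0 k; have q1 := sqwt_le1 k.
  by rewrite ler_norml; case: (odd m && _); rewrite /= ?mulr1n ?mulr0n; apply/andP; split; lra.
rewrite sumr_const_nat addKn ler_nat /d; have := ltn_pmod M d0; rewrite /d; lia.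
Qed.

Lemma nat_sqr_sqrt k : Num.sqrt (k * k)%:R = k%:R :> R.
Proof. by rewrite natrM -expr2 sqrtr_sqr ger0_norm. Qed.

Lemma row_bound n M : (0 < n)%N ->
  `|\sum_(0 <= m < M) (jac m n - qd n)| <= Num.sqrt n%:R * (2 * harm R n + 4).
Proof.
move=> n0; have s0 : 0 <= Num.sqrt n%:R :> R by exact: sqrtr_ge0.
have h0 := harm_ge0 R n.
have [on|en] := boolP (odd n); last first.
  rewrite big1 ?normr0 ?mulr_ge0 //; first lra.
  move=> m _; rewrite /jac (negPf en) andbF qd_nsqr ?subr0 // => k ok.
  by apply/eqP => E; move: en; rewrite E oddM ok.
have [[k E]|nsq] := pselect (exists k, n = (k * k)%N); last first.
  have H k : (n != k * k)%N by apply/eqP => E; apply: nsq; exists k.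
  rewrite qd_nsqr //; under eq_bigr do rewrite subr0.
  by rewrite (le_trans (row_bound_nonsquare M on H)) // ler_wpM2l //; lra.
have ok : odd k by move: on; rewrite E oddM andbb.
have k0 : (0 < k)%N by lia.
rewrite E qd_sqr // nat_sqr_sqrt.
have -> : \sum_(0 <= m < M) (jac m (k * k) - sqwt k) =
   \sum_(0 <= m < M) ((odd m && coprime m k)%:R - sqwt k).
  apply: eq_bigr => m _; congr (_ - _); rewrite /jac oddM ok !andbT.
  by case: (odd m) => //=; rewrite jacobi_sqrr //; case: (coprime m k).
rewrite (le_trans (periodic_mean_bound M k0 ok)) // natrM mulrC ler_wpM2l //.
by have := harm_ge0 R (k * k); lra.
Qed.

Lemma col_bound m N : (0 < m)%N ->
  `|\sum_(0 <= n < N) (jac m n - qd m)| <= Num.sqrt m%:R * (2 * harm R m + 4).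
Proof.
move=> n0; have s0 : 0 <= Num.sqrt m%:R :> R by exact: sqrtr_ge0.
have h0 := harm_ge0 R m.
have [on|en] := boolP (odd m); last first.
  rewrite big1 ?normr0 ?mulr_ge0 //; first lra.
  move=> n _; rewrite /jac (negPf en) /= qd_nsqr ?subr0 // => k ok.
  by apply/eqP => E; move: en; rewrite E oddM ok.
have [[k E]|nsq] := pselect (exists k, m = (k * k)%N); last first.
  have H k : (m != k * k)%N by apply/eqP => E; apply: nsq; exists k.
  rewrite qd_nsqr //; under eq_bigr do rewrite subr0.
  by rewrite (le_trans (col_bound_nonsquare N on H)) // mulrCA ler_wpM2l //; lra.
have ok : odd k by move: on; rewrite E oddM andbb.
have k0 : (0 < k)%N by lia.
rewrite E qd_sqr // nat_sqr_sqrt.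
have -> : \sum_(0 <= n < N) (jac (k * k) n - sqwt k) =
   \sum_(0 <= n < N) ((odd n && coprime n k)%:R - sqwt k).
  apply: eq_bigr => n _; congr (_ - _); rewrite /jac oddM ok /=.
  case: (boolP (odd n)) => //= on'; rewrite jacobi_sqrl; last by lia.
  by rewrite coprime_sym; case: (coprime n k).
rewrite (le_trans (periodic_mean_bound N k0 ok)) // natrM mulrC ler_wpM2l //.
by have := harm_ge0 R (k * k); lra.
Qed.

End CharacterSums.

(** * Limits and series with explicit tails *)

Section Limits.
Variable R : realType.
Local Notation C := R[i].
Implicit Types (u v : nat -> C) (l m : C) (a b : nat -> R).

Definition clim u l := forall e : R, 0 < e -> exists N, forall n, (N <= n)%N -> cabs (u n - l) <= e.
Definition rnull a := forall e : R, 0 < e -> exists N, forall n, (N <= n)%N -> a n <= e.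

Lemma clim_unique u l m : clim u l -> clim u m -> l = m.
Proof.
move=> hl hm; apply/eqP; rewrite -subr_eq0; apply/eqP; apply: cabs_small => e e0.
have e2 : 0 < e / 2 by lra.
have [N1 H1] := hl _ e2; have [N2 H2] := hm _ e2.
have h1 := H1 _ (leq_maxl N1 N2); have h2 := H2 _ (leq_maxr N1 N2).
have := cabs_triangle l m (u (maxn N1 N2)); rewrite (cabsBC l (u _)); lra.
Qed.

Lemma clim_squeeze u l b : (forall n, cabs (u n - l) <= b n) -> rnull b -> clim u l.
Proof. by move=> H B e e0; have [N HN] := B e e0; exists N => n /HN; apply: le_trans. Qed.

Lemma rnullD a b : rnull a -> rnull b -> rnull (fun n => a n + b n).
Proof.
move=> A B e e0; have e2 : 0 < e / 2 by lra.
have [N1 H1] := A _ e2; have [N2 H2] := B _ e2.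
exists (maxn N1 N2) => n; rewrite geq_max => /andP[/H1 h1 /H2 h2]; lra.
Qed.

Lemma rnullZ (k : R) a : 0 <= k -> rnull a -> rnull (fun n => k * a n).
Proof.
move=> k0 A e e0; have k1 : 0 < k + 1 by lra.
have [N H] := A _ (divr_gt0 e0 k1); exists N => n /H h.
apply: (le_trans (ler_wpM2l k0 h)); rewrite mulrCA ger_pMr // ler_pdivrMr //; lra.
Qed.

Definition cofinal_nat (f : nat -> nat) := forall N, exists n0, forall n, (n0 <= n)%N -> (N <= f n)%N.

Lemma rnull_sub a f : cofinal_nat f -> rnull a -> rnull (fun n => a (f n)).
Proof.
move=> cf A e e0; have [N HN] := A e e0; have [n0 H0] := cf N.
by exists n0 => n /H0; exact: HN.
Qed.

Lemma clim_sub u l f : cofinal_nat f -> clim u l -> clim (fun n => u (f n)) l.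
Proof. by move=> cf; exact: (@rnull_sub (fun n => cabs (u n - l))). Qed.

Lemma clim_ext u v l : u =1 v -> clim u l -> clim v l.
Proof. by move=> E H e e0; have [N HN] := H e e0; exists N => n /HN; rewrite E. Qed.

Lemma clim_cst l : clim (fun=> l) l.
Proof. by move=> e e0; exists 0%N => n _; rewrite subrr cabs0 ltW. Qed.

Lemma climD u v l m : clim u l -> clim v m -> clim (fun n => u n + v n) (l + m).
Proof.
move=> U V; apply: (clim_squeeze (b := fun n => cabs (u n - l) + cabs (v n - m))); last exact: rnullD.
move=> n; have -> : u n + v n - (l + m) = (u n - l) + (v n - m) by ring.
exact: cabsD.
Qed.

Lemma climM u v l m : clim u l -> clim v m -> clim (fun n => u n * v n) (l * m).
Proof.
move=> U V e e0.
have e2 : 0 < e / 2 by lra.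
have m1 : 0 < 1 + cabs m by rewrite ltr_pwDl ?cabs_ge0.
have l1 : 0 < 1 + cabs l by rewrite ltr_pwDl ?cabs_ge0.
have [N1 H1] := U _ (divr_gt0 e2 m1); have [N2 H2] := V _ (divr_gt0 e2 l1).
have [N3 H3] := V _ ltr01.
exists (maxn N1 (maxn N2 N3)) => n; rewrite !geq_max => /and3P[/H1 h1 /H2 h2 /H3 h3].
have -> : u n * v n - l * m = (u n - l) * v n + l * (v n - m) by ring.
apply: (le_trans (cabsD _ _)); rewrite !cabsM.
have hv : cabs (v n) <= 1 + cabs m.
  have -> : v n = (v n - m) + m by ring.
  by apply: (le_trans (cabsD _ _)); lra.
have k1 : cabs (u n - l) * cabs (v n) <= e / 2.
  apply: (le_trans (ler_pM (cabs_ge0 _) (cabs_ge0 _) h1 hv)).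
  by rewrite divfK // gt_eqF.
have k2 : cabs l * cabs (v n - m) <= e / 2.
  have cl : cabs l <= 1 + cabs l by lra.
  apply: (le_trans (ler_pM (cabs_ge0 _) (cabs_ge0 _) cl h2)).
  by rewrite mulrC divfK // gt_eqF.
lra.
Qed.

Lemma climZ k u l : clim u l -> clim (fun n => k * u n) (k * l).
Proof. by apply: climM; exact: clim_cst. Qed.

Lemma climB u v l m : clim u l -> clim v m -> clim (fun n => u n - v n) (l - m).
Proof.
move=> U V; have := climD U (climZ (-1) V); rewrite mulN1r; apply: clim_ext => n.
by rewrite mulN1r.
Qed.

Lemma clim_le u l (c : C) (B : R) N0 : (forall n, (N0 <= n)%N -> cabs (u n - c) <= B) ->
  clim u l -> cabs (l - c) <= B.
Proof.
move=> H U; apply/ler_addgt0Pr => e e0; have [N HN] := U _ e0.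
have h1 := HN _ (leq_maxr N0 N); have h2 := H _ (leq_maxl N0 N).
have := cabs_triangle l c (u (maxn N0 N)); rewrite (cabsBC l (u _)); lra.
Qed.

Lemma clim_abs_le u l (B : R) : (forall n, cabs (u n) <= B) -> clim u l -> cabs l <= B.
Proof.
move=> H U; rewrite -(subr0 l); apply: (@clim_le u l 0 B 0) => // n _.
by rewrite subr0.
Qed.

Lemma rcauchy (w : nat -> R) : (forall e : R, 0 < e -> exists N, forall n, (N <= n)%N -> `|w n - w N| <= e) ->
  exists l : R, forall e : R, 0 < e -> exists N, forall n, (N <= n)%N -> `|w n - l| <= e.
Proof.
move=> H; have cw : cvg (w @ \oo).
  apply: cauchy_cvg; apply: cauchy_exP => e e0.
  have e2 : 0 < e / 2 by lra.
  have [N HN] := H _ e2; exists (w N).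
  exists N => // n /= Nn; rewrite /ball /= distrC; have := HN n Nn; lra.
exists (lim (w @ \oo)) => e e0.
have /cvgrPdist_le/(_ _ e0)[N _ HN] := cw.
by exists N => n Nn; rewrite distrC; exact: HN.
Qed.

Lemma ccauchy u : (forall e : R, 0 < e -> exists N, forall n, (N <= n)%N -> cabs (u n - u N) <= e) ->
  exists l, clim u l.
Proof.
move=> H.
have [x Hx] : exists l : R, forall e : R, 0 < e -> exists N, forall n, (N <= n)%N -> `|RE (u n) - l| <= e.
  apply: rcauchy => e e0; have [N HN] := H e e0; exists N => n /HN.
  by apply: le_trans; rewrite -ReB; exact: abs_Re_le.
have [y Hy] : exists l : R, forall e : R, 0 < e -> exists N, forall n, (N <= n)%N -> `|IM (u n) - l| <= e.
  apply: rcauchy => e e0; have [N HN] := H e e0; exists N => n /HN.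
  by apply: le_trans; rewrite -ImB; exact: abs_Im_le.
exists (x +i* y) => e e0; have e2 : 0 < e / 2 by lra.
have [N1 H1] := Hx _ e2; have [N2 H2] := Hy _ e2.
exists (maxn N1 N2) => n; rewrite geq_max => /andP[/H1 h1 /H2 h2].
apply: (le_trans (cabs_le_ReIm _)); rewrite ReB ImB /=; lra.
Qed.

(** A total function, with the default 0 when the partial sums have no limit. *)
Definition csum u : C := xget 0 [set l | clim (fun N => \sum_(0 <= n < N) u n) l].

(** With a [tau] common to all parameters in a disc, this is the hypothesis of the Weierstrass
    M-test. *)
Definition tails u (tau : nat -> R) := rnull tau /\
  forall N M, (N <= M)%N -> \sum_(N <= n < M) cabs (u n) <= tau N.

Lemma csum_eq u l : clim (fun N => \sum_(0 <= n < N) u n) l -> csum u = l.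
Proof.
move=> H; apply: (clim_unique (u := fun N => \sum_(0 <= n < N) u n)) => //.
by rewrite /csum; apply: (@xgetPex _ 0 [set l | clim (fun N => \sum_(0 <= n < N) u n) l]); exists l.
Qed.

Lemma tails_partial u tau N M : tails u tau -> (N <= M)%N ->
  cabs (\sum_(0 <= n < M) u n - \sum_(0 <= n < N) u n) <= tau N.
Proof.
move=> [_ H] NM; rewrite (big_cat_nat (n := N)) //= addrAC subrr add0r.
by apply: (le_trans (cabs_sum _ _ _)); exact: H.
Qed.

Lemma csum_lim u tau : tails u tau -> clim (fun N => \sum_(0 <= n < N) u n) (csum u).
Proof.
move=> T; have [l Hl] : exists l, clim (fun N => \sum_(0 <= n < N) u n) l.
  apply: ccauchy => e e0; have [N HN] := T.1 _ e0.
  by exists N => n Nn; apply: (le_trans (tails_partial T Nn)); exact: HN.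
by rewrite (csum_eq Hl).
Qed.

Lemma csum_tail u tau N : tails u tau -> cabs (csum u - \sum_(0 <= n < N) u n) <= tau N.
Proof.
move=> T; apply: (@clim_le _ _ _ _ N _ (csum_lim T)) => n Nn.
exact: tails_partial.
Qed.

Lemma csum_bound u tau : tails u tau -> cabs (csum u) <= tau 0%N.
Proof. by move=> T; have := csum_tail 0 T; rewrite big_geq // subr0. Qed.

Lemma series_hol (u : nat -> C -> C) tau z r : 0 < r ->
  (forall n w, cabs (w - z) < r -> hol (u n) w) ->
  (forall w, cabs (w - z) < r -> tails (u^~ w) tau) ->
  hol (fun w => csum (u^~ w)) z.
Proof.
move=> r0 hu T; apply: (@weierstrass _ (fun N w => \sum_(0 <= n < N) u n w) _ z r r0).
  elim=> [|N ih] w wz.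
    by apply: (@hol_near _ (fun=> 0) _ _ 1 ltr01 _ (hol_cst _ _)) => h _; rewrite big_geq.
  apply: (@hol_near _ (fun w => \sum_(0 <= n < N) u n w + u N w) _ _ 1 ltr01).
    by move=> h _; rewrite big_nat_recr.
  by apply: holD; [exact: ih|exact: hu].
move=> e e0; have z0 : cabs (z - z) < r by rewrite subrr cabs0.
have [N HN] := (T z z0).1 e e0; exists N => w wz.
by rewrite cabsBC; apply: (le_trans (csum_tail N (T w wz))); exact: HN.
Qed.

Lemma clim_of_cvg u l : (u : nat -> Cplx R) @ \oo --> (l : Cplx R) -> clim u l.
Proof.
move=> H e e0; have e1 : 0 < e%:C by rewrite (ltcR 0).
have /cvgrPdist_le/(_ _ e1)[N _ HN] := H.
by exists N => n Nn; have := HN n Nn; rewrite /= cabsE lecR cabsBC.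
Qed.

(** Brings the differentiability of [zeta] and, along the coordinate directions, that of [A] into
    the form of [cderiv]. *)
Lemma cderiv_of_derivable (V : normedModType C) (f : V -> Cplx R) (a v : V) :
  derivable f a v -> exists l : C, cderiv (fun h => f (h *: v + a)) 0 l.
Proof.
rewrite /derivable; move/cvgrPdist_le; set L := lim _ => D; exists L => e e0.
have e1 : 0 < e%:C by rewrite (ltcR 0).
have /nbhs_ballP[d /= d0 Hd] := D _ e1.
have dC : d = (RE d)%:C by move: d0; rewrite ltcE => /andP[/eqP i _]; exact: complex_ext.
have d0' : 0 < RE d by move: d0; rewrite dC (ltcR 0).
exists (RE d); split=> // h hd; rewrite add0r scale0r add0r.
have [->|hn] := eqVneq h 0; first by rewrite scale0r add0r subrr sub0r mulr0 oppr0 cabs0 mulr0.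
have := Hd h; rewrite /ball /= sub0r normrN cabsE {1}dC ltcR => /(_ hd hn).
rewrite /= cabsE lecR => H.
have -> : f (h *: v + a) - f a - L * h = - (L - h^-1 * (f (h *: v + a) - f a)) * h.
  by rewrite mulNr mulrBl mulrAC mulVf // mul1r; ring.
by rewrite cabsM cabsN ler_wpM2r ?cabs_ge0.
Qed.

End Limits.

(** * Tails of sums of powers *)

Section PowerSums.
Variable R : realType.
Local Notation C := R[i].

Lemma powRE (x a : R) : 0 < x -> x `^ a = expR (a * ln x).
Proof. by move=> x0; rewrite /powR gt_eqF. Qed.

Lemma powRDp (x a b : R) : 0 < x -> x `^ a * x `^ b = x `^ (a + b).
Proof. by move=> x0; rewrite powRD // (gt_eqF x0) implybT. Qed.

(** The constant in the tail bound for the exponent [- (1 + a)]: [1 / a] comes from comparison with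
    telescoping differences of powers [- a], and [2^(1 + a)] from passing between neighbouring
    integers. *)
Definition Kp (a : R) : R := 2 `^ (1 + a) / a.

Lemma Kp_gt0 a : 0 < a -> 0 < Kp a.
Proof. by move=> a0; rewrite divr_gt0 // powR_gt0. Qed.

Lemma ln_succ_ge (n : nat) : n.+2%:R^-1 <= ln n.+2%:R - ln n.+1%:R :> R.
Proof.
have x0 : 0 < n.+1%:R :> R by rewrite ltr0n.
have y0 : 0 < n.+2%:R :> R by rewrite ltr0n.
rewrite -[X in _ <= X]opprB lerNr -ln_div ?posrE //.
have -> : n.+1%:R / n.+2%:R = 1 + - n.+2%:R^-1 :> R.
  have -> : n.+2%:R = n.+1%:R + 1 :> R by rewrite natr1.
  by move: (n.+1%:R : R) x0 => x x0; field; rewrite gt_eqF //; lra.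
by apply: le_ln1Dx; rewrite ltrN2 invf_lt1 // ltr1n.
Qed.

Lemma pow_diff (a : R) n : 0 < a ->
  n.+1%:R `^ (- (1 + a)) <= Kp a * (n.+1%:R `^ (- a) - n.+2%:R `^ (- a)).
Proof.
move=> a0; have x0 : 0 < n.+1%:R :> R by rewrite ltr0n.
have y0 : 0 < n.+2%:R :> R by rewrite ltr0n.
pose y : R := n.+2%:R.
have h1 : n.+1%:R `^ (- (1 + a)) <= 2 `^ (1 + a) * y `^ (- (1 + a)).
  rewrite !powRN -ler_pdivrMl ?powR_gt0 // -invfM lef_pV2 ?posrE ?mulr_gt0 ?powR_gt0 //.
  rewrite -powRM ?ler0n // ge0_ler_powR ?nnegrE ?mulr_ge0 ?ler0n //; first by rewrite addr_ge0 // ltW.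
  by rewrite -natrM ler_nat; lia.
have h2 : a * y `^ (- (1 + a)) <= n.+1%:R `^ (- a) - y `^ (- a).
  have -> : y `^ (- (1 + a)) = y^-1 * y `^ (- a).
    rewrite opprD powRD; last by rewrite (gt_eqF y0) implybT.
    by rewrite (powRN y 1) (powRr1 (ltW y0)).
  have -> : n.+1%:R `^ (- a) = y `^ (- a) * expR (a * (ln y - ln n.+1%:R)).
    by rewrite !powRE // -expRD; congr expR; ring.
  have k1 : 1 + a * y^-1 <= expR (a * (ln y - ln n.+1%:R)).
    apply: le_trans (expR_ge1Dx _); rewrite lerD2l ler_wpM2l ?ln_succ_ge //.
    exact: ltW.
  have := ler_wpM2l (powR_ge0 y (- a)) k1; move: (y `^ (- a)) (y^-1) (expR _) => p q r; lra.
apply: (le_trans h1); rewrite /Kp -mulrA ler_pM2l ?powR_gt0 //.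
by rewrite ler_pdivlMl.
Qed.

Lemma pow_tail (a : R) N M : 0 < a -> (N <= M)%N ->
  \sum_(N <= n < M) n.+1%:R `^ (- (1 + a)) <= Kp a * N.+1%:R `^ (- a).
Proof.
move=> a0 NM; suff : \sum_(N <= n < M) n.+1%:R `^ (- (1 + a)) <=
    Kp a * (N.+1%:R `^ (- a) - M.+1%:R `^ (- a)).
  move=> h; apply: (le_trans h); rewrite ler_pM2l ?Kp_gt0 // lerBlDr lerDl.
  exact: powR_ge0.
rewrite -(subnKC NM); elim: (M - N)%N => [|k ih]; first by rewrite addn0 big_geq // subrr mulr0.
rewrite addnS big_nat_recr ?leq_addr //=.
apply: (le_trans (lerD ih (pow_diff _ a0))); rewrite -mulrDr ler_pM2l ?Kp_gt0 //; lra.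
Qed.

Lemma rnull_pow (a : R) : 0 < a -> rnull (fun N => N.+1%:R `^ (- a) : R).
Proof.
move=> a0 e e0; pose x := e `^ (- a^-1).
have x0 : 0 < x by exact: powR_gt0.
have := archi_boundP (ltW x0); move: (Num.Def.archi_bound x) => N xN.
exists N => n Nn.
have -> : e = x `^ (- a) by rewrite /x -powRrM mulrNN mulVf ?gt_eqF // powRr1 ?ltW.
apply: powR_nonpos_le => //; last lra.
by apply: ltW; apply: (lt_le_trans xN); rewrite ler_nat; lia.
Qed.

End PowerSums.

(** * Partial sums of the symbol minus its means *)

Section ErrorMatrix.
Variable R : realType.

Lemma qd_le1 n : qd R n <= 1.
Proof.
have [[k [ok ->]]|H] := pselect (exists k, odd k /\ n = (k * k)%N).
  by rewrite qd_sqr //; exact: sqwt_le1.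
rewrite qd_nsqr // => k ok; apply/eqP => E; apply: H; exists k; by split.
Qed.

Lemma sum_qd_le M K : (M < K.+1 * K.+1)%N -> \sum_(0 <= m < M.+1) qd R m <= K%:R.
Proof.
elim: M K => [|M ih] K MK.
  by rewrite big_nat1 qd_nsqr // => k ok; apply/eqP => E; move: ok; have -> : k = 0%N by nia.
rewrite big_nat_recr //=.
have [[k [ok E]]|H] := pselect (exists k, odd k /\ M.+1 = (k * k)%N).
  have k0 : (0 < k)%N by lia.
  have h1 := ih k.-1; rewrite prednK // in h1.
  have {}h1 := h1 ltac:(lia).
  have h2 := qd_le1 M.+1.
  apply: (@le_trans _ _ (k.-1%:R + 1)); first by rewrite lerD.
  by rewrite natr1 prednK // ler_nat; nia.
rewrite qd_nsqr ?addr0; first by apply: ih; lia.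
by move=> k ok; apply/eqP => E; apply: H; exists k.
Qed.

Lemma nat_sqrt_ex M : exists K, (K * K <= M < K.+1 * K.+1)%N.
Proof.
elim: M => [|M [K /andP[h1 h2]]]; first by exists 0%N.
have [h|h] := leqP (K.+1 * K.+1)%N M.+1; last by exists K; lia.
by exists K.+1; apply/andP; split => //; nia.
Qed.

Lemma sum_qd_sqrt M : \sum_(0 <= m < M) qd R m.+1 <= Num.sqrt M.+1%:R.
Proof.
have [K /andP[h1 h2]] := nat_sqrt_ex M.
apply: (@le_trans _ _ K%:R).
  apply: le_trans (sum_qd_le h2); rewrite [leRHS]big_nat_recl //= lerDr; exact: qd_ge0.
by rewrite -(nat_sqr_sqrt R) ler_sqrt ?ler0n // ler_nat; lia.
Qed.

Lemma harm_le_ln n : harm R n.+2 <= 1 + ln n.+1%:R.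
Proof.
elim: n => [|n ih]; first by rewrite /harm big_nat1 invr1 ln1 addr0.
have -> : harm R n.+3 = harm R n.+2 + n.+2%:R^-1 by rewrite /harm big_nat_recr.
have := ln_succ_ge R n; move: ih.
by move: (harm R _) (n.+2%:R^-1) (ln n.+2%:R) (ln n.+1%:R) => p q r t; lra.
Qed.

Lemma harm_mono n : harm R n <= harm R n.+1.
Proof.
rewrite /harm; case: n => [|n]; first by rewrite !big_geq.
by rewrite [leRHS]big_nat_recr //= lerDl invr_ge0.
Qed.

Lemma ln_le_pow (x h : R) : 0 < x -> 0 < h -> ln x <= x `^ h / h.
Proof.
move=> x0 h0; rewrite ler_pdivlMr // powRE // mulrC.
by have := expR_ge1Dx (h * ln x); lra.
Qed.

Lemma pow_ge1 (x a : R) : 1 <= x -> 0 <= a -> 1 <= x `^ a.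
Proof. by move=> x1 a0; rewrite -(powRr0 x) ler_powR. Qed.

Lemma pow_mono (x y a : R) : 0 <= x -> x <= y -> 0 <= a -> x `^ a <= y `^ a.
Proof. by move=> x0 xy a0; apply: ge0_ler_powR => //; rewrite nnegrE //; lra. Qed.

Lemma harm_pow (h : R) : 0 < h -> exists2 L : R, 1 <= L &
  forall n, 2 * harm R n.+1 + 5 <= L * n.+1%:R `^ h.
Proof.
move=> h0; have i0 : 0 < h^-1 by rewrite invr_gt0.
exists (7 + 2 / h) => [|n]; first lra.
have x1 : 1 <= n.+1%:R :> R by rewrite ler1n.
have k1 := le_trans (harm_mono n.+1) (harm_le_ln n).
have k2 := ln_le_pow (lt_le_trans ltr01 x1) h0.
have k3 := pow_ge1 x1 (ltW h0).
have -> : (7 + 2 / h) * n.+1%:R `^ h = 7 * n.+1%:R `^ h + 2 * (n.+1%:R `^ h / h) by ring.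
lra.
Qed.

(** Indices are shifted by one here and below: the entry [(m, n)] belongs to the integers [m + 1]
    and [n + 1]. *)
Definition ee m n : R := jac R m.+1 n.+1 - qd R m.+1 - qd R n.+1.
Definition EE M N : R := \sum_(0 <= m < M.+1) \sum_(0 <= n < N.+1) ee m n.

Lemma jac0l n : jac R 0 n = 0. Proof. by []. Qed.
Lemma jac0r n : jac R n 0 = 0. Proof. by rewrite /jac andbF. Qed.

(** The row and column bounds start at index 0, where the symbol vanishes; dropping that term costs
    [q <= 1]. *)
Lemma shifted_bound (F : nat -> R) q M B : F 0%N = 0 -> 0 <= q <= 1 ->
  `|\sum_(0 <= m < M.+1) (F m - q)| <= B -> `|\sum_(0 <= m < M) (F m.+1 - q)| <= B + 1.
Proof.
move=> F0 /andP[q0 q1]; rewrite big_nat_recl //= F0 sub0r => H.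
move: H; move: (\sum_(_ <= _ < _) _) => S; rewrite !ler_norml => /andP[h1 h2].
by apply/andP; split; lra.
Qed.

Lemma EE_bound1 M N :
  `|EE M N| <= N.+1%:R * (Num.sqrt N.+1%:R * (2 * harm R N.+1 + 5) + Num.sqrt M.+2%:R).
Proof.
rewrite /EE exchange_big /=.
apply: (le_trans (ler_norm_sum _ _ _)).
rewrite mulr_natl -[X in _ *+ X](subn0 N.+1) -sumr_const_nat; apply: ler_sum_nat => n /andP[_ nN].
have -> : \sum_(0 <= m < M.+1) ee m n =
   \sum_(0 <= m < M.+1) (jac R m.+1 n.+1 - qd R n.+1) - \sum_(0 <= m < M.+1) qd R m.+1.
  by rewrite -sumrB; apply: eq_bigr => m _; rewrite /ee; ring.
apply: (le_trans (ler_normB _ _)); apply: lerD; last first.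
  by rewrite ger0_norm ?sumr_ge0 // => [|i _]; [exact: sum_qd_sqrt|exact: qd_ge0].
have q01 : 0 <= qd R n.+1 <= 1 by rewrite qd_ge0 qd_le1.
apply: (le_trans (shifted_bound (F := fun m => jac R m n.+1) (jac0l _) q01 (row_bound R M.+2 (ltn0Sn n)))).
have s1 : 1 <= Num.sqrt N.+1%:R :> R by rewrite -{1}sqrtr1 ler_sqrt ?ler1n.
have s2 : Num.sqrt n.+1%:R <= Num.sqrt N.+1%:R :> R by rewrite ler_sqrt ?ler0n // ler_nat.
have hm : harm R n.+1 <= harm R N.+1.
  by move: nN; rewrite ltnS => nN; rewrite -(subnKC nN); elim: (N - n)%N => [|k ih];
    rewrite ?addn0 // addnS; apply: (le_trans ih); exact: harm_mono.
have h0 := harm_ge0 R n.+1.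
have : Num.sqrt n.+1%:R * (2 * harm R n.+1 + 4) <= Num.sqrt N.+1%:R * (2 * harm R N.+1 + 4).
  by apply: ler_pM; rewrite ?sqrtr_ge0 //; lra.
lra.
Qed.

Lemma EE_bound2 M N :
  `|EE M N| <= M.+1%:R * (Num.sqrt M.+1%:R * (2 * harm R M.+1 + 5) + Num.sqrt N.+2%:R).
Proof.
rewrite /EE.
apply: (le_trans (ler_norm_sum _ _ _)).
rewrite mulr_natl -[X in _ *+ X](subn0 M.+1) -sumr_const_nat; apply: ler_sum_nat => m /andP[_ nM].
have -> : \sum_(0 <= n < N.+1) ee m n =
   \sum_(0 <= n < N.+1) (jac R m.+1 n.+1 - qd R m.+1) - \sum_(0 <= n < N.+1) qd R n.+1.
  by rewrite -sumrB; apply: eq_bigr => n _; rewrite /ee; ring.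
apply: (le_trans (ler_normB _ _)); apply: lerD; last first.
  by rewrite ger0_norm ?sumr_ge0 // => [|i _]; [exact: sum_qd_sqrt|exact: qd_ge0].
have q01 : 0 <= qd R m.+1 <= 1 by rewrite qd_ge0 qd_le1.
apply: (le_trans (shifted_bound (F := fun n => jac R m.+1 n) (jac0r _) q01 (col_bound R N.+2 (ltn0Sn m)))).
have s1 : 1 <= Num.sqrt M.+1%:R :> R by rewrite -{1}sqrtr1 ler_sqrt ?ler1n.
have s2 : Num.sqrt m.+1%:R <= Num.sqrt M.+1%:R :> R by rewrite ler_sqrt ?ler0n // ler_nat.
have hm : harm R m.+1 <= harm R M.+1.
  by move: nM; rewrite ltnS => nM; rewrite -(subnKC nM); elim: (M - m)%N => [|k ih];
    rewrite ?addn0 // addnS; apply: (le_trans ih); exact: harm_mono.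
have h0 := harm_ge0 R m.+1.
have : Num.sqrt m.+1%:R * (2 * harm R m.+1 + 4) <= Num.sqrt M.+1%:R * (2 * harm R M.+1 + 4).
  by apply: ler_pM; rewrite ?sqrtr_ge0 //; lra.
lra.
Qed.

Lemma sqrt_pow (x : R) : 0 <= x -> Num.sqrt x = x `^ (1 / 2).
Proof. by move=> x0; rewrite div1r powR12_sqrt. Qed.

Lemma sqrt_succ_le n : Num.sqrt n.+2%:R <= 2 * n.+1%:R `^ (1 / 2) :> R.
Proof.
rewrite -sqrt_pow ?ler0n //; have -> : 2 = Num.sqrt (2 * 2) :> R by rewrite -expr2 sqrtr_sqr ger0_norm.
rewrite -sqrtrM ?mulr_ge0 //.
by rewrite ler_sqrt ?mulr_ge0 ?ler0n //; rewrite -!natrM ler_nat; lia.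
Qed.

Lemma mixed_power_bound (x y h L B : R) : 1 <= x -> 1 <= y -> 0 < h <= 1 / 8 -> 1 <= L ->
  B <= y * (y `^ (1 / 2) * (L * y `^ h) + 2 * x `^ (1 / 2)) ->
  B <= x * (x `^ (1 / 2) * (L * x `^ h) + 2 * y `^ (1 / 2)) ->
  B <= 3 * L * (x `^ (3 / 4 + 2 * h) * y `^ (3 / 4 - h)).
Proof.
move=> x1 y1 /andP[h0 h1] L1 B1 B2.
have x0 : 0 < x by lra. have y0 : 0 < y by lra.
have pD := @powRDp R.
have p1 (t : R) : 0 < t -> t `^ 1 = t by move=> t0; rewrite powRr1 // ltW.
pose P := x `^ (3 / 4 + 2 * h) * y `^ (3 / 4 - h).
have P0 : 0 <= P by rewrite mulr_ge0 ?powR_ge0.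
have [yx|xy] := lerP y x.
  have a1 : y * (y `^ (1 / 2) * y `^ h) <= P.
    rewrite -{1}(p1 y) // !pD //.
    have -> : 1 + (1 / 2 + h) = (3 / 4 + 2 * h) + (3 / 4 - h) by field.
    rewrite -pD // /P ler_wpM2r ?powR_ge0 // pow_mono //; lra.
  have a2 : y * x `^ (1 / 2) <= P.
    have e : y = y `^ (1 / 4 + h) * y `^ (3 / 4 - h).
      by rewrite pD // -[LHS]p1 //; congr (_ `^ _); field.
    rewrite {1}e mulrAC /P ler_wpM2r ?powR_ge0 //.
    apply: (@le_trans _ _ (x `^ (1 / 4 + h) * x `^ (1 / 2))).
      by rewrite ler_wpM2r ?powR_ge0 // pow_mono //; lra.
    by rewrite pD // ler_powR //; lra.
  have : B <= L * (y * (y `^ (1 / 2) * y `^ h)) + 2 * (y * x `^ (1 / 2)).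
    by apply: (le_trans B1); rewrite le_eqVlt; apply/orP; left; apply/eqP; ring.
  have : L * (y * (y `^ (1 / 2) * y `^ h)) <= L * P by rewrite ler_wpM2l //; lra.
  have : P <= L * P by rewrite ler_peMl.
  rewrite -/P; lra.
have a1 : x * (x `^ (1 / 2) * x `^ h) <= P.
  rewrite -{1}(p1 x) // !pD //.
  have -> : 1 + (1 / 2 + h) = (3 / 4 + 2 * h) + (3 / 4 - h) by field.
  rewrite -pD // /P ler_wpM2l ?powR_ge0 // pow_mono //; lra.
have a2 : x * y `^ (1 / 2) <= P.
  have e : x = x `^ (3 / 4 + 2 * h) * x `^ (1 / 4 - 2 * h).
    by rewrite pD // -[LHS]p1 //; congr (_ `^ _); field.
  rewrite {1}e -mulrA /P ler_wpM2l ?powR_ge0 //.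
  apply: (@le_trans _ _ (y `^ (1 / 4 - 2 * h) * y `^ (1 / 2))).
    by rewrite ler_wpM2r ?powR_ge0 // pow_mono //; lra.
  by rewrite pD // ler_powR //; lra.
have : B <= L * (x * (x `^ (1 / 2) * x `^ h)) + 2 * (x * y `^ (1 / 2)).
  by apply: (le_trans B2); rewrite le_eqVlt; apply/orP; left; apply/eqP; ring.
have : L * (x * (x `^ (1 / 2) * x `^ h)) <= L * P by rewrite ler_wpM2l //; lra.
have : P <= L * P by rewrite ler_peMl.
rewrite -/P; lra.
Qed.

Lemma EE_bound (h : R) : 0 < h <= 1 / 8 -> exists2 L : R, 0 <= L & forall M N,
  `|EE M N| <= L * (M.+1%:R `^ (3 / 4 + 2 * h) * N.+1%:R `^ (3 / 4 - h)).
Proof.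
move=> hh; have /andP[h0 _] := hh; have [L L1 HL] := harm_pow h0.
exists (3 * L) => [|M N]; first lra.
have xx (n : nat) : 1 <= n.+1%:R :> R by rewrite ler1n.
have key (n m : nat) : n.+1%:R * (Num.sqrt n.+1%:R * (2 * harm R n.+1 + 5) + Num.sqrt m.+2%:R) <=
   n.+1%:R * (n.+1%:R `^ (1 / 2) * (L * n.+1%:R `^ h) + 2 * m.+1%:R `^ (1 / 2)).
  rewrite ler_wpM2l ?ler0n // lerD ?sqrt_succ_le // sqrt_pow ?ler0n // ler_wpM2l ?powR_ge0 //.
apply: mixed_power_bound => //.
  by apply: (le_trans (EE_bound1 M N)); exact: key.
by apply: (le_trans (EE_bound2 M N)); exact: key.
Qed.

End ErrorMatrix.

(** * Integrals over vertical lines and shifts of contours *)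

Section LineIntegrals.
Variable R : realType.
Local Notation C := R[i].
Local Notation mu := (@lebesgue_measure R).
Implicit Types (a b c D T t : R) (f g : C -> C) (z : C).

(** The universal majorant on vertical lines. Its integral [pi] and truncated integral [2 atan T]
    are explicit, which makes truncation errors explicit too. *)
Definition ck t : R := (1 + t ^+ 2)^-1.

Lemma ck_den_gt0 t : 0 < 1 + t ^+ 2.
Proof. by rewrite ltr_pwDl ?sqr_ge0. Qed.

Lemma ck_gt0 t : 0 < ck t.
Proof. by rewrite invr_gt0 ck_den_gt0. Qed.

Lemma continuous_ck : continuous ck.
Proof.
move=> t; apply: cvgV; first by rewrite gt_eqF // ck_den_gt0.
apply: cvgD; first exact: cvg_cst.
by apply: (@cvgM _ _ _ _ id id); exact: cvg_id.
Qed.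

Lemma integral_ckT : (\int[mu]_t (ck t)%:E)%E = (pi%:E)%E.
Proof.
rewrite ge0_symfun_integralT.
- have -> : [set x : R | 0 <= x] = `[0, +oo[%classic.
    by apply/seteqP; split => x /=; rewrite in_itv /= andbT.
  have := @integral0y_oneDsqr R; rewrite /oneDsqr /ck => ->.
  by rewrite -EFinM; congr (_%:E); field.
- by move=> x; rewrite ltW ?ck_gt0.
- exact: continuous_ck.
- by move=> x; rewrite /ck /= sqrrN.
Qed.

Lemma integrable_ck : mu.-integrable setT (EFin \o ck).
Proof.
apply/integrableP; split.
  by apply/measurable_EFinP; apply: continuous_measurable_fun; exact: continuous_ck.
have -> : (\int[mu]_x `|(EFin \o ck) x|)%E = (\int[mu]_t (ck t)%:E)%E.
  by apply: eq_integral => t _ /=; rewrite ger0_norm // ltW ?ck_gt0.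
by rewrite integral_ckT ltry.
Qed.

Lemma Rintegral_ckT : \int[mu]_t ck t = pi.
Proof. by rewrite /Rintegral integral_ckT. Qed.

Lemma Rintegral_ck T : 0 <= T -> \int[mu]_(t in `[- T, T]) ck t = 2 * atan T.
Proof.
move=> T0; have : cint (- T) T (fun t => (ck t)%:C) = (atan T)%:C - (atan (- T))%:C.
  apply: (@cint_FTC _ _ _ (fun t => (atan t)%:C)); first lra.
    by move=> t _; split => /=; [exact: is_derive1_atan|exact: is_derive_cst].
  by move=> t _; apply: rccont_real; exact: continuous_ck.
move/(congr1 (fun z => RE z)); rewrite Re_cintegral /= => ->.
by rewrite atanN opprK mulr2n mulrDl mul1r.
Qed.

Lemma atan_tail (e : R) : 0 < e -> exists T0 : R, forall T, T0 <= T -> pi - 2 * atan T <= e.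
Proof.
move=> e0; have p0 := pi_gt0 R; pose y := pi / 2 - Num.min e pi / 2.
have m0 : 0 < Num.min e pi by rewrite lt_min e0.
have m1 : Num.min e pi <= e by rewrite ge_min lexx.
have m2 : Num.min e pi <= pi by rewrite ge_min lexx orbT.
(* The minimum with [pi] keeps [y] in the half-open interval from 0 to [pi / 2], where [atan]
   inverts [tan]. *)
exists (tan y) => T yT.
have : atan (tan y) <= atan T by exact: le_atan.
rewrite tanK ?in_itv /= /y; first lra.
by apply/andP; split; lra.
Qed.

Lemma ccont_ext f g z : (forall w, f w = g w) -> ccont f z -> ccont g z.
Proof. by move=> E; have -> : g = f by apply/funext. Qed.

Section OneLine.
Variables (h : R -> C) (D : R).
Hypothesis hc : forall t, rccont h t.
Hypothesis hD : forall t, cabs (h t) <= D * ck t.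

Let mRe : measurable_fun setT (fun t => RE (h t)).
Proof. by apply: continuous_measurable_fun => t; have /rccontP[] := hc t. Qed.

Let mIm : measurable_fun setT (fun t => IM (h t)).
Proof. by apply: continuous_measurable_fun => t; have /rccontP[] := hc t. Qed.

Lemma integrable_Dck A : measurable A -> mu.-integrable A (EFin \o (fun t => D * ck t)).
Proof.
move=> mA; have := integrableS measurableT mA (@subsetT _ A) integrable_ck.
move=> /(integrableZl mA) => /(_ D); apply: eq_integrable => // t _ /=.
Qed.

Lemma line_integrable A : measurable A -> cintegrable A h.
Proof.
move=> mA; apply: (@measurable_cintegrable R A h (fun t => D * ck t)) => //.
- by apply: measurable_funS mRe.
- by apply: measurable_funS mIm.
- exact: integrable_Dck.
Qed.

Lemma line_bound : cabs (cintegral setT h) <= D * pi.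
Proof.
apply: (le_trans (cabs_cintegral_le measurableT (line_integrable measurableT)
  (integrable_Dck measurableT) (fun t _ => hD t))).
by rewrite RintegralZl //; [rewrite Rintegral_ckT|exact: integrable_ck].
Qed.

Lemma line_trunc T : 0 <= T -> cabs (cintegral setT h - cint (- T) T h) <= D * (pi - 2 * atan T).
Proof.
move=> T0; pose A := `[- T, T]%classic : set R; pose B := ~` A.
have mA : measurable A by exact: measurable_itv.
have mB : measurable B by exact: measurableC.
have AB : A `|` B = setT by rewrite setUv.
have dAB : [disjoint A & B] by apply/disj_setPS; rewrite setICr.
have sp : cintegral setT h = cintegral A h + cintegral B h.
  have [i1 i2] := line_integrable measurableT.
  apply: complex_ext; rewrite ?ReD ?ImD ?Re_cintegral ?Im_cintegral -AB Rintegral_setU //; by rewrite AB.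
rewrite sp /cint addrAC subrr add0r.
apply: (le_trans (cabs_cintegral_le mB (line_integrable mB) (integrable_Dck mB) (fun t _ => hD t))).
rewrite RintegralZl //; last exact: integrableS integrable_ck.
suff -> : \int[mu]_(x in B) ck x = pi - 2 * atan T by [].
rewrite -(Rintegral_ck T0) -Rintegral_ckT -AB Rintegral_setU //; first by rewrite addrAC subrr add0r.
by rewrite AB; exact: integrable_ck.
Qed.

End OneLine.

(** Rectangles of growing height: the horizontal sides are [O(1 / T^2)] and the tails of the
    vertical lines are controlled by the arctangent. Inside the strip the bound is asked only for
    [T0 <= |Im z|], which leaves room for a pole. *)
Lemma strip_limit a b f D T0 (l : C) : a <= b -> 0 <= D ->
  (forall t, ccont f (a +i* t)) -> (forall t, ccont f (b +i* t)) ->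
  (forall t, cabs (f (a +i* t)) <= D * ck t) -> (forall t, cabs (f (b +i* t)) <= D * ck t) ->
  (forall z, a <= RE z <= b -> T0 <= `|IM z| -> ccont f z /\ cabs (f z) <= D * ck (IM z)) ->
  (forall T, T0 <= T -> rect f a b (- T) T = l) ->
  vline_integral b f - vline_integral a f = l.
Proof.
move=> ab D0 ca cb Da Db Hs HT; apply/eqP; rewrite -subr_eq0; apply/eqP.
apply: cabs_small => e e0; pose k := 4 * (D + 1).
have k0 : 0 < k by rewrite /k; lra.
have [T1 HT1] := atan_tail (divr_gt0 e0 k0).
(* [T0] passes the exceptional part of the strip, [T1] makes the two vertical tails small, and the
   last entry makes the horizontal sides small. *)
pose T := Num.max (Num.max T0 T1) (Num.max 1 (4 * (b - a) * (D + 1) / e)).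
have t0 : T0 <= T by rewrite /T !le_max lexx.
have t1 : T1 <= T by rewrite /T !le_max lexx !orbT.
have t2 : 1 <= T by rewrite /T !le_max lexx !orbT.
have t3 : 4 * (b - a) * (D + 1) / e <= T by rewrite /T !le_max lexx !orbT.
clearbody T; have T00 : 0 <= T by lra.
have rc c : (forall t, ccont f (c +i* t)) -> forall t, rccont (fun u => f (c +i* u)) t.
  by move=> H t; apply: ccont_v.
have ea := line_trunc (rc _ ca) Da T00; have eb := line_trunc (rc _ cb) Db T00.
have hb y : `|y| = T -> cabs (hint f a b y) <= e / 4.
  move=> yT; apply: (@le_trans _ _ (D * ck y * (b - a))).
    apply: cabs_cint_le => //.
      by move=> t tab; apply: ccont_h; apply: (Hs _ _ _).1; rewrite //= yT.
    by move=> t tab; apply: (Hs (t +i* y) _ _).2; rewrite //= yT.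
  have -> : ck y = (1 + T ^+ 2)^-1 by rewrite /ck -yT real_normK ?num_real.
  rewrite mulrAC ler_pdivrMr ?ck_den_gt0 //.
  move: t3; rewrite ler_pdivrMr // => t3.
  have : T * e <= e * (1 + T ^+ 2) by rewrite mulrC ler_wpM2l ?ltW //; nra.
  lra.
have := HT T t0; rewrite /rect /vint => <-.
rewrite /vline_integral; move: ea eb.
move: (cintegral setT _) => Ia; move: (cintegral setT _) => Ib.
move: (cint _ _ _) => Ja; move: (cint _ _ _) => Jb ea eb.
have h1 := hb (- T); have h2 := hb T; rewrite normrN ger0_norm // in h1 h2.
have {}h1 := h1 erefl; have {}h2 := h2 erefl.
have -> : 'i * Ib - 'i * Ia - (hint f a b (- T) + 'i * Jb - hint f a b T - 'i * Ja) =
  'i * (Ib - Jb) - 'i * (Ia - Ja) - (hint f a b (- T) - hint f a b T) by ring.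
have at1 : D * (pi - 2 * atan T) <= e / 4.
  have := HT1 T t1; rewrite ler_pdivlMr // => q.
  have q0 : 0 <= pi - 2 * atan T by have := @atan_ltpi2 R T; lra.
  by move: q q0; move: (pi - 2 * atan T) => q; rewrite /k; nra.
apply: (le_trans (cabsB _ _)).
have e1 := cabsB ('i * (Ib - Jb)) ('i * (Ia - Ja)).
have e2 := cabsB (hint f a b (- T)) (hint f a b T).
move: e1; rewrite (cabsM 'i (Ib - Jb)) (cabsM 'i (Ia - Ja)) cabs_i !mul1r; lra.
Qed.

Lemma hol_strip_rect a b c d f : a <= b -> c <= d ->
  (forall z, a <= RE z <= b -> hol f z) -> rect f a b c d = 0.
Proof. by move=> ab cd H; apply: goursat => // z /andP[h _]; exact: H. Qed.

Lemma contour_shift a b f D : a <= b -> 0 <= D -> (forall z, a <= RE z <= b -> hol f z) ->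
  (forall z, a <= RE z <= b -> cabs (f z) <= D * ck (IM z)) ->
  vline_integral b f = vline_integral a f.
Proof.
move=> ab D0 H B; apply/eqP; rewrite -subr_eq0; apply/eqP.
apply: (@strip_limit a b f D 0 0) => //.
- by move=> t; apply/hol_ccont/H; rewrite /= lexx ab.
- by move=> t; apply/hol_ccont/H; rewrite /= lexx ab.
- by move=> t; apply: (B (a +i* t)); rewrite /= lexx ab.
- by move=> t; apply: (B (b +i* t)); rewrite /= lexx ab.
- by move=> z zab _; split; [exact/hol_ccont/H|exact: B].
- by move=> T T0; apply: hol_strip_rect => //; lra.
Qed.

(** The residue theorem for one simple pole: every sufficiently tall rectangle contains [z0], and
    Cauchy's formula gives the same value for all of them. *)
Lemma contour_shift_pole a b g z0 D : a < RE z0 < b -> 0 <= D ->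
  (forall z, a <= RE z <= b -> hol g z) ->
  (forall z, a <= RE z <= b -> cabs (g z) <= D * ck (IM z)) ->
  vline_integral b (fun z => g z / (z - z0)) - vline_integral a (fun z => g z / (z - z0))
    = tpi R * g z0.
Proof.
move=> /andP[az zb] D0 H B.
pose m := Num.min 1 (Num.min (RE z0 - a) (b - RE z0)).
have m0 : 0 < m by rewrite /m !lt_min ltr01 /=; apply/andP; split; lra.
have m1 : m <= 1 by rewrite /m ge_min lexx.
have m2 : m <= RE z0 - a by rewrite /m !ge_min lexx orbT.
have m3 : m <= b - RE z0 by rewrite /m !ge_min lexx !orbT.
clearbody m.
have ab : a <= b by lra.
have dz z : m <= cabs (z - z0) -> a <= RE z <= b ->
    ccont (fun z => g z / (z - z0)) z /\ cabs (g z / (z - z0)) <= D / m * ck (IM z).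
  move=> mz zab; have zn : z - z0 != 0 by rewrite -cabs_gt0; lra.
  split.
    apply: hol_ccont; apply: holM; first exact: H.
    by apply: holV => //; apply: holB; [exact: hol_id|exact: hol_cst].
  rewrite cabsM cabsV mulrAC; apply: ler_pM; rewrite ?cabs_ge0 ?invr_ge0 ?cabs_ge0 //.
    exact: B.
  by rewrite lef_pV2 ?posrE //; lra.
have da t : m <= cabs ((a +i* t) - z0).
  by apply: (le_trans m2); apply: le_trans (abs_Re_le _); rewrite ReB /= distrC; exact: ler_norm.
have db t : m <= cabs ((b +i* t) - z0).
  by apply: (le_trans m3); apply: le_trans (abs_Re_le _); rewrite ReB /=; exact: ler_norm.
have ra t : a <= RE (a +i* t) <= b by rewrite /= lexx ab.
have rb t : a <= RE (b +i* t) <= b by rewrite /= lexx ab.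
apply: (@strip_limit a b _ (D / m) (1 + `|IM z0|)) => //.
- by rewrite divr_ge0 // ltW.
- by move=> t; exact: (dz _ (da t) (ra t)).1.
- by move=> t; exact: (dz _ (db t) (rb t)).1.
- by move=> t; exact: (dz _ (da t) (ra t)).2.
- by move=> t; exact: (dz _ (db t) (rb t)).2.
- move=> z zab zT; apply: dz => //; apply: (le_trans m1); apply: le_trans (abs_Im_le _).
  by rewrite ImB; have := lerB_dist (IM z) (IM z0); lra.
- move=> T T1; have : - T < IM z0 < T.
    have := ler_norm (IM z0); have := ler_norm (- IM z0); rewrite normrN => ? ?.
    by apply/andP; split; lra.
  move=> zT; rewrite cauchy_formula ?az //.
  by move=> w /andP[h _]; exact: H.
Qed.

(** Continuity and a majorant [ck] on one line: stable under finite sums and scalars, and sufficient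
    for integrability, so it is the only side condition of the calculus of line integrals. *)
Definition vdec c f := (forall t, ccont f (c +i* t)) /\
  exists D, forall t, cabs (f (c +i* t)) <= D * ck t.

Lemma vdec_rccont c f : vdec c f -> forall t, rccont (fun u => f (c +i* u)) t.
Proof. by move=> [cf _] t; apply: ccont_v. Qed.

Lemma vdec_integrable c f : vdec c f -> vline_integrable c f.
Proof. by move=> vf; have [_ [D HD]] := vf; exact: (line_integrable (vdec_rccont vf) HD measurableT). Qed.

Lemma vline_bound c f D : vdec c f -> (forall t, cabs (f (c +i* t)) <= D * ck t) ->
  cabs (vline_integral c f) <= D * pi.
Proof.
move=> vf HD; rewrite /vline_integral cabsM cabs_i mul1r.
exact: (line_bound (vdec_rccont vf) HD).
Qed.

Lemma vdecD c f g : vdec c f -> vdec c g -> vdec c (fun w => f w + g w).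
Proof.
move=> [cf [D HD]] [cg [D' HD']]; split.
  move=> t; have := ccontB (cf t) (ccontB (@hol_ccont _ _ (c +i* t) (hol_cst 0 _)) (cg t)).
  by apply: ccont_ext => w; rewrite sub0r opprK.
exists (D + D') => t; rewrite mulrDl; apply: (le_trans (cabsD _ _)); exact: lerD.
Qed.

Lemma vdecZ c k f : vdec c f -> vdec c (fun w => k * f w).
Proof.
move=> [cf [D HD]]; split.
  by move=> t; apply: ccontM => //; exact/hol_ccont/hol_cst.
by exists (cabs k * D) => t; rewrite cabsM -mulrA ler_wpM2l ?cabs_ge0.
Qed.

Lemma vline_integralD c f g : vdec c f -> vdec c g ->
  vline_integral c (fun w => f w + g w) = vline_integral c f + vline_integral c g.
Proof.
move=> /vdec_integrable F /vdec_integrable G.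
by rewrite /vline_integral cintegralD // mulrDr.
Qed.

Lemma vline_integralZ c k f : vdec c f ->
  vline_integral c (fun w => k * f w) = k * vline_integral c f.
Proof. by move=> /vdec_integrable F; rewrite /vline_integral cintegralZ // mulrCA. Qed.

Lemma eq_vline_integral c f g : (forall t, f (c +i* t) = g (c +i* t)) ->
  vline_integral c f = vline_integral c g.
Proof. by move=> E; rewrite /vline_integral; congr (_ * _); apply: eq_cintegral. Qed.

Lemma vdec_ext c f g : (forall w, f w = g w) -> vdec c f -> vdec c g.
Proof. by move=> E; have -> : g = f by apply/funext. Qed.

Lemma vdec0 c : vdec c (fun=> 0).
Proof.
split; first by move=> t; exact/hol_ccont/hol_cst.
by exists 0 => t; rewrite cabs0 mul0r.
Qed.

Lemma vline_integral0 c : vline_integral c (fun=> 0 : C) = 0.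
Proof.
transitivity (0 * vline_integral c (fun=> 0 : C)); last by rewrite mul0r.
by rewrite -(vline_integralZ 0 (vdec0 c)); apply: eq_vline_integral => t; rewrite mul0r.
Qed.

Lemma vdec_sum c n (F : nat -> C -> C) : (forall i, vdec c (F i)) ->
  vdec c (fun w => \sum_(0 <= i < n) F i w).
Proof.
move=> H; elim: n => [|n ih].
  by apply: vdec_ext (vdec0 c) => w; rewrite big_geq.
by apply: vdec_ext (vdecD ih (H n)) => w; rewrite big_nat_recr.
Qed.

Lemma vline_integral_sum c n (F : nat -> C -> C) : (forall i, vdec c (F i)) ->
  vline_integral c (fun w => \sum_(0 <= i < n) F i w) = \sum_(0 <= i < n) vline_integral c (F i).
Proof.
move=> H; elim: n => [|n ih].
  rewrite [RHS]big_geq //; transitivity (vline_integral c (fun=> 0 : C)); last exact: vline_integral0.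
  by apply: eq_vline_integral => t; rewrite big_geq.
rewrite big_nat_recr //= -ih -vline_integralD //; last exact: vdec_sum.
by apply: eq_vline_integral => t; rewrite big_nat_recr.
Qed.

(** Replaces dominated convergence: approximation that is uniform relative to [ck] lets series and
    Riemann sums be integrated termwise. *)
Lemma vline_approx c f l : vdec c f ->
  (forall e : R, 0 < e -> exists g, [/\ vdec c g,
     forall t, cabs (f (c +i* t) - g (c +i* t)) <= e * ck t &
     cabs (vline_integral c g - l) <= e]) -> vline_integral c f = l.
Proof.
move=> vf H; apply/eqP; rewrite -subr_eq0; apply/eqP; apply: cabs_small => e e0.
have p0 := pi_gt0 R; have k0 : 0 < 1 + pi :> R by lra.
have [g [vg h1 h2]] := H _ (divr_gt0 e0 k0).
have vN := vdecZ (-1) vg.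
have E : vline_integral c f - vline_integral c g = vline_integral c (fun w => f w + -1 * g w).
  by rewrite vline_integralD // vline_integralZ // mulN1r.
have h3 := vline_bound (D := e / (1 + pi)) (vdecD vf vN).
have {}h3 := h3 ltac:(by move=> t /=; rewrite mulN1r; exact: h1).
rewrite -E in h3.
have := cabs_triangle (vline_integral c f) l (vline_integral c g).
suff : e / (1 + pi) * pi + e / (1 + pi) = e by lra.
move: (pi : R) p0 k0 => P P0 k0; field; lra.
Qed.

End LineIntegrals.

(** * Dirichlet series summed by parts *)

Section DifferenceSeries.
Variable R : realType.
Local Notation C := R[i].
Implicit Types (c : nat -> C) (s z : C) (K a b S : R).

Definition npow s (n : nat) : C := cpow n.+1%:R (- s).
Definition dl s n : C := npow s n - npow s n.+1.

Lemma cabs_npow s n : cabs (npow s n) = n.+1%:R `^ (- RE s).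
Proof. by rewrite cabs_cpow ?ltr0n // ReN. Qed.

Lemma npow0 s : npow s 0 = 1.
Proof. by rewrite /npow cpow1l. Qed.

Lemma hol_npow n z : hol (npow^~ n) z.
Proof. by apply: (@hol_comp R (fun s => - s) (cpow n.+1%:R)); [apply: holN; exact: hol_id|exact: hol_cpow]. Qed.

Lemma hol_dl n z : hol (dl^~ n) z.
Proof. by apply: holB; exact: hol_npow. Qed.

(** The mean value inequality: a difference gains a full power of [n] at the price of the factor
    [cabs s]. *)
Lemma dl_bound s n : -1 <= RE s -> cabs (dl s n) <= cabs s * n.+1%:R `^ (- (RE s + 1)).
Proof.
move=> s0; rewrite /dl cabsBC.
have := @mean_value_cabs R (fun x => cpow x (- s)) (fun x => - s * cpow x (- s - 1)) n.+1%:R n.+2%:R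
  (cabs s * n.+1%:R `^ (- (RE s + 1))).
have -> : n.+2%:R - n.+1%:R = 1 :> R by rewrite -(natr1 n.+1) addrAC subrr add0r.
rewrite mulr1; apply.
- by rewrite ler_nat.
- by move=> t /andP[t1 _]; apply: rcderiv_cpow; apply: lt_le_trans t1; rewrite ltr0n.
- move=> t /andP[t1 _]; have t0 : 0 < t by apply: lt_le_trans t1; rewrite ltr0n.
  rewrite cabsM cabsN cabs_cpow // ler_wpM2l ?cabs_ge0 // ReB ReN -opprD.
  by rewrite powR_nonpos_le ?ltr0n //=; lra.
Qed.

Definition pbound c K a := forall n, cabs (c n) <= K * n.+1%:R `^ a.

Lemma pbound_ge0 c K a : pbound c K a -> 0 <= K.
Proof. by move=> /(_ 0%N); rewrite powR1 mulr1; apply: le_trans; exact: cabs_ge0. Qed.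

(** If [c] are the partial sums of the coefficients, this is the Dirichlet series after Abel
    summation. It converges absolutely to the right of the growth exponent of [c] and so continues
    the original series. *)
Definition dsum c s : C := csum (fun n => c n * dl s n).

Lemma pow_term (x u v w : R) : 1 <= x -> u + v <= w -> x `^ u * x `^ v <= x `^ w.
Proof.
by move=> x1 uvw; rewrite powRDp ?ler_powR // (lt_le_trans ltr01).
Qed.

Lemma dsum_tails c K a b s S : pbound c K a -> 0 < b -> a + b <= RE s -> -1 <= RE s ->
  cabs s <= S ->
  tails (fun n => c n * dl s n) (fun N => K * S * Kp b * N.+1%:R `^ (- b)).
Proof.
move=> hc b0 abs s0 sS; have K0 := pbound_ge0 hc.
have S0 : 0 <= S := le_trans (cabs_ge0 _) sS.
have k0 := ltW (Kp_gt0 b0).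
have k1 : 0 <= K * S * Kp b by rewrite mulr_ge0 // mulr_ge0.
split; first exact: (rnullZ k1 (rnull_pow b0)).
move=> N M NM; apply: (@le_trans _ _ (K * S * \sum_(N <= n < M) n.+1%:R `^ (- (1 + b)))).
  rewrite mulr_sumr; apply: ler_sum => n _; rewrite cabsM.
  apply: (le_trans (ler_pM (cabs_ge0 _) (cabs_ge0 _) (hc n) (dl_bound n s0))).
  rewrite mulrACA; apply: ler_pM; rewrite ?mulr_ge0 ?cabs_ge0 ?powR_ge0 //.
    by rewrite ler_wpM2l.
  by apply: pow_term; [rewrite ler1n|lra].
by rewrite -[leRHS]mulrA ler_wpM2l ?mulr_ge0 // pow_tail.
Qed.

Lemma dsum_bound c K a b s : pbound c K a -> 0 < b -> a + b <= RE s -> -1 <= RE s ->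
  cabs (dsum c s) <= K * cabs s * Kp b.
Proof.
move=> hc b0 h1 h2; have := csum_bound (dsum_tails hc b0 h1 h2 (lexx _)).
by rewrite powR1 mulr1.
Qed.

Lemma dsum_hol c K a z : pbound c K a -> 0 <= a -> a < RE z -> hol (dsum c) z.
Proof.
move=> hc a0 az; pose r := (RE z - a) / 2; have r0 : 0 < r by rewrite /r; lra.
apply: (@series_hol R (fun n s => c n * dl s n)
   (fun N => K * (cabs z + r) * Kp r * N.+1%:R `^ (- r)) z r r0).
  by move=> n w _; apply: holM; [exact: hol_cst|exact: hol_dl].
move=> w wz; have h : a + r <= RE w.
  have := le_lt_trans (abs_Re_le _) wz; rewrite ReB ltr_norml /r; lra.
apply: (dsum_tails hc) => //; first lra.
have -> : w = z + (w - z) by ring.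
by apply: (le_trans (cabsD _ _)); rewrite lerD2l ltW.
Qed.

Lemma summation_by_parts (bb f : nat -> C) N :
  \sum_(0 <= j < N) bb j * f j =
  \sum_(0 <= n < N) (\sum_(0 <= j < n.+1) bb j) * (f n - f n.+1) + (\sum_(0 <= j < N) bb j) * f N.
Proof.
elim: N => [|N ih]; first by rewrite !big_geq // mul0r addr0.
rewrite big_nat_recr //= ih (big_nat_recr N) //= [X in _ = _ + X * _](big_nat_recr N) //=.
rewrite [X in _ = _ + X * (_ - _) + _](big_nat_recr N) //=; ring.
Qed.

Lemma dsum_dirichlet (bb : nat -> C) K a s :
  pbound (fun n => \sum_(0 <= j < n.+1) bb j) K a -> 0 <= a -> a < RE s ->
  clim (fun N => \sum_(0 <= j < N) bb j * npow s j) (dsum (fun n => \sum_(0 <= j < n.+1) bb j) s).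
Proof.
move=> hc a0 as'; have K0 := pbound_ge0 hc.
have b0 : 0 < RE s - a by lra.
have h1 : a + (RE s - a) <= RE s by lra.
have h2 : -1 <= RE s by lra.
have T := dsum_tails hc b0 h1 h2 (lexx (cabs s)).
rewrite -[dsum _ _]addr0.
apply: (@clim_ext _ (fun N => \sum_(0 <= n < N) (\sum_(0 <= j < n.+1) bb j) * dl s n +
   (\sum_(0 <= j < N) bb j) * npow s N)).
  by move=> N; rewrite -summation_by_parts.
apply: climD; first exact: csum_lim T.
apply: (@clim_squeeze _ _ _ (fun N => K * N.+1%:R `^ (- (RE s - a)))); last first.
  by apply: rnullZ => //; exact: rnull_pow.
move=> N; rewrite subr0 cabsM cabs_npow.
have h : cabs (\sum_(0 <= j < N) bb j) <= K * N.+1%:R `^ a.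
  case: N => [|N]; first by rewrite big_geq // cabs0 mulr_ge0 ?powR_ge0.
  apply: (le_trans (hc N)); rewrite ler_wpM2l // ge0_ler_powR ?nnegrE ?ler0n //.
  by rewrite ler_nat.
apply: (le_trans (ler_wpM2r (powR_ge0 _ _) h)); rewrite -mulrA ler_wpM2l //.
by apply: pow_term; [rewrite ler1n|lra].
Qed.

End DifferenceSeries.

(** * The Mellin transform of a smooth function supported in the unit interval *)

Section MellinTransform.
Variable R : realType.
Local Notation C := R[i].
Local Notation mu := (@lebesgue_measure R).
Implicit Types (phi : R -> R) (s w z : C) (b c x y t : R).

Definition good phi := smooth phi /\ supported_in01 phi.

Lemma good_out phi x : good phi -> ~~ (0 < x < 1) -> phi x = 0.
Proof. by move=> [_ h]; case: (eqVneq (phi x) 0) => // /h ->. Qed.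

Lemma good_is_derive phi x : good phi -> is_derive x 1 phi (derive1 phi x).
Proof. by move=> [h _]; rewrite derive1E; apply: derivableP; exact: (h 0%N x). Qed.

Lemma good_derive phi : good phi -> good (derive1 phi).
Proof.
move=> g; split; first by move=> k x; rewrite -derive1Sn; exact: g.1.
move=> x; apply: contraNT => xo.
have /is_derive_epsP H := good_is_derive x g.
rewrite -normr_eq0; apply/eqP/le_anti; rewrite normr_ge0 andbT; apply/ler_addgt0Pl => e e0; rewrite addr0.
have [d [d0 Hd]] := H e e0.
(* The direction pointing away from the unit interval, in which the function stays 0. *)
pose sg : R := if x <= 0 then -1 else 1.
have sg1 : `|sg| = 1 by rewrite /sg; case: ifP; rewrite ?normrN normr1.
have hd : `|sg * (d / 2)| = d / 2 by rewrite normrM sg1 mul1r ger0_norm //; lra.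
have := Hd (sg * (d / 2)); rewrite hd => /(_ ltac:(lra)).
have xo' : ~~ (0 < x + sg * (d / 2) < 1).
  by move: xo; rewrite /sg !negb_and -!leNgt; case: ifP => [x0 _|/negbT]; rewrite -?ltNge => *;
    apply/orP; [left|right]; lra.
rewrite (good_out g xo) (good_out g xo') subrr sub0r normrN normrM hd ler_pM2r //; lra.
Qed.

Lemma good_rccont phi t : good phi -> rccont (fun x => (phi x)%:C) t.
Proof.
move=> g; have D := good_is_derive t g; apply: rccont_real.
by apply: differentiable_continuous; apply/derivable1_diffP; exact: (g.1 0%N t).
Qed.

Lemma good_rcderiv phi t : good phi -> rcderiv (fun x => (phi x)%:C) t (derive1 phi t)%:C.
Proof. by move=> g; split => /=; [exact: good_is_derive|exact: is_derive_cst]. Qed.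

(** Every derivative is again supported in the unit interval, so [phi] is flat at 0. Hence its
    Mellin transform converges for every [s]. *)
Lemma good_bound phi j : good phi -> exists2 K : R, 0 <= K & forall x, 0 <= x -> `|phi x| <= K * x ^+ j.
Proof.
elim: j phi => [|j ih] phi g.
  have [K HK] := cont_on_bounded (@ler01 R) (fun t _ => good_rccont t g).
  have K0 : 0 <= K := le_trans (cabs_ge0 _) (HK 0 ltac:(by rewrite lexx ler01)).
  exists K => // x x0; rewrite expr0 mulr1.
  have [x1|x1] := lerP x 1; first by have := HK x; rewrite x0 x1 cabs_real => /(_ isT).
  by rewrite (good_out g) ?normr0 // negb_and -!leNgt (ltW x1) orbT.
have [K K0 HK] := ih _ (good_derive g); exists K => // x x0.
have := @mean_value_cabs R _ _ 0 x (K * x ^+ j) x0 (fun t _ => good_rcderiv t g).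
rewrite (good_out g (x := 0)) ?ltxx // subr0 cabs_real subr0 exprSr mulrA; apply.
move=> t /andP[t0 tx]; rewrite cabs_real; apply: (le_trans (HK t t0)).
by rewrite ler_wpM2l // lerXn2r ?nnegrE //; lra.
Qed.

Definition mint phi s : R -> C := fun x => (phi x)%:C * cpow x (s - 1).

Lemma powR_le1_anti (x u v : R) : 0 < x <= 1 -> u <= v -> x `^ v <= x `^ u.
Proof.
move=> /andP[x0 x1] uv; rewrite !powRE // ler_expR ler_wnM2r //; exact: ln_le0.
Qed.

Lemma mint_small phi (b : R) j : good phi -> exists2 K : R, 0 <= K & forall s, b <= RE s ->
  forall x, cabs (mint phi s x) <= K * `|x| ^+ j.
Proof.
(* An order of flatness [k] for which [x^k x^(Re s - 1) <= x^j] whenever [b <= Re s] and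
   [0 < x < 1]. *)
move=> g; pose k := Num.Def.archi_bound (`|j%:R + 1 - b|).
have kb : j%:R + 1 - b <= k%:R.
  by apply: (le_trans (ler_norm _)); apply: ltW; exact: archi_boundP.
have [K K0 HK] := good_bound k g; exists K => // s bs x.
have [x01|xo] := boolP (0 < x < 1); last first.
  by rewrite /mint (good_out g xo) mul0r cabs0 mulr_ge0 ?exprn_ge0.
have /andP[x0 x1] := x01.
rewrite /mint cabsM cabs_real (cabs_cpow _ x0) (ger0_norm (ltW x0)).
apply: (le_trans (ler_wpM2r (powR_ge0 _ _) (HK x (ltW x0)))).
rewrite -mulrA ler_wpM2l // -!(powR_mulrn _ (ltW x0)) powRDp //.
by apply: powR_le1_anti; [rewrite x0 (ltW x1)|rewrite ReB /=; lra].
Qed.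

Lemma rcderiv_quadratic (f : R -> C) (K : R) : (forall x, cabs (f x) <= K * `|x| ^+ 2) -> rcderiv f 0 0.
Proof.
move=> H; have f0 : f 0 = 0.
  apply/eqP; rewrite -cabs_eq0 eq_le cabs_ge0 andbT.
  by have := H 0; rewrite normr0 expr0n mulr0.
have K0 : 0 <= K by have := le_trans (cabs_ge0 _) (H 1); rewrite normr1 expr1n mulr1.
have aux (p : C -> R) : (forall z, `|p z| <= cabs z) -> is_derive (0 : R) 1 (fun x => p (f x)) 0.
  move=> Hp; apply/is_derive_epsP => e e0; exists (e / (K + 1)); split; first by rewrite divr_gt0 //; lra.
  move=> h hd; rewrite add0r mul0r subr0 f0.
  have -> : p 0 = 0 by apply/eqP; rewrite -normr_le0; have := Hp 0; rewrite cabs0.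
  rewrite subr0; apply: (le_trans (Hp _)); apply: (le_trans (H h)).
  rewrite expr2 mulrA ler_wpM2r //; move: hd; rewrite ltr_pdivlMr; last lra.
  by have := normr_ge0 h; nra.
by split => /=; apply: aux; [exact: abs_Re_le|exact: abs_Im_le].
Qed.

(** At [t = 0] the value of [cpow] is a default, but [phi] and its derivative vanish there, and
    flatness gives derivative 0; so the whole closed interval can be used. *)
Lemma mint_rcderiv phi s t : good phi -> 0 <= t ->
  rcderiv (mint phi s) t (mint (derive1 phi) s t + (s - 1) * mint phi (s - 1) t).
Proof.
move=> g; rewrite le_eqVlt => /orP[/eqP <-|t0].
  have z0 f : good f -> f 0 = 0 by move=> gf; rewrite (good_out gf) ?ltxx.
  rewrite /mint (z0 _ g) (z0 _ (good_derive g)) !mul0r mulr0 addr0.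
  have [K _ HK] := mint_small (RE s) 2 g.
  by apply: rcderiv_quadratic => x; exact: HK.
have -> : (s - 1) * mint phi (s - 1) t = (phi t)%:C * ((s - 1) * cpow t (s - 1 - 1)).
  by rewrite /mint mulrCA.
exact: rcderivM (good_rcderiv t g) (rcderiv_cpow (s - 1) t0).
Qed.

Lemma mint_cont phi s : good phi -> cont_on 0 1 (mint phi s).
Proof. by move=> g t /andP[t0 _]; exact: rcderiv_cont (mint_rcderiv s g t0). Qed.

Lemma mellinE phi s : good phi -> mellin phi s = cint 0 1 (mint phi s).
Proof.
move=> g; have E (p : C -> R) : p 0 = 0 ->
  \int[mu]_(x in `]0, +oo[) p (mint phi s x) = \int[mu]_(x in `[0, 1]) p (mint phi s x).
  move=> p0; rewrite Rintegral_mkcond [RHS]Rintegral_mkcond; congr Rintegral.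
  apply/funext => x; rewrite /patch; have [/andP[x0 x1]|xo] := boolP (0 < x < 1).
    by rewrite !mem_setE !in_itv /= x0 (ltW x0) (ltW x1).
  by rewrite /mint (good_out g xo) mul0r p0; case: ifP; case: ifP.
by rewrite /mellin /cint /cintegral; congr (_ +i* _); [apply: (E (fun z => RE z))|apply: (E (fun z => IM z))].
Qed.

Lemma mellin_bounded phi b : good phi -> exists2 K : R, 0 <= K & forall s, b <= RE s -> cabs (mellin phi s) <= K.
Proof.
move=> g; have [K K0 HK] := mint_small b 0 g; exists K => // s bs; rewrite mellinE //.
have := @cabs_cint_le R 0 1 (mint phi s) K ler01 (mint_cont s g).
rewrite subr0 mulr1; apply => t _; by have := HK s bs t; rewrite expr0 mulr1.
Qed.

Lemma mellin_parts phi s : good phi -> mellin (derive1 phi) (s + 1) = - s * mellin phi s.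
Proof.
move=> g; have g' := good_derive g.
have h : cint 0 1 (fun t => mint (derive1 phi) (s + 1) t + s * mint phi s t) = 0.
  have E : forall t, mint (derive1 phi) (s + 1) t + s * mint phi s t =
     mint (derive1 phi) (s + 1) t + (s + 1 - 1) * mint phi (s + 1 - 1) t.
    by move=> t; rewrite (addrK 1 s).
  rewrite (@cint_FTC R 0 1 (mint phi (s + 1))) ?ler01 //.
  - rewrite /mint (good_out g (x := 1)) ?ltxx ?andbF // (good_out g (x := 0)) ?ltxx //.
    by rewrite !mul0r subr0.
  - by move=> t /andP[t0 _]; rewrite E; exact: mint_rcderiv.
  - by apply: cont_onD; [exact: mint_cont|apply: cont_onZ; exact: mint_cont].
move: h; rewrite cintD ?cintZ; [|exact: mint_cont|exact: mint_cont|apply: cont_onZ; exact: mint_cont].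
by rewrite -!mellinE // mulNr => /eqP; rewrite addr_eq0 => /eqP.
Qed.

(** Each integration by parts passes to a derivative of [phi] and gains one factor [s]. *)
Lemma mellin_decay_pow phi k b : good phi -> exists2 K : R, 0 <= K & forall s, b <= RE s ->
  cabs (mellin phi s) * `|IM s| ^+ k <= K.
Proof.
elim: k phi b => [|k ih] phi b g.
  have [K K0 HK] := mellin_bounded b g; exists K => // s bs.
  by rewrite expr0 mulr1; exact: HK.
have [K K0 HK] := ih _ (b + 1) (good_derive g); exists K => // s bs.
have := HK (s + 1) ltac:(rewrite ReD /=; lra).
rewrite mellin_parts // cabsM cabsN ImD /= addr0; apply: le_trans.
rewrite exprS (mulrC (cabs s)) -mulrA ler_wpM2l ?cabs_ge0 // ler_wpM2r ?exprn_ge0 //.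
exact: abs_Im_le.
Qed.

Lemma mellin_decay phi k b : good phi -> exists2 K : R, 0 <= K & forall s, b <= RE s ->
  cabs (mellin phi s) * (1 + `|IM s|) ^+ k <= K.
Proof.
move=> g; have [K1 K10 H1] := mellin_decay_pow k b g; have [K0 K00 H0] := mellin_bounded b g.
exists (2 ^+ k * (K0 + K1)) => [|s bs]; first by rewrite mulr_ge0 ?exprn_ge0 ?addr_ge0.
have h1 := H1 s bs; have h0 := H0 s bs.
move: (cabs_ge0 (mellin phi s)) (normr_ge0 (IM s)) h1 h0.
move: (cabs _) `|IM s| => m t m0 t0 h1 h0.
have [t1|t1] := lerP t 1.
  apply: (@le_trans _ _ (m * 2 ^+ k)).
    by rewrite ler_wpM2l // lerXn2r ?nnegrE //; lra.
  by rewrite mulrC ler_wpM2l ?exprn_ge0 //; lra.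
apply: (@le_trans _ _ (m * (2 * t) ^+ k)).
  by rewrite ler_wpM2l // lerXn2r ?nnegrE //; lra.
by rewrite exprMn mulrCA ler_wpM2l ?exprn_ge0 //; lra.
Qed.

Lemma riemann_sum (f : R -> C) (L : R) n : cont_on 0 1 f ->
  (forall x y, 0 <= x <= 1 -> 0 <= y <= 1 -> cabs (f x - f y) <= L * `|x - y|) ->
  cabs (cint 0 1 f - \sum_(0 <= j < n.+1) n.+1%:R^-1 * f (j.+1%:R / n.+1%:R)) <= L / n.+1%:R.
Proof.
move=> cf Lf; pose N : R := n.+1%:R; have N0 : 0 < N by rewrite ltr0n.
have L0 : 0 <= L.
  have := Lf 1 0; rewrite !lexx ler01 subr0 normr1 mulr1 => /(_ isT isT).
  by apply: le_trans; exact: cabs_ge0.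
suff H k : (k <= n.+1)%N -> cabs (cint 0 (k%:R / N) f -
    \sum_(0 <= j < k) (N^-1)%:C * f (j.+1%:R / N)) <= k%:R * (L / N ^+ 2).
  have := H n.+1 (leqnn _); rewrite -/N divff ?gt_eqF //.
  have -> : N * (L / N ^+ 2) = L / N by field; rewrite gt_eqF.
  have -> : (N^-1)%:C = n.+1%:R^-1 :> C by rewrite rmorphV ?unitfE ?gt_eqF //= rmorph_nat.
  by [].
elim: k => [|k ih] kn.
  by rewrite mul0r cint_id big_geq // subrr cabs0 mul0r.
have k0 : 0 <= k%:R / N by rewrite divr_ge0 // ltW.
have kk : k%:R / N <= k.+1%:R / N by rewrite ler_pM2r ?invr_gt0 // ler_nat.
have k1 : k.+1%:R / N <= 1 by rewrite ler_pdivrMr // mul1r ler_nat.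
have dk : k.+1%:R / N - k%:R / N = N^-1 by rewrite -mulrBl -(natr1 k) addrAC subrr add0r mul1r.
have c1 : cont_on (k%:R / N) (k.+1%:R / N) f by apply: cont_on_sub cf.
rewrite (@cint_chasles R 0 (k%:R / N)) ?k0 ?kk //; last by apply: cont_on_sub cf.
rewrite big_nat_recr //=.
have {}ih := ih (ltnW kn).
have e : (N^-1)%:C * f (k.+1%:R / N) = cint (k%:R / N) (k.+1%:R / N) (fun=> f (k.+1%:R / N)).
  rewrite (@cint_FTC R _ _ (fun t => t%:C * f (k.+1%:R / N))) //.
  - by rewrite -mulrBl -rmorphB dk.
  - move=> t _; have := @rcderivM R (fun t => t%:C) (fun=> f (k.+1%:R / N)) t 1 0.
    rewrite mul1r mulr0 addr0; apply; last exact: rcderiv_cst.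
    by split => /=; [exact: is_derive_id|exact: is_derive_cst].
  - by move=> t _; exact: rcderiv_cont (rcderiv_cst _ _).
have h2 : cabs (cint (k%:R / N) (k.+1%:R / N) f - (N^-1)%:C * f (k.+1%:R / N)) <= L / N ^+ 2.
  have cc : cont_on (k%:R / N) (k.+1%:R / N) (fun=> f (k.+1%:R / N)).
    by move=> t _; exact: rcderiv_cont (rcderiv_cst _ _).
  rewrite e -cintB //.
  apply: (le_trans (@cabs_cint_le R _ _ _ (L / N) kk _ _)).
  - exact: cont_onB.
  - move=> t /andP[t1 t2]; apply: (le_trans (Lf _ _ _ _)); first by rewrite (le_trans k0 t1) (le_trans t2 k1).
      by rewrite (le_trans k0 kk) k1.
    rewrite ler_wpM2l // distrC ger0_norm ?subr_ge0 //.
    by apply: (@le_trans _ _ (k.+1%:R / N - k%:R / N)); [rewrite lerD2l lerN2|rewrite dk].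
  - by rewrite dk expr2 invfM mulrA.
have -> : cint 0 (k%:R / N) f + cint (k%:R / N) (k.+1%:R / N) f -
   (\sum_(0 <= i < k) (N^-1)%:C * f (i.+1%:R / N) + (N^-1)%:C * f (k.+1%:R / N)) =
   (cint 0 (k%:R / N) f - \sum_(0 <= i < k) (N^-1)%:C * f (i.+1%:R / N)) +
   (cint (k%:R / N) (k.+1%:R / N) f - (N^-1)%:C * f (k.+1%:R / N)) by ring.
apply: (le_trans (cabsD _ _)); apply: (le_trans (lerD ih h2)).
by rewrite -[X in _ + X]mul1r -mulrDl natr1.
Qed.

(** Riemann sums are finite combinations of powers. They approximate the transform on right
    half-planes with an error of order [cabs (s - 1) / n], which yields holomorphy and inversion
    without interchanging integrals. *)
Definition rsum phi n s : C := \sum_(0 <= j < n.+1) n.+1%:R^-1 * mint phi s (j.+1%:R / n.+1%:R).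

Lemma mellin_rsum phi b : good phi -> exists2 K : R, 0 <= K & forall n s, b <= RE s ->
  cabs (mellin phi s - rsum phi n s) <= K * (1 + cabs (s - 1)) / n.+1%:R.
Proof.
move=> g; have [K1 K10 H1] := mint_small b 0 (good_derive g).
have [K2 K20 H2] := mint_small (b - 1) 0 g.
exists (K1 + K2) => [|n s bs]; first exact: addr_ge0.
rewrite mellinE //; apply: riemann_sum; first exact: mint_cont.
have key x y : 0 <= x -> x <= y -> cabs (mint phi s y - mint phi s x) <=
   (K1 + K2) * (1 + cabs (s - 1)) * (y - x).
  move=> x0 xy; apply: (@mean_value_cabs R _ (fun t => mint (derive1 phi) s t + (s - 1) * mint phi (s - 1) t)) => //.
    by move=> t /andP[t0 _]; apply: mint_rcderiv => //; lra.
  move=> t _; apply: (le_trans (cabsD _ _)); rewrite cabsM.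
  have hr := H1 s bs t; have hq := H2 (s - 1) ltac:(rewrite ReB /=; lra) t.
  rewrite !expr0 !mulr1 in hr hq.
  have p0 := cabs_ge0 (s - 1).
  have : cabs (s - 1) * cabs (mint phi (s - 1) t) <= cabs (s - 1) * K2 by rewrite ler_wpM2l.
  have : 0 <= cabs (s - 1) * K1 by rewrite mulr_ge0.
  lra.
move=> x y /andP[x0 x1] /andP[y0 y1]; have [xy|xy] := lerP x y.
  by rewrite cabsBC; exact: key.
by apply: key => //; lra.
Qed.

Lemma hol_mint phi x z : hol (fun s => mint phi s x) z.
Proof.
apply: holM; first exact: hol_cst.
apply: (@hol_comp R (fun s => s - 1) (cpow x)); last exact: hol_cpow.
by apply: holB; [exact: hol_id|exact: hol_cst].
Qed.

Lemma hol_rsum phi n z : hol (rsum phi n) z.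
Proof. by apply: hol_sum => j; apply: holM; [exact: hol_cst|exact: hol_mint]. Qed.

Lemma mellin_hol phi z : good phi -> hol (mellin phi) z.
Proof.
move=> g; have [K K0 HK] := mellin_rsum (RE z - 1) g.
apply: (@weierstrass R (rsum phi) _ z 1) => //; first by move=> n w _; exact: hol_rsum.
move=> e e0; pose B := K * (1 + (cabs z + 2)).
have B0 : 0 <= B by rewrite mulr_ge0 // addr_ge0 // addr_ge0 ?cabs_ge0.
pose n := Num.Def.archi_bound (B / e); exists n => w wz; rewrite cabsBC.
have rw : RE z - 1 <= RE w by have := le_lt_trans (abs_Re_le _) wz; rewrite ReB ltr_norml; lra.
apply: (le_trans (HK n w rw)); rewrite ler_pdivrMr ?ltr0n //.
apply: (@le_trans _ _ B).
  rewrite ler_wpM2l // lerD2l; have -> : w - 1 = (w - z) + (z - 1) by ring.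
  apply: (le_trans (cabsD _ _)); have := cabsB z 1; rewrite cabs1; lra.
have := archi_boundP (divr_ge0 B0 (ltW e0)); rewrite -/n ltr_pdivrMr // => h.
apply: (le_trans (ltW h)); by rewrite (mulrC n%:R) ler_wpM2l ?(ltW e0) // ler_nat.
Qed.

End MellinTransform.

(** * Perron's formula of order three and Mellin inversion *)

Section MellinInversion.
Variable R : realType.
Local Notation C := R[i].
Implicit Types (phi : R -> R) (s w z : C) (a b c x y t r : R).

Lemma cabs_shift_sqr w (p : R) : 1 / 2 <= `|RE w + p| -> 1 / 4 * (1 + IM w ^+ 2) <= cabs (w + p%:C) ^+ 2.
Proof.
move=> h; rewrite cabs_sqr ReD ImD /= addr0 -(real_normK (num_real (RE w + p))).
by have := sqr_ge0 (IM w); nra.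
Qed.

Lemma cabs_shift_ge w (p : R) : `|RE w + p| <= cabs (w + p%:C).
Proof. by have := abs_Re_le (w + p%:C); rewrite ReD. Qed.

Lemma inv_quad w (p q : R) : 1 / 2 <= `|RE w + p| -> 1 / 2 <= `|RE w + q| ->
  (cabs (w + p%:C) * cabs (w + q%:C))^-1 <= 4 * ck (IM w).
Proof.
move=> hp hq; have hA := cabs_shift_sqr hp; have hB := cabs_shift_sqr hq.
have A0 := cabs_ge0 (w + p%:C); have B0 := cabs_ge0 (w + q%:C).
have T0 := ck_den_gt0 (IM w); rewrite /ck.
move: (cabs _) (cabs _) (1 + IM w ^+ 2) hA hB A0 B0 T0 => A B T hA hB A0 B0 T0.
have h : T / 4 <= A * B.
  rewrite -[leLHS]ger0_norm ?divr_ge0 ?(ltW T0) // -[leRHS]ger0_norm ?mulr_ge0 //.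
  rewrite -ler_sqr ?nnegrE ?normr_ge0 // !real_normK ?num_real // [in leRHS]exprMn.
  have -> : (T / 4) ^+ 2 = (1 / 4 * T) * (1 / 4 * T) by field.
  by apply: ler_pM; rewrite ?mulr_ge0 ?(ltW T0) //; lra.
have T4 : 0 < T / 4 by lra.
have -> : 4 * T^-1 = (T / 4)^-1 by rewrite invf_div.
by rewrite lef_pV2 ?posrE //; lra.
Qed.

(** Two factors of the denominator give the majorant [ck]; the third supplies the decay that sends
    the line to infinity. Each is written as [w + p%:C] so that all three poles are treated by the
    same lemmas. *)
Definition perron r w : C := cpow r w / ((w + 0%:C) * (w + 1%:C) * (w + 2%:C)).

Lemma shift_neq0 w (p : R) : 1 / 2 <= `|RE w + p| -> w + p%:C != 0.
Proof. by move=> h; rewrite -cabs_gt0; have := cabs_shift_ge w p; lra. Qed.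

Lemma hol_shift z (p : R) : hol (fun w => w + p%:C) z.
Proof. by apply: holD; [exact: hol_id|exact: hol_cst]. Qed.

Lemma perron_hol r w : 1 / 2 <= `|RE w + 0| -> 1 / 2 <= `|RE w + 1| -> 1 / 2 <= `|RE w + 2| ->
  hol (perron r) w.
Proof.
move=> h0 h1 h2; apply: holM; first exact: hol_cpow.
apply: holV; first by rewrite !mulf_neq0 ?shift_neq0.
by apply: holM; [apply: holM|]; exact: hol_shift.
Qed.

Lemma perron_bound r w : 0 < r -> 1 / 2 <= `|RE w + 0| -> 1 / 2 <= `|RE w + 1| ->
  1 / 2 <= `|RE w + 2| ->
  cabs (perron r w) <= r `^ RE w * (4 / cabs (w + 2%:C)) * ck (IM w).
Proof.
move=> r0 h0 h1 h2; rewrite /perron (cabsM (cpow r w)) (cabs_cpow _ r0) -[leRHS]mulrA.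
rewrite ler_wpM2l ?powR_ge0 // cabsV (cabsM (_ * _)) (cabsM (w + 0%:C)) invfM.
by rewrite [leRHS]mulrAC ler_wpM2r ?invr_ge0 ?cabs_ge0 ?inv_quad.
Qed.

Lemma small_all_eq0 z (B : R) : (forall b, 3 <= b -> cabs z <= B / (b - 2)) -> z = 0.
Proof.
move=> H; apply: cabs_small => e e0.
have B0 : 0 <= B.
  have := le_trans (cabs_ge0 _) (H 3 (lexx _)); have -> : 3 - 2 = 1 :> R by ring.
  by rewrite divr1.
have k : 0 <= B / e by rewrite divr_ge0 // ltW.
have := H (B / e + 3) ltac:(lra); move=> h; apply: (le_trans h).
rewrite ler_pdivrMr; last lra.
have -> : e * (B / e + 3 - 2) = B + e by field; rewrite gt_eqF.
lra.
Qed.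

Lemma cabs_w2 w (k : R) : k <= `|RE w + 2| -> 0 < k -> 4 / cabs (w + 2%:C) <= 4 / k.
Proof.
move=> h k0; rewrite ler_wpM2l // lef_pV2 ?posrE //; first exact: le_trans h (cabs_shift_ge _ _).
by apply: lt_le_trans k0 _; apply: le_trans h (cabs_shift_ge _ _).
Qed.

Lemma perron_vdec c r : 0 < r -> 1 / 2 <= `|c + 0| -> 1 / 2 <= `|c + 1| -> 1 / 2 <= `|c + 2| ->
  vdec c (perron r).
Proof.
move=> r0 h0 h1 h2; split; first by move=> t; apply: hol_ccont; exact: perron_hol.
exists (r `^ c * 8) => t; apply: (le_trans (@perron_bound r (c +i* t) r0 h0 h1 h2)) => /=.
rewrite ler_wpM2r ?(ltW (ck_gt0 _)) // ler_wpM2l ?powR_ge0 //.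
by apply: (le_trans (cabs_w2 (w := c +i* t) h2 _)); lra.
Qed.

Lemma norm_ge_pos (x k : R) : k <= x -> k <= `|x|.
Proof. by move=> h; apply: le_trans h (ler_norm _). Qed.

Lemma norm_ge_neg (x k : R) : x <= - k -> k <= `|x|.
Proof. by move=> h; rewrite -normrN; apply: norm_ge_pos; lra. Qed.

(** For [r <= 1] the line is pushed to the right, where no pole is met and the factor
    [1 / cabs (w + 2)] tends to 0. *)
Lemma perron_le1 c r : 1 / 2 <= c -> 0 < r <= 1 -> vline_integral c (perron r) = 0.
Proof.
move=> c2 /andP[r0 r1]; apply: (@small_all_eq0 _ (4 * pi)) => b b3.
pose b' := c + b.
have hc w : c <= RE w -> [/\ 1 / 2 <= `|RE w + 0|, 1 / 2 <= `|RE w + 1| & 1 / 2 <= `|RE w + 2|].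
  by move=> h; split; apply: norm_ge_pos; lra.
have -> : vline_integral c (perron r) = vline_integral b' (perron r).
  apply/esym; apply: (@contour_shift R c b' _ 8); rewrite /b' //; try lra.
    by move=> z /andP[h _]; have [? ? ?] := hc z h; exact: perron_hol.
  move=> z /andP[h _]; have [? ? h2] := hc z h; apply: (le_trans (perron_bound r0 _ _ _)) => //.
  rewrite ler_wpM2r ?(ltW (ck_gt0 _)) // -[leRHS]mul1r; apply: ler_pM => //; rewrite ?powR_ge0 ?divr_ge0 ?cabs_ge0 //.
    by rewrite -(powRr0 r) powR_le1_anti ?r0 //; lra.
  by apply: (le_trans (cabs_w2 h2 _)); lra.
have [k0 k1 k2] := hc (b' +i* 0) ltac:(rewrite /b' /=; lra); rewrite /= in k0 k1 k2.
apply: (le_trans (vline_bound (D := 4 / (b - 2)) (perron_vdec r0 k0 k1 k2) _)); last by rewrite mulrAC.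
move=> t; apply: (le_trans (@perron_bound r (b' +i* t) r0 k0 k1 k2)) => /=.
rewrite ler_wpM2r ?(ltW (ck_gt0 _)) // -[leRHS]mul1r; apply: ler_pM; rewrite ?powR_ge0 ?divr_ge0 ?cabs_ge0 //.
  by rewrite -(powRr0 r) powR_le1_anti ?r0 // /b'; lra.
by apply: cabs_w2; [apply: norm_ge_pos; rewrite /b' /=; lra|lra].
Qed.

Lemma perron_left r : 1 <= r -> vline_integral (- (5 / 2)) (perron r) = 0.
Proof.
move=> r1; have r0 : 0 < r by lra.
apply: (@small_all_eq0 _ (4 * pi)) => b b3.
have hc w : RE w <= - (5 / 2) -> [/\ 1 / 2 <= `|RE w + 0|, 1 / 2 <= `|RE w + 1| & 1 / 2 <= `|RE w + 2|].
  by move=> h; split; apply: norm_ge_neg; lra.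
have -> : vline_integral (- (5 / 2)) (perron r) = vline_integral (- b) (perron r).
  apply: (@contour_shift R (- b) _ _ 8) => //; try lra.
    by move=> z /andP[_ h]; have [? ? ?] := hc z h; exact: perron_hol.
  move=> z /andP[_ h]; have [? ? h2] := hc z h; apply: (le_trans (perron_bound r0 _ _ _)) => //.
  rewrite ler_wpM2r ?(ltW (ck_gt0 _)) // -[leRHS]mul1r; apply: ler_pM => //; rewrite ?powR_ge0 ?divr_ge0 ?cabs_ge0 //.
    by rewrite -(powRr0 r) ler_powR //; lra.
  by apply: (le_trans (cabs_w2 h2 _)); lra.
have [k0 k1 k2] := hc (- b +i* 0) ltac:(rewrite /=; lra); rewrite /= in k0 k1 k2.
apply: (le_trans (vline_bound (D := 4 / (b - 2)) (perron_vdec r0 k0 k1 k2) _)); last by rewrite mulrAC.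
move=> t; apply: (le_trans (@perron_bound r (- b +i* t) r0 k0 k1 k2)) => /=.
rewrite ler_wpM2r ?(ltW (ck_gt0 _)) // -[leRHS]mul1r; apply: ler_pM; rewrite ?powR_ge0 ?divr_ge0 ?cabs_ge0 //.
  by rewrite -(powRr0 r) ler_powR //; lra.
by apply: cabs_w2; [apply: norm_ge_neg; rewrite /=; lra|lra].
Qed.

(** The line crosses the single pole [- l]; [p] and [q] give the other two factors. *)
Lemma perron_step (l p q a b r : R) : 1 <= r -> a < - l < b ->
  (forall x, a <= x <= b -> 1 / 2 <= `|x + p| /\ 1 / 2 <= `|x + q|) ->
  (forall w, (w + 0%:C) * (w + 1%:C) * (w + 2%:C) = (w + p%:C) * (w + q%:C) * (w + l%:C)) ->
  vline_integral b (perron r) - vline_integral a (perron r) =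
  tpi R * (cpow r (- l%:C) / ((p - l)%:C * (q - l)%:C)).
Proof.
move=> r1 lab H E; have r0 : 0 < r by lra.
pose g w := cpow r w / ((w + p%:C) * (w + q%:C)).
have eg c : vline_integral c (perron r) = vline_integral c (fun z => g z / (z - - l%:C)).
  by apply: eq_vline_integral => t; rewrite /perron E opprK /g invfM mulrA.
rewrite !eg (@contour_shift_pole R a b g _ (r `^ b * 4)).
- by congr (_ * _); rewrite /g !rmorphB /= ![- l%:C + _]addrC.
- by rewrite ReN.
- by rewrite mulr_ge0 ?powR_ge0.
- move=> z zab; have [h1 h2] := H _ zab; apply: holM; first exact: hol_cpow.
  by apply: holV; [rewrite mulf_neq0 ?shift_neq0|apply: holM; exact: hol_shift].
- move=> z zab; have [h1 h2] := H _ zab; rewrite /g cabsM cabs_cpow // cabsV (cabsM (z + p%:C)) -mulrA.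
  apply: ler_pM; rewrite ?powR_ge0 ?invr_ge0 ?mulr_ge0 ?cabs_ge0 ?inv_quad //.
  by rewrite ler_powR // (andP zab).2.
Qed.

(** Pushed to the left the line crosses 0, -1 and -2, with residues [1/2], [- 1/r] and [1/(2 r^2)],
    whose sum is a square. *)
Lemma perron_ge1 c r : 1 / 2 <= c -> 1 <= r ->
  vline_integral c (perron r) = tpi R * ((1 - r^-1) ^+ 2 / 2)%:C.
Proof.
move=> c2 r1; have r0 : 0 < r by lra.
have s0 := @perron_step 0 1 2 (- (1 / 2)) c r r1.
have s1 := @perron_step 1 0 2 (- (3 / 2)) (- (1 / 2)) r r1.
have s2 := @perron_step 2 0 1 (- (5 / 2)) (- (3 / 2)) r r1.
have {}s0 := s0 ltac:(apply/andP; split; lra)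
  ltac:(by move=> x /andP[? ?]; split; apply: norm_ge_pos; lra) ltac:(move=> w; ring).
have {}s1 := s1 ltac:(apply/andP; split; lra)
  ltac:(by move=> x /andP[? ?]; split; [apply: norm_ge_neg|apply: norm_ge_pos]; lra) ltac:(move=> w; ring).
have {}s2 := s2 ltac:(apply/andP; split; lra)
  ltac:(by move=> x /andP[? ?]; split; apply: norm_ge_neg; lra) ltac:(move=> w; ring).
have := perron_left r1 => s3.
have -> : vline_integral c (perron r) =
  (vline_integral c (perron r) - vline_integral (- (1 / 2)) (perron r)) +
  (vline_integral (- (1 / 2)) (perron r) - vline_integral (- (3 / 2)) (perron r)) +
  (vline_integral (- (3 / 2)) (perron r) - vline_integral (- (5 / 2)) (perron r)) by rewrite s3; ring.
rewrite s0 s1 s2 -!mulrDr; congr (_ * _).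
have e x : cpow r (- x%:C) = (r `^ (- x))%:C by rewrite -rmorphN /= cpow_real.
rewrite !e -!rmorphM -!fmorphV -!rmorphM -!rmorphD; congr (_%:C).
have -> : r `^ (- 2) = r^-1 ^+ 2 by rewrite (powRN r 2) (powR_mulrn 2 (ltW r0)) exprVn.
rewrite oppr0 powRr0 (powRN r 1) (powRr1 (ltW r0)); by field; rewrite gt_eqF.
Qed.

(** The truncated power that is the kernel of the integral remainder in Taylor's formula. *)
Definition tpart y x : R := (Num.max (x - y) 0) ^+ 2 / 2.

Lemma tpart_le y x : x <= y -> tpart y x = 0.
Proof. by move=> xy; rewrite /tpart max_r ?expr0n ?mul0r //; lra. Qed.

Lemma tpart_ge y x : y <= x -> tpart y x = (x - y) ^+ 2 / 2.
Proof. by move=> xy; rewrite /tpart max_l //; lra. Qed.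

Lemma tpart_lip y x x' : 0 < y -> x <= 2 -> x' <= 2 -> `|tpart y x - tpart y x'| <= 2 * `|x - x'|.
Proof.
move=> y0; rewrite /tpart => x2 x2'.
have m0 u : 0 <= Num.max (u - y) 0 by rewrite le_max lexx orbT.
have m2 u : u <= 2 -> Num.max (u - y) 0 <= 2 by move=> u2; rewrite ge_max; apply/andP; split; lra.
have ml : `|Num.max (x - y) 0 - Num.max (x' - y) 0| <= `|x - x'|.
  have h1 := ler_norm (x - x'); have h2 := ler_norm (x' - x); rewrite (distrC x' x) in h2.
  by have [a|a] := leP (x - y) 0; have [b|b] := leP (x' - y) 0; rewrite ler_norml; apply/andP; split; lra.
move: (m0 x) (m0 x') (m2 x x2) (m2 x' x2') ml.
move: (Num.max _ _) (Num.max _ _) => m' m a b c d ml.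
have -> : m ^+ 2 / 2 - m' ^+ 2 / 2 = ((m + m') / 2) * (m - m') by field.
by rewrite normrM; apply: ler_pM => //; rewrite ger0_norm; lra.
Qed.

Lemma good_bounded phi : good phi -> exists2 K : R, 0 <= K & forall x, `|phi x| <= K.
Proof.
move=> g; have [K K0 HK] := good_bound 0 g; exists K => // x.
have [x0|x0] := lerP 0 x; first by have := HK x x0; rewrite expr0 mulr1.
by rewrite (good_out g) ?normr0 // negb_and -leNgt (ltW x0).
Qed.

Lemma good_lip phi (K : R) : good phi -> (forall x, `|derive1 phi x| <= K) ->
  forall x x', `|phi x - phi x'| <= K * `|x - x'|.
Proof.
move=> g H x x'; wlog xx : x x' / x' <= x.
  by move=> W; have [h|/ltW h] := leP x' x; [exact: W|rewrite distrC (distrC x); exact: W].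
have := @mean_value_cabs R _ _ x' x K xx (fun t _ => good_rcderiv t g).
have -> : (phi x)%:C - (phi x')%:C = (phi x - phi x')%:C :> C by rewrite rmorphB.
rewrite cabs_real (ger0_norm (_ : 0 <= x - x')) ?subr_ge0 //; apply => t _.
by rewrite cabs_real; exact: H.
Qed.

Lemma real_complex2 : (2 : R)%:C = 2 :> C.
Proof. by apply: complex_ext; rewrite ?Re_nat ?Im_nat. Qed.

Lemma real_complex_weight n (a x : R) : (n.+1%:R^-1 * a * x ^+ 2)%:C = n.+1%:R^-1 * a%:C * (x%:C * x%:C) :> C.
Proof. by rewrite expr2 !rmorphM /= fmorphV rmorph_nat. Qed.

(** Taylor's formula expanded at 1, where all derivatives of [phi] vanish, so only the remainder is
    left; the Lipschitz bound prepares the Riemann sum. *)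
Lemma taylor_integral phi y : good phi -> 0 < y ->
  cint 0 1 (fun x => (derive1 (derive1 (derive1 phi)) x * tpart y x)%:C) = - (phi y)%:C /\
  exists2 L : R, 0 <= L & forall x x', 0 <= x <= 1 -> 0 <= x' <= 1 ->
    cabs ((derive1 (derive1 (derive1 phi)) x * tpart y x)%:C -
          (derive1 (derive1 (derive1 phi)) x' * tpart y x')%:C) <= L * `|x - x'|
    /\ cont_on 0 1 (fun x => (derive1 (derive1 (derive1 phi)) x * tpart y x)%:C).
Proof.
move=> g y0; have g1 := good_derive g; have g2 := good_derive g1; have g3 := good_derive g2.
have D2' x := good_rcderiv x g2.
move: (derive1 (derive1 (derive1 phi)) : R -> R) g3 D2' => f3 g3 D2'.
have [K3 K30 b3] := good_bounded g3; have [K4 K40 b4] := good_bounded (good_derive g3).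
have l3 := good_lip g3 b4.
have lip x x' : x <= 2 -> x' <= 2 -> cabs ((f3 x * tpart y x)%:C - (f3 x' * tpart y x')%:C) <=
    (2 * K3 + 2 * K4) * `|x - x'|.
  move=> x2 x2'; rewrite -(rmorphB (real_complex R)) cabs_real.
  have -> : f3 x * tpart y x - f3 x' * tpart y x' =
     f3 x * (tpart y x - tpart y x') + (f3 x - f3 x') * tpart y x' by ring.
  apply: (le_trans (ler_normD _ _)); rewrite (normrM (f3 x)) (normrM (f3 x - f3 x')).
  have t2 : `|tpart y x'| <= 2.
    rewrite /tpart ger0_norm ?divr_ge0 ?sqr_ge0 //.
    have m0 : 0 <= Num.max (x' - y) 0 by rewrite le_max lexx orbT.
    have m2 : Num.max (x' - y) 0 <= 2 by rewrite ge_max; apply/andP; split; lra.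
    by nra.
  have a1 := ler_pM (normr_ge0 _) (normr_ge0 _) (b3 x) (tpart_lip y0 x2 x2').
  have a2 := ler_pM (normr_ge0 _) (normr_ge0 _) (l3 x x') t2.
  lra.
have L0 : 0 <= 2 * K3 + 2 * K4 by lra.
have ct : cont_on 0 1 (fun x => (f3 x * tpart y x)%:C).
  move=> t /andP[t0 t1] e e0; exists (Num.min 1 (e / (2 * K3 + 2 * K4 + 1))).
  have k0 : 0 < 2 * K3 + 2 * K4 + 1 by lra.
  split; first by rewrite lt_min ltr01 divr_gt0.
  move=> h; rewrite lt_min => /andP[h1 h2].
  have th : t + h <= 2 by have := ler_norm h; lra.
  apply: (le_trans (lip _ _ th _)); first lra.
  have -> : t + h - t = h by ring.
  by move: h2; rewrite ltr_pdivlMr // => h2; have := normr_ge0 h; nra.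
split; last by exists (2 * K3 + 2 * K4) => // x x' /andP[_ x1] /andP[_ x1']; split => //; apply: lip; lra.
have zero a b : a <= b -> cint a b (fun=> 0 : C) = 0.
  move=> ab; rewrite (@cint_FTC R a b (fun=> 0)) ?subrr //.
    by move=> t _; exact: rcderiv_cst.
  by move=> t _; exact: rcderiv_cont (rcderiv_cst _ _).
have [y1|y1] := lerP 1 y.
  rewrite (good_out g) ?oppr0; last by rewrite negb_and -!leNgt y1 orbT.
  rewrite (@eq_cint R 0 1 _ (fun=> 0)); first exact: zero ler01.
  by move=> t /andP[_ t1]; rewrite tpart_le ?mulr0 //; lra.
rewrite (@cint_chasles R 0 y 1) ?(ltW y0) ?(ltW y1) //.
rewrite (@eq_cint R 0 y _ (fun=> 0)); last first.
  by move=> t /andP[_ t1]; rewrite tpart_le ?mulr0.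
rewrite zero ?(ltW y0) // add0r.
pose l x : C := x%:C - y%:C.
have dl x : rcderiv l x 1.
  have := rcderivD (_ : rcderiv (fun y => y%:C : C) x 1) (rcderiv_cst (- y%:C) x); rewrite addr0; apply.
  by split => /=; [exact: is_derive_id|exact: is_derive_cst].
(* The primitive produced by integrating by parts twice. *)
pose G x : C := 2^-1 * ((derive1 (derive1 phi) x)%:C * (l x * l x)) + -1 * ((derive1 phi x)%:C * l x) + (phi x)%:C.
have dG x : rcderiv G x ((f3 x)%:C * (l x * l x) / 2).
  have D2 := rcderivZ 2^-1 (rcderivM (D2' x) (rcderivM (dl x) (dl x))).
  have D1 := rcderivZ (-1) (rcderivM (good_rcderiv x g1) (dl x)).
  have := rcderivD (rcderivD D2 D1) (good_rcderiv x g).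
  set u := (X in rcderiv _ _ X); set v := (X in _ -> rcderiv _ _ X).
  suff -> : u = v by [].
  by rewrite /u /v; field.
rewrite (@eq_cint R y 1 _ (fun x => (f3 x)%:C * (l x * l x) / 2)); last first.
  move=> x /andP[yx _]; rewrite tpart_ge // /l -rmorphB -!rmorphM.
  have -> : 2^-1 = (2^-1 : R)%:C by rewrite fmorphV rmorph_nat.
  by rewrite -rmorphM; congr (_%:C); rewrite expr2; ring.
rewrite (@cint_FTC R y 1 G) ?(ltW y1) //; last first.
  move=> x _; apply: (@rcderiv_cont R _ x (((derive1 f3 x)%:C * (l x * l x) + (f3 x)%:C * (1 * l x + l x * 1)) / 2)).
  have := rcderivM (rcderivM (good_rcderiv x g3) (rcderivM (dl x) (dl x))) (rcderiv_cst 2^-1 x).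
  by rewrite mulr0 addr0.
rewrite /G (good_out g (x := 1)) ?ltxx ?andbF // (good_out g1 (x := 1)) ?ltxx ?andbF //.
rewrite (good_out g2 (x := 1)) ?ltxx ?andbF // /l subrr !mul0r !mulr0 !addr0; ring.
Qed.

Lemma mellin_vdec phi c f (A : R) m : good phi -> 0 <= A -> (forall t, ccont f (c +i* t)) ->
  (forall t, cabs (f (c +i* t)) <= A * (1 + `|t|) ^+ m) -> vdec c (fun w => f w * mellin phi w).
Proof.
move=> g A0 cf Hf; split.
  by move=> t; apply: ccontM => //; apply: hol_ccont; exact: mellin_hol.
have [K K0 HK] := mellin_decay (m + 2) c g; exists (A * K) => t; rewrite cabsM.
have h := HK (c +i* t) (lexx _); rewrite /= exprD mulrA in h.
have p0 : 0 <= (1 + `|t|) ^+ m by rewrite exprn_ge0 // addr_ge0.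
apply: (le_trans (ler_wpM2r (cabs_ge0 _) (Hf t))).
rewrite -!mulrA ler_wpM2l // mulrC.
rewrite ler_pdivlMr ?ck_den_gt0 //; apply: le_trans h.
rewrite ler_wpM2l ?mulr_ge0 ?cabs_ge0 //.
have := normr_ge0 t; have := real_normK (num_real t); nra.
Qed.

Lemma ccont_cpowN y z : ccont (fun w => cpow y (- w)) z.
Proof.
apply: hol_ccont; apply: (@hol_comp R (fun s => - s) (cpow y)); last exact: hol_cpow.
by apply: holN; exact: hol_id.
Qed.

Lemma mellin_parts3 phi w : good phi ->
  mellin (derive1 (derive1 (derive1 phi))) (w + 3) = - ((w + 0%:C) * (w + 1%:C) * (w + 2%:C)) * mellin phi w.
Proof.
move=> g; have g1 := good_derive g; have g2 := good_derive g1.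
have -> : w + 3 = w + 1 + 1 + 1 by ring.
rewrite mellin_parts // mellin_parts // mellin_parts //.
rewrite real_complex2 addr0; ring.
Qed.

(** Three integrations by parts bring in the Mellin transform of the third derivative, which is
    replaced by a Riemann sum. Each term is a Perron integral with [r = x_ j / y], and the results
    form a Riemann sum of the Taylor integral for [phi y]. Order three compensates the factor
    [cabs (w + 2)] in the approximation error. *)
Lemma mellin_inversion phi c y : good phi -> 1 / 2 <= c -> 0 < y ->
  vline_integral c (fun w => cpow y (- w) * mellin phi w) = tpi R * (phi y)%:C.
Proof.
move=> g c2 y0; have g3 := good_derive (good_derive (good_derive g)).
have [TE [L L0 HL]] := taylor_integral g y0.
have parts3 w := mellin_parts3 w g.
move: (derive1 (derive1 (derive1 phi)) : R -> R) g3 TE HL parts3 => f3 g3 TE HL parts3.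
have [K K0 HK] := mellin_rsum (c + 3) g3.
have yc : 0 < y `^ (- c) by exact: powR_gt0.
apply: vline_approx.
  apply: (@mellin_vdec phi c _ (y `^ (- c)) 0) => //; first exact: ltW.
    by move=> t; exact: ccont_cpowN.
  by move=> t; rewrite expr0 mulr1 cabs_cpow // ReN.
move=> e e0; pose B := Num.max (12 * K * y `^ (- c)) (cabs (tpi R) * L).
have B1 : 12 * K * y `^ (- c) <= B by rewrite le_max lexx.
have B2 : cabs (tpi R) * L <= B by rewrite le_max lexx orbT.
have B0 : 0 <= B by apply: le_trans B2; rewrite mulr_ge0 ?cabs_ge0.
clearbody B.
pose n := Num.Def.archi_bound (B / e); pose N : R := n.+1%:R.
have N0 : 0 < N by rewrite ltr0n.
have BN : B / N <= e.
  have := archi_boundP (divr_ge0 B0 (ltW e0)); rewrite -/n ltr_pdivrMr // => h.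
  rewrite ler_pdivrMr //; apply: (le_trans (ltW h)).
  by rewrite mulrC ler_wpM2l ?(ltW e0) // ler_nat.
pose x_ j : R := j.+1%:R / N.
have x0 j : 0 < x_ j by rewrite divr_gt0 ?ltr0n.
pose g_ j w : C := - (N^-1 * f3 (x_ j) * x_ j ^+ 2)%:C * perron (x_ j / y) w.
have xy j : 0 < x_ j / y by rewrite divr_gt0.
have vp j : vdec c (perron (x_ j / y)).
  by apply: perron_vdec => //; apply: norm_ge_pos; lra.
exists (fun w => \sum_(0 <= j < n.+1) g_ j w); split.
- by apply: vdec_sum => j; exact: vdecZ.
- move=> t; set w := c +i* t.
  have hw0 : 1 / 2 <= `|RE w + 0| by apply: norm_ge_pos; rewrite /=; lra.
  have hw1 : 1 / 2 <= `|RE w + 1| by apply: norm_ge_pos; rewrite /=; lra.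
  have hw2 : 1 / 2 <= `|RE w + 2| by apply: norm_ge_pos; rewrite /=; lra.
  pose P := (w + 0%:C) * (w + 1%:C) * (w + 2%:C).
  have P0 : P != 0 by rewrite !mulf_neq0 ?shift_neq0.
  have E1 : mellin phi w = - P^-1 * mellin f3 (w + 3).
    by rewrite parts3 -/P; field.
  have E2 : \sum_(0 <= j < n.+1) g_ j w = cpow y (- w) * (- P^-1 * rsum f3 n (w + 3)).
    rewrite /rsum !mulr_sumr; apply: eq_bigr => j _; rewrite /g_ /perron -/P -/N -/(x_ j) /mint.
    have -> : w + 3 - 1 = w + 1 + 1 by ring.
    rewrite !cpowD (cpow_1r (x0 j)) cpowM ?invr_gt0 //.
    have -> : cpow y^-1 w = cpow y (- w).
      have := @cpow_powR R y (-1) w y0; rewrite (powRN y 1) (powRr1 (ltW y0)) => ->.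
      by rewrite rmorphN1 mulN1r.
    rewrite real_complex_weight; ring.
  rewrite E1 E2 -mulrBr -mulrBr cabsM cabs_cpow // ReN cabsM cabsN cabsV.
  have h := HK n (w + 3) ltac:(rewrite ReD /=; lra).
  have q0 : 0 < cabs (w + 2%:C) by rewrite cabs_gt0 shift_neq0.
  have q2 : 1 / 2 <= cabs (w + 2%:C) by apply: (le_trans hw2); exact: cabs_shift_ge.
  have E3 : w + 3 - 1 = w + 2%:C by rewrite real_complex2; ring.
  rewrite E3 in h.
  have hP : (cabs P)^-1 <= 4 * ck t / cabs (w + 2%:C).
    rewrite /P (cabsM (_ * _)) (cabsM (w + 0%:C)) invfM ler_wpM2r ?invr_ge0 ?cabs_ge0 //.
    exact: (inv_quad hw0 hw1).
  have c0 := ltW (ck_gt0 t).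
  have hh : (cabs P)^-1 * cabs (mellin f3 (w + 3) - rsum f3 n (w + 3)) <= 12 * K / N * ck t.
    apply: (le_trans (ler_pM _ (cabs_ge0 _) hP h)); first by rewrite invr_ge0 cabs_ge0.
    have q3 : (1 + cabs (w + 2%:C)) / cabs (w + 2%:C) <= 3 by rewrite ler_pdivrMr //; lra.
    have -> : 4 * ck t / cabs (w + 2%:C) * (K * (1 + cabs (w + 2%:C)) / n.+1%:R) =
      4 * K / N * ck t * ((1 + cabs (w + 2%:C)) / cabs (w + 2%:C)).
      by rewrite -/N; move: (cabs _) q0 => q q0; field; rewrite !gt_eqF.
    have k0 : 0 <= 4 * K / N * ck t by rewrite mulr_ge0 // divr_ge0 ?mulr_ge0 // ltW.
    apply: (le_trans (ler_wpM2l k0 q3)).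
    by rewrite (_ : 4 * K / N * ck t * 3 = 12 * K / N * ck t) //; ring.
  apply: (le_trans (ler_wpM2l (ltW yc) hh)).
  have -> : y `^ (- c) * (12 * K / N * ck t) = (12 * K * y `^ (- c)) / N * ck t by ring.
  rewrite ler_wpM2r //; apply: le_trans BN; rewrite ler_wpM2r ?invr_ge0 ?(ltW N0) //.
- rewrite vline_integral_sum; last by move=> j; exact: vdecZ.
  have E j : vline_integral c (g_ j) = - tpi R * (N^-1 * (f3 (x_ j) * tpart y (x_ j)))%:C.
    rewrite /g_ vline_integralZ //.
    have [h|h] := leP (x_ j) y.
      rewrite perron_le1 //; last by rewrite xy ler_pdivrMr // mul1r.
      by rewrite tpart_le // !mulr0.
    rewrite perron_ge1 //; last by rewrite ler_pdivlMr // mul1r ltW.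
    have -> : N^-1 * (f3 (x_ j) * tpart y (x_ j)) =
       (N^-1 * f3 (x_ j) * x_ j ^+ 2) * ((1 - (x_ j / y)^-1) ^+ 2 / 2).
      rewrite tpart_ge ?(ltW h) //; move: (x_ j) (x0 j) (N^-1) => x xp N'.
      by field; rewrite !gt_eqF.
    have R2 (u v : R) (z : C) : - u%:C * (z * v%:C) = - z * (u * v)%:C by rewrite rmorphM /=; ring.
    exact: R2.
  rewrite (eq_bigr _ (fun j _ => E j)) -mulr_sumr.
  have -> : - tpi R * (\sum_(0 <= i < n.+1) (N^-1 * (f3 (x_ i) * tpart y (x_ i)))%:C) - tpi R * (phi y)%:C =
    tpi R * (cint 0 1 (fun x => (f3 x * tpart y x)%:C) -
       \sum_(0 <= i < n.+1) n.+1%:R^-1 * (f3 (x_ i) * tpart y (x_ i))%:C).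
    rewrite TE mulrBr mulrN addrC; congr (_ + _); rewrite mulNr; congr (- (_ * _)).
    by apply: eq_bigr => j _; rewrite rmorphM /= fmorphV rmorph_nat.
  rewrite cabsM; have ct := (HL 0 0 ltac:(by rewrite lexx ler01) ltac:(by rewrite lexx ler01)).2.
  have := riemann_sum n ct (fun x x' hx hx' => (HL x x' hx hx').1) => h.
  apply: (le_trans (ler_wpM2l (cabs_ge0 _) h)); rewrite mulrA; apply: le_trans BN.
  by rewrite ler_wpM2r ?invr_ge0 ?(ltW N0).
Qed.

End MellinInversion.

(** * Continuation of zeta by the trapezoid rule *)

Section ZetaContinuation.
Variable R : realType.
Local Notation C := R[i].
Implicit Types (s z w : C) (n m N : nat).

(* The trapezoid error of [x ^ (-s)] on [m + 1, m + 2], times [s - 1]. *)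
Definition trap s m : C :=
  (s - 1) * (npow s m + npow s m.+1) / 2 - npow (s - 1) m + npow (s - 1) m.+1.

Lemma rcderiv_shift_cpow (a : R) s (x : R) : 0 < a + x ->
  rcderiv (fun y => cpow (a + y) s) x (s * cpow (a + x) (s - 1)).
Proof.
move=> ax; have [/is_derive_epsP H1 /is_derive_epsP H2] := rcderiv_cpow s ax.
split; apply/is_derive_epsP => e e0; [have [d [d0 Hd]] := H1 e e0|have [d [d0 Hd]] := H2 e e0];
  by exists d; split=> // h /Hd; rewrite addrA.
Qed.

Lemma rcderiv_real (x : R) : rcderiv (fun y => y%:C : C) x 1.
Proof. by split => /=; [exact: is_derive_id|exact: is_derive_cst]. Qed.

(** The error, as a function of the right end point, has derivative [(s - 1) / 2 * h], and [h] has
    derivative [s (s + 1) y r(y)]. Two mean value inequalities gain two powers of [m], enough for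
    convergence when [Re s > -1]. *)
Lemma trap_bound s m : -1 <= RE s ->
  cabs (trap s m) <= cabs (s - 1) * cabs s * cabs (s + 1) * m.+1%:R `^ (- (RE s + 2)).
Proof.
move=> s0; pose a : R := m.+1%:R; have a0 : 0 < a by rewrite ltr0n.
pose p y := cpow (a + y) (- s) : C; pose q y := cpow (a + y) (- s - 1) : C.
pose r y := cpow (a + y) (- s - 1 - 1) : C; pose u y := cpow (a + y) (- (s - 1)) : C.
have ay y : 0 <= y -> 0 < a + y by lra.
have dp y : 0 <= y -> rcderiv p y (- s * q y) by move=> y0; apply: rcderiv_shift_cpow; exact: ay.
have dq y : 0 <= y -> rcderiv q y ((- s - 1) * r y) by move=> y0; apply: rcderiv_shift_cpow; exact: ay.
have du y : 0 <= y -> rcderiv u y (- (s - 1) * p y).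
  move=> y0; have := rcderiv_shift_cpow (- (s - 1)) (ay y y0).
  by rewrite /p (_ : - (s - 1) - 1 = - s) //; ring.
pose h y := p 0 - p y - s * (y%:C * q y).
have dh y : 0 <= y -> rcderiv h y (s * (s + 1) * (y%:C * r y)).
  move=> y0; have D1 := rcderivZ (-1) (dp y y0).
  have D2 := rcderivZ (- s) (rcderivM (rcderiv_real y) (dq y y0)).
  have := rcderivD (rcderivD (rcderiv_cst (p 0) y) D1) D2.
  have -> : 0 + -1 * (- s * q y) + - s * (1 * q y + y%:C * ((- s - 1) * r y)) =
     s * (s + 1) * (y%:C * r y) by ring.
  congr rcderiv; apply/funext => t; rewrite /h; ring.
pose A := cabs s * cabs (s + 1) * a `^ (- (RE s + 2)).
have A0 : 0 <= A by rewrite !mulr_ge0 ?cabs_ge0 ?powR_ge0.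
have hb y : 0 <= y <= 1 -> cabs (h y) <= A.
  move=> /andP[y0 y1].
  have h0 : h 0 = 0 by rewrite /h mul0r mulr0 subr0 subrr.
  have := @mean_value_cabs R h (fun y => s * (s + 1) * (y%:C * r y)) 0 y A y0.
  rewrite h0 !subr0 => H; apply: (le_trans (H _ _)).
  - by move=> t /andP[t0 _]; exact: dh.
  - move=> t /andP[t0 ty]; rewrite (cabsM (s * (s + 1))) (cabsM s) (cabsM t%:C) cabs_real ger0_norm // /A.
    have at0 := ay t t0; rewrite /r cabs_cpow //.
    rewrite ler_wpM2l ?mulr_ge0 ?cabs_ge0 //.
    have -> : RE (- s - 1 - 1) = - (RE s + 2) by rewrite !ReB ReN /=; ring.
    apply: (@le_trans _ _ (1 * a `^ (- (RE s + 2)))); last by rewrite mul1r.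
    apply: ler_pM; rewrite ?powR_ge0 //; first lra.
    by apply: powR_nonpos_le => //; lra.
  - exact: ler_piMr A0 y1.
pose g y := (s - 1) / 2 * (y%:C * (p 0 + p y)) - u 0 + u y.
have g0 : g 0 = 0 by rewrite /g mul0r mulr0 sub0r addNr.
have g1 : g 1 = trap s m.
  rewrite /g /trap /npow /p /u addr0 /a natr1 mul1r; congr (_ - _ + _); by rewrite mulrAC.
have dg y : 0 <= y -> rcderiv g y ((s - 1) / 2 * h y).
  move=> y0.
  have D1 := rcderivM (rcderiv_real y) (rcderivD (rcderiv_cst (p 0) y) (dp y y0)).
  have := rcderivD (rcderivD (rcderivZ ((s - 1) / 2) D1) (rcderiv_cst (- u 0) y)) (du y y0).
  have -> : (s - 1) / 2 * (1 * (p 0 + p y) + y%:C * (0 + - s * q y)) + 0 + - (s - 1) * p y =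
     (s - 1) / 2 * h y by rewrite /h; field.
  by [].
have := @mean_value_cabs R g _ 0 1 (cabs (s - 1) * A) ler01 (fun t ht => dg t (andP ht).1).
rewrite g0 g1 !subr0 mulr1 => H.
apply: (le_trans (H _)); last by rewrite /A !mulrA.
move=> t ht; rewrite cabsM ler_pM ?cabs_ge0 ?hb //.
rewrite cabsM cabsV cabs_nat ler_piMr ?cabs_ge0 //; lra.
Qed.

(** This is [(s - 1) zeta s], continued to [Re s > -1]. It is holomorphic at 1 too, where the given
    [zeta] carries no information. *)
Definition kz s : C := 1 + (s - 1) / 2 + csum (trap s).

Lemma trap_tails s (b S : R) : 0 < b -> b - 1 <= RE s -> cabs (s - 1) <= S -> cabs s <= S ->
  cabs (s + 1) <= S -> tails (trap s) (fun N => S ^+ 3 * Kp b * N.+1%:R `^ (- b)).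
Proof.
move=> b0 bs S1 S2 S3; have S0 : 0 <= S := le_trans (cabs_ge0 _) S1.
have k1 : 0 <= S ^+ 3 * Kp b by rewrite mulr_ge0 ?exprn_ge0 // (ltW (Kp_gt0 b0)).
split; first exact: (rnullZ k1 (rnull_pow b0)).
move=> N M NM; apply: (@le_trans _ _ (S ^+ 3 * \sum_(N <= n < M) n.+1%:R `^ (- (1 + b)))).
  rewrite mulr_sumr; apply: ler_sum => n _.
  apply: (le_trans (trap_bound n _)); first lra.
  apply: ler_pM; rewrite ?mulr_ge0 ?cabs_ge0 ?powR_ge0 //.
    by rewrite !exprS expr0 mulr1 mulrA; apply: ler_pM; rewrite ?mulr_ge0 ?cabs_ge0 //; apply: ler_pM; rewrite ?cabs_ge0.
  by rewrite ler_powR ?ler1n //; lra.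
by rewrite -[leRHS]mulrA ler_wpM2l ?exprn_ge0 // pow_tail.
Qed.

Lemma hol_trap m z : hol (trap^~ m) z.
Proof.
have hs : hol (fun s : C => s - 1) z by apply: holB; [exact: hol_id|exact: hol_cst].
have hn n : hol (fun s => npow (s - 1) n) z.
  exact: (hol_comp hs (hol_npow n (z - 1))).
apply: holD; last exact: hn.
apply: holB; last exact: hn.
apply: holM; last exact: hol_cst.
by apply: holM => //; apply: holD; exact: hol_npow.
Qed.

Lemma kz_hol z : -1 < RE z -> hol kz z.
Proof.
move=> z1; apply: holD.
  apply: holD; first exact: hol_cst.
  by apply: holM; [apply: holB; [exact: hol_id|exact: hol_cst]|exact: hol_cst].
pose r := (RE z + 1) / 2; have r0 : 0 < r by rewrite /r; lra.
pose S := cabs z + r + 1.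
apply: (@series_hol R (fun n s => trap s n) (fun N => S ^+ 3 * Kp r * N.+1%:R `^ (- r)) z r r0).
  by move=> n w _; exact: hol_trap.
move=> w wz; have wS : cabs w <= cabs z + r.
  have -> : w = z + (w - z) by ring.
  by apply: (le_trans (cabsD _ _)); rewrite lerD2l ltW.
apply: trap_tails => //.
- by have := le_lt_trans (abs_Re_le _) wz; rewrite ReB ltr_norml /r; lra.
- by apply: (le_trans (cabsB _ _)); rewrite cabs1 /S; lra.
- by rewrite /S; lra.
- by apply: (le_trans (cabsD _ _)); rewrite cabs1 /S; lra.
Qed.

Lemma kz_bound (b : R) : 0 < b -> exists2 K : R, 0 <= K &
  forall s, b - 1 <= RE s -> cabs (kz s) <= K * (1 + cabs s) ^+ 3.
Proof.
move=> b0; have K0 := Kp_gt0 b0; exists (2 + Kp b) => [|s bs]; first lra.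
have s0 := cabs_ge0 s; pose S := 1 + cabs s.
have h1 : cabs (s - 1) <= S by apply: (le_trans (cabsB _ _)); rewrite cabs1 /S; lra.
have h2 : cabs (s + 1) <= S by apply: (le_trans (cabsD _ _)); rewrite cabs1 /S; lra.
have h3 : cabs s <= S by rewrite /S; lra.
have := csum_bound (trap_tails b0 bs h1 h3 h2); rewrite powR1 mulr1 => h.
rewrite /kz; apply: (le_trans (cabsD _ _)); have h4 := cabsD 1 ((s - 1) / 2).
rewrite cabs1 cabsM cabsV cabs_nat in h4.
have S1 : 1 <= S by rewrite /S; lra.
have : S <= S ^+ 3 by rewrite -[leLHS]expr1 ler_weXn2l.
rewrite -/S => k; move: h k; move: (S ^+ 3) => c; lra.
Qed.

Lemma kz1 : kz 1 = 1.
Proof.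
rewrite /kz subrr mul0r addr0; have -> : csum (trap 1) = 0; last by rewrite addr0.
apply: csum_eq; apply: clim_ext (clim_cst 0) => N.
rewrite big1 // => i _; rewrite /trap subrr !mul0r /npow oppr0 !cpow0; ring.
Qed.

Lemma trap_partial s N : \sum_(0 <= m < N) trap s m =
  (s - 1) * (\sum_(0 <= m < N) npow s m + npow s N / 2 - 1 / 2) - 1 + npow (s - 1) N.
Proof.
elim: N => [|N ih]; first by rewrite !big_geq // !npow0; field.
by rewrite !big_nat_recr //= ih /trap; field.
Qed.

Lemma clim_npow s : 0 < RE s -> clim (npow s) 0.
Proof.
move=> s0; apply: (clim_squeeze (b := fun N => N.+1%:R `^ (- RE s))); last exact: rnull_pow.
by move=> n; rewrite subr0 cabs_npow.
Qed.

Section GivenZeta.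
Variable zeta : C -> C.
Hypothesis hzeta : is_riemann_zeta zeta.

Lemma zeta_clim s : 1 < RE s -> clim (fun N => \sum_(0 <= m < N) npow s m) (zeta s).
Proof.
move=> s1; have := clim_of_cvg (hzeta.1 s s1).
move/(@clim_sub _ _ _ succn) => H; apply: clim_ext (H _).
  by move=> N; rewrite big_add1 /=; apply: eq_bigr.
by move=> N; exists N => n; exact: leqW.
Qed.

Lemma zeta_hol s : s != 1 -> hol zeta s.
Proof.
move=> s1; have := diff_derivable (v := (1 : Cplx R)) (hzeta.2 s s1).
move/cderiv_of_derivable => [l H]; exists l => e e0.
have [d [d0 Hd]] := H e e0; exists d; split=> // h /Hd.
by rewrite add0r scale0r add0r (addrC _ s) [h *: _](mulr1 h).
Qed.

Lemma kz_zeta_large s : 1 < RE s -> kz s = (s - 1) * zeta s.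
Proof.
move=> s1.
have E : csum (trap s) = (s - 1) * (zeta s + 0 / 2 - 1 / 2) - 1 + 0.
  apply: csum_eq; apply: (@clim_ext _ (fun N => (s - 1) * (\sum_(0 <= m < N) npow s m + npow s N / 2 - 1 / 2)
     - 1 + npow (s - 1) N)); first by move=> N; rewrite trap_partial.
  apply: climD; last by apply: clim_npow; rewrite ReB /=; lra.
  apply: climB; last exact: clim_cst.
  apply: climZ; apply: climB; last exact: clim_cst.
  apply: climD; first exact: zeta_clim.
  by apply: climM; [apply: clim_npow; lra|exact: clim_cst].
by rewrite /kz E; field.
Qed.

Lemma kz_zeta s : -1 < RE s -> s != 1 -> kz s = (s - 1) * zeta s.
Proof.
move=> s0 s1; apply/eqP; rewrite -subr_eq0; apply/eqP.
apply: (@identity_halfplane R (fun s => kz s - (s - 1) * zeta s) (-1) 1) => //.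
  move=> z z0 z1; apply: holB; first exact: kz_hol.
  by apply: holM; [apply: holB; [exact: hol_id|exact: hol_cst]|exact: zeta_hol].
by move=> z z1; rewrite kz_zeta_large ?subrr.
Qed.

End GivenZeta.
End ZetaContinuation.

(** * The inequality behind the nonvanishing on the line Re s = 1 *)

Section ThreeFourOne.
Variable R : realType.
Implicit Types r c : R.

(* In terms of y = (1 - c) / 2 the right-hand side is half of a combination of
   the monomials r^a (1 - r)^(4-a), whose coefficients are nonnegative on [0, 1]. *)
Lemma log_derivative_341 r c : 0 <= r <= 1 -> -1 <= c <= 1 ->
  0 <= 3 * (1 - 2 * r * c + r ^+ 2) * (1 - 2 * r * (2 * c ^+ 2 - 1) + r ^+ 2) +
   (1 - r) * (4 * (c - r) * (1 - 2 * r * (2 * c ^+ 2 - 1) + r ^+ 2) +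
     (2 * c ^+ 2 - 1 - r) * (1 - 2 * r * c + r ^+ 2)).
Proof.
move=> /andP[r0 r1] /andP[c0 c1].
pose y := (1 - c) / 2; have y0 : 0 <= y by rewrite /y; lra.
have y1 : 0 <= 1 - y by rewrite /y; lra.
have cE : c = 1 - 2 * y by rewrite /y; field.
clearbody y; rewrite cE.
have q0 : 0 <= 1 - r by lra.
have h1 : 0 <= 14 - 33 * y + 20 * y ^+ 2.
  have -> : 14 - 33 * y + 20 * y ^+ 2 = 20 * (y - 33 / 40) ^+ 2 + 31 / 80 by field.
  by have := sqr_ge0 (y - 33 / 40); lra.
have h2 : 0 <= 8 - 15 * y + 8 * y ^+ 2.
  have -> : 8 - 15 * y + 8 * y ^+ 2 = 8 * (y - 15 / 16) ^+ 2 + 31 / 32 by field.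
  by have := sqr_ge0 (y - 15 / 16); lra.
rewrite [leRHS](_ : _ =
  8 * (1 - r) ^+ 4 * (1 - y) ^+ 2 + 8 * r * (1 - r) ^+ 3 * y * (14 - 33 * y + 20 * y ^+ 2) +
  16 * r ^+ 2 * (1 - r) ^+ 2 * y * (8 - 15 * y + 8 * y ^+ 2) +
  224 * r ^+ 3 * (1 - r) * y ^+ 2 * (1 - y) + 192 * r ^+ 4 * y ^+ 2 * (1 - y)); last by ring.
move: (14 - 33 * y + 20 * y ^+ 2) h1 (8 - 15 * y + 8 * y ^+ 2) h2 => P h1 Q h2.
move: (exprn_ge0 4 q0) (exprn_ge0 3 q0) (exprn_ge0 2 q0) (exprn_ge0 2 r0) (exprn_ge0 3 r0)
  (exprn_ge0 4 r0) (exprn_ge0 2 y0) (exprn_ge0 2 y1).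
move: ((1 - r) ^+ 4) ((1 - r) ^+ 3) ((1 - r) ^+ 2) (r ^+ 2) (r ^+ 3) (r ^+ 4) (y ^+ 2) ((1 - y) ^+ 2).
by move=> *; rewrite !addr_ge0 ?mulr_ge0.
Qed.

(** With [c] a cosine and [r = p^(-x)] this concerns the squared modulus of one factor of the
    inverse Euler product. It equals 1 at [r = 0] and decreases by the preceding lemma: a
    multiplicative form of [3 + 4 cos + cos 2 >= 0] that avoids the logarithm of the product. *)
Lemma product_341 r c : 0 <= r < 1 -> -1 <= c <= 1 ->
  (1 - r) ^+ 6 * (1 - 2 * r * c + r ^+ 2) ^+ 4 * (1 - 2 * r * (2 * c ^+ 2 - 1) + r ^+ 2) <= 1.
Proof.
move=> /andP[r0 r1] hc.
pose H x := (1 - x) ^+ 6 * (1 - 2 * x * c + x ^+ 2) ^+ 4 * (1 - 2 * x * (2 * c ^+ 2 - 1) + x ^+ 2).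
have dH (x : R) : is_derive x 1 H (- 2 * ((1 - x) ^+ 5 * (1 - 2 * x * c + x ^+ 2) ^+ 3 *
   (3 * (1 - 2 * x * c + x ^+ 2) * (1 - 2 * x * (2 * c ^+ 2 - 1) + x ^+ 2) +
   (1 - x) * (4 * (c - x) * (1 - 2 * x * (2 * c ^+ 2 - 1) + x ^+ 2) +
     (2 * c ^+ 2 - 1 - x) * (1 - 2 * x * c + x ^+ 2))))).
  by apply: is_derive_eq; rewrite /GRing.scale /=; ring.
suff : H r <= H 0 by rewrite /H subr0 !mulr0 !mul0r !subr0 expr0n !addr0 !expr1n !mulr1.
apply: (@ler0_derive1_le_cc R H 0 r) => //; try by rewrite in_itv /= ?lexx ?r0.
- move=> x; rewrite in_itv /= => /andP[x0 xr]; rewrite derive1E; have [_ ->] := dH x.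
  rewrite nmulr_rle0 //; apply: mulr_ge0; last first.
    by apply: log_derivative_341 => //; apply/andP; split; lra.
  move: hc => /andP[c0 c1].
  rewrite mulr_ge0 // exprn_ge0 //; first lra.
  by nra.
- by apply: derivable_within_continuous => x _; case: (dH x).
Qed.

End ThreeFourOne.

(** * The Euler product, zeros and lower bounds of zeta *)

Section EulerProduct.
Variable R : realType.
Local Notation C := R[i].
Implicit Types (s z w : C) (n m N p : nat).

(** The power with unshifted index and value 0 at 0, hence completely multiplicative. *)
Definition np s m : C := if m is m'.+1 then npow s m' else 0.

Lemma npM s p m : np s (p * m) = np s p * np s m.
Proof.
case: p => [|p]; first by rewrite mul0n mul0r.
case: m => [|m]; first by rewrite muln0 mulr0.
have -> : (p.+1 * m.+1 = (p.+1 * m.+1).-1.+1)%N by [].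
rewrite /np /npow; have -> : (p.+1 * m.+1).-1.+1 = (p.+1 * m.+1)%N by [].
by rewrite natrM cpowM ?ltr0n.
Qed.

Definition eprod N s : C := \prod_(0 <= p < N | prime p) (1 - np s p).
Definition eprimo N : nat := (\prod_(0 <= p < N | prime p) p)%N.

Lemma coprime_eprimo p N : prime p -> (N <= p)%N -> coprime p (eprimo N).
Proof.
move=> pp; elim: N => [|N ih] Np; first by rewrite /eprimo big_geq // coprimen1.
rewrite /eprimo big_mkcond big_nat_recr //= -big_mkcond /= coprimeMr ih ?(ltnW Np) //=.
case: ifP => pN; last by rewrite coprimen1.
by rewrite prime_coprime // gtnNdvd // prime_gt0.
Qed.

Lemma prime_dvd_eprimo p N : prime p -> (p < N)%N -> (p %| eprimo N)%N.
Proof.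
move=> pp pN; rewrite /eprimo (big_cat_nat (n := p)) ?(ltnW pN) //=.
by rewrite dvdn_mull // big_ltn_cond // pp dvdn_mulr.
Qed.

Lemma coprime_eprimo_large m N : (1 < m)%N -> coprime m (eprimo N) -> (N <= m)%N.
Proof.
move=> m1 cm; rewrite leqNgt; apply/negP => mN.
have pp := pdiv_prime m1.
have := prime_dvd_eprimo pp (leq_ltn_trans (pdiv_leq (ltnW m1)) mN).
move: cm => /(coprime_dvdl (pdiv_dvd m)); rewrite prime_coprime // => /negbTE -> //.
Qed.

Section GivenZeta.
Variable zeta : C -> C.
Hypothesis hzeta : is_riemann_zeta zeta.

(** The sieve of Eratosthenes: multiplying by [1 - p^(-s)] deletes the multiples of [p] from the
    Dirichlet series. *)
Lemma eprod_clim N s : 1 < RE s ->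
  clim (fun M => \sum_(0 <= m < M | coprime m (eprimo N)) np s m) (eprod N s * zeta s).
Proof.
move=> s1; elim: N => [|N ih].
  rewrite /eprod big_geq // mul1r.
  have H := @clim_sub _ _ _ predn _ (zeta_clim hzeta s1).
  apply: clim_ext (H _); last by move=> N; exists N.+1 => n; lia.
  move=> M; rewrite [RHS](eq_bigl xpredT); last by move=> m; rewrite /eprimo big_geq // coprimen1.
  case: M => [|M]; first by rewrite !big_geq.
  by rewrite [RHS]big_nat_recl //= add0r.
have [pN|pN] := boolP (prime N); last first.
  have E1 : eprimo N.+1 = eprimo N.
    by rewrite /eprimo big_mkcond big_nat_recr //= (negPf pN) muln1 -big_mkcond.
  have E2 : eprod N.+1 s = eprod N s.
    by rewrite /eprod big_mkcond big_nat_recr //= (negPf pN) mulr1 -big_mkcond.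
  by rewrite E1 E2.
have E1 : eprimo N.+1 = (N * eprimo N)%N.
  by rewrite /eprimo big_mkcond big_nat_recr //= pN mulnC -big_mkcond.
have E2 : eprod N.+1 s = eprod N s * (1 - np s N).
  by rewrite /eprod big_mkcond big_nat_recr //= pN -big_mkcond.
rewrite E1 E2.
have -> : eprod N s * (1 - np s N) * zeta s = eprod N s * zeta s - np s N * (eprod N s * zeta s) by ring.
have N0 := prime_gt0 pN.
pose f M := ((M + N.-1) %/ N)%N.
have cf : cofinal_nat f.
  by move=> K; exists (K * N)%N => n h; rewrite /f leq_divRL //; lia.
apply: clim_ext (climB ih (climZ (np s N) (clim_sub cf ih))) => M.
rewrite coprime_interval_split // /f.
have -> : ((0 + N.-1) %/ N = 0)%N by rewrite divn_small // add0n prednK.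
congr (_ - _); rewrite mulr_sumr; apply: eq_big => m.
  by rewrite coprimeMl (coprime_eprimo pN (leqnn N)).
by rewrite npM.
Qed.

(** After the sieve the term 1 is followed by nothing below [n + 2], since an integer above 1 free
    of small primes is large. *)
Lemma eprod_tail n s : 1 < RE s ->
  cabs (eprod n.+2 s * zeta s - 1) <= Kp (RE s - 1) * n.+2%:R `^ (- (RE s - 1)).
Proof.
move=> s1; apply: (@clim_le R _ _ 1 _ n.+2 _ (eprod_clim n.+2 s1)) => M nM.
have a0 : 0 < RE s - 1 by lra.
rewrite (big_cat_nat (n := 2%N)) //=; last by lia.
have -> : \sum_(0 <= m < 2 | coprime m (eprimo n.+2)) np s m = 1.
  rewrite big_mkcond /= big_nat_recr //= big_nat1 /= coprime1n npow0.
  by case: ifP => _; rewrite ?add0r ?addr0.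
rewrite addrAC subrr add0r; apply: (le_trans (cabs_sum _ _ _)).
rewrite (big_cat_nat (n := n.+2)) //=.
rewrite big1_seq ?add0r; last first.
  move=> m /andP[cm]; rewrite mem_index_iota => /andP[m2 mn].
  by have := coprime_eprimo_large m2 cm; lia.
case: M nM => [|M] // nM.
apply: le_trans (pow_tail a0 (_ : n.+1 <= M)%N) => //.
rewrite big_mkcond big_add1 /=; apply: ler_sum => m _.
have -> : - (1 + (RE s - 1)) = - RE s by ring.
by case: ifP => _; rewrite ?powR_ge0 // cabs_npow.
Qed.

Lemma eprod_zeta_clim s : 1 < RE s -> clim (fun n => eprod n.+2 s * zeta s) 1.
Proof.
move=> s1; have a0 : 0 < RE s - 1 by lra.
apply: (clim_squeeze (b := fun n => Kp (RE s - 1) * n.+2%:R `^ (- (RE s - 1)))).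
  by move=> n; exact: eprod_tail.
apply: rnullZ; first exact: ltW (Kp_gt0 a0).
by apply: (@rnull_sub _ _ succn _ (rnull_pow a0)) => N; exists N => n; exact: leqW.
Qed.

Lemma cabs_prod_le1 (I : Type) (rr : seq I) (P : pred I) (F : I -> C) :
  (forall i, P i -> cabs (F i) <= 1) -> cabs (\prod_(i <- rr | P i) F i) <= 1.
Proof.
move=> H; apply: (big_ind (fun z => cabs z <= 1)) => //; first by rewrite cabs1.
by move=> x y hx hy; rewrite cabsM mulr_ile1 ?cabs_ge0.
Qed.

Lemma np_prime_small s p : prime p -> 0 < RE s -> 0 < cabs (np s p) < 1.
Proof.
case: p => [|[|p]] // _ s0; rewrite /np cabs_npow powR_gt0 ?ltr0n //= powRN invf_lt1 ?powR_gt0 ?ltr0n //.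
have : 0 < RE s * ln (p.+2%:R : R) by rewrite mulr_gt0 // ln_gt0 // ltr1n.
by rewrite powRE ?ltr0n // -ltr_expR expR0.
Qed.

Lemma np_real (x : R) m : np x%:C m = (cabs (np x%:C m))%:C.
Proof.
case: m => [|m]; first by rewrite /= cabs0.
by rewrite /np cabs_npow /npow -rmorphN cpow_real ?ltr0n.
Qed.

Lemma cabs_np_Re s m : cabs (np (RE s)%:C m) = cabs (np s m).
Proof. by case: m => [|m] //=; rewrite !cabs_npow. Qed.

(** For [r = p^(- Re s)] the Euler factors satisfy [|1 - p^(-s)| (1 - r) <= (1 + r)(1 - r) <= 1]. *)
Lemma zeta_lower s : 1 < RE s -> 1 <= cabs (zeta s) * cabs (zeta (RE s)%:C).
Proof.
move=> s1; have := climM (eprod_zeta_clim s1) (eprod_zeta_clim (s := (RE s)%:C) s1).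
rewrite mulr1 => H; have := clim_abs_le _ H; rewrite cabs1; apply => n.
rewrite mulrACA !cabsM -[leRHS]mul1r -cabsM; apply: ler_wpM2r; first by rewrite mulr_ge0 ?cabs_ge0.
rewrite /eprod -big_split /=; apply: cabs_prod_le1 => p pp.
have /andP[r0 r1] := np_prime_small pp (lt_trans ltr01 s1).
have E : 1 - np (RE s)%:C p = (1 - cabs (np s p))%:C.
  by rewrite np_real cabs_np_Re rmorphB.
rewrite cabsM E cabs_real ger0_norm; last lra.
have h := cabsB 1 (np s p); rewrite cabs1 in h.
by have := cabs_ge0 (1 - np s p); nra.
Qed.

Lemma zeta_neq0 s : 1 < RE s -> zeta s != 0.
Proof.
move=> s1; apply/eqP => z; have := zeta_lower s1; rewrite z cabs0 mul0r; lra.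
Qed.

Lemma factor_341 (x t : R) p : prime p -> 0 < x ->
  cabs ((1 - np x%:C p) ^+ 3 * (1 - np (x +i* t) p) ^+ 4 * (1 - np (x +i* (2 * t)) p)) <= 1.
Proof.
move=> pp x0; case: p pp => [|[|p]] // pp.
pose r : R := p.+2%:R `^ (- x); pose th := t * ln (p.+2%:R : R).
have /andP[r0 r1] := np_prime_small (s := x%:C) pp x0.
rewrite /np cabs_npow /= -/r in r0 r1.
have rE : expR (- x * ln p.+2%:R) = r by rewrite /r powRE ?ltr0n.
have sq (y : R) : cabs (1 - np (x +i* y) p.+2) ^+ 2 = 1 - 2 * r * cos (y * ln p.+2%:R) + r ^+ 2.
  rewrite cabs_sqr ReB ImB /np /npow cpowE Re_cexp Im_cexp /=.
  have -> : - x * ln p.+2%:R - - y * 0 = - x * ln p.+2%:R by ring.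
  have -> : - x * 0 + - y * ln p.+2%:R = - (y * ln p.+2%:R) by ring.
  rewrite rE cosN sinN; have := cos2Dsin2 (y * ln p.+2%:R).
  move: (cos _) (sin _) => c s' h.
  have -> : (1 - r * c) ^+ 2 + (0 - r * - s') ^+ 2 = 1 - 2 * r * c + r ^+ 2 * (c ^+ 2 + s' ^+ 2) by ring.
  by rewrite h mulr1.
have r01 : 0 <= r < 1 by rewrite (ltW r0).
have c01 : -1 <= cos th <= 1 by rewrite cos_geN1 cos_le1.
have := product_341 r01 c01.
have E0 : cabs (1 - np x%:C p.+2) = 1 - r.
  have -> : 1 - np x%:C p.+2 = (1 - r)%:C by rewrite np_real /np cabs_npow rmorphB.
  by rewrite cabs_real ger0_norm //; lra.
have E1 := sq t; have E2 := sq (2 * t); rewrite -/th in E1.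
have e2 : cos (2 * t * ln p.+2%:R) = 2 * cos th ^+ 2 - 1.
  have -> : 2 * t * ln (p.+2%:R : R) = th + th by rewrite /th; ring.
  by rewrite cosD; have := cos2Dsin2 th; rewrite !expr2; lra.
rewrite e2 in E2; rewrite -E1 -E2 -E0 => h.
rewrite -(@ler_pXn2r _ 2) ?nnegrE ?cabs_ge0 // expr1n (cabsM (_ * _)) (cabsM (_ ^+ 3)) !cabsX.
have -> : (cabs (1 - np x%:C p.+2) ^+ 3 * cabs (1 - np (x +i* t) p.+2) ^+ 4 *
   cabs (1 - np (x +i* (2 * t)) p.+2)) ^+ 2 =
   cabs (1 - np x%:C p.+2) ^+ 6 * (cabs (1 - np (x +i* t) p.+2) ^+ 2) ^+ 4 *
   cabs (1 - np (x +i* (2 * t)) p.+2) ^+ 2; last by [].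
by move: (cabs _) (cabs _) (cabs _) => a b c; ring.
Qed.

Lemma zeta_341 (x t : R) : 1 < x ->
  1 <= cabs (zeta x%:C) ^+ 3 * cabs (zeta (x +i* t)) ^+ 4 * cabs (zeta (x +i* (2 * t))).
Proof.
move=> x1; have X (u : nat -> C) l k : clim u l -> clim (fun n => u n ^+ k) (l ^+ k).
  move=> H; elim: k => [|k ih]; first by under [X in clim X]eq_fun do rewrite expr0; exact: clim_cst.
  by apply: (@clim_ext _ (fun n => u n * u n ^+ k)); [move=> n; rewrite exprS|rewrite exprS; exact: climM].
have H0 := X _ _ 3%N (eprod_zeta_clim (s := x%:C) x1).
have H1 := X _ _ 4%N (eprod_zeta_clim (s := x +i* t) x1).
have H2 := eprod_zeta_clim (s := x +i* (2 * t)) x1.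
have := clim_abs_le _ (climM (climM H0 H1) H2); rewrite !expr1n !mulr1 cabs1; apply => n.
rewrite !exprMn.
have -> : eprod n.+2 x%:C ^+ 3 * zeta x%:C ^+ 3 * (eprod n.+2 (x +i* t) ^+ 4 * zeta (x +i* t) ^+ 4) *
   (eprod n.+2 (x +i* (2 * t)) * zeta (x +i* (2 * t))) =
   (eprod n.+2 x%:C ^+ 3 * eprod n.+2 (x +i* t) ^+ 4 * eprod n.+2 (x +i* (2 * t))) *
   (zeta x%:C ^+ 3 * zeta (x +i* t) ^+ 4 * zeta (x +i* (2 * t))) by ring.
rewrite cabsM [X in _ * X]cabsM (cabsM (_ ^+ 3)) !cabsX -[leRHS]mul1r.
apply: ler_wpM2r; first by rewrite !mulr_ge0 ?exprn_ge0 ?cabs_ge0.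
rewrite /eprod -!prodrXl -!big_split /=; apply: cabs_prod_le1 => p pp.
by apply: factor_341 => //; lra.
Qed.

(** A zero would make [zeta (1 + e + i t)] of order [e]. Its fourth power outweighs the cube of the
    pole at 1, so the product in [zeta_341] would tend to 0. *)
Lemma kz_line1_neq0 (t : R) : t != 0 -> kz (1 +i* t) != 0.
Proof.
move=> t0; apply/eqP => k0.
have [l Hl] : hol (@kz R) (1 +i* t) by apply: kz_hol => /=; lra.
have [d1 [d10 H1]] := cderiv_lip Hl; rewrite k0 in H1.
have [d2 [d20 H2]] := ccont_bounded (hol_ccont (@kz_hol R 1 ltac:(rewrite /=; lra))).
have [d3 [d30 H3]] := ccont_bounded (hol_ccont (@kz_hol R (1 +i* (2 * t)) ltac:(rewrite /=; lra))).
rewrite kz1 cabs1 in H2.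
pose A := 1 + cabs l; pose B := 1 + cabs (kz (1 +i* (2 * t))).
have A0 : 0 < A by rewrite ltr_pwDl ?cabs_ge0.
have B0 : 0 < B by rewrite ltr_pwDl ?cabs_ge0.
have tt : 0 < `|t| by rewrite normr_gt0.
(* Chosen so that the product of the three bounds [2 / e], [A e / |t|], [B / |t|], with exponents 3,
   4, 1, is exactly [e / D]. *)
pose D := `|t| ^+ 5 / (8 * A ^+ 4 * B).
have D0 : 0 < D by rewrite divr_gt0 ?exprn_gt0 // !mulr_gt0 ?exprn_gt0.
pose e := Num.min (D / 2) (Num.min (d1 / 2) (Num.min (d2 / 2) (d3 / 2))).
have e0 : 0 < e by rewrite /e !lt_min; apply/and4P; split; lra.
have e1 : e <= D / 2 by rewrite /e ge_min lexx.
have e2 : e <= d1 / 2 by rewrite /e !ge_min lexx !orbT.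
have e3 : e <= d2 / 2 by rewrite /e !ge_min lexx !orbT.
have e4 : e <= d3 / 2 by rewrite /e !ge_min lexx !orbT.
clearbody e.
have x1 : 1 < 1 + e by lra.
have ce : cabs (e%:C : C) = e by rewrite cabs_real ger0_norm // ltW.
have s1 : ((1 + e)%:C : C) = 1 + e%:C by rewrite rmorphD.
have s2 y : ((1 + e) +i* y : C) = (1 +i* y) + e%:C by apply: complex_ext => /=; rewrite ?addr0.
have g1 := H1 e%:C ltac:(rewrite ce; lra); rewrite -s2 ce subr0 -/A in g1.
have g2 := H2 e%:C ltac:(rewrite ce; lra); rewrite -s1 in g2.
have g3 := H3 e%:C ltac:(rewrite ce; lra); rewrite -s2 -/B in g3.
have := zeta_341 t x1.
have z0 : kz (1 + e)%:C = e%:C * zeta (1 + e)%:C.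
  by rewrite (kz_zeta_large hzeta) //; congr (_ * _); rewrite s1; ring.
have z1 y : kz ((1 + e) +i* y) = (e +i* y) * zeta ((1 + e) +i* y).
  rewrite (kz_zeta_large hzeta) //; congr (_ * _); apply: complex_ext => /=; ring.
have w0 : cabs (zeta (1 + e)%:C) <= 2 / e.
  by rewrite ler_pdivlMr // mulrC; move: g2; rewrite z0 cabsM ce; lra.
have w1 : cabs (zeta ((1 + e) +i* t)) <= A * e / `|t|.
  rewrite ler_pdivlMr //; apply: le_trans g1; rewrite z1 cabsM mulrC ler_wpM2r ?cabs_ge0 //.
  exact: (abs_Im_le (e +i* t)).
have w2 : cabs (zeta ((1 + e) +i* (2 * t))) <= B / `|t|.
  rewrite ler_pdivlMr //; apply: le_trans g3; rewrite z1 cabsM mulrC ler_wpM2r ?cabs_ge0 //.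
  apply: le_trans (abs_Im_le (e +i* (2 * t))) => /=; rewrite normrM ger0_norm //; lra.
move=> h; have : 1 <= (2 / e) ^+ 3 * (A * e / `|t|) ^+ 4 * (B / `|t|).
  apply: (le_trans h); apply: ler_pM; rewrite ?mulr_ge0 ?exprn_ge0 ?cabs_ge0 //.
  by apply: ler_pM; rewrite ?exprn_ge0 ?cabs_ge0 // lerXn2r ?nnegrE ?cabs_ge0 // ?mulr_ge0 ?invr_ge0 // ltW.
have -> : (2 / e) ^+ 3 * (A * e / `|t|) ^+ 4 * (B / `|t|) = e / D.
  rewrite /D; move: `|t| tt => T T0; field; by rewrite !gt_eqF ?mulr_gt0 ?exprn_gt0.
by rewrite ler_pdivlMr // mul1r; lra.
Qed.

End GivenZeta.
End EulerProduct.

(** * The Dirichlet series of qd *)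

Section SquareSeries.
Variable R : realType.
Local Notation C := R[i].
Implicit Types (s z w : C) (n m N k d M : nat).

Definition qcoef n : C := (qd R n.+1)%:C.
Definition qpart n : C := \sum_(0 <= j < n.+1) qcoef j.
(** The coefficients live on squares, so their partial sums are [O(sqrt n)] and the series is
    defined for [Re s > 1/2]. *)
Definition Dq s : C := dsum qpart s.

Lemma qpart_bound : pbound qpart 2 (1 / 2).
Proof.
move=> n; rewrite /qpart; have -> : \sum_(0 <= j < n.+1) qcoef j = (\sum_(0 <= j < n.+1) qd R j.+1)%:C.
  by rewrite rmorph_sum.
rewrite cabs_real ger0_norm ?sumr_ge0 // => [|j _]; last exact: qd_ge0.
exact: le_trans (sum_qd_sqrt R n.+1) (sqrt_succ_le R n).
Qed.

Lemma Dq_hol z : 1 / 2 < RE z -> hol Dq z.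
Proof. by move=> h; apply: (dsum_hol qpart_bound) => //; lra. Qed.

Lemma Dq_clim s : 1 / 2 < RE s -> clim (fun N => \sum_(0 <= j < N) qcoef j * npow s j) (Dq s).
Proof. by move=> h; apply: (dsum_dirichlet qpart_bound) => //; lra. Qed.

Lemma np_add s w m : np (s + w) m = np s m * np w m.
Proof. by case: m => [|m] /=; rewrite ?mul0r // /npow opprD cpowD. Qed.

Lemma np1V m : m != 0%N -> np (1 : C) m = m%:R^-1.
Proof. by case: m => // m _; rewrite /np /npow cpowN cpow_1r ?ltr0n // rmorph_nat. Qed.

Lemma qd_sum_np w N : \sum_(0 <= n < N.+1) (qd R n)%:C * np w n = \sum_(0 <= j < N) qcoef j * npow w j.
Proof. by rewrite big_nat_recl //= mulr0 add0r. Qed.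

Lemma qd_sum_squares w K : \sum_(0 <= n < K * K) (qd R n)%:C * np w n =
  \sum_(0 <= k < K | odd k) (sqwt R k)%:C * np (w + w) k.
Proof.
elim: K => [|K ih]; first by rewrite !big_geq.
rewrite (big_cat_nat (n := (K * K)%N)) //=; last by nia.
rewrite ih [RHS]big_mkcond big_nat_recr //= -big_mkcond /=; congr (_ + _).
rewrite big_ltn; last by nia.
rewrite big_nat big1 ?addr0; last first.
  move=> n /andP[n1 n2]; rewrite qd_nsqr ?mul0r // => k ok; apply/eqP => E.
  have h1 : (K < k)%N by nia.
  have h2 : (k < K.+1)%N by nia.
  lia.
case: ifP => oK; first by rewrite qd_sqr // npM np_add.
rewrite qd_nsqr ?mul0r // => k ok; apply/eqP => E.
have : odd (k * k) by rewrite oddM ok.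
by rewrite -E oddM oK.
Qed.

Lemma cofinal_sqr : cofinal_nat (fun K => (K * K).-1)%N.
Proof. by move=> N; exists N.+2 => n h; nia. Qed.

Lemma Dq_totient w : 1 / 2 < RE w ->
  clim (fun K => \sum_(0 <= k < K | odd k) (totient k)%:R * np (w + w + 1) k) (2 * Dq w).
Proof.
move=> h; have H := climZ 2 (clim_sub cofinal_sqr (Dq_clim h)).
have H' : clim (fun K => 2 * \sum_(0 <= k < K.+1 | odd k) (sqwt R k)%:C * np (w + w) k) (2 * Dq w).
  apply: clim_ext (clim_sub (_ : cofinal_nat succn) H); last by move=> N; exists N => n; exact: leqW.
  by move=> K; rewrite -qd_sum_squares -qd_sum_np prednK.
have H2 := clim_sub (_ : cofinal_nat predn) H'.
have {}H2 := H2 ltac:(by move=> N; exists N.+1 => n; lia).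
move=> e e0; have [N HN] := H2 e e0; exists (maxn N 1) => K; rewrite geq_max => /andP[NK K1].
have := HN K NK; rewrite prednK // mulr_sumr.
rewrite (eq_bigr (fun k => (totient k)%:R * np (w + w + 1) k)) // => k ok.
have k0 : (k != 0)%N by case: k ok.
have kn : k%:R != 0 :> C by rewrite pnatr_eq0.
rewrite /sqwt rmorphM /= fmorphV !rmorph_nat natrM (np_add (w + w) 1).
rewrite (np1V k0).
by field.
Qed.

Section GivenZeta.
Variable zeta : C -> C.
Hypothesis hzeta : is_riemann_zeta zeta.

Lemma zeta2_clim z : 1 < RE z -> clim (fun M => \sum_(0 <= m < M | odd m) np z m) (zeta2 zeta z).
Proof.
move=> z1; have := eprod_clim hzeta 3 z1.
have -> : eprimo 3 = 2 by rewrite /eprimo unlock.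
have -> : eprod 3 z * zeta z = zeta2 zeta z.
  by rewrite /zeta2 /eprod unlock /= mulr1.
by apply: clim_ext => M; apply: eq_bigl => m; rewrite coprimen2.
Qed.

Lemma zeta2_tail z D : 1 < RE z ->
  cabs (zeta2 zeta (z + 1) - \sum_(0 <= d < D.+1 | odd d) np (z + 1) d) <= Kp (RE z) * D.+1%:R `^ (- RE z).
Proof.
move=> z1; have z2 : 1 < RE (z + 1) by rewrite ReD /=; lra.
apply: (@clim_le R _ _ _ _ D.+1 _ (zeta2_clim z2)) => M DM.
rewrite (big_cat_nat (n := D.+1)) //= addrAC subrr add0r.
apply: (le_trans (cabs_sum _ _ _)); case: M DM => // M DM.
have r0 : 0 < RE z by lra.
apply: le_trans (pow_tail r0 (_ : D <= M)%N) => //.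
rewrite big_mkcond big_add1 /=; apply: ler_sum => m _.
case: ifP => _; rewrite ?powR_ge0 // cabs_npow ReD /= addrC; exact: lexx.
Qed.

(** The identity that [n] is the sum of [totient k] over its divisors, in truncated form;
    [(N + k - 1) / k] counts the [d] with [k d < N]. *)
Lemma totient_convolution z N :
  \sum_(0 <= n < N | odd n) np z n =
  \sum_(0 <= k < N | odd k) (totient k)%:R * np (z + 1) k *
     \sum_(0 <= d < (N + k.-1) %/ k | odd d) np (z + 1) d.
Proof.
transitivity (\sum_(0 <= n < N | odd n) \sum_(0 <= k < N | (k %| n)%N) (totient k)%:R * np (z + 1) n).
  rewrite big_nat_cond [RHS]big_nat_cond; apply: eq_bigr => n /andP[/andP[_ nN] on].
  have n0 : (n != 0)%N by case: n on {nN}.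
  rewrite -mulr_suml -natr_sum.
  have -> : (\sum_(0 <= k < N | (k %| n)%N) totient k = n)%N.
    rewrite -[RHS]cyclic.sum_totient_dvd -(big_mkord (fun k => k %| n)%N).
    rewrite [RHS](big_nat_widen _ _ N) //; apply: eq_bigl => k.
    by case: (boolP (k %| n)%N) => //= /dvdn_leq; rewrite lt0n n0 ltnS => ->.
  by rewrite np_add mulrCA (np1V n0) mulfV ?mulr1 // pnatr_eq0.
rewrite (exchange_big_dep xpredT) //= [RHS]big_mkcond; apply: eq_big_nat => k /andP[_ kN].
rewrite -mulr_sumr.
case: k kN => [|k] kN.
  by rewrite big1 ?mulr0 // => n /andP[on]; rewrite dvd0n => /eqP nE; rewrite nE in on.
have -> : \sum_(0 <= i < N | odd i && (k.+1 %| i)%N) np (z + 1) i =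
   \sum_(0 <= i < N | (i %% k.+1 == 0)%N && odd i) np (z + 1) i.
  by apply: eq_bigl => i; rewrite andbC.
rewrite (sum_residue_class (np (z + 1)) (fun i => odd i) N (ltn0Sn k)) subn0.
have [ok|ek] := boolP (odd k.+1).
  rewrite -mulrA; congr (_ * _); rewrite mulr_sumr; apply: eq_big => j.
    by rewrite addn0 oddM ok.
  by rewrite addn0 npM.
by rewrite big1 ?mulr0 // => j; rewrite addn0 oddM (negPf ek).
Qed.

(** In [totient_convolution] every inner sum is replaced by its limit. Because [k D >= N] for its
    length [D], each of the [N] replacements costs [O(N^(- Re z))], in total [O(N^(1 - Re z))],
    where [z = 2 w]. *)
Lemma Dq_zeta2 w : 1 / 2 < RE w -> 2 * Dq w * zeta2 zeta (w + w + 1) = zeta2 zeta (w + w).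
Proof.
move=> h; set z := w + w; have z1 : 1 < RE z by rewrite /z ReD; lra.
pose sg := RE z; pose b := zeta2 zeta (z + 1).
have HA := climM (Dq_totient h) (clim_cst b); rewrite -/z in HA.
have HT := zeta2_clim z1.
have sg0 : 0 < sg by rewrite /sg; lra.
have HD := climB HT HA.
suff H0 : clim (fun N => \sum_(0 <= n < N | odd n) np z n -
    (\sum_(0 <= k < N | odd k) (totient k)%:R * np (z + 1) k) * b) 0.
  by have /eqP := clim_unique HD H0; rewrite subr_eq0 => /eqP ->.
have b1 : 0 < sg - 1 by rewrite /sg; lra.
pose c := Kp sg; have c0 : 0 < c by exact: Kp_gt0.
suff key N : cabs (\sum_(0 <= n < N.+1 | odd n) np z n -
    (\sum_(0 <= k < N.+1 | odd k) (totient k)%:R * np (z + 1) k) * b) <= c * N.+1%:R `^ (- (sg - 1)).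
  move=> e e0; have [N HN] := rnullZ (ltW c0) (rnull_pow b1) e0.
  exists N.+1 => -[|n] // nN; rewrite subr0; apply: (le_trans (key n)); exact: HN.
rewrite totient_convolution mulr_suml -sumrB; apply: (le_trans (cabs_sum _ _ _)).
apply: (@le_trans _ _ (\sum_(0 <= k < N.+1 | odd k) c * N.+1%:R `^ (- sg))); last first.
  apply: (@le_trans _ _ (\sum_(0 <= k < N.+1) c * N.+1%:R `^ (- sg))).
    rewrite big_mkcond /=; apply: ler_sum => k _; case: ifP => // _.
    by rewrite mulr_ge0 ?powR_ge0 // ltW.
  rewrite sumr_const_nat subn0 -mulrnAr ler_wpM2l ?(ltW c0) // -mulr_natl.
  have p1 : N.+1%:R = N.+1%:R `^ 1 :> R by rewrite powRr1 ?ler0n.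
  by rewrite {1}p1 powRDp ?ltr0n // opprB addrC lexx.
rewrite big_nat_cond [leRHS]big_nat_cond; apply: ler_sum => k /andP[/andP[_ kN] ok].
case: k ok kN => // k ok kN.
rewrite -mulrBr /=.
have D0 : (0 < (N.+1 + k) %/ k.+1)%N by rewrite divn_gt0 //; lia.
have kD : (N.+1 <= k.+1 * ((N.+1 + k) %/ k.+1))%N.
  by have := divn_eq (N.+1 + k) k.+1; have := ltn_mod (N.+1 + k) k.+1; nia.
have /= := zeta2_tail ((N.+1 + k) %/ k.+1).-1 z1; rewrite prednK // -/b -/c -/sg => hb.
rewrite cabsM (cabsBC _ b).
have hk : cabs ((totient k.+1)%:R * np (z + 1) k.+1) <= k.+1%:R `^ (- sg).
  rewrite cabsM cabs_nat /np cabs_npow ReD /= -/sg opprD.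
  apply: (@le_trans _ _ (k.+1%:R * k.+1%:R `^ (- sg - 1))).
    by rewrite ler_wpM2r ?powR_ge0 // ler_nat totient_le.
  have p1 : k.+1%:R = k.+1%:R `^ 1 :> R by rewrite powRr1 ?ler0n.
  by rewrite {1}p1 powRDp ?ltr0n // addrC subrK.
apply: (le_trans (ler_pM (cabs_ge0 _) (cabs_ge0 _) hk hb)).
rewrite mulrCA ler_wpM2l ?(ltW c0) // -powRM ?ler0n // -natrM.
by apply: powR_nonpos_le; rewrite ?ltr0n ?ler_nat //; lra.
Qed.

End GivenZeta.
End SquareSeries.

(** * The sum of the reciprocal odd squares *)

Section OddReciprocalSquares.
Variable R : realType.
Local Notation C := R[i].

Lemma sin_le_id (x : R) : 0 <= x -> sin x <= x.
Proof.
move=> x0; pose f (y : R) := y - sin y.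
have df (y : R) : is_derive y 1 f (1 - cos y) by apply: is_derive_eq.
rewrite -subr_ge0; have -> : 0 = f 0 by rewrite /f sin0 subr0.
rewrite -/(f x); apply: (@ger0_derive1_le_cc R f 0 x) => //; try by rewrite in_itv /= lexx x0.
- move=> y _; rewrite derive1E; have [_ ->] := df y; rewrite subr_ge0; exact: cos_le1.
- by apply: derivable_within_continuous => y _; case: (df y).
Qed.

Definition ang n k : R := (2 * k + 1)%:R * pi / (2 ^ n.+2)%:R.

Lemma ang_itv n k : (k < 2 ^ n)%N -> 0 < ang n k < pi / 2.
Proof.
move=> kn; have p0 := pi_gt0 R; have d0 : 0 < (2 ^ n.+2)%:R :> R by rewrite ltr0n expn_gt0.
rewrite /ang; apply/andP; split; first by rewrite divr_gt0 // mulr_gt0 // ltr0n addn1.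
rewrite ltr_pdivrMr //.
have h : 2 * (2 * k + 1)%:R < (2 ^ n.+2)%:R :> R by rewrite -natrM ltr_nat !expnS; lia.
move: h p0; move: ((2 * k + 1)%:R : R) ((2 ^ n.+2)%:R : R) (pi : R) => q D P h P0; nra.
Qed.

Lemma ang_double n k : ang n.+1 k + ang n.+1 k = ang n k.
Proof.
rewrite /ang (expnS 2 n.+2) natrM; have d0 : (2 ^ n.+2)%:R != 0 :> R by rewrite pnatr_eq0 expn_eq0.
by move: ((2 ^ n.+2)%:R) d0 (pi : R) => d d0 p; field.
Qed.

Lemma ang_compl n k : (k < 2 ^ n)%N -> ang n.+1 (2 ^ n.+1 - k.+1) = pi / 2 - ang n.+1 k.
Proof.
move=> kn; have d0 : (2 ^ n)%:R != 0 :> R by rewrite pnatr_eq0 expn_eq0.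
rewrite /ang; have -> : (2 * (2 ^ n.+1 - k.+1) + 1)%:R = 4 * (2 ^ n)%:R - (2 * k + 1)%:R :> R.
  rewrite -natrM -natrB; last by lia.
  by congr (_%:R); rewrite expnS; lia.
rewrite !(expnS 2) !natrM; move: ((2 ^ n)%:R) d0 (pi : R) ((2 * k + 1)%:R) => d d0 p q.
by field.
Qed.

(** Complementary angles are paired and [1 / sin^2 x + 1 / cos^2 x = 4 / sin^2 (2 x)], so refining
    the angles multiplies the sum by 4. *)
Lemma sum_inv_sin2 n : \sum_(0 <= k < 2 ^ n) (sin (ang n k) ^+ 2)^-1 = 2 * (4 ^ n)%:R.
Proof.
elim: n => [|n ih].
  rewrite big_nat1 /ang mul1r; have -> : pi / (2 ^ 2)%:R = pi / 4 :> R by [].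
  have p4 : pi / 4 + pi / 4 = pi / 2 :> R by move: (pi : R) => p; field.
  have h1 := sin_pihalf R; rewrite -p4 sinD in h1.
  have h2 := cos2Dsin2 (pi / 4 : R).
  move: (sin _) (cos _) h1 h2 => s c h1 h2.
  have /eqP : (s - c) ^+ 2 = 0.
    have -> : (s - c) ^+ 2 = (c ^+ 2 + s ^+ 2) - (s * c + c * s) by ring.
    by rewrite h1 h2 subrr.
  rewrite sqrf_eq0 subr_eq0 => /eqP sc; rewrite -sc in h2.
  have -> : s ^+ 2 = 2^-1 by lra.
  by rewrite invrK mulr1.
rewrite expnS mul2n -addnn (big_cat_nat (n := (2 ^ n)%N)) ?leq_addr //=.
rewrite [X in _ + X](_ : _ = \sum_(0 <= k < 2 ^ n) (sin (ang n.+1 (2 ^ n.+1 - k.+1)) ^+ 2)^-1); last first.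
  rewrite -{1}(add0n (2 ^ n)%N) big_addn addnK big_nat_rev /= add0n.
  rewrite big_nat_cond [RHS]big_nat_cond; apply: eq_bigr => k /andP[/andP[_ kn] _].
  by congr ((sin (ang _ _) ^+ 2)^-1); rewrite expnS; lia.
rewrite -big_split /=.
transitivity (\sum_(0 <= k < 2 ^ n) 4 * (sin (ang n k) ^+ 2)^-1).
  rewrite big_nat_cond [RHS]big_nat_cond; apply: eq_bigr => k /andP[/andP[_ kn] _].
  rewrite ang_compl // -(opprB (ang n.+1 k)) sinN sinBpihalf opprK -(ang_double n k) sinD.
  have kn' : (k < 2 ^ n.+1)%N by rewrite expnS; lia.
  have /andP[a0 a1] := ang_itv kn'.
  have s0 : 0 < sin (ang n.+1 k) by apply: sin_gt0_pihalf; rewrite a0.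
  have c0 : 0 < cos (ang n.+1 k) by apply: cos_gt0_pihalf; rewrite a1 andbT; have := pi_gt0 R; lra.
  have e := cos2Dsin2 (ang n.+1 k).
  move: (sin _) (cos _) s0 c0 e => s c s0 c0 e.
  have -> : s * c + c * s = 2 * (s * c) by ring.
  have -> : (s ^+ 2)^-1 + (c ^+ 2)^-1 = (c ^+ 2 + s ^+ 2) / (s ^+ 2 * c ^+ 2) by field; rewrite !gt_eqF.
  by rewrite e; field; rewrite !gt_eqF.
by rewrite -mulr_sumr ih expnS natrM mulrCA.
Qed.

(** The lower end is the squared cotangent; both inequalities restate [x cos x <= sin x <= x]. *)
Lemma inv_sin2_sandwich (x : R) : 0 < x < pi / 2 ->
  (sin x ^+ 2)^-1 - 1 <= (x ^+ 2)^-1 <= (sin x ^+ 2)^-1.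
Proof.
move=> /andP[x0 x1].
have s0 : 0 < sin x by apply: sin_gt0_pihalf; rewrite x0.
have c0 : 0 < cos x by apply: cos_gt0_pihalf; rewrite x1 andbT; have := pi_gt0 R; lra.
have h1 := sin_le_id (ltW x0).
have h2 : x * cos x <= sin x by apply: xcos_le_sin; rewrite !ltW.
have e := cos2Dsin2 x.
move: (sin x) (cos x) s0 c0 h1 h2 e => s c s0 c0 h1 h2 e.
apply/andP; split; last by rewrite lef_pV2 ?posrE ?exprn_gt0 // lerXn2r ?nnegrE // ltW.
have -> : (s ^+ 2)^-1 - 1 = c ^+ 2 / s ^+ 2.
  have -> : c ^+ 2 = 1 - s ^+ 2 by rewrite -e addrK.
  by field; rewrite gt_eqF.
rewrite ler_pdivrMr ?exprn_gt0 // mulrC ler_pdivlMr ?exprn_gt0 // -exprMn mulrC.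
by rewrite lerXn2r ?nnegrE ?mulr_ge0 // ltW.
Qed.

Lemma odd_reciprocal_squares n :
  `|\sum_(0 <= k < 2 ^ n) ((2 * k + 1)%:R ^+ 2)^-1 - pi ^+ 2 / 8| <= pi ^+ 2 / 16 / (2 ^ n)%:R :> R.
Proof.
have p0 := pi_gt0 R.
pose S : R := \sum_(0 <= k < 2 ^ n) ((2 * k + 1)%:R ^+ 2)^-1; rewrite -/S.
pose X : R := \sum_(0 <= k < 2 ^ n) (ang n k ^+ 2)^-1.
have d0 : 0 < (2 ^ n)%:R :> R by rewrite ltr0n expn_gt0.
have XS : X = 16 * (2 ^ n)%:R ^+ 2 / pi ^+ 2 * S.
  rewrite /X /S mulr_sumr; apply: eq_bigr => k _; rewrite /ang !(expnS 2) !natrM.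
  have q0 : 0 < (2 * k + 1)%:R :> R by rewrite ltr0n addn1.
  move: ((2 * k + 1)%:R) q0 (pi : R) p0 ((2 ^ n)%:R) d0 => q q0 p p0 d d0.
  by field; rewrite !gt_eqF.
have h1 : X <= 2 * (4 ^ n)%:R.
  rewrite -sum_inv_sin2; apply: ler_sum_nat => k /andP[_ kn].
  by have /andP[] := inv_sin2_sandwich (ang_itv kn).
have h2 : 2 * (4 ^ n)%:R - (2 ^ n)%:R <= X.
  rewrite -sum_inv_sin2; have -> : (2 ^ n)%:R = \sum_(0 <= k < 2 ^ n) 1 :> R.
    by rewrite sumr_const_nat subn0.
  rewrite -sumrB; apply: ler_sum_nat => k /andP[_ kn].
  by have /andP[] := inv_sin2_sandwich (ang_itv kn).
have e4 : (4 ^ n)%:R = (2 ^ n)%:R ^+ 2 :> R by rewrite -natrX -expnM mulnC expnM.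
rewrite e4 in h1 h2; clearbody X S; subst X.
move: (pi : R) p0 ((2 ^ n)%:R : R) d0 h1 h2 {e4} => p p0 d d0 h1 h2.
have k0 : 0 < 16 * d ^+ 2 / p ^+ 2 by rewrite divr_gt0 ?mulr_gt0 ?exprn_gt0.
have e1 : 2 * d ^+ 2 = 16 * d ^+ 2 / p ^+ 2 * (p ^+ 2 / 8) by field; rewrite gt_eqF.
have e2 : 2 * d ^+ 2 - d = 16 * d ^+ 2 / p ^+ 2 * (p ^+ 2 / 8 - p ^+ 2 / 16 / d) by field; rewrite !gt_eqF.
rewrite e2 ler_pM2l // in h2; rewrite e1 ler_pM2l // in h1.
have : 0 <= p ^+ 2 / 16 / d by rewrite !divr_ge0 ?exprn_ge0 // ltW.
move=> q0; rewrite ler_norml; apply/andP; split; lra.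
Qed.

Lemma zeta2_at2 (zeta : C -> C) : is_riemann_zeta zeta -> zeta2 zeta 2 = (pi ^+ 2 / 8)%:C.
Proof.
move=> hz; have h2 : 1 < RE (2 : C) by rewrite Re_nat; lra.
have cf : cofinal_nat (fun n => 2 ^ n.+1)%N.
  move=> N; exists N => n Nn; apply: leq_trans (leq_trans Nn (leqnSn n)) _.
  by rewrite ltnW // ltn_expl.
have H := clim_sub cf (zeta2_clim hz h2).
apply: (clim_unique H).
have cp : 0 <= pi ^+ 2 / 16 :> R by rewrite divr_ge0 ?sqr_ge0.
apply: (clim_squeeze (b := fun n => pi ^+ 2 / 16 * n.+1%:R `^ (- 1))); last first.
  by apply: rnullZ => //; apply: rnull_pow.
move=> n.
have -> : \sum_(0 <= m < 2 ^ n.+1 | odd m) np (2 : C) m =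
   (\sum_(0 <= k < 2 ^ n) ((2 * k + 1)%:R ^+ 2)^-1)%:C.
  have E : \sum_(0 <= m < 2 ^ n.+1 | odd m) np (2 : C) m =
     \sum_(0 <= m < 2 ^ n.+1 | (m %% 2 == 1)%N && xpredT m) np (2 : C) m.
    by apply: eq_bigl => m; rewrite modn2 andbT; case: (odd m).
  rewrite E (sum_residue_class _ xpredT) // addn0 expnS mulKn // rmorph_sum.
  apply: eq_bigr => k _; rewrite addn1 /np /npow.
  have -> : (2 : C) = 1 + 1 by [].
  rewrite cpowN cpowD cpow_1r ?ltr0n //= fmorphV /= rmorphXn /= expr2.
  by [].
rewrite -rmorphB cabs_real; apply: (le_trans (odd_reciprocal_squares n)).
rewrite ler_wpM2l // powRN powRr1 ?ler0n // lef_pV2 ?posrE ?ltr0n ?expn_gt0 // ler_nat.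
exact: ltn_expl.
Qed.

End OddReciprocalSquares.

(** * Primitives and logarithms on squares *)

Section Logarithm.
Variable R : realType.
Local Notation C := R[i].
Implicit Types (z u w h : C) (f q : C -> C) (S r x : R).

Lemma insq_segment z S u x : insq z S u -> 0 <= x <= 1 -> insq z S (z + x%:C * (u - z)).
Proof.
move=> /andP[h1 h2] /andP[x0 x1]; rewrite /insq !ReD !ImD !ReM_real !ImM_real !ReB !ImB.
have e1 (a b : R) : a + b - a = b by ring.
rewrite !e1 !normrM (ger0_norm x0).
have k (y : R) : 0 <= y -> x * y <= y by move=> y0; rewrite ler_piMl.
by rewrite (le_trans (k _ (normr_ge0 _)) h1) (le_trans (k _ (normr_ge0 _)) h2).
Qed.

Lemma insq_le z S S' u : S <= S' -> insq z S u -> insq z S' u.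
Proof. by move=> h /andP[h1 h2]; rewrite /insq (le_trans h1 h) (le_trans h2 h). Qed.

Lemma insq_center z S : 0 <= S -> insq z S z.
Proof. by move=> h; rewrite /insq !subrr normr0 h. Qed.

Lemma cont_onM_cst (a b : R) (k : C) (f : R -> C) : cont_on a b f -> cont_on a b (fun t => k * f t).
Proof. exact: cont_onZ. Qed.

(** The primitive is the integral of [q] along the segment from [z] to [u], which stays in the
    square by convexity. Its derivative is an integral of [D], and [D x] is the derivative of
    [x q(v x)], so the integral is [q u]. *)
Lemma primitive_sq q z S r : 0 < r -> r < S -> (forall w, insq z S w -> hol q w) ->
  exists L, L z = 0 /\ forall u, insq z (S - r) u -> cderiv L u (q u).
Proof.
move=> r0 rS hq; have [dq [M [hdq HM]]] := taylor2 r0 rS hq.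
have M0 : 0 <= M.
  have zi : insq z (S - r) z by apply: insq_center; lra.
  have rr : cabs ((r / 2)%:C : C) <= r / 2 by rewrite cabs_real ger0_norm //; lra.
  have := le_trans (cabs_ge0 _) (HM z _ zi rr); rewrite pmulr_lge0 // exprn_gt0 // cabs_real normr_gt0.
  by rewrite gt_eqF //; lra.
have Dq u : insq z (S - r) u -> cderiv q u (dq u).
  move=> ui; apply: (@cderiv_quadratic R q u _ M (r / 2)); first lra.
  by move=> h hr; apply: HM => //; exact: ltW.
pose K (x : R) u := (u - z) * q (z + x%:C * (u - z)).
pose L u := cint 0 1 (fun x => K x u).
exists L; split.
  rewrite /L (@eq_cint R 0 1 _ (fun=> 0)).
    rewrite (@cint_FTC R 0 1 (fun=> 0)) ?subrr ?ler01 //; first by move=> t _; exact: rcderiv_cst.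
    by move=> t _; exact: rcderiv_cont (rcderiv_cst _ _).
  by move=> t _; rewrite /K subrr mul0r.
move=> u ui.
pose v (x : R) := z + x%:C * (u - z).
have vi x : 0 <= x <= 1 -> insq z (S - r) (v x) by move=> hx; exact: insq_segment.
pose D x := q (v x) + x%:C * ((u - z) * dq (v x)).
have rx x : rcderiv (fun y => y%:C : C) x 1.
  by split => /=; [exact: is_derive_id|exact: is_derive_cst].
have cqv x : 0 <= x <= 1 -> rccont (fun x => q (v x)) x.
  by move=> hx; apply: ccont_line; exact: cderiv_ccont (Dq _ (vi x hx)).
have cdv x : 0 <= x <= 1 -> rccont (fun x => dq (v x)) x.
  by move=> hx; apply: ccont_line; apply: hol_ccont; apply: hdq; exact: vi.
have dqv x : 0 <= x <= 1 -> rcderiv (fun x => q (v x)) x (dq (v x) * (u - z)).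
  by move=> hx; apply: cderiv_line; apply: Dq; exact: vi.
have cD : cont_on 0 1 D.
  (* [dd] selects a derivative of [dq] along the segment; it serves only to make [D] differentiable,
     hence continuous. *)
  have [dd [M' [hdd HM']]] : exists d2 : C -> C, exists M', (forall x, 0 <= x <= 1 -> cderiv dq (v x) (d2 (v x))) /\ (M' = 0 :> R).
    exists (fun w => xget 0 [set l | cderiv dq w l]); exists 0; split => // x hx.
    have [l Hl] := hdq _ (vi x hx).
    by apply: (@xgetPex _ 0 [set l | cderiv dq (v x) l]); exists l.
  move=> x hx; apply: (@rcderiv_cont R _ x (dq (v x) * (u - z) + (1 * ((u - z) * dq (v x)) + x%:C * ((u - z) * (dd (v x) * (u - z)))))).
  apply: rcderivD; first exact: dqv.
  apply: rcderivM; first exact: rx.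
  apply: rcderivZ; apply: cderiv_line; exact: hdd.
have ID : cint 0 1 D = q u.
  rewrite (@cint_FTC R 0 1 (fun x => x%:C * q (v x))) ?ler01 //.
    have -> : v 1 = u by rewrite /v mul1r addrC subrK.
    by rewrite mul1r mul0r subr0.
  move=> x hx; have := rcderivM (rx x) (dqv x hx); rewrite mul1r /D.
  by rewrite (mulrC (dq _)).
have [B HB] := cont_on_bounded (@ler01 R) (fun x hx => cdv x hx).
have B0 : 0 <= B := le_trans (cabs_ge0 _) (HB 0 ltac:(by rewrite lexx ler01)).
rewrite -ID; apply: (@cderiv_quadratic R L u _ (cabs (u - z) * M + (B + M * r)) (r / 2)); first lra.
have Mq : 0 <= cabs (u - z) * M + (B + M * r).
  by rewrite !addr_ge0 // mulr_ge0 ?cabs_ge0 // ltW.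
have := @cint_param_deriv R 0 1 K D u (cabs (u - z) * M + (B + M * r)) (r / 2) ler01 ltac:(lra) _ cD _.
move=> H h hr; have := H _ _ h hr; rewrite subr0 mulr1; apply.
- move=> k kr x hx; rewrite /K; apply: cont_onM_cst hx => t ht.
  apply: ccont_line; apply: hol_ccont; apply: hq; apply: insq_segment => //.
  by apply: (@insq_le z (S - r / 2)); [lra|apply: insq_shift => //; exact: ltW].
- move=> x k hx kr; rewrite /K /D.
  have xk : cabs (x%:C * k) <= cabs k.
    by case/andP: hx => x0 x1; rewrite cabsM cabs_real ger0_norm // ler_piMl ?cabs_ge0.
  have -> : z + x%:C * (u + k - z) = v x + x%:C * k by rewrite /v; ring.
  rewrite -/(v x).
  have h1 := HM _ (x%:C * k) (vi x hx) (le_trans xk (ltW kr)).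
  have -> : (u + k - z) * q (v x + x%:C * k) - (u - z) * q (v x) -
      (q (v x) + x%:C * ((u - z) * dq (v x))) * k =
      (u - z) * (q (v x + x%:C * k) - q (v x) - dq (v x) * (x%:C * k)) +
      k * ((q (v x + x%:C * k) - q (v x) - dq (v x) * (x%:C * k)) + dq (v x) * (x%:C * k)) by ring.
  move: (q (v x + _) - _ - _) h1 => E h1.
  have hE : cabs E <= M * cabs k ^+ 2.
    by apply: (le_trans h1); rewrite ler_wpM2l // lerXn2r ?nnegrE ?cabs_ge0.
  have hB := HB x hx; have k0 := cabs_ge0 k.
  apply: (le_trans (cabsD _ _)); rewrite (cabsM (u - z)) (cabsM k).
  have a1 : cabs (u - z) * cabs E <= cabs (u - z) * M * cabs k ^+ 2 by rewrite -mulrA ler_wpM2l ?cabs_ge0.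
  have a2 : cabs (E + dq (v x) * (x%:C * k)) <= (B + M * r) * cabs k.
    apply: (le_trans (cabsD _ _)); rewrite (cabsM (dq _)).
    have b1 : cabs (dq (v x)) * cabs (x%:C * k) <= B * cabs k by apply: ler_pM; rewrite ?cabs_ge0.
    have b2 : M * cabs k ^+ 2 <= M * r * cabs k.
      by rewrite expr2 -mulrA ler_wpM2l // ler_wpM2r //; lra.
    lra.
  have a3 := ler_wpM2l k0 a2; rewrite !expr2 in a1 *; lra.
Qed.

Lemma zero_deriv_segment f z S u : 0 <= S -> insq z S u -> (forall w, insq z S w -> cderiv f w 0) -> f u = f z.
Proof.
move=> S0 ui H.
have := @mean_value_cabs R (fun x => f (z + x%:C * (u - z))) (fun=> 0) 0 1 0 ler01.
have -> : z + 1%:C * (u - z) = u by rewrite mul1r addrC subrK.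
have -> : z + 0%:C * (u - z) = z by rewrite mul0r addr0.
rewrite mul0r => h.
apply/eqP; rewrite -subr_eq0 -cabs_eq0 eq_le cabs_ge0 andbT; apply: h.
- move=> t ht; have := cderiv_line (H _ (insq_segment ui ht)); by rewrite mul0r.
- by move=> t _; rewrite cabs0.
Qed.

(** [L] is a primitive of [f' / f], and [f exp (- L)] has derivative 0. *)
Lemma log_sq f z S r : 0 < r -> 0 < S -> (forall w, insq z (S + 2 * r) w -> hol f w) ->
  (forall w, insq z (S + 2 * r) w -> f w != 0) ->
  exists L, [/\ L z = 0, forall u, insq z S u -> hol L u &
    forall u, insq z S u -> f u = f z * cexp (L u)].
Proof.
move=> r0 S0 hf nf.
have rS : r < S + 2 * r by lra.
have [df [M [hdf HM]]] := taylor2 r0 rS hf.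
have E1 : S + 2 * r - r = S + r by ring.
rewrite E1 in hdf HM.
have sub u : insq z (S + r) u -> insq z (S + 2 * r) u by apply: insq_le; lra.
have sub' u : insq z S u -> insq z (S + r) u by apply: insq_le; lra.
pose q w := df w / f w.
have hq w : insq z (S + r) w -> hol q w.
  by move=> wi; apply: holM; [exact: hdf|apply: holV; [exact: nf (sub _ wi)|exact: hf (sub _ wi)]].
have [L [L0 HL]] := @primitive_sq q z (S + r) r r0 ltac:(lra) hq.
have E2 : S + r - r = S by ring.
rewrite E2 in HL; exists L; split => //.
  by move=> u ui; exists (q u); exact: HL.
move=> u ui.
have Df w : insq z (S + r) w -> cderiv f w (df w).
  move=> wi; apply: (@cderiv_quadratic R f w _ M (r / 2)); first lra.
  by move=> h hr; apply: HM => //; exact: ltW.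
have := @zero_deriv_segment (fun w => f w * cexp (- L w)) z S u (ltW S0) ui.
rewrite /= L0 oppr0 cexp0 mulr1 => H.
have {}H : f u * cexp (- L u) = f z.
  apply: H => w wi.
  have D1 := cderiv_comp (cderivM (cderiv_cst (-1) w) (HL w wi)) (cderiv_cexp _).
  have := cderivM (Df w (sub' _ wi)) D1.
  have E (y : C) : -1 * y = - y by rewrite mulN1r.
  rewrite !E mul0r add0r.
  have -> : df w * cexp (- L w) + f w * (cexp (- L w) * - q w) = 0.
    rewrite /q; have := nf _ (sub _ (sub' _ wi)) => fn.
    by move: (cexp _) => e; field.
  by apply: cderiv_ext => y; rewrite mulN1r.
by rewrite -H -mulrA cexpN mulr1.
Qed.

End Logarithm.

(** * Lower bounds for zeta, with and without the Riemann hypothesis *)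

Section RiemannHypothesisBound.
Variable R : realType.
Local Notation C := R[i].
Variable zeta : C -> C.
Hypothesis hzeta : is_riemann_zeta zeta.
Implicit Types (s : C).

Lemma zeta_upper (a : R) s : 0 < a -> 1 + a <= RE s -> cabs (zeta s) <= Kp a.
Proof.
move=> a0 sa; have s1 : 1 < RE s by lra.
apply: clim_abs_le (zeta_clim hzeta s1) => N.
apply: (le_trans (cabs_sum _ _ _)).
apply: (@le_trans _ _ (\sum_(0 <= n < N) n.+1%:R `^ (- (1 + a)))).
  by apply: ler_sum => n _; rewrite cabs_npow ler_powR ?ler1n //; lra.
by apply: (le_trans (pow_tail a0 (leq0n N))); rewrite powR1 mulr1.
Qed.

Lemma zeta_inv_bound (a : R) s : 0 < a -> 1 + a <= RE s -> cabs (zeta s)^-1 <= Kp a.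
Proof.
move=> a0 sa; have s1 : 1 < RE s by lra.
have h := zeta_lower hzeta s1; have h2 := @zeta_upper a (RE s)%:C a0 sa.
have z0 : 0 < cabs (zeta s) by rewrite cabs_gt0 zeta_neq0.
rewrite cabsV -[leLHS]mul1r ler_pdivrMr //; apply: (le_trans h).
by rewrite mulrC ler_wpM2r // ltW.
Qed.

Lemma kz_lower_right s : 2 <= RE s -> (Kp 1)^-1 <= cabs (@kz R s).
Proof.
move=> s2; have s1 : 1 < RE s by lra.
have k1 := @Kp_gt0 R 1 ltr01.
rewrite (kz_zeta_large hzeta s1) cabsM.
have h := zeta_inv_bound (@ltr01 R) (_ : 1 + 1 <= RE s); have {}h := h ltac:(lra).
have z0 : 0 < cabs (zeta s) by rewrite cabs_gt0 (zeta_neq0 hzeta).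
have e1 : 1 <= cabs (s - 1) by apply: le_trans (Re_le_cabs _); rewrite ReB /=; lra.
have e2 : (Kp 1)^-1 <= cabs (zeta s).
  by rewrite -[leRHS]invrK lef_pV2 ?posrE ?invr_gt0 // -cabsV.
by rewrite -[leLHS]mul1r ler_pM // ltW // invr_gt0.
Qed.

Hypothesis rh : riemann_hypothesis zeta.

Lemma kz_neq0_rh s : 1 / 2 < RE s -> @kz R s != 0.
Proof.
move=> s2; have [->|s1] := eqVneq s 1; first by rewrite kz1 oner_eq0.
have sn : s - 1 != 0 by rewrite subr_eq0.
have [lt1|gt1|eq1] := ltgtP (RE s) 1.
- rewrite (kz_zeta hzeta) //; last lra.
  rewrite mulf_neq0 //; apply/eqP => z0.
  by have := rh (_ : 0 < RE s < 1) z0; rewrite lt1 andbT => /(_ ltac:(lra)); lra.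
- by rewrite (kz_zeta_large hzeta) // mulf_neq0 // (zeta_neq0 hzeta).
- have -> : s = 1 +i* IM s by apply: complex_ext.
  apply: (kz_line1_neq0 hzeta); apply/eqP => i0; move/eqP: s1; apply.
  by apply: complex_ext.
Qed.

(** On a square about [2 + i t] without zeros, [kz] is the exponential of a function whose real part
    is at most [ln W], with [W] a power of [1 + |t|] up to a constant. Borel-Caratheodory bounds the
    modulus of that function by [kap * ln W], hence [1 / kz] by a power of [W]. *)
Lemma kz_lower_rh (d : R) : 0 < d < 1 -> exists A : R, exists m : nat, 0 <= A /\
  forall s, 1 / 2 + d <= RE s -> RE s <= 2 -> (cabs (@kz R s))^-1 <= A * (1 + `|IM s|) ^+ m.
Proof.
move=> /andP[d0 d1].
have [K K0 HK] := @kz_bound R 1 ltr01.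
(* The square reaches down to real part [1/2 + d/2], its margin [2 r] to [1/2 + d/4], still free of
   zeros, whereas [s] is within [3/2 - d = tau * S] of the centre. *)
pose S := 3 / 2 - d / 2; pose r := d / 8.
have S0 : 0 < S by rewrite /S; lra.
have r0 : 0 < r by rewrite /r; lra.
pose tau := (3 / 2 - d) / S.
have tau1 : tau < 1 by rewrite ltr_pdivrMr // mul1r /S; lra.
have tau0 : 0 <= tau by rewrite divr_ge0 ?(ltW S0) //; lra.
pose kap := 2 * tau / (1 - tau).
have t1' : 0 < 1 - tau by rewrite subr_gt0.
have kap0 : 0 <= kap by apply: divr_ge0; [exact: mulr_ge0|exact: ltW].
(* [216 = 6^3] stems from the cubic bound of [kz] and [1 + cabs w <= 6 (1 + |t|)] on the square; the
   maximum with 3 makes [ln W] positive. *)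
pose B := Num.max 3 (K * 216 * Kp 1).
have B3 : 3 <= B by rewrite le_max lexx.
have BK : K * 216 * Kp 1 <= B by rewrite le_max lexx orbT.
clearbody B.
have k1 := @Kp_gt0 R 1 ltr01.
pose m := Num.Def.archi_bound kap.
have km : kap <= m%:R by apply: ltW; exact: archi_boundP.
exists (Kp 1 * B ^+ m); exists (3 * m)%N; split.
  by rewrite mulr_ge0 ?exprn_ge0 ?(ltW k1) //; lra.
move=> s s1 s2; pose t := IM s; pose z : C := 2 +i* t.
have kzz : (Kp 1)^-1 <= cabs (kz z) by apply: kz_lower_right.
have kz0 : 0 < cabs (kz z) by apply: lt_le_trans kzz; rewrite invr_gt0.
have insR u (S' : R) : insq z S' u -> 2 - S' <= RE u.
  by move=> /andP[h _]; move: h; rewrite /= ler_norml => /andP[h _]; lra.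
have hf u : insq z (S + 2 * r) u -> hol (@kz R) u.
  by move/insR => h; apply: kz_hol; move: h; rewrite /S /r; lra.
have nf u : insq z (S + 2 * r) u -> @kz R u != 0.
  by move/insR => h; apply: kz_neq0_rh; move: h; rewrite /S /r; lra.
have [L [Lz hL LE]] := log_sq r0 S0 hf nf.
pose T := 1 + `|t|; have T1 : 1 <= T by rewrite /T lerDl.
pose W := B * T ^+ 3; have T3 : 1 <= T ^+ 3 by rewrite exprn_ege1.
have W3 : 3 <= W by rewrite /W -[leLHS]mulr1; apply: ler_pM.
have W0 : 0 < W by lra.
have lW : 0 < ln W by apply: ln_gt0; lra.
have ReL w : insq z S w -> RE (L w) <= ln W.
  move=> wi; have := LE w wi; move/(congr1 (@cabs R)); rewrite cabsM cabs_cexp => E.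
  rewrite -ler_expR lnK ?posrE // -(ler_pM2l kz0) -E.
  apply: (le_trans (HK w _)); first by have := insR _ _ wi; rewrite /S; lra.
  have wS : 1 + cabs w <= 6 * T.
    have h := insq_cabs wi; have h1 := cabsD z (w - z); have h2 := cabs_le_ReIm z.
    rewrite /= ger0_norm // -/t in h2; rewrite addrC subrK in h1.
    by rewrite /T; move: h; rewrite /S; have := normr_ge0 t; lra.
  have c0 : 0 <= 1 + cabs w by rewrite addr_ge0 ?cabs_ge0.
  have w3 : (1 + cabs w) ^+ 3 <= 216 * T ^+ 3.
    have -> : 216 * T ^+ 3 = (6 * T) ^+ 3 by rewrite exprMn; congr (_ * _); ring.
    by rewrite lerXn2r ?nnegrE //; lra.
  apply: (le_trans (ler_wpM2l K0 w3)).
  apply: (@le_trans _ _ ((Kp 1)^-1 * W)); last by rewrite ler_wpM2r // ltW.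
  rewrite ler_pdivlMl // /W (_ : Kp 1 * (K * (216 * T ^+ 3)) = K * 216 * Kp 1 * T ^+ 3); last by ring.
  by rewrite ler_wpM2r //; lra.
have us : cabs (s - z) <= tau * S.
  have -> : s - z = (RE s - 2)%:C by apply: complex_ext; rewrite ?ReB ?ImB /= /t ?subrr.
  rewrite cabs_real ler0_norm; last lra.
  by rewrite /tau divfK ?gt_eqF //; lra.
have t01 : 0 <= tau < 1 by rewrite tau0.
have bc := borel_caratheodory S0 lW t01 hL Lz ReL us.
have si : insq z S s.
  apply: cabs_insq; apply: (le_trans us); rewrite ler_piMl ?(ltW S0) // ltW //.
have := LE s si; move/(congr1 (@cabs R)); rewrite cabsM cabs_cexp => ->.
rewrite invfM -expRN.
have e1 : (cabs (kz z))^-1 <= Kp 1 by rewrite -[leRHS]invrK lef_pV2 ?posrE ?invr_gt0.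
have e2 : expR (- RE (L s)) <= W ^+ m.
  rewrite -powR_mulrn ?(ltW W0) // powRE // ler_expR.
  have h1 := le_trans (ler_norm _) (abs_Re_le (- L s)); rewrite ReN cabsN in h1.
  apply: (le_trans h1); apply: (le_trans bc).
  have -> : 2 * ln W * tau / (1 - tau) = kap * ln W by rewrite /kap; ring.
  by rewrite ler_wpM2r // ltW.
have -> : Kp 1 * B ^+ m * (1 + `|IM s|) ^+ (3 * m) = Kp 1 * W ^+ m.
  by rewrite /W exprMn -exprM -mulrA.
by apply: ler_pM; rewrite ?invr_ge0 ?cabs_ge0 ?expR_ge0.
Qed.

End RiemannHypothesisBound.

(** * Zeta and Dq integrated against X^w times a Mellin transform *)

Section LineFunctional.
Variable R : realType.
Local Notation C := R[i].
Implicit Types (phi : R -> R) (w z : C) (c X : R) (N n m : nat).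

Lemma mellin_ck phi (a : R) m : good phi -> exists2 D : R, 0 <= D & forall w, a <= RE w ->
  (1 + `|IM w|) ^+ m * cabs (mellin phi w) <= D * ck (IM w).
Proof.
move=> g; have [K K0 HK] := mellin_decay (m + 2) a g; exists K => // w aw.
have h := HK w aw; rewrite exprD mulrA in h.
rewrite ler_pdivlMr ?ck_den_gt0 //; apply: le_trans h; rewrite (mulrC (cabs _)).
rewrite ler_wpM2l ?mulr_ge0 ?cabs_ge0 ?exprn_ge0 ?addr_ge0 //.
have := normr_ge0 (IM w); have := real_normK (num_real (IM w)); nra.
Qed.

Lemma cabs_strip w (k : R) : `|RE w| <= k -> 0 <= k -> 1 + cabs w <= (1 + k) * (1 + `|IM w|).
Proof.
move=> h k0; have := cabs_le_ReIm w; have := normr_ge0 (IM w); nra.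
Qed.

Definition XM phi X w : C := cpow X w * mellin phi w.

Lemma XM_hol phi X z : good phi -> hol (XM phi X) z.
Proof. by move=> g; apply: holM; [exact: hol_cpow|exact: mellin_hol]. Qed.

Lemma XM_vdec phi X c f (A : R) m : good phi -> 0 < X -> 0 <= A -> (forall t, ccont f (c +i* t)) ->
  (forall t, cabs (f (c +i* t)) <= A * (1 + `|t|) ^+ m) -> vdec c (fun w => f w * XM phi X w).
Proof.
move=> g X0 A0 cf Hf.
have cp z : ccont (cpow X) z by apply: hol_ccont; exact: hol_cpow.
have V : vdec c (fun w => f w * cpow X w * mellin phi w).
  apply: (@mellin_vdec R phi c (fun w => f w * cpow X w) (A * X `^ c) m g).
  - by rewrite mulr_ge0 ?powR_ge0.
  - by move=> t; apply: ccontM.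
  - by move=> t; rewrite cabsM cabs_cpow // mulrAC; apply: ler_pM; rewrite ?cabs_ge0 ?powR_ge0.
by apply: vdec_ext V => w; rewrite /XM (mulrA (f w) (cpow X w) (mellin phi w)).
Qed.

Lemma npow_XM phi X n w : 0 < X -> npow w n * XM phi X w = cpow (n.+1%:R / X) (- w) * mellin phi w.
Proof.
move=> X0; rewrite /XM mulrA; congr (_ * _); rewrite cpowM ?ltr0n ?invr_gt0 //; congr (_ * _).
have := @cpow_powR R X (-1) (- w) X0; rewrite (powRN X 1) (powRr1 (ltW X0)) => ->.
by rewrite rmorphN1 mulrNN mul1r.
Qed.

Lemma npow_vdec phi X c n : good phi -> 0 < X -> vdec c (fun w => npow w n * XM phi X w).
Proof.
move=> g X0; apply: (@XM_vdec phi X c (fun w => npow w n) (n.+1%:R `^ (- c)) 0) => //.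
- by move=> t; apply: hol_ccont; exact: hol_npow.
- by move=> t; rewrite expr0 mulr1 cabs_npow.
Qed.

Lemma npow_line phi X c n : good phi -> 1 / 2 <= c -> 0 < X ->
  vline_integral c (fun w => npow w n * XM phi X w) = tpi R * (phi (n.+1%:R / X))%:C.
Proof.
move=> g c2 X0; rewrite -(mellin_inversion g c2) ?divr_gt0 ?ltr0n //.
by apply: eq_vline_integral => t; exact: npow_XM.
Qed.

Definition gph phi X n : C := (phi (n.+1%:R / X))%:C.

Lemma gph_large phi X N n : good phi -> 0 < X -> X <= N.+1%:R -> (N <= n)%N -> gph phi X n = 0.
Proof.
move=> g X0 XN Nn; rewrite /gph (good_out g) ?rmorph0 // negb_and -!leNgt; apply/orP; right.
rewrite ler_pdivlMr // mul1r; apply: (le_trans XN); by rewrite ler_nat.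
Qed.

Lemma dl_line phi X c n : good phi -> 1 / 2 <= c -> 0 < X ->
  vdec c (fun w => dl w n * XM phi X w) /\
  vline_integral c (fun w => dl w n * XM phi X w) = tpi R * (gph phi X n - gph phi X n.+1).
Proof.
move=> g c2 X0; have v0 := npow_vdec c n g X0; have v1 := vdecZ (-1) (npow_vdec c n.+1 g X0).
have E w : npow w n * XM phi X w + -1 * (npow w n.+1 * XM phi X w) = dl w n * XM phi X w.
  by rewrite /dl; ring.
split; first exact: vdec_ext E (vdecD v0 v1).
transitivity (vline_integral c (fun w => npow w n * XM phi X w + -1 * (npow w n.+1 * XM phi X w))).
  by apply: eq_vline_integral => t; rewrite E.
rewrite vline_integralD // vline_integralZ; last exact: npow_vdec.
by rewrite !npow_line // /gph; ring.
Qed.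

(** Truncating the series at [M] costs [O(M^(-b))] relative to [ck]. The differences of [gph] with
    index at least [N] vanish by the support of [phi], so the limit is a finite sum. *)
Lemma dsum_line phi X c (cc : nat -> C) (K a : R) : good phi -> 0 <= a -> a < c -> 1 / 2 <= c -> 0 < X ->
  pbound cc K a ->
  vdec c (fun w => dsum cc w * XM phi X w) /\
  forall N, X <= N.+1%:R -> vline_integral c (fun w => dsum cc w * XM phi X w) =
    tpi R * \sum_(0 <= n < N) cc n * (gph phi X n - gph phi X n.+1).
Proof.
move=> g a0 ac c2 X0 hc; have K0 := pbound_ge0 hc.
pose b := c - a; have b0 : 0 < b by rewrite /b; lra.
have Kb := Kp_gt0 b0.
have absw t : cabs (c +i* t) <= (1 + c) * (1 + `|t|).
  have := @cabs_strip (c +i* t) c; rewrite /= ger0_norm; last lra.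
  by move=> /(_ (lexx _) ltac:(lra)); lra.
have hab t : a + b <= RE (c +i* t) by rewrite /b /=; lra.
have h1 t : -1 <= RE (c +i* t) by rewrite /=; lra.
have vd : vdec c (fun w => dsum cc w * XM phi X w).
  apply: (@XM_vdec phi X c (dsum cc) (K * (1 + c) * Kp b) 1) => //.
  - have c0 : 0 <= 1 + c by lra.
    by rewrite mulr_ge0 ?(ltW Kb) // mulr_ge0.
  - by move=> t; apply: hol_ccont; apply: (dsum_hol hc a0).
  - move=> t; apply: (le_trans (dsum_bound hc b0 (hab t) (h1 t))); rewrite expr1 [leRHS]mulrAC.
    by rewrite ler_wpM2r ?(ltW Kb) // -[leRHS]mulrA ler_wpM2l.
split=> // N XN.
have [_ [D HD]] : vdec c (fun w => w * XM phi X w).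
  apply: (@XM_vdec phi X c (fun w => w) (1 + c) 1) => //; first lra.
  by move=> t; exact/hol_ccont/hol_id.
have D0 : 0 <= D.
  by have := le_trans (cabs_ge0 _) (HD 0); rewrite pmulr_lge0 // ck_gt0.
apply: vline_approx => // e e0.
have KD : 0 <= K * Kp b * D by rewrite (mulr_ge0 (mulr_ge0 K0 (ltW Kb))).
have [M0 HM0] := rnullZ KD (rnull_pow b0) e0.
pose M := maxn N M0.
exists (fun w => \sum_(0 <= n < M) cc n * (dl w n * XM phi X w)); split.
- by apply: vdec_sum => n; apply: vdecZ; exact: (dl_line n g c2 X0).1.
- move=> t; set w := c +i* t.
  have -> : \sum_(0 <= n < M) cc n * (dl w n * XM phi X w) = (\sum_(0 <= n < M) cc n * dl w n) * XM phi X w.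
    by rewrite mulr_suml; apply: eq_bigr => n _; rewrite mulrA.
  rewrite -mulrBl cabsM.
  have T := csum_tail M (dsum_tails hc b0 (hab t) (h1 t) (lexx _)).
  apply: (le_trans (ler_wpM2r (cabs_ge0 _) T)).
  have hd := HD t; rewrite cabsM -/w in hd.
  have -> : K * cabs w * Kp b * M.+1%:R `^ (- b) * cabs (XM phi X w) =
     K * Kp b * M.+1%:R `^ (- b) * (cabs w * cabs (XM phi X w)) by ring.
  have k0 : 0 <= K * Kp b * M.+1%:R `^ (- b) by rewrite (mulr_ge0 (mulr_ge0 K0 (ltW Kb))) ?powR_ge0.
  apply: (le_trans (ler_wpM2l k0 hd)); rewrite mulrA ler_wpM2r ?(ltW (ck_gt0 _)) //.
  by rewrite mulrAC; apply: HM0; rewrite leq_max leqnn orbT.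
- rewrite vline_integral_sum; last by move=> n; apply: vdecZ; exact: (dl_line n g c2 X0).1.
  have E n : vline_integral c (fun w => cc n * (dl w n * XM phi X w)) =
     tpi R * (cc n * (gph phi X n - gph phi X n.+1)).
    have [v1 e1] := dl_line n g c2 X0.
    by rewrite vline_integralZ // e1 mulrCA.
  rewrite (eq_bigr _ (fun n _ => E n)) -mulr_sumr (big_cat_nat (n := N)) ?leq_maxl //=.
  have -> : \sum_(N <= n < M) cc n * (gph phi X n - gph phi X n.+1) = 0.
    rewrite big_nat big1 // => n /andP[Nn _].
    by rewrite !(gph_large g X0 XN) ?subrr ?mulr0 //; exact: leqW.
  by rewrite addr0 subrr cabs0 ltW.
Qed.

Lemma by_parts_gph phi X (bb : nat -> C) N : good phi -> 0 < X -> X <= N.+1%:R ->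
  \sum_(0 <= n < N) (\sum_(0 <= j < n.+1) bb j) * (gph phi X n - gph phi X n.+1) =
  \sum_(0 <= j < N) bb j * gph phi X j.
Proof.
by move=> g X0 XN; rewrite [RHS]summation_by_parts (gph_large g X0 XN (leqnn N)) mulr0 addr0.
Qed.

Definition Qsum phi X N : C := \sum_(0 <= j < N) qcoef R j * gph phi X j.
Definition Ssum phi X N : C := \sum_(0 <= j < N) gph phi X j.

Lemma Dq_line phi X c : good phi -> 1 / 2 < c -> 0 < X ->
  vdec c (fun w => Dq w * XM phi X w) /\
  forall N, X <= N.+1%:R -> vline_integral c (fun w => Dq w * XM phi X w) = tpi R * Qsum phi X N.
Proof.
move=> g c2 X0.
have h0 : 0 <= 1 / 2 :> R by lra.
have [v H] := @dsum_line phi X c (@qpart R) 2 (1 / 2) g h0 c2 (ltW c2) X0 (@qpart_bound R).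
by split=> // N XN; rewrite (H N XN); congr (_ * _); exact: by_parts_gph.
Qed.

Section GivenZeta.
Variable zeta : C -> C.
Hypothesis hzeta : is_riemann_zeta zeta.

Lemma ones_pbound : pbound (fun n => \sum_(0 <= j < n.+1) (1 : C)) 1 1.
Proof.
by move=> n; rewrite sumr_const_nat subn0 cabs_nat mul1r powRr1 ?ler0n.
Qed.

Lemma zeta_dsum w : 1 < RE w -> zeta w = dsum (fun n => \sum_(0 <= j < n.+1) (1 : C)) w.
Proof.
move=> w1; apply: (clim_unique (zeta_clim hzeta w1)).
apply: clim_ext (dsum_dirichlet ones_pbound ler01 w1) => N.
by apply: eq_bigr => j _; rewrite mul1r.
Qed.

Lemma kz_strip_bound : exists2 K : R, 0 <= K & forall w, -1 / 2 <= RE w <= 2 ->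
  cabs (@kz R w) <= K * (1 + `|IM w|) ^+ 3.
Proof.
have [K K0 HK] := @kz_bound R (1 / 2) ltac:(lra).
exists (K * 27) => [|w /andP[w0 w1]]; first by rewrite mulr_ge0.
apply: (le_trans (HK w _)); first lra.
rewrite -mulrA ler_wpM2l //.
have -> : 27 * (1 + `|IM w|) ^+ 3 = ((1 + 2) * (1 + `|IM w|)) ^+ 3 by rewrite exprMn; congr (_ * _); ring.
rewrite lerXn2r ?nnegrE ?mulr_ge0 ?addr_ge0 ?cabs_ge0 //.
by apply: cabs_strip => //; rewrite ler_norml; apply/andP; split; lra.
Qed.

(** On the line at 2 the series may be integrated termwise; moving back across the pole at 1
    subtracts the residue. *)
Lemma zeta_line phi X c : good phi -> 1 / 2 <= c < 1 -> 1 <= X ->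
  vdec c (fun w => zeta w * XM phi X w) /\
  forall N, X <= N.+1%:R -> vline_integral c (fun w => zeta w * XM phi X w) =
    tpi R * (Ssum phi X N - X%:C * mellin phi 1).
Proof.
move=> g /andP[c2 c1] X1; have X0 : 0 < X by lra.
have [K K0 HK] := kz_strip_bound.
have n1 t : (c +i* t : C) != 1 by apply/eqP => /(congr1 (fun z => RE z)) /=; lra.
have zE t : zeta (c +i* t) = kz (c +i* t) / (c +i* t - 1).
  rewrite (kz_zeta hzeta) //=; last lra.
  by rewrite mulrC mulKf // subr_eq0.
have vd : vdec c (fun w => zeta w * XM phi X w).
  apply: (@XM_vdec phi X c zeta (K / (1 - c)) 3) => //.
  - by rewrite divr_ge0 //; lra.
  - by move=> t; apply: hol_ccont; exact: (zeta_hol hzeta).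
  - move=> t; rewrite zE cabsM cabsV mulrAC; apply: ler_pM; rewrite ?cabs_ge0 ?invr_ge0 ?cabs_ge0 //.
      by apply: (HK (c +i* t)); rewrite /=; apply/andP; split; lra.
    have q : 1 - c <= cabs (c +i* t - 1).
      by apply: le_trans (abs_Re_le _); rewrite ReB /= distrC; exact: ler_norm.
    by rewrite lef_pV2 ?posrE //; lra.
split=> // N XN.
pose G w := @kz R w * XM phi X w.
have [D D0 HD] := mellin_ck c 3 g.
have := @contour_shift_pole R c 2 G 1 (K * X `^ 2 * D).
have e2 : vline_integral 2 (fun z => G z / (z - 1)) = tpi R * Ssum phi X N.
  have h12 : 1 < 2 :> R by lra.
  have h22 : 1 / 2 <= 2 :> R by lra.
  have [_ H2] := @dsum_line phi X 2 _ 1 1 g ler01 h12 h22 X0 ones_pbound.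
  have := H2 N XN; rewrite by_parts_gph // => E.
  rewrite (_ : \sum_(0 <= j < N) 1 * gph phi X j = Ssum phi X N) in E; last first.
    by apply: eq_bigr => j _; rewrite mul1r.
  rewrite -E; apply: eq_vline_integral => t.
  rewrite -zeta_dsum /=; last lra.
  rewrite /G (kz_zeta_large hzeta) /=; last lra.
  have n2 : (2 +i* t - 1 : C) != 0.
    by rewrite subr_eq0; apply/eqP => /(congr1 (fun z => RE z)) /=; lra.
  by move: (2 +i* t - 1) n2 (zeta _) (XM _ _ _) => a n2 b d; field.
have ec : vline_integral c (fun z => G z / (z - 1)) = vline_integral c (fun w => zeta w * XM phi X w).
  by apply: eq_vline_integral => t; rewrite zE /G mulrAC.
have G1 : G 1 = X%:C * mellin phi 1 by rewrite /G kz1 mul1r /XM (cpow_1r X0).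
rewrite e2 ec G1 => H.
rewrite mulrBr -H ?subKr //.
- by rewrite /= c1; lra.
- by rewrite !mulr_ge0 ?powR_ge0.
- by move=> z /andP[z1 _]; apply: holM; [apply: kz_hol; lra|exact: XM_hol].
- move=> z /andP[z1 z2]; rewrite /G /XM (cabsM (kz z)) (cabsM (cpow X z)) cabs_cpow //.
  have h1 := HK z ltac:(apply/andP; split; lra).
  have h2 : X `^ RE z <= X `^ 2 by rewrite ler_powR.
  have h3 := HD z z1.
  apply: (le_trans (ler_wpM2r _ h1)); first by rewrite mulr_ge0 ?powR_ge0 ?cabs_ge0.
  have -> : K * (1 + `|IM z|) ^+ 3 * (X `^ RE z * cabs (mellin phi z)) =
     K * X `^ RE z * ((1 + `|IM z|) ^+ 3 * cabs (mellin phi z)) by ring.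
  rewrite -[leRHS]mulrA; apply: ler_pM => //; rewrite ?mulr_ge0 ?powR_ge0 ?cabs_ge0 ?exprn_ge0 ?addr_ge0 //.
  by rewrite ler_wpM2l.
Qed.

(** This is [(w - 1/2) Dq w], expressed through [kz] so that it remains holomorphic to the left of
    1/2. *)
Definition gq w : C := (1 - cpow 2 (- (w + w))) * kz (w + w) * ((w + w) / kz (w + w + 1)) /
  (4 * (1 - cpow 2 (- (w + w + 1)))).

Lemma two_pow_lt1 z : 0 < RE z -> cabs (cpow 2 (- z)) < 1.
Proof.
by move=> z0; rewrite cabs_cpow // ReN powRE // -[ltRHS]expR0 ltr_expR mulNr oppr_lt0 mulr_gt0 ?ln_gt0 ?ltr1n.
Qed.

Lemma two_pow_neq0 z : 0 < RE z -> 1 - cpow 2 (- z) != 0.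
Proof.
move=> z0; have := two_pow_lt1 z0; apply: contraTneq => /eqP; rewrite subr_eq0 => /eqP <-.
by rewrite cabs1 ltxx.
Qed.

Lemma gq_Dq w : 1 / 2 < RE w -> Dq w = gq w / (w - 2^-1).
Proof.
move=> w2; have E := Dq_zeta2 hzeta w2.
have r1 : 1 < RE (w + w) by rewrite ReD; lra.
have r2 : 1 < RE (w + w + 1) by rewrite !ReD /=; lra.
have z2 := zeta_neq0 hzeta r2.
have p2 : 1 - cpow 2 (- (w + w + 1)) != 0 by apply: two_pow_neq0; lra.
have n1 : w + w - 1 != 0 by rewrite subr_eq0; apply/eqP => /(congr1 (fun z => RE z)) /=; lra.
have n2 : w + w != 0 by apply/eqP => /(congr1 (fun z => RE z)) /=; lra.
have n3 : w - 2^-1 != 0.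
  have -> : w - 2^-1 = (w + w - 1) / 2 by field.
  by rewrite mulf_neq0 // invr_eq0 pnatr_eq0.
rewrite /gq !(kz_zeta_large hzeta) //.
have -> : w + w + 1 - 1 = w + w by ring.
move: E; rewrite /zeta2; move: (1 - cpow 2 (- (w + w + 1))) p2 (1 - cpow 2 (- (w + w))) => p p2 q.
move: (zeta (w + w + 1)) z2 (zeta (w + w)) => zb z2 za E.
have -> : Dq w = q * za / (2 * (p * zb)).
  by rewrite -E; field; rewrite ?z2 ?p2.
have -> : w - 2^-1 = (w + w - 1) / 2 by field.
by field; rewrite ?n1 ?n2 ?z2 ?p2.
Qed.

Lemma gq_half : gq 2^-1 = ((pi ^+ 2)^-1)%:C.
Proof.
have h : 2^-1 + 2^-1 = 1 :> C by field.
have r2 : 1 < RE (1 + 1 : C) by rewrite ReD /=; lra.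
rewrite /gq h kz1 (kz_zeta_large hzeta r2).
have -> : 1 + 1 - 1 = 1 :> C by ring.
have z0 := zeta_neq0 hzeta r2.
have p2 : 1 - cpow 2 (- (1 + 1)) != 0 :> C by apply: two_pow_neq0; rewrite ReD /=; lra.
have e1 : 1 - cpow 2 (- 1) = 2^-1 :> C.
  by rewrite cpowN cpow_1r // real_complex2; field.
have E : (1 - cpow 2 (- (1 + 1))) * zeta (1 + 1) = (pi ^+ 2 / 8)%:C := zeta2_at2 hzeta.
rewrite e1.
have p0 : pi != 0 :> R by rewrite gt_eqF // pi_gt0.
have -> : ((pi ^+ 2)^-1)%:C = 8^-1 * ((pi ^+ 2 / 8)%:C)^-1 :> C.
  rewrite -fmorphV /= invf_div rmorphM /= rmorph_nat mulrA mulVf ?mul1r // pnatr_eq0.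
by rewrite -E; field; rewrite ?z0 ?p2.
Qed.

(* [c] is the abscissa to which the line of integration can be moved. *)
Definition shift_ok (c : R) := exists A : R, exists m : nat, 0 <= A /\ forall w, c <= RE w <= 3 / 4 ->
  kz (w + w + 1) != 0 /\ cabs ((w + w) / kz (w + w + 1)) <= A * (1 + `|IM w|) ^+ m.

Lemma shift_ok_uncond (e : R) : 0 < e -> shift_ok e.
Proof.
move=> e0; have e2 : 0 < 2 * e by lra.
exists (Kp (2 * e)); exists 0%N; split; first exact: ltW (Kp_gt0 e2).
move=> w /andP[ew _].
have r2 : 1 < RE (w + w + 1) by rewrite !ReD /=; lra.
have z2 := zeta_neq0 hzeta r2.
have n2 : w + w != 0 by apply/eqP => /(congr1 (fun z => RE z)) /=; rewrite ReD; lra.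
rewrite (kz_zeta_large hzeta r2) (_ : w + w + 1 - 1 = w + w); last by ring.
split; first by rewrite mulf_neq0.
rewrite expr0 mulr1 (_ : (w + w) / ((w + w) * zeta (w + w + 1)) = (zeta (w + w + 1))^-1).
  by apply: (zeta_inv_bound hzeta) => //; rewrite !ReD /=; lra.
by move: (w + w) n2 z2 => a n2 z2; field; rewrite n2 z2.
Qed.

(** For [Re w >= - 1/4 + e] the argument [2 w + 1] has real part at least [1/2 + 2 e], where
    [kz_lower_rh] applies; beyond real part 2 the Euler product takes over. *)
Lemma shift_ok_rh (e : R) : 0 < e < 1 / 4 -> riemann_hypothesis zeta -> shift_ok (- 4^-1 + e).
Proof.
move=> /andP[e0 e1] rh.
have d01 : 0 < 2 * e < 1 by apply/andP; split; lra.
have [A [m [A0 HA]]] := kz_lower_rh hzeta rh d01.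
have k1 := @Kp_gt0 R 1 ltr01.
exists ((A * 2 ^+ m + Kp 1) * 4); exists m.+1; split.
  by rewrite mulr_ge0 // addr_ge0 ?mulr_ge0 ?exprn_ge0 // ltW.
move=> w /andP[ew w34].
have r2 : 1 / 2 + 2 * e <= RE (w + w + 1) by rewrite !ReD /=; lra.
split; first by apply: (kz_neq0_rh hzeta rh); lra.
pose T := 1 + `|IM w|; have T1 : 1 <= T by rewrite /T lerDl.
have h1 : cabs (w + w) <= 4 * T.
  have := cabsD w w; have := @cabs_strip w (3 / 4); rewrite -/T.
  have hn : `|RE w| <= 3 / 4 by rewrite ler_norml; apply/andP; split; lra.
  by move=> /(_ hn ltac:(lra)); lra.
have h2 : (cabs (kz (w + w + 1)))^-1 <= (A * 2 ^+ m + Kp 1) * T ^+ m.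
  have Tm : 1 <= T ^+ m by exact: exprn_ege1.
  have [le2|gt2] := lerP (RE (w + w + 1)) 2.
    apply: (le_trans (HA _ r2 le2)).
    have i2 : 1 + `|IM (w + w + 1)| <= 2 * T.
      rewrite !ImD /= addr0 /T; have := ler_normD (IM w) (IM w); lra.
    have : (1 + `|IM (w + w + 1)|) ^+ m <= (2 * T) ^+ m.
      by rewrite lerXn2r ?nnegrE ?addr_ge0 //; lra.
    rewrite exprMn => h; apply: (le_trans (ler_wpM2l A0 h)).
    rewrite mulrA ler_wpM2r ?exprn_ge0 //; lra.
  have := kz_lower_right hzeta (ltW gt2) => h.
  have k0 : 0 < cabs (kz (w + w + 1)) by apply: lt_le_trans h; rewrite invr_gt0.
  apply: (@le_trans _ _ (Kp 1)); first by rewrite -[leRHS]invrK lef_pV2 ?posrE ?invr_gt0.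
  have : 0 <= A * 2 ^+ m by rewrite mulr_ge0 ?exprn_ge0.
  move: (A * 2 ^+ m) (T ^+ m) Tm => p q q1 p0.
  by nra.
rewrite cabsM cabsV exprS.
have -> : (A * 2 ^+ m + Kp 1) * 4 * ((1 + `|IM w|) * (1 + `|IM w|) ^+ m) =
  4 * T * ((A * 2 ^+ m + Kp 1) * T ^+ m) by rewrite -/T; ring.
by apply: ler_pM; rewrite ?cabs_ge0 ?invr_ge0 ?cabs_ge0.
Qed.

Lemma gq_bound (c : R) : - (1 / 4) <= c -> shift_ok c -> exists A : R, exists m : nat, 0 <= A /\
  forall w, c <= RE w <= 3 / 4 -> hol gq w /\ cabs (gq w) <= A * (1 + `|IM w|) ^+ m.
Proof.
move=> c4 [A [m [A0 HA]]]; have [K K0 HK] := kz_strip_bound.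
(* A lower bound for the Euler factor at 2 in the denominator of [gq], because [- 1/4 <= c] keeps
   [Re (2 w + 1)] at least [1/2]. *)
pose kap : R := 1 - 2 `^ (- (1 / 2)).
have kap0 : 0 < kap.
  by rewrite /kap subr_gt0 powRE // -[ltRHS]expR0 ltr_expR mulNr oppr_lt0 mulr_gt0 ?divr_gt0 ?ln_gt0 ?ltr1n.
exists (3 * (K * 8) * A / (4 * kap)); exists (3 + m)%N; split.
  by rewrite divr_ge0 ?mulr_ge0 // ltW.
move=> w wc; have [kn kb] := HA w wc; have /andP[cw w34] := wc.
have r2 : 1 / 2 <= RE (w + w + 1) by rewrite !ReD /=; lra.
have p2 : 1 - cpow 2 (- (w + w + 1)) != 0 by apply: two_pow_neq0; lra.
have hw : hol (fun w : C => w + w) w by apply: holD; exact: hol_id.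
have hw1 : hol (fun w : C => w + w + 1) w by apply: holD => //; exact: hol_cst.
have hp (f : C -> C) : hol f w -> hol (fun w => 1 - cpow 2 (- f w)) w.
  move=> hf; apply: holB; first exact: hol_cst.
  exact: (hol_comp (holN hf) (hol_cpow 2 _)).
split.
  apply: holM; last first.
    apply: holV; first by rewrite mulf_neq0 // pnatr_eq0.
    by apply: holM; [exact: hol_cst|exact: hp].
  apply: holM.
    apply: holM; first exact: hp.
    by apply: (hol_comp hw); apply: kz_hol; rewrite ReD; lra.
  apply: holM => //; apply: holV => //.
  by apply: (hol_comp hw1); apply: kz_hol; lra.
pose T := 1 + `|IM w|; have T1 : 1 <= T by rewrite /T lerDl.
have h1 : cabs (1 - cpow 2 (- (w + w))) <= 3.
  apply: (le_trans (cabsB _ _)); rewrite cabs1 cabs_cpow // ReN.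
  suff : 2 `^ (- RE (w + w)) <= 2 :> R by lra.
  by rewrite -[leRHS]powRr1 // ler_powR ?ler1n // ReD; lra.
have h2 : cabs (kz (w + w)) <= K * 8 * T ^+ 3.
  apply: (le_trans (HK _ _)); first by rewrite ReD; apply/andP; split; lra.
  rewrite -mulrA ler_wpM2l //.
  have -> : 8 * T ^+ 3 = (2 * T) ^+ 3 by rewrite exprMn; congr (_ * _); ring.
  rewrite lerXn2r ?nnegrE ?mulr_ge0 ?addr_ge0 //.
  by rewrite ImD /T; have := ler_normD (IM w) (IM w); lra.
have h3 : cabs (4 * (1 - cpow 2 (- (w + w + 1))))^-1 <= (4 * kap)^-1.
  rewrite cabsV cabsM cabs_nat.
  have q : kap <= cabs (1 - cpow 2 (- (w + w + 1))).
    apply: le_trans (cabsB_ge _ _); rewrite cabs1 cabs_cpow // ReN /kap lerD2l lerN2.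
    by rewrite ler_powR ?ler1n // lerN2.
  rewrite lef_pV2 ?posrE ?mulr_gt0 //; last by lra.
  by rewrite ler_pM2l.
rewrite /gq (cabsM (_ * _ * _)) (cabsM (_ * _)) (cabsM (1 - _)).
have -> : 3 * (K * 8) * A / (4 * kap) * (1 + `|IM w|) ^+ (3 + m) =
  3 * (K * 8 * T ^+ 3) * (A * T ^+ m) * (4 * kap)^-1 by rewrite exprD -/T; ring.
apply: ler_pM; rewrite ?mulr_ge0 ?cabs_ge0 //.
apply: ler_pM; rewrite ?mulr_ge0 ?cabs_ge0 //.
by apply: ler_pM; rewrite ?cabs_ge0.
Qed.

Lemma Qsum_asymp phi (c : R) : good phi -> - (1 / 4) <= c < 1 / 2 -> shift_ok c ->
  exists2 D : R, 0 <= D & forall X N, 1 <= X -> X <= N.+1%:R ->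
    cabs (Qsum phi X N - (Num.sqrt X)%:C * mellin phi 2^-1 * ((pi ^+ 2)^-1)%:C) <= D * X `^ c.
Proof.
move=> g /andP[c4 c2] sok; have [A [m [A0 HA]]] := gq_bound c4 sok.
have [D D0 HD] := mellin_ck c m g.
pose E := A * D / (1 / 2 - c) * pi.
have q0 : 0 < 1 / 2 - c by lra.
have p0 := pi_gt0 R.
exists E => [|X N X1 XN].
  by rewrite /E !mulr_ge0 ?invr_ge0 // ltW.
have X0 : 0 < X by lra.
pose G w := gq w * XM phi X w.
have GE w : c <= RE w <= 3 / 4 -> cabs (G w) <= A * D * X `^ RE w * ck (IM w).
  move=> wc; have [_ h1] := HA w wc; have /andP[cw _] := wc; have h2 := HD w cw.
  rewrite /G /XM (cabsM (gq w)) (cabsM (cpow X w)) cabs_cpow //.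
  apply: (le_trans (ler_wpM2r _ h1)); first by rewrite mulr_ge0 ?powR_ge0 ?cabs_ge0.
  have -> : A * (1 + `|IM w|) ^+ m * (X `^ RE w * cabs (mellin phi w)) =
     A * X `^ RE w * ((1 + `|IM w|) ^+ m * cabs (mellin phi w)) by ring.
  have -> : A * D * X `^ RE w * ck (IM w) = A * X `^ RE w * (D * ck (IM w)) by ring.
  by rewrite ler_wpM2l // mulr_ge0 ?powR_ge0.
have hG w : c <= RE w <= 3 / 4 -> hol G w.
  by move=> wc; apply: holM; [exact: (HA w wc).1|exact: XM_hol].
have rh2 : RE (2^-1 : C) = 1 / 2.
  have -> : (2^-1 : C) = (1 / 2 : R)%:C by rewrite div1r fmorphV rmorph_nat.
  by [].
have := @contour_shift_pole R c (3 / 4) G 2^-1 (A * D * X `^ (3 / 4)).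
rewrite rh2 => H.
have {}H := H ltac:(apply/andP; split; lra) ltac:(by rewrite !mulr_ge0 ?powR_ge0) hG.
have {}H : vline_integral (3 / 4) (fun z => G z / (z - 2^-1)) -
    vline_integral c (fun z => G z / (z - 2^-1)) = tpi R * G 2^-1.
  apply: H => z zc; apply: (le_trans (GE z zc)).
  rewrite ler_wpM2r ?(ltW (ck_gt0 _)) // ler_wpM2l ?mulr_ge0 // ler_powR //.
  by case/andP: zc.
have [_ HQ] := @Dq_line phi X (3 / 4) g ltac:(lra) X0.
have e34 : vline_integral (3 / 4) (fun z => G z / (z - 2^-1)) = tpi R * Qsum phi X N.
  rewrite -(HQ N XN); apply: eq_vline_integral => t.
  have w34 : 1 / 2 < RE (3 / 4 +i* t) by rewrite /=; lra.
  by rewrite (gq_Dq w34) /G; exact: mulrAC.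
have G2 : G 2^-1 = (Num.sqrt X)%:C * mellin phi 2^-1 * ((pi ^+ 2)^-1)%:C.
  rewrite /G /XM gq_half.
  have -> : cpow X 2^-1 = (Num.sqrt X)%:C.
    have -> : (2^-1 : C) = (2^-1 : R)%:C by rewrite fmorphV rmorph_nat.
    by rewrite cpow_real // powR12_sqrt ?ltW.
  by rewrite mulrC.
rewrite e34 G2 in H.
have E2 : tpi R * (Qsum phi X N - (Num.sqrt X)%:C * mellin phi 2^-1 * ((pi ^+ 2)^-1)%:C) =
   vline_integral c (fun z => G z / (z - 2^-1)).
  by rewrite mulrBr -H; ring.
have lb t : 1 / 2 - c <= cabs (c +i* t - 2^-1).
  by apply: le_trans (abs_Re_le _); rewrite ReB rh2 /= distrC; exact: ler_norm.
have cc t : c <= RE (c +i* t) <= 3 / 4 by rewrite /=; apply/andP; split; lra.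
have dn t : c +i* t - 2^-1 != 0 by rewrite -cabs_gt0; have := lb t; lra.
have bd t : cabs (G (c +i* t) / (c +i* t - 2^-1)) <= A * D / (1 / 2 - c) * X `^ c * ck t.
  rewrite cabsM cabsV.
  have -> : A * D / (1 / 2 - c) * X `^ c * ck t = A * D * X `^ c * ck t / (1 / 2 - c) by ring.
  apply: ler_pM; rewrite ?cabs_ge0 ?invr_ge0 ?cabs_ge0 //; first exact: (GE _ (cc t)).
  by rewrite lef_pV2 ?posrE ?cabs_gt0.
have vc : vdec c (fun z => G z / (z - 2^-1)).
  split; last by exists (A * D / (1 / 2 - c) * X `^ c).
  move=> t; apply: hol_ccont; apply: holM; first exact: hG.
  by apply: holV => //; apply: holB; [exact: hol_id|exact: hol_cst].
have vb := vline_bound vc bd.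
rewrite -E2 cabsM cabs_tpi in vb.
have t1 : 1 <= 2 * pi :> R by have := pi_ge2 R; lra.
have := cabs_ge0 (Qsum phi X N - (Num.sqrt X)%:C * mellin phi 2^-1 * ((pi ^+ 2)^-1)%:C).
move: (cabs _) vb => q vb qq.
have -> : E * X `^ c = A * D / (1 / 2 - c) * X `^ c * pi by rewrite /E; ring.
apply: le_trans vb; rewrite ler_peMl //.
Qed.

End GivenZeta.
End LineFunctional.

Lemma odd_sum (V : nmodType) K (F : nat -> V) :
  \sum_(0 <= m < K.+1 | odd m) F m = \sum_(0 <= m < K) (if odd m.+1 then F m.+1 else 0).
Proof. by rewrite big_mkcond big_nat_recl //= add0r. Qed.

(** * The double Dirichlet series near Re s = Re w = 3/4 *)

Section DoubleDirichletSeries.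
Variable R : realType.
Local Notation C := R[i].
Implicit Types (s w z : C) (M N K m n : nat).
Variables (zeta : C -> C) (A : Cplx R * Cplx R -> Cplx R).
Hypothesis hzeta : is_riemann_zeta zeta.
Hypothesis hA : is_double_dirichlet zeta A.
Variable eta : R.
Hypothesis heta : 0 < eta <= 1 / 8.

(** If the real parts sum to more than 3/2, then [2 s + 2 w - 1] has real part above 1, where the
    Euler product excludes zeros of [zeta2]. *)
Lemma not_polar s w : s != 1 -> w != 1 -> 3 / 2 < RE s + RE w -> ~ polar_set zeta (s, w).
Proof.
move=> s1 w1 sw [/eqP|/eqP|/(congr1 (fun z => RE z))|[_ z0]].
- by rewrite (negPf s1).
- by rewrite (negPf w1).
- have -> : RE (3 / 2 : C) = 3 / 2.
    have -> : (3 / 2 : C) = (3 / 2 : R)%:C by rewrite rmorphM /= fmorphV !rmorph_nat.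
    by [].
  by rewrite ReD; lra.
- have E : RE (2 * s + 2 * w - 1 : C) = 2 * (RE s + RE w) - 1.
    have d (z : C) : 2 * z = z + z by ring.
    rewrite ReB ReD !d !ReD /=; ring.
  have r : 1 < RE (2 * s + 2 * w - 1 : C) by rewrite E; lra.
  move: z0; rewrite /zeta2 => /eqP; rewrite mulf_eq0 => /orP[]; apply/negP.
    by apply: two_pow_neq0; lra.
  exact: (zeta_neq0 hzeta r).
Qed.

Lemma A_hol_s s w : ~ polar_set zeta (s, w) -> hol (fun z => A (z, w)) s.
Proof.
case: hA => _ dA _ np; have := diff_derivable (v := ((1, 0) : Cplx R * Cplx R)) (dA _ np).
move/cderiv_of_derivable => [l H]; exists l => e e0.
have [d [d0 Hd]] := H e e0; exists d; split=> // h /Hd.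
have E (k : C) : k *: ((1, 0) : Cplx R * Cplx R) + (s, w) = (s + k, w).
  by congr pair; rewrite /= ?scaler0 ?add0r // addrC [k *: _](mulr1 k).
by rewrite !E add0r addr0.
Qed.

Lemma A_hol_w s w : ~ polar_set zeta (s, w) -> hol (fun z => A (s, z)) w.
Proof.
case: hA => _ dA _ np; have := diff_derivable (v := ((0, 1) : Cplx R * Cplx R)) (dA _ np).
move/cderiv_of_derivable => [l H]; exists l => e e0.
have [d [d0 Hd]] := H e e0; exists d; split=> // h /Hd.
have E (k : C) : k *: ((0, 1) : Cplx R * Cplx R) + (s, w) = (s, w + k).
  by congr pair; rewrite /= ?scaler0 ?add0r // addrC [k *: _](mulr1 k).
by rewrite !E add0r addr0.
Qed.

Definition Ec M N : C := (EE R M N)%:C.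
Definition GG M s : C := dsum (Ec M) s.
(** The double series of [ee], summed by parts in both variables: [GG] treats the variable [s] for
    each [M], and its growth in [M] is what the sum in [w] needs. *)
Definition FF s w : C := dsum (fun M => GG M s) w.

Lemma Ec_bound : exists2 L : R, 0 <= L &
  forall M, pbound (Ec M) (L * M.+1%:R `^ (3 / 4 + 2 * eta)) (3 / 4 - eta).
Proof.
have [L L0 HL] := EE_bound heta; exists L => // M N.
by rewrite /Ec cabs_real -mulrA; exact: HL.
Qed.

Lemma GG_bound : exists2 L : R, 0 <= L & forall (b : R) s, 0 < b -> 3 / 4 - eta + b <= RE s ->
  pbound (fun M => GG M s) (L * cabs s * Kp b) (3 / 4 + 2 * eta).
Proof.
have [L L0 HL] := Ec_bound; exists L => // b s b0 bs M.
have /andP[e0 e1] := heta.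
apply: (le_trans (dsum_bound (HL M) b0 bs _)); first lra.
by rewrite le_eqVlt; apply/orP; left; apply/eqP; ring.
Qed.

Lemma GG_hol M s : 3 / 4 - eta < RE s -> hol (GG M) s.
Proof.
move=> h; have [L _ HL] := Ec_bound; have /andP[e0 e1] := heta.
by apply: (dsum_hol (HL M)) => //; lra.
Qed.

Lemma FF_hol_w s w : 3 / 4 - eta < RE s -> 3 / 4 + 2 * eta < RE w -> hol (FF s) w.
Proof.
move=> hs hw; have [L _ HL] := GG_bound; have /andP[e0 e1] := heta.
have b0 : 0 < RE s - (3 / 4 - eta) by lra.
have h1 : 3 / 4 - eta + (RE s - (3 / 4 - eta)) <= RE s by lra.
by apply: (dsum_hol (HL _ _ b0 h1)) => //; lra.
Qed.

Lemma FF_hol_s s w : 3 / 4 - eta < RE s -> 3 / 4 + 2 * eta < RE w -> hol (fun z => FF z w) s.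
Proof.
move=> hs hw; have [L L0 HL] := GG_bound; have /andP[e0 e1] := heta.
pose r := (RE s - (3 / 4 - eta)) / 2; have r0 : 0 < r by rewrite /r; lra.
pose b := RE w - (3 / 4 + 2 * eta); have b0 : 0 < b by rewrite /b; lra.
pose K := L * (cabs s + r) * Kp r.
apply: (@series_hol R (fun M z => GG M z * dl w M) (fun N => K * cabs w * Kp b * N.+1%:R `^ (- b)) s r r0).
  move=> M z zs; apply: holM; last exact: hol_cst.
  by apply: GG_hol; have := le_lt_trans (abs_Re_le _) zs; rewrite ReB ltr_norml /r; lra.
move=> z zs; have hz : 3 / 4 - eta + r <= RE z.
  by have := le_lt_trans (abs_Re_le _) zs; rewrite ReB ltr_norml /r; lra.
have zb : cabs z <= cabs s + r.
  have -> : z = s + (z - s) by ring.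
  by apply: (le_trans (cabsD _ _)); rewrite lerD2l ltW.
have P : pbound (fun M => GG M z) K (3 / 4 + 2 * eta).
  move=> M; apply: (le_trans (HL _ _ r0 hz M)).
  rewrite ler_wpM2r ?powR_ge0 // /K ler_wpM2r ?(ltW (Kp_gt0 r0)) // ler_wpM2l //.
apply: (dsum_tails P b0) => //; rewrite /b; lra.
Qed.

Lemma ee_le3 m n : `|ee R m n| <= 3.
Proof.
have h1 : `|jac R m.+1 n.+1| <= 1.
  rewrite /jac; case: ifP => _; last by rewrite normr0.
  by case: (jacobi_cases m.+1 n.+1) => ->; rewrite ?normr0 ?mulr1z ?mulrN1z ?normrN ?normr1.
have a := qd_ge0 R m.+1; have b := qd_le1 R m.+1; have c := qd_ge0 R n.+1; have d := qd_le1 R n.+1.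
move: h1; rewrite /ee !ler_norml => /andP[u v]; apply/andP; split; lra.
Qed.

Definition cole M n : C := (\sum_(0 <= m < M.+1) ee R m n)%:C.

Lemma Ec_col M N : Ec M N = \sum_(0 <= n < N.+1) cole M n.
Proof. by rewrite /Ec /EE exchange_big /= rmorph_sum. Qed.

Lemma cole_bound M n : cabs (cole M n) <= 3 * M.+1%:R.
Proof.
rewrite /cole cabs_real; apply: (le_trans (ler_norm_sum _ _ _)).
apply: (@le_trans _ _ (\sum_(0 <= m < M.+1) 3)); first by apply: ler_sum => m _; exact: ee_le3.
by rewrite sumr_const_nat subn0 mulr_natr.
Qed.

Definition HH M K s : C := \sum_(0 <= n < K) cole M n * npow s n.

Lemma HH_clim M s : 2 <= RE s -> clim (fun K => HH M K s) (GG M s).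
Proof.
move=> s2; have [L _ HL] := Ec_bound; have /andP[e0 e1] := heta.
have E : Ec M = (fun N => \sum_(0 <= n < N.+1) cole M n) by apply/funext => N; exact: Ec_col.
have P := HL M; rewrite E in P.
by rewrite /GG E; apply: (dsum_dirichlet P); lra.
Qed.

Lemma HH_tail M K s : 2 <= RE s -> cabs (GG M s - HH M K s) <= 3 * M.+1%:R * Kp 1 * K.+1%:R `^ (- 1).
Proof.
move=> s2; apply: (@clim_le R _ _ _ _ K _ (HH_clim M s2)) => K' KK.
rewrite /HH (big_cat_nat (n := K)) //= addrAC subrr add0r.
apply: (le_trans (cabs_sum _ _ _)).
apply: (@le_trans _ _ (3 * M.+1%:R * \sum_(K <= n < K') n.+1%:R `^ (- (1 + 1)))).
  rewrite mulr_sumr; apply: ler_sum => n _; rewrite cabsM; apply: ler_pM; rewrite ?cabs_ge0 ?cole_bound //.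
  by rewrite cabs_npow ler_powR ?ler1n //; lra.
by rewrite -[leRHS]mulrA ler_wpM2l ?mulr_ge0 // pow_tail.
Qed.

Definition TT K s w : C := \sum_(0 <= m < K) (\sum_(0 <= n < K) (ee R m n)%:C * npow s n) * npow w m.

Lemma TT_parts K s w : TT K s w = \sum_(0 <= M < K) HH M K s * dl w M +
  (\sum_(0 <= m < K) \sum_(0 <= n < K) (ee R m n)%:C * npow s n) * npow w K.
Proof.
rewrite /TT (summation_by_parts (fun m => \sum_(0 <= n < K) (ee R m n)%:C * npow s n) (npow w)).
congr (_ + _); apply: eq_bigr => M _; congr (_ * _).
rewrite exchange_big /=; apply: eq_bigr => n _.
by rewrite -mulr_suml /cole rmorph_sum.
Qed.

(** Summation by parts in [m] turns the square sum into a partial sum of [FF] with [GG M] replaced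
    by its truncation [HH M K], plus a boundary term. For real parts at least 4 crude bounds make
    both discrepancies [O(1 / K)]. *)
Lemma TT_clim s w : 4 <= RE s -> 4 <= RE w -> clim (fun K => TT K s w) (FF s w).
Proof.
move=> s4 w4; have /andP[e0 e1] := heta.
have [L L0 HL] := GG_bound.
have h1 : 3 / 4 - eta + 1 <= RE s by lra.
have h2 : 3 / 4 + 2 * eta + 1 <= RE w by lra.
have h3 : -1 <= RE w by lra.
have HF := csum_lim (dsum_tails (HL _ _ ltr01 h1) ltr01 h2 h3 (lexx _)).
pose c := 3 * Kp 1 * cabs w * Kp 1 + 3.
have k1 := @Kp_gt0 R 1 ltr01.
have c0 : 0 <= c by rewrite addr_ge0 // !mulr_ge0 ?cabs_ge0 // ltW.
have HD : clim (fun K => TT K s w - \sum_(0 <= M < K) GG M s * dl w M) 0.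
  apply: (clim_squeeze (b := fun K => c * K.+1%:R `^ (- 1))); last first.
    by apply: rnullZ => //; exact: rnull_pow.
  move=> K; rewrite subr0 TT_parts addrAC -sumrB.
  apply: (le_trans (cabsD _ _)); rewrite /c mulrDl; apply: lerD.
    apply: (le_trans (cabs_sum _ _ _)).
    apply: (@le_trans _ _ (3 * Kp 1 * K.+1%:R `^ (- 1) * cabs w * \sum_(0 <= M < K) M.+1%:R `^ (- (1 + 1)))).
      rewrite mulr_sumr; apply: ler_sum => M _; rewrite -mulrBl cabsM cabsBC.
      apply: (le_trans (ler_pM (cabs_ge0 _) (cabs_ge0 _) (HH_tail M K (_ : 2 <= RE s)) (dl_bound M h3))); first lra.
      have m0 : 0 < M.+1%:R :> R by rewrite ltr0n.
      have -> : 3 * M.+1%:R * Kp 1 * K.+1%:R `^ (- 1) * (cabs w * M.+1%:R `^ (- (RE w + 1))) =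
        3 * Kp 1 * K.+1%:R `^ (- 1) * cabs w * (M.+1%:R * M.+1%:R `^ (- (RE w + 1))) by ring.
      rewrite ler_wpM2l ?mulr_ge0 ?powR_ge0 ?cabs_ge0 ?(ltW k1) //.
      rewrite -{1}(powRr1 (ltW m0)) powRDp // ler_powR ?ler1n //; lra.
    have := @pow_tail R 1 0 K ltr01 (leq0n K); rewrite powR1 mulr1 => h.
    have -> : 3 * Kp 1 * cabs w * Kp 1 * K.+1%:R `^ (- 1) = 3 * Kp 1 * K.+1%:R `^ (- 1) * cabs w * Kp 1 by ring.
    by rewrite ler_wpM2l ?mulr_ge0 ?powR_ge0 ?cabs_ge0 ?(ltW k1).
  rewrite cabsM.
  have hb : cabs (\sum_(0 <= m < K) \sum_(0 <= n < K) (ee R m n)%:C * npow s n) <= 3 * K%:R * K%:R.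
    apply: (le_trans (cabs_sum _ _ _)).
    apply: (@le_trans _ _ (\sum_(0 <= m < K) 3 * K%:R)); last by rewrite sumr_const_nat subn0 -(mulr_natr (3 * K%:R) K).
    apply: ler_sum => m _; apply: (le_trans (cabs_sum _ _ _)).
    apply: (@le_trans _ _ (\sum_(0 <= n < K) 3)); last by rewrite sumr_const_nat subn0 mulr_natr.
    apply: ler_sum => n _; rewrite cabsM cabs_real cabs_npow -[leRHS]mulr1.
    apply: ler_pM; rewrite ?powR_ge0 ?ee_le3 //.
    rewrite -[leRHS](powRr0 n.+1%:R) ler_powR ?ler1n //; lra.
  have K1 : 0 < K.+1%:R :> R by rewrite ltr0n.
  apply: (@le_trans _ _ (3 * (K.+1%:R * K.+1%:R) * K.+1%:R `^ (- 3))).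
    rewrite cabs_npow; apply: ler_pM; rewrite ?cabs_ge0 ?powR_ge0 //.
      by apply: (le_trans hb); rewrite -mulrA ler_wpM2l // -!natrM ler_nat leq_mul.
    by rewrite ler_powR ?ler1n //; lra.
  rewrite -mulrA ler_wpM2l // -{1 2}(powRr1 (ltW K1)) !powRDp //.
  by rewrite (_ : 1 + 1 + - 3 = - 1 :> R) //; ring.
have := climD HD HF; rewrite add0r; apply: clim_ext => K; by rewrite subrK.
Qed.

Definition Aform s w : C := zeta w * Dq s + zeta s * Dq w + FF s w.

Lemma square_sum K s w :
  \sum_(0 <= m < K.+1 | odd m) \sum_(0 <= n < K.+1 | odd n)
     (jacobi m n)%:~R * cpow m%:R (- w) * cpow n%:R (- s) =
  (\sum_(0 <= m < K) npow w m) * (\sum_(0 <= n < K) qcoef R n * npow s n) +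
  (\sum_(0 <= n < K) npow s n) * (\sum_(0 <= m < K) qcoef R m * npow w m) + TT K s w.
Proof.
have E m n : (if odd m.+1 then if odd n.+1 then (jacobi m.+1 n.+1)%:~R * cpow m.+1%:R (- w) * cpow n.+1%:R (- s) else 0 else 0)
   = npow w m * (qcoef R n * npow s n) + (npow s n * (qcoef R m * npow w m)) + (ee R m n)%:C * npow s n * npow w m :> C.
  have -> : (ee R m n)%:C = (jac R m.+1 n.+1)%:C - qcoef R m - qcoef R n :> C by rewrite /ee !rmorphB.
  have -> : (jac R m.+1 n.+1)%:C = (if odd m.+1 && odd n.+1 then (jacobi m.+1 n.+1)%:~R else 0) :> C.
    by rewrite /jac; case: (_ && _) => //; rewrite rmorph_int.
  rewrite /npow; move: (cpow m.+1%:R (- w)) (cpow n.+1%:R (- s)) (jacobi _ _)%:~R => a b j.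
  move: (odd m.+1) (odd n.+1) (qcoef R m) (qcoef R n) => o p u v; move: {j}(j : C) => j.
  by case: o; case: p => /=; ring.
rewrite odd_sum.
transitivity (\sum_(0 <= m < K) \sum_(0 <= n < K)
   (npow w m * (qcoef R n * npow s n) + (npow s n * (qcoef R m * npow w m)) + (ee R m n)%:C * npow s n * npow w m)).
  apply: eq_bigr => m _; rewrite odd_sum.
  rewrite (eq_bigr _ (fun n _ => esym (E m n))).
  by case: (odd m.+1) => //; rewrite big1.
rewrite /TT !mulr_suml.
under eq_bigr do rewrite 2!big_split /=.
rewrite 2!big_split /=; congr (_ + _ + _).
- by apply: eq_bigr => m _; rewrite mulr_sumr.
- by rewrite exchange_big /=; apply: eq_bigr => n _; rewrite mulr_sumr.
- by apply: eq_bigr => m _; rewrite mulr_suml.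
Qed.

Lemma A_large : exists b : R, 4 <= b /\ forall s w, b < RE s -> b < RE w -> A (s, w) = Aform s w.
Proof.
case: hA => -[sg H] _ _; exists (Num.max sg 4); split; first by rewrite le_max lexx orbT.
move=> s w; rewrite !gt_max => /andP[s1 s4] /andP[w1 w4].
have := clim_of_cvg (H s w s1 w1).
move/(@clim_sub _ _ _ succn) => HA'; have {}HA' := HA' ltac:(by move=> N; exists N => n; exact: leqW).
apply: (clim_unique HA').
apply: (@clim_ext R (fun K => (\sum_(0 <= m < K) npow w m) * (\sum_(0 <= n < K) qcoef R n * npow s n) +
  (\sum_(0 <= n < K) npow s n) * (\sum_(0 <= m < K) qcoef R m * npow w m) + TT K s w)).
  by move=> K; rewrite square_sum.
apply: climD; last by apply: TT_clim; exact: ltW.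
have w2 : 1 < RE w by lra.
have s2 : 1 < RE s by lra.
have hz z : 1 < RE z -> clim (fun K => \sum_(0 <= m < K) npow z m) (zeta z) by exact: (zeta_clim hzeta).
have hd z : 1 < RE z -> clim (fun K => \sum_(0 <= n < K) qcoef R n * npow z n) (Dq z).
  by move=> z1; apply: Dq_clim; lra.
exact: climD (climM (hz w w2) (hd s s2)) (climM (hz s s2) (hd w w2)).
Qed.

Lemma Re_neq1 z : RE z != 1 -> z != 1.
Proof. by apply: contraNneq => ->. Qed.

(** Continuation in one variable at a time: first in [s] with [w] far to the right, then in [w] with
    [s] fixed on its line. Along both ways the real parts sum to more than 3/2, so only the excepted
    point 1 is polar. *)
Lemma A_formula s w : RE s = 3 / 4 -> 3 / 4 + 2 * eta < RE w -> w != 1 -> A (s, w) = Aform s w.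
Proof.
move=> s34; have /andP[e0 e1] := heta; have [b [b4 Hb]] := A_large.
have ns : s != 1 by apply: Re_neq1; rewrite s34; apply/eqP; lra.
have step1 z v : b < RE v -> 3 / 4 - eta < RE z -> z != 1 -> A (z, v) = Aform z v.
  move=> bv z0 z1; apply/eqP; rewrite -subr_eq0; apply/eqP.
  have nv : v != 1 by apply: Re_neq1; apply/eqP; lra.
  apply: (@identity_halfplane R (fun z => A (z, v) - Aform z v) (3 / 4 - eta) b) => //.
    move=> u u0 u1; apply: holB; first by apply: A_hol_s; apply: not_polar => //; lra.
    apply: holD; last by apply: FF_hol_s => //; lra.
    apply: holD; first by apply: holM; [exact: hol_cst|apply: Dq_hol; lra].
    by apply: holM; [exact: (zeta_hol hzeta)|exact: hol_cst].
  by move=> u bu; rewrite Hb ?subrr.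
move=> w0 w1; apply/eqP; rewrite -subr_eq0; apply/eqP.
apply: (@identity_halfplane R (fun v => A (s, v) - Aform s v) (3 / 4 + 2 * eta) b) => //.
  move=> u u0 u1; apply: holB; first by apply: A_hol_w; apply: not_polar => //; lra.
  apply: holD; last by apply: FF_hol_w => //; lra.
  apply: holD; first by apply: holM; [exact: (zeta_hol hzeta)|exact: hol_cst].
  by apply: holM; [exact: hol_cst|apply: Dq_hol; lra].
by move=> u bu; rewrite step1 ?subrr //; lra.
Qed.

End DoubleDirichletSeries.

(** * The character sum as a finite sum *)

Section CharacterSum.
Variable R : realType.
Local Notation C := R[i].
Variables (phi psi : R -> R).
Hypotheses (gphi : good phi) (gpsi : good psi).

Lemma good_large (f : R -> R) (X : R) (N m : nat) : good f -> 0 < X -> X <= N.+1%:R -> (N < m)%N ->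
  f (m%:R / X) = 0.
Proof.
move=> g X0 XN Nm; rewrite (good_out g) // negb_and -!leNgt; apply/orP; right.
by rewrite ler_pdivlMr // mul1r; apply: (le_trans XN); rewrite ler_nat.
Qed.

Lemma char_sum_finite (X Y : R) (NX NY : nat) : 0 < X -> X <= NX.+1%:R -> 0 < Y -> Y <= NY.+1%:R ->
  (char_sum phi psi X Y)%:C = \sum_(0 <= m < NX) \sum_(0 <= n < NY)
    (jac R m.+1 n.+1)%:C * gph phi X m * gph psi Y n.
Proof.
move=> X0 XN Y0 YN.
pose F m n : R := (jacobi m n)%:~R * phi (m%:R / X) * psi (n%:R / Y).
have E : char_sum phi psi X Y = \sum_(0 <= m < NX.+1 | odd m) \sum_(0 <= n < NY.+1 | odd n) F m n.
  rewrite /char_sum.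
  transitivity (\sum_(m \in [set m | odd m]) \sum_(0 <= n < NY.+1 | odd n) F m n).
    apply: eq_fsbigr => m _; apply/esym; apply: (bigfs _ (P := odd)); first exact: iota_uniq.
    move=> n _; rewrite mem_index_iota leq0n ltnS -ltnNge => h.
    by rewrite /F (good_large gpsi Y0 YN h) mulr0.
  apply/esym; apply: (bigfs _ (P := odd)); first exact: iota_uniq.
  move=> m _; rewrite mem_index_iota leq0n ltnS -ltnNge => h.
  by rewrite big1 // => n _; rewrite /F (good_large gphi X0 XN h) mulr0 mul0r.
rewrite E odd_sum rmorph_sum; apply: eq_bigr => m _.
have [om|om] := ifP; last first.
  by rewrite rmorph0 big1 // => n _; rewrite /jac om rmorph0 !mul0r.
rewrite odd_sum rmorph_sum; apply: eq_bigr => n _.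
rewrite /jac om; case: (odd n.+1); last by rewrite rmorph0 !mul0r.
by rewrite /F !rmorphM.
Qed.

Lemma char_sum_split (X Y : R) (NX NY : nat) : 0 < X -> X <= NX.+1%:R -> 0 < Y -> Y <= NY.+1%:R ->
  (char_sum phi psi X Y)%:C =
  \sum_(0 <= m < NX) (\sum_(0 <= n < NY) (ee R m n)%:C * gph psi Y n) * gph phi X m +
  Qsum phi X NX * Ssum psi Y NY + Ssum phi X NX * Qsum psi Y NY.
Proof.
move=> X0 XN Y0 YN; rewrite (char_sum_finite X0 XN Y0 YN) /Qsum /Ssum.
rewrite ![(\sum_(0 <= j < NX) _) * _]mulr_suml -!big_split; apply: eq_bigr => m _ /=; rewrite mulr_suml !mulr_sumr -!big_split.
apply: eq_bigr => n _ /=.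
have -> : (ee R m n)%:C = (jac R m.+1 n.+1)%:C - qcoef R m - qcoef R n :> C by rewrite /ee !rmorphB.
by ring.
Qed.

(** The left side is what the integrals of [FF] produce; the weights vanish at the upper ends, so
    there are no boundary terms. *)
Lemma double_by_parts (X Y : R) (NX NY : nat) : 0 < X -> X <= NX.+1%:R -> 0 < Y -> Y <= NY.+1%:R ->
  \sum_(0 <= M < NX) (gph phi X M - gph phi X M.+1) *
     (\sum_(0 <= N < NY) Ec R M N * (gph psi Y N - gph psi Y N.+1)) =
  \sum_(0 <= m < NX) (\sum_(0 <= n < NY) (ee R m n)%:C * gph psi Y n) * gph phi X m.
Proof.
move=> X0 XN Y0 YN; rewrite -(by_parts_gph _ gphi X0 XN); apply: eq_bigr => M _.
rewrite mulrC; congr (_ * _).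
transitivity (\sum_(0 <= n < NY) cole R M n * gph psi Y n).
  rewrite -(by_parts_gph _ gpsi Y0 YN); apply: eq_bigr => N _; by rewrite Ec_col.
rewrite exchange_big /=; apply: eq_bigr => n _.
by rewrite -mulr_suml /cole rmorph_sum.
Qed.

End CharacterSum.

(** * Evaluation of the double integral *)

Section DoubleIntegral.
Variable R : realType.
Local Notation C := R[i].
Variables (zeta : C -> C) (A : Cplx R * Cplx R -> Cplx R) (phi psi : R -> R) (eps : R).
Hypotheses (hzeta : is_riemann_zeta zeta) (hA : is_double_dirichlet zeta A).
Hypotheses (gphi : good phi) (gpsi : good psi) (heps : 0 < eps < 1 / 4).

(** Makes [3/4 + 2 eta] smaller than the abscissa [3/4 + eps] of the inner line, with the outer line
    to the right of [3/4 - eta]. *)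
Let eta : R := eps / 4.
Let heta : 0 < eta <= 1 / 8.
Proof. by rewrite /eta; have /andP[] := heps => *; apply/andP; split; lra. Qed.

Let innerS (X : R) NX (s : C) : C :=
  Dq s * (Ssum phi X NX - X%:C * mellin phi 1) + zeta s * Qsum phi X NX +
  \sum_(0 <= M < NX) GG M s * (gph phi X M - gph phi X M.+1).

Lemma inner_line (X : R) NX (s : C) : RE s = 3 / 4 -> 1 <= X -> X <= NX.+1%:R ->
  vdec (3 / 4 + eps) (fun w => Aform zeta s w * XM phi X w) /\
  vline_integral (3 / 4 + eps) (fun w => Aform zeta s w * XM phi X w) = tpi R * innerS X NX s.
Proof.
move=> s34 X1 XN; have /andP[e0 e1] := heps; have X0 : 0 < X by lra.
have c1 : 1 / 2 <= 3 / 4 + eps < 1 by apply/andP; split; lra.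
have c2 : 1 / 2 < 3 / 4 + eps by lra.
have [vz Hz] := zeta_line hzeta gphi c1 X1.
have [vq Hq] := Dq_line gphi c2 X0.
have [L L0 HL] := GG_bound heta.
have h1 : 3 / 4 - eta + eta <= RE s by rewrite s34; lra.
have h0 : 0 <= 3 / 4 + 2 * eta by rewrite /eta; lra.
have h2 : 3 / 4 + 2 * eta < 3 / 4 + eps by rewrite /eta; lra.
have eta0 : 0 < eta by rewrite /eta; lra.
have [vf Hf] := dsum_line gphi h0 h2 (ltW c2) X0 (HL _ _ eta0 h1).
have E w : Dq s * (zeta w * XM phi X w) + zeta s * (Dq w * XM phi X w) + FF s w * XM phi X w =
   Aform zeta s w * XM phi X w by rewrite /Aform; ring.
have v1 := vdecZ (Dq s) vz; have v2 := vdecZ (zeta s) vq.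
have v12 := vdecD v1 v2.
split; first exact: vdec_ext E (vdecD v12 vf).
transitivity (vline_integral (3 / 4 + eps) (fun w => Dq s * (zeta w * XM phi X w) +
    zeta s * (Dq w * XM phi X w) + FF s w * XM phi X w)).
  by apply: eq_vline_integral => t; rewrite E.
rewrite (vline_integralD v12 vf) (vline_integralD v1 v2) (vline_integralZ _ vz) (vline_integralZ _ vq).
by rewrite (Hz _ XN) (Hq _ XN) (Hf _ XN) /innerS; ring.
Qed.

Lemma integrand_line (X Y : R) (s : C) (t : R) : RE s = 3 / 4 ->
  integrand A phi psi X Y s ((3 / 4 + eps) +i* t) =
  XM psi Y s * (Aform zeta s ((3 / 4 + eps) +i* t) * XM phi X ((3 / 4 + eps) +i* t)).
Proof.
move=> s34; have /andP[e0 e1] := heps; rewrite /integrand.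
rewrite (A_formula hzeta hA heta s34); first by rewrite /XM; ring.
  by rewrite /= /eta; lra.
by apply: Re_neq1; rewrite /=; apply/eqP; lra.
Qed.

Lemma inner_integralE (X Y : R) NX (s : C) : RE s = 3 / 4 -> 1 <= X -> X <= NX.+1%:R ->
  vline_integrable (3 / 4 + eps) (integrand A phi psi X Y s) /\
  inner_integral A phi psi eps X Y s = tpi R * innerS X NX s * XM psi Y s.
Proof.
move=> s34 X1 XN; have [v H] := inner_line s34 X1 XN; split.
  have := vdec_integrable (vdecZ (XM psi Y s) v); rewrite /vline_integrable.
  have -> // : (fun t => integrand A phi psi X Y s ((3 / 4 + eps) +i* t)) = (fun t => XM psi Y s *
    (Aform zeta s ((3 / 4 + eps) +i* t) * XM phi X ((3 / 4 + eps) +i* t))).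
  by apply/funext => t; exact: integrand_line.
transitivity (vline_integral (3 / 4 + eps) (fun w => XM psi Y s * (Aform zeta s w * XM phi X w))).
  by apply: eq_vline_integral => t; exact: integrand_line.
by rewrite (vline_integralZ _ v) H mulrC.
Qed.

(** The three parts of [innerS] give the [ee] sum and the two products of [Qsum] and [Ssum], which
    [char_sum_split] reassembles. What is missing are the residues at the pole of [zeta], one from
    each integration. *)
Lemma outer_line (X Y : R) NX NY : 1 <= X -> X <= NX.+1%:R -> 1 <= Y -> Y <= NY.+1%:R ->
  vdec (3 / 4) (fun s => tpi R * innerS X NX s * XM psi Y s) /\
  vline_integral (3 / 4) (fun s => tpi R * innerS X NX s * XM psi Y s) =
  tpi R ^+ 2 * ((char_sum phi psi X Y)%:C -
    (X%:C * mellin phi 1 * Qsum psi Y NY + Y%:C * mellin psi 1 * Qsum phi X NX)).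
Proof.
move=> X1 XN Y1 YN; have X0 : 0 < X by lra.
have Y0 : 0 < Y by lra.
have c1 : ((1 / 2 : R) <= 3 / 4) && ((3 / 4 : R) < 1) by apply/andP; split; lra.
have c2 : 1 / 2 < 3 / 4 :> R by lra.
have [vz Hz] := zeta_line hzeta gpsi c1 Y1.
have [vq Hq] := Dq_line gpsi c2 Y0.
have [L L0 HL] := Ec_bound heta.
have h0 : 0 <= 3 / 4 - eta by rewrite /eta; have /andP[] := heps => *; lra.
have h2 : 3 / 4 - eta < 3 / 4 by rewrite /eta; have /andP[] := heps => *; lra.
have HM M := dsum_line gpsi h0 h2 (ltW c2) Y0 (HL M).
pose dg M : C := gph phi X M - gph phi X M.+1.
have v3 : vdec (3 / 4) (fun s => \sum_(0 <= M < NX) dg M * (GG M s * XM psi Y s)).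
  by apply: (@vdec_sum R _ NX (fun M s => dg M * (GG M s * XM psi Y s))) => M; apply: vdecZ; exact: (HM M).1.
have v1 := vdecZ (Ssum phi X NX - X%:C * mellin phi 1) vq.
have v2 := vdecZ (Qsum phi X NX) vz.
have v12 := vdecD v1 v2.
have v := vdecD v12 v3.
have E s : tpi R * ((Ssum phi X NX - X%:C * mellin phi 1) * (Dq s * XM psi Y s) +
   Qsum phi X NX * (zeta s * XM psi Y s) + \sum_(0 <= M < NX) dg M * (GG M s * XM psi Y s)) =
   tpi R * innerS X NX s * XM psi Y s.
  have -> : \sum_(0 <= M < NX) dg M * (GG M s * XM psi Y s) =
     (\sum_(0 <= M < NX) GG M s * dg M) * XM psi Y s.
    by rewrite mulr_suml; apply: eq_bigr => M _; ring.
  by rewrite /innerS -/dg; ring.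
split; first exact: vdec_ext E (vdecZ _ v).
transitivity (vline_integral (3 / 4) (fun s => tpi R * ((Ssum phi X NX - X%:C * mellin phi 1) *
    (Dq s * XM psi Y s) + Qsum phi X NX * (zeta s * XM psi Y s) +
    \sum_(0 <= M < NX) dg M * (GG M s * XM psi Y s)))).
  by apply: eq_vline_integral => t; rewrite E.
rewrite (vline_integralZ _ v).
rewrite (vline_integralD v12 v3) (vline_integralD v1 v2) (vline_integralZ _ vz) (vline_integralZ _ vq).
rewrite (Hz _ YN) (Hq _ YN).
rewrite (@vline_integral_sum R _ NX (fun M s => dg M * (GG M s * XM psi Y s))); last first.
  by move=> M; apply: vdecZ; exact: (HM M).1.
have -> : \sum_(0 <= M < NX) vline_integral (3 / 4) (fun s => dg M * (GG M s * XM psi Y s)) =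
  tpi R * \sum_(0 <= M < NX) dg M * \sum_(0 <= N < NY) Ec R M N * (gph psi Y N - gph psi Y N.+1).
  rewrite mulr_sumr; apply: eq_bigr => M _; have [vM eM] := HM M.
  by rewrite (vline_integralZ _ vM) (eM _ YN) mulrCA.
rewrite (double_by_parts gphi gpsi X0 XN Y0 YN) (char_sum_split gphi gpsi X0 XN Y0 YN).
by ring.
Qed.

Lemma double_integralE (X Y : R) NX NY : 1 <= X -> X <= NX.+1%:R -> 1 <= Y -> Y <= NY.+1%:R ->
  double_integral_converges A phi psi eps X Y /\
  double_integral A phi psi eps X Y = (char_sum phi psi X Y)%:C -
    (X%:C * mellin phi 1 * Qsum psi Y NY + Y%:C * mellin psi 1 * Qsum phi X NX).
Proof.
move=> X1 XN Y1 YN; have [v H] := outer_line X1 XN Y1 YN.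
have I t : inner_integral A phi psi eps X Y (3 / 4 +i* t) =
   tpi R * innerS X NX (3 / 4 +i* t) * XM psi Y (3 / 4 +i* t).
  by have [] := @inner_integralE X Y NX (3 / 4 +i* t) erefl X1 XN.
split.
  split; first by move=> s s34; have [] := @inner_integralE X Y NX s s34 X1 XN.
  have := vdec_integrable v; rewrite /vline_integrable.
  have -> // : (fun t => inner_integral A phi psi eps X Y (3 / 4 +i* t)) =
    (fun t => tpi R * innerS X NX (3 / 4 +i* t) * XM psi Y (3 / 4 +i* t)).
  exact/funext.
rewrite /double_integral -/(tpi R).
have -> : vline_integral (3 / 4) (inner_integral A phi psi eps X Y) =
  vline_integral (3 / 4) (fun s => tpi R * innerS X NX s * XM psi Y s) by exact: eq_vline_integral.
by rewrite H mulrA -exprMn mulVf ?tpi_neq0 // expr1n mul1r.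
Qed.

Lemma nat_above (X : R) : exists N : nat, X <= N.+1%:R.
Proof.
exists (Num.bound `|X|); apply: (le_trans (ler_norm X)); apply: ltW.
by apply: (lt_le_trans (archi_boundP (normr_ge0 X))); rewrite ler_nat.
Qed.

(** By the exact formula the character sum cancels; the difference is a combination of the errors of
    [Qsum_asymp], weighted by [X] and [Y]. *)
Lemma asymptotic (c : R) : - (1 / 4) <= c < 1 / 2 -> shift_ok c -> asymptotic_formula A phi psi eps c.
Proof.
move=> hc sok; have [D1 D10 H1] := Qsum_asymp hzeta gphi hc sok.
have [D2 D20 H2] := Qsum_asymp hzeta gpsi hc sok.
exists (cabs (mellin phi 1) * D2 + cabs (mellin psi 1) * D1); exists 1 => X Y X1 Y1.
have [NX XN] := nat_above X; have [NY YN] := nat_above Y.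
have [cv ->] := double_integralE X1 XN Y1 YN; split=> //.
have := H1 X NX X1 XN; have := H2 Y NY Y1 YN.
rewrite cabsE lecR /main_term.
have -> : (X * Num.sqrt Y)%:C = X%:C * (Num.sqrt Y)%:C :> C by rewrite rmorphM.
have -> : (Y * Num.sqrt X)%:C = Y%:C * (Num.sqrt X)%:C :> C by rewrite rmorphM.
rewrite fmorphV.
set qx := Qsum phi X NX; set qy := Qsum psi Y NY; set sx := (Num.sqrt X)%:C; set sy := (Num.sqrt Y)%:C.
set i2 := ((pi ^+ 2)%:C)^-1; set m1 := mellin phi 1; set m2 := mellin psi 1.
set h1 := mellin phi 2^-1; set h2 := mellin psi 2^-1.
move=> b2 b1.
have -> : (char_sum phi psi X Y)%:C - ((m1 * h2 * (X%:C * sy) + m2 * h1 * (Y%:C * sx)) * i2 +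
   ((char_sum phi psi X Y)%:C - (X%:C * m1 * qy + Y%:C * m2 * qx))) =
   m1 * X%:C * (qy - sy * h2 * i2) + m2 * Y%:C * (qx - sx * h1 * i2).
  by move: i2 m1 m2 h1 h2 qx qy sx sy (char_sum _ _ _ _)%:C {b1 b2} => *; ring.
clearbody i2 m1 m2 h1 h2 qx qy sx sy.
apply: (le_trans (cabsD _ _)); rewrite (cabsM (m1 * X%:C)) (cabsM m1) (cabsM (m2 * Y%:C)) (cabsM m2).
have X0 : 0 <= X by lra.
have Y0 : 0 <= Y by lra.
rewrite (cabs_real X) (cabs_real Y) (ger0_norm X0) (ger0_norm Y0).
move: b1 b2; move: (cabs (qx - _)) (cabs (qy - _)) (cabs_ge0 m1) (cabs_ge0 m2).
move: (cabs m1) (cabs m2) (powR_ge0 X c) (powR_ge0 Y c).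
move: (X `^ c) (Y `^ c) => p q a b p0 q0 u v a0 b0 hu hv.
apply: (@le_trans _ _ (a * X * (D2 * q) + b * Y * (D1 * p))).
  by apply: lerD; apply: ler_wpM2l => //; apply: mulr_ge0.
have t1 : 0 <= a * D2 * (Y * p) by rewrite !mulr_ge0.
have t2 : 0 <= b * D1 * (X * q) by rewrite !mulr_ge0.
lra.
Qed.

End DoubleIntegral.

Theorem theorem5 (R : realType)
  (zeta : Cplx R -> Cplx R) (hzeta : is_riemann_zeta zeta)
  (A : Cplx R * Cplx R -> Cplx R) (hA : is_double_dirichlet zeta A)
  (phi psi : R -> R)
  (phi_ge0 : forall x, 0 <= phi x) (psi_ge0 : forall x, 0 <= psi x)
  (phi_smooth : smooth phi) (psi_smooth : smooth psi)
  (phi_supp : supported_in01 phi) (psi_supp : supported_in01 psi)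
  (eps : R) (eps_gt0 : 0 < eps) (eps_small : eps < 4^-1) :
  asymptotic_formula A phi psi eps eps /\
  (riemann_hypothesis zeta ->
   asymptotic_formula A phi psi eps (- 4^-1 + eps)).
Proof.
have gphi : good phi by [].
have gpsi : good psi by [].
have heps : 0 < eps < 1 / 4 by apply/andP; split; lra.
split=> [|rh].
  apply: (asymptotic hzeta hA gphi gpsi heps); first by apply/andP; split; lra.
  exact: (shift_ok_uncond hzeta).
apply: (asymptotic hzeta hA gphi gpsi heps); first by apply/andP; split; lra.
exact: (shift_ok_rh hzeta).
Qed.
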